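(* Let $V\colon\mathbb R^d\to[0,\infty)$ be real-analytic with zero set nonempty and not all of $\mathbb R^d$, let $D\subset\mathbb R^d$ be a bounded open domain that is subanalytic and meets $V^{-1}(0)$, and let $Z=\{x\in D\colon V(x)=0\}$. Fix resolution data $(M,W,\pi,\{E_\alpha\},(k_\alpha,h_\alpha))$ as described in the context. For each singularity type $(\lambda,m)$ occurring in $Z$ there exists a Radon measure $\mu_{\lambda,m}$ on $Z_{\lambda,m}$ with full support such that for any $f\in C_c(D_{\lambda,m})$, $$\beta^{\lambda}(\log\beta)^{1-m}\int_D f(x)e^{-\beta V(x)}\,dx\;\to\;\int_{Z_{\lambda,m}}f\,d\mu_{\lambda,m},\qquad\beta\to\infty .$$ Furthermore, the limit measure is the pushforward $$\mu_{\lambda,m}=\pi_*\rho_{\lambda,m}$$ of a density $\rho_{\lambda,m}$ on the manifold $E_{\lambda,m}$ that can be described as follows: for any $A\subset A_{\mathrm{crit}}$ with $|A|=m$, and any monomializing chart $(U,y)$ such that $E_A$ is given in $U$ by $\{y_I=0\}$ for some $I\subset\{1,\dots,d'\}$, the density is given by $$\rho_{\lambda,m}=\frac{\Gamma(\lambda)}{(m-1)!}\,\frac{b(0_I,y_{-I})}{\prod_{i\in I}k_i}\,\prod_{i\notin I}|y_i|^{-2k_i\lambda+h_i}\,dy_{-I}.$$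
   Context: **Resolution data.** Let $K=\overline D$. By Hironaka's resolution theorem there exist, and we fix, a $d$-dimensional real-analytic manifold $M$, a relatively compact open neighborhood $W$ of $K$, a proper real-analytic map $\pi\colon M\to W$, and a finite collection $\{E_\alpha\}$ of real-analytic hypersurfaces in $M$ with simple normal crossings, each carrying numerical data $(k_\alpha,h_\alpha)$ with $k_\alpha\ge1$ and $h_\alpha\ge0$ integers, such that, with $W_0=W\cap V^{-1}(0)$: $\pi^{-1}(W_0)=\bigcup_\alpha E_\alpha$; $\pi$ restricts to a real-analytic isomorphism from $M\setminus\pi^{-1}(W_0)$ onto its image; and each $p\in\pi^{-1}(W_0)$ lies in a *monomializing chart* $(U,y)$, i.e. one with real-analytic coordinates $y=(y_1,\dots,y_d)$ in which those $E_\alpha$ that meet $U$ are given by $\{y_i=0\}$, $i=1,\dots,d'\le d$, and $V\circ\pi(y)=\prod_{i=1}^{d'}y_i^{2k_i}$, $|D\pi(y)|=b(y)\prod_{i=1}^{d'}|y_i|^{h_i}$, where $k_i,h_i$ are the numerical data of $\{y_i=0\}$, $|D\pi|$ is the absolute Jacobian determinant and $b$ is strictly positive real-analytic. By convention $k_i=h_i=0$ for $i=d'+1,\dots,d$. **Singularity types.** For an index set $A$ write $E_A=\bigcap_{\alpha\in A}E_\alpha$. For $x\in Z$, $$\lambda(x)=\min_\alpha\Big\{\tfrac{h_\alpha+1}{2k_\alpha}\colon x\in\pi(E_\alpha)\Big\},\qquad m(x)=\max_A\Big\{|A|\colon x\in\pi(E_A),\ \tfrac{h_\alpha+1}{2k_\alpha}=\lambda(x)\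 \forall\alpha\in A\Big\}.$$ The pair $(\lambda(x),m(x))$ is the singularity type of $x$; $Z_{\lambda,m}=\{x\in Z\colon\lambda(x)=\lambda,\ m(x)=m\}$. Only finitely many types occur; they are totally ordered by: $(\lambda,m)<(\lambda',m')$ iff $\lambda<\lambda'$, or $\lambda=\lambda'$ and $m>m'$. Set $$D_{\lambda,m}=D\setminus\bigcup_{(\lambda',m')<(\lambda,m)}Z_{\lambda',m'}.$$ This is an open set in which $Z_{\lambda,m}$ is closed. **Index sets and $E_{\lambda,m}$.** Given $\lambda$, let $A_{\mathrm{crit}}=\{\alpha\colon\frac{h_\alpha+1}{2k_\alpha}=\lambda\}$ and $A_{\mathrm{sup}}=\{\alpha\colon\frac{h_\alpha+1}{2k_\alpha}<\lambda\}$. Let $$C=\Big(\bigcup_{\alpha\in A_{\mathrm{sup}}}E_\alpha\Big)\cup\Big(\bigcup_{A\subset A_{\mathrm{crit}},\,|A|>m}E_A\Big),\quad C_{\mathrm{sat}}=\pi^{-1}(\pi(C)),\quad E_{\lambda,m}=\pi^{-1}(D)\cap\Big(\bigcup_{A\subset A_{\mathrm{crit}},\,|A|=m}E_A\Big)\setminus C_{\mathrm{sat}}.$$ $E_{\lambda,m}$ is a codimension-$m$ real-analytic submanifold of $M$ with $\pi(E_{\lambda,m})=Z_{\lambda,m}$. The pushforward $\pi_*\rho_{\lambda,m}$ is by the restriction of $\pi$ to $E_{\lambda,m}$, with the density $\rho_{\lambda,m}$ regarded as a measure on $E_{\lambda,m}$; the displayed formula describes it on $E_{\lambda,m}\cap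 E_A\cap U$. **Notation.** For $I\subset\{1,\dots,d\}$, $y_I=(y_i)_{i\in I}$, $y_{-I}=(y_i)_{i\notin I}$, and $(0_I,y_{-I})$ is the point whose coordinates in $I$ are zero and whose other coordinates are $y_{-I}$. $\Gamma$ is the Gamma function. A set is subanalytic if locally (near every point of the ambient real-analytic manifold) it is the image under a projection $M'\times N\to M'$ of a relatively compact semianalytic set, a semianalytic set being one locally given by finite unions of finite intersections of sets $\{f>0\}$ or $\{f=0\}$ with $f$ real-analytic. *)

(* Defs.v *)
From HB Require Import structures.
From mathcomp Require Import all_boot all_order all_algebra.
From mathcomp Require Import all_classical all_reals all_analysis.
Set Implicit Arguments.
Unset Strict Implicit.
Unset Printing Implicit Defensive.
Import Order.TTheory GRing.Theory Num.Theory.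
Import numFieldNormedType.Exports.
Local Open Scope classical_set_scope.
Local Open Scope ring_scope.

Definition borel (T : ptopologicalType) := g_sigma_algebraType (@open T).


Section ProductMeasure.
Context {R : realType}.

Definition cons_row n (p : measurableTypeR R * borel 'rV[R]_n) :
  borel 'rV[R]_(1 + n) := row_mx (p.1 : R)%:M (p.2 : 'rV[R]_n).

Lemma measurable_cons_row n : measurable_fun setT (@cons_row n).
Proof.
apply: (@measurability _ _ _ _ setT (@cons_row n) (@open 'rV[R]_(1 + n))) => //.
move=> _ [ O openO <-]; rewrite setTI.
pose qball (c : 'rV[rat]_(1 + n)) (k : nat) : set 'rV[R]_(1 + n) :=
  ball (map_mx ratr c : 'rV[R]_(1 + n)) k.+1%:R^-1.
pose rect (i : 'rV[rat]_(1 + n) * nat) :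
    set (measurableTypeR R * borel 'rV[R]_n) :=
  if `[< qball i.1 i.2 `<=` O >] then
    ball (ratr (i.1 ord0 (lshift n ord0)) : R) i.2.+1%:R^-1 `*`
    ball (map_mx ratr (rsubmx i.1) : 'rV[R]_n) i.2.+1%:R^-1
  else set0.
have qballE c k t u : qball c k (cons_row (t, u)) <->
    (ball (ratr (c ord0 (lshift n ord0)) : R) k.+1%:R^-1 t /\
     ball (map_mx ratr (rsubmx c) : 'rV[R]_n) k.+1%:R^-1 u).
  split=> [[_ h]|[h1 [_ h2]]].
    split; first by have := h ord0 (lshift n ord0);
      rewrite /cons_row/= row_mxEl !mxE eqxx mulr1n.
    split=> // i j; have := h i (rshift 1 j).
    by rewrite /cons_row/= row_mxEr !mxE.
  split=> // i j; rewrite (ord1 i) /cons_row/=.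
  case: (split_ordP j) => j' ->.
    by rewrite row_mxEl !mxE (ord1 j') eqxx mulr1n.
  by rewrite row_mxEr; have := h2 ord0 j'; rewrite !mxE.
have -> : @cons_row n @^-1` O = \bigcup_i rect i.
  apply/seteqP; split=> [[t u] Otu|[t u] [[c k] _]]; last first.
    rewrite /rect/=; case: asboolP => // cO -[/= h1 h2].
    by apply: cO; apply/qballE.
  have /= := openO; rewrite openE => /(_ _ Otu) /nbhs_ballP[e /= e0 eO].
  have [k ke] : exists k : nat, k.+1%:R^-1 < e / 2 :> R.
    have := @near_infty_natSinv_lt R (PosNum (divr_gt0 e0 (ltr0n R 2))).
    by move=> [k _ /(_ k (leqnn k))] ?; exists k.
  have kk0 : 0 < k.+1%:R^-1 :> R by rewrite invr_gt0 ltr0n.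
  have /choice[q hq] : forall j : 'I_(1 + n), exists q : rat,
      ball (ratr q : R) k.+1%:R^-1 (cons_row (t, u) ord0 j).
    move=> j; set x : R := cons_row _ _ _.
    have : x < x + k.+1%:R^-1 by rewrite ltrDl.
    move=> /rat_in_itvoo[q /itvP qx]; exists q.
    rewrite /ball/= ger0_norm ?subr_ge0 ?qx//.
    by rewrite ltrBlDl qx.
  pose c : 'rV[rat]_(1 + n) := \row_j q j.
  have cx : qball c k (cons_row (t, u)).
    by split=> // i j; have := hq j; rewrite (ord1 i) !mxE.
  exists (c, k) => //; rewrite /rect; case: asboolP => /= [_|]; last first.
    case=> y cy; apply: eO; rewrite (splitr e).
    apply: (@ball_triangle _ 'rV[R]_(1 + n) (map_mx ratr c)).
      by apply: ball_sym; apply: le_ball (ltW ke) _ _.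
    by apply: le_ball (ltW ke) _ _.
  exact/qballE.
apply: countable_bigcupT_measurable; first exact: countableP.
move=> i; rewrite /rect; case: asboolP => // _; apply: measurableX.
  by apply: measurable_realfun.open_measurable; exact: ball_open.
by apply: sub_sigma_algebra; exact: ball_open.
Qed.

Section cons_measure.
Context n (nu : {sigma_finite_measure set (measurableTypeR R) -> \bar R})
  (m : {measure set (borel 'rV[R]_n) -> \bar R}).

Definition cons_measure : set (borel 'rV[R]_(1 + n)) -> \bar R :=
  pushforward (nu \x^ m)%E (@cons_row n).

Let cons_measure0 : cons_measure set0 = 0%E.
Proof. by rewrite /cons_measure /pushforward preimage_set0 measure0. Qed.

Let cons_measure_ge0 A : (0 <= cons_measure A)%E.
Proof. by rewrite /cons_measure /pushforward measure_ge0. Qed.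

Let cons_measure_sigma_additive : semi_sigma_additive cons_measure.
Proof.
move=> F mF tF mUF; rewrite /cons_measure /pushforward preimage_bigcup.
have mpre A : measurable A -> measurable (@cons_row n @^-1` A).
  by move=> mA; rewrite -[X in measurable X]setTI; exact: measurable_cons_row.
apply: measure_semi_sigma_additive.
- by move=> i; exact: mpre.
- apply/trivIsetP => /= i j _ _ ij; rewrite -preimage_setI.
  by move/trivIsetP : tF => /(_ _ _ _ _ ij) ->//; rewrite preimage_set0.
- by rewrite -preimage_bigcup; exact: mpre.
Qed.

HB.instance Definition _ := isMeasure.Build _ _ _ cons_measure
  cons_measure0 cons_measure_ge0 cons_measure_sigma_additive.

End cons_measure.

(* The recursion is the usual one,
   nu_0 x ... x nu_n = nu_0 x (nu_1 x ... x nu_n), read on row vectors. *)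
Fixpoint prod_measure n :
    ('I_n -> {sigma_finite_measure set (measurableTypeR R) -> \bar R}) ->
    {measure set (borel 'rV[R]_n) -> \bar R} :=
  match n with
  | 0 => fun _ => @dirac _ (borel 'rV[R]_0) 0 R
  | n'.+1 => fun nu =>
      cons_measure (nu ord0) (prod_measure (fun i => nu (lift ord0 i)))
  end.

Definition lebesgue_rV n : {measure set (borel 'rV[R]_n) -> \bar R} :=
  prod_measure (fun _ => lebesgue_measure).

Definition coord_measure (dirac0 : bool) :
    {sigma_finite_measure set (measurableTypeR R) -> \bar R} :=
  match dirac0 with
  | true => @dirac _ (measurableTypeR R) 0 R
  | false => lebesgue_measure
  end.

(* The measure dy_{-J} on the coordinate subspace {y | y_J = 0}, as a measure
   on the ambient space: Dirac mass at 0 in the coordinates of J, Lebesgue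
   measure in the others. *)
Definition lebesgue_off n (J : {set 'I_n}) :
    {measure set (borel 'rV[R]_n) -> \bar R} :=
  prod_measure (fun i => coord_measure (i \in J)).

Definition Gamma (s : R) : R :=
  \int[lebesgue_measure]_(t in `]0, +oo[%classic) (t `^ (s - 1) * expR (- t)).

End ProductMeasure.

Section Analytic.
Context {R : realType}.

Definition monomial n (a : {ffun 'I_n -> nat}) (z : 'rV[R]_n) : R :=
  \prod_i z ord0 i ^+ a i.

(* Near x, f is the sum of an absolutely convergent power series; the order of
   summation being then irrelevant, its value is computed as the limit of the
   partial sums over the boxes {a | a_i < N for all i}. *)
Definition analytic_at n (f : 'rV[R]_n -> R) (x : 'rV[R]_n) :=
  exists c : {ffun 'I_n -> nat} -> R,
  \forall y \near x,
    summable setT (fun a => (c a * monomial a (y - x))%:E) /\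
    (fun N => \sum_(a : {ffun 'I_n -> 'I_N})
       c [ffun i => val (a i)] * monomial [ffun i => val (a i)] (y - x))
      @ \oo --> f y.

Definition analytic_on n (U : set 'rV[R]_n) (f : 'rV[R]_n -> R) :=
  forall x, U x -> analytic_at f x.

Definition analytic_map_on n m (U : set 'rV[R]_n) (f : 'rV[R]_n -> 'rV[R]_m) :=
  forall j, analytic_on U (fun x => f x ord0 j).

End Analytic.

Section Manifold.
Context {R : realType}.

(* Only the values of chart_fwd on chart_dom, and of chart_bwd on the image of
   chart_dom, are meaningful. *)
Record chart (M : topologicalType) (n : nat) := Chart {
  chart_dom : set M ;
  chart_fwd : M -> 'rV[R]_n ;
  chart_bwd : 'rV[R]_n -> M }.

Definition chart_cod M n (c : chart M n) : set 'rV[R]_n := chart_fwd c @` chart_dom c.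

Definition is_chart M n (c : chart M n) :=
  [/\ open (chart_dom c), open (chart_cod c),
      (forall p, chart_dom c p -> chart_bwd c (chart_fwd c p) = p),
      {within chart_dom c, continuous (chart_fwd c)} &
      {within chart_cod c, continuous (chart_bwd c)}].

Definition analytic_transition M n (c c' : chart M n) :=
  analytic_map_on (chart_fwd c @` (chart_dom c `&` chart_dom c')) (chart_fwd c' \o chart_bwd c).

Definition analytic_atlas M n (A : set (chart M n)) :=
  [/\ (forall c, A c -> is_chart c),
      (forall p, exists2 c, A c & chart_dom c p) &
      (forall c c', A c -> A c' -> analytic_transition c c')].

Definition analytic_manifold (M : topologicalType) n (A : set (chart M n)) :=
  [/\ hausdorff_space M, @second_countable M & analytic_atlas A].

(* The charts of the maximal atlas, i.e. all real-analytic coordinates. *)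
Definition analytic_chart M n (A : set (chart M n)) (c : chart M n) :=
  is_chart c /\
  forall c', A c' -> analytic_transition c c' /\ analytic_transition c' c.

Definition mfd_analytic_on M n (A : set (chart M n)) (U : set M) (f : M -> R) :=
  forall c, A c -> analytic_on (chart_fwd c @` (chart_dom c `&` U)) (f \o chart_bwd c).

Definition prod_chart M N m n (c : chart M m) (c' : chart N n) :
    chart (M * N)%type (m + n) :=
  Chart (chart_dom c `*` chart_dom c') (fun p => row_mx (chart_fwd c p.1) (chart_fwd c' p.2))
    (fun v => (chart_bwd c (lsubmx v), chart_bwd c' (rsubmx v))).

Definition prod_atlas M N m n (A : set (chart M m)) (B : set (chart N n)) :
    set (chart (M * N)%type (m + n)) :=
  [set c | exists a b, [/\ A a, B b & c = prod_chart a b]].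

Definition rV_atlas n : set (chart 'rV[R]_n n) := [set Chart setT id id].

Definition semianalytic M n (A : set (chart M n)) (X : set M) :=
  forall p : M, exists U : set M, [/\ open U, U p &
    exists (r s : nat) (g : 'I_r -> 'I_s -> M -> R) (pos : 'I_r -> 'I_s -> bool),
      (forall i j, mfd_analytic_on A U (g i j)) /\
      (forall q, U q -> (X q <-> exists i, forall j,
         if pos i j then 0 < g i j q else g i j q == 0))].

Definition subanalytic M n (A : set (chart M n)) (X : set M) :=
  forall p : M, exists U : set M, [/\ open U, U p &
    exists (N : topologicalType) (k : nat) (B : set (chart N k))
      (S : set (M * N)),
      [/\ analytic_manifold B, semianalytic (prod_atlas A B) S,
          compact (closure S) & X `&` U = fst @` S]].

Definition hypersurface M n (A : set (chart M n)) (H : set M) :=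
  closed H /\
  forall p, H p -> exists c, [/\ analytic_chart A c, chart_dom c p &
    exists i, forall q, chart_dom c q -> (H q <-> chart_fwd c q ord0 i = 0)].

(* lab i = Some a means that the coordinate hyperplane {y_i = 0} is the trace
   of E a on the domain of c; the coordinates with lab i = None cut out none
   of the E a. *)
Definition normal_crossing_chart M n (A : set (chart M n)) (I : finType)
    (E : I -> set M) (c : chart M n) (lab : 'I_n -> option I) :=
  [/\ analytic_chart A c,
      (forall a, (E a `&` chart_dom c !=set0) <-> exists i, lab i = Some a),
      (forall i j a, lab i = Some a -> lab j = Some a -> i = j) &
      (forall i a, lab i = Some a ->
         forall q, chart_dom c q -> (E a q <-> chart_fwd c q ord0 i = 0))].

Definition simple_normal_crossings M n (A : set (chart M n)) (I : finType)
    (E : I -> set M) :=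
  forall p, exists c lab, chart_dom c p /\ normal_crossing_chart A E c lab.

End Manifold.

Section Resolution.
Context {R : realType} {d : nat}.

Record resolution_data := ResolutionData {
  rd_space : ptopologicalType ;
  rd_atlas : set (@chart R rd_space d) ;
  rd_base : set 'rV[R]_d ;
  rd_proj : rd_space -> 'rV[R]_d ;
  rd_index : finType ;
  rd_div : rd_index -> set rd_space ;
  rd_k : rd_index -> nat ;
  rd_h : rd_index -> nat }.

Arguments rd_atlas : clear implicits.
Arguments rd_proj : clear implicits.
Arguments rd_div : clear implicits.
Arguments rd_k : clear implicits.
Arguments rd_h : clear implicits.

(* The convention that k_i = h_i = 0 when {y_i = 0} is not one of the
   E_alpha. *)
Definition num_at (I : finType) n (num : I -> nat) (lab : 'I_n -> option I)
  (i : 'I_n) : nat := oapp num 0%N (lab i).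

Record monomializing (V : 'rV[R]_d -> R) (X : resolution_data)
    (c : chart (rd_space X) d) (lab : 'I_d -> option (rd_index X))
    (b : 'rV[R]_d -> R) : Prop := Monomializing {
  mono_chart : normal_crossing_chart (rd_atlas X) (rd_div X) c lab ;
  mono_first : exists2 d' : nat, (d' <= d)%N &
    forall i : 'I_d, isSome (lab i) = (i < d')%N ;
  mono_V : forall y, chart_cod c y ->
    V (rd_proj X (chart_bwd c y)) = \prod_i y ord0 i ^+ (2 * num_at (rd_k X) lab i) ;
  mono_b : analytic_on (chart_cod c) b /\ (forall y, chart_cod c y -> 0 < b y) ;
  mono_jac : forall y, chart_cod c y ->
    `| \det (jacobian (rd_proj X \o chart_bwd c) y) | =
    b y * \prod_i `| y ord0 i | ^+ num_at (rd_h X) lab i }.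

(* The preimage of W_0, the zero set of V in W = rd_base X. *)
Definition total_divisor (V : 'rV[R]_d -> R) (X : resolution_data) :
    set (rd_space X) :=
  rd_proj X @^-1` (rd_base X `&` V @^-1` [set 0]).

Arguments total_divisor : clear implicits.
Arguments monomializing : clear implicits.

(* Off the total divisor, rd_proj is an analytic isomorphism with inverse g onto
   its image O. The field res_lift makes the singularity type of every zero of V
   in D a minimum over a nonempty family of E_alpha. *)
Record resolution (V : 'rV[R]_d -> R) (D : set 'rV[R]_d)
    (X : resolution_data) : Prop := Resolution {
  res_base : [/\ open (rd_base X), compact (closure (rd_base X)) &
    closure D `<=` rd_base X] ;
  res_space : analytic_manifold (rd_atlas X) ;
  res_range : forall p, rd_base X (rd_proj X p) ;
  res_analytic : forall j,
    mfd_analytic_on (rd_atlas X) setT (fun p => rd_proj X p ord0 j) ;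
  res_proper : forall K, K `<=` rd_base X -> compact K ->
    compact (rd_proj X @^-1` K) ;
  res_divisor : forall a, hypersurface (rd_atlas X) (rd_div X a) ;
  res_snc : simple_normal_crossings (rd_atlas X) (rd_div X) ;
  res_knum : forall a, (1 <= rd_k X a)%N ;
  res_preimage : total_divisor V X = \bigcup_a rd_div X a ;
  res_iso : exists (O : set 'rV[R]_d) (g : 'rV[R]_d -> rd_space X),
    [/\ O = rd_proj X @` ~` total_divisor V X, open O,
        (forall p, ~ total_divisor V X p -> g (rd_proj X p) = p),
        {within O, continuous g} &
        forall c, rd_atlas X c ->
          analytic_map_on (O `&` g @^-1` chart_dom c) (chart_fwd c \o g)] ;
  res_mono : forall p, total_divisor V X p ->
    exists c lab b, chart_dom c p /\ monomializing V X c lab b ;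
  res_lift : forall x, D x -> V x = 0 -> exists p, rd_proj X p = x }.

End Resolution.
Arguments resolution_data : clear implicits.
Arguments rd_atlas {R d} X : rename.
Arguments rd_proj {R d} X p : rename.
Arguments rd_div {R d} X a _ : rename.
Arguments rd_k {R d} X a : rename.
Arguments rd_h {R d} X a : rename.
Arguments total_divisor {R d} V X _.
Arguments monomializing {R d} V X c lab b.

Section SingularityTypes.
Context {R : realType} {d : nat}.
Variables (V : 'rV[R]_d -> R) (D : set 'rV[R]_d) (X : resolution_data R d).

Let M := rd_space X.
Let pi := rd_proj X.
Let E := rd_div X.

Definition zeros : set 'rV[R]_d := D `&` V @^-1` [set 0].

Definition ratio (a : rd_index X) : R := (rd_h X a).+1%:R / (2 * rd_k X a)%:R.

Definition stratum (A : {set rd_index X}) : set M := \bigcap_(a in [set` A]) E a.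

(* Extended-real valued so that the minimum over the empty family is +oo. *)
Definition lambda_at (x : 'rV[R]_d) : \bar R :=
  \big[Order.min/+oo%E]_(a | `[< (pi @` E a) x >]) (ratio a)%:E.

Definition mult_at (x : 'rV[R]_d) : nat :=
  \max_(A : {set rd_index X} | `[< (pi @` stratum A) x /\
    forall a, a \in A -> (ratio a)%:E = lambda_at x >]) #|A|.

Definition Zset (lam : R) (m : nat) : set 'rV[R]_d :=
  [set x | [/\ zeros x, lambda_at x = lam%:E & mult_at x = m]].

Definition type_lt (lam : R) (m : nat) (lam' : R) (m' : nat) : Prop :=
  lam < lam' \/ (lam = lam' /\ (m' < m)%N).

Definition Dset (lam : R) (m : nat) : set 'rV[R]_d :=
  D `\` [set x | exists lam' m', type_lt lam' m' lam m /\ Zset lam' m' x].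

Definition crit (lam : R) : {set rd_index X} := [set a | ratio a == lam]%SET.
Definition subcrit (lam : R) : {set rd_index X} := [set a | ratio a < lam]%SET.

Definition Cset (lam : R) (m : nat) : set M :=
  \bigcup_(a in [set` subcrit lam]) E a `|`
  \bigcup_(A in [set A : {set rd_index X} | A \subset crit lam /\ (m < #|A|)%N]) stratum A.

Definition Csat (lam : R) (m : nat) : set M := pi @^-1` (pi @` Cset lam m).

Definition Eset (lam : R) (m : nat) : set M :=
  (pi @^-1` D `&`
   \bigcup_(A in [set A : {set rd_index X} | A \subset crit lam /\ #|A| = m]) stratum A)
  `\` Csat lam m.

End SingularityTypes.
Arguments crit {R d} X lam.
Arguments subcrit {R d} X lam.
Arguments Cset {R d} X lam m _.
Arguments Csat {R d} X lam m _.
Arguments Eset {R d} D X lam m _.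

Section Conclusion.
Context {R : realType}.

(* Radon measures of full support on a Borel subset Z of R^n, given as Borel
   measures on R^n concentrated on Z: finiteness is required on the compact
   subsets of Z only, so mu need not be locally finite at the boundary of Z. *)
Definition radon_on n (Z : set 'rV[R]_n)
    (mu : {measure set (borel 'rV[R]_n) -> \bar R}) :=
  [/\ mu (~` Z) = 0%E,
      (forall K : set 'rV[R]_n, compact K -> K `<=` Z -> (mu K < +oo)%E) &
      forall B : set (borel 'rV[R]_n), measurable B ->
        mu B = ereal_sup [set mu K | K in
                 [set K : set 'rV[R]_n | compact K /\ K `<=` B `&` Z]]].

Definition full_support_on n (Z : set 'rV[R]_n)
    (mu : {measure set (borel 'rV[R]_n) -> \bar R}) :=
  forall O : set 'rV[R]_n, open O -> O `&` Z !=set0 -> (0 < mu (O `&` Z))%E.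

Definition compactly_supported_in n (U : set 'rV[R]_n) (f : 'rV[R]_n -> R) :=
  [/\ continuous f, compact (closure [set x | f x != 0]) &
      closure [set x | f x != 0] `<=` U].

Definition laplace_limit d (V : 'rV[R]_d -> R) (D : set 'rV[R]_d)
    (lam : R) (m : nat) (Z : set 'rV[R]_d)
    (mu : {measure set (borel 'rV[R]_d) -> \bar R}) (f : 'rV[R]_d -> R) :=
  (fun beta : R => (beta `^ lam * ln beta ^ (1 - m%:Z))%:E *
     \int[lebesgue_rV d]_(x in D) (f x * expR (- (beta * V x)))%:E)%E
  @ +oo%R --> (\int[mu]_(x in Z) (f x)%:E)%E.

Definition zero_coords n (J : {set 'I_n}) (y : 'rV[R]_n) : 'rV[R]_n :=
  \row_i (if i \in J then 0 else y ord0 i).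

Definition density_coef d (X : resolution_data R d)
    (lab : 'I_d -> option (rd_index X)) (b : 'rV[R]_d -> R)
    (lam : R) (m : nat) (J : {set 'I_d}) (y : 'rV[R]_d) : R :=
  Gamma lam / (m.-1)`!%:R *
  (b (zero_coords J y) / \prod_(i in J) (num_at (rd_k X) lab i)%:R) *
  \prod_(i in ~: J) `| y ord0 i | `^
     (- (2 * (num_at (rd_k X) lab i)%:R * lam) +
      (num_at (rd_h X) lab i)%:R).

(* The density rho is handled as the Borel measure it defines on M, which is
   concentrated on the submanifold Eset; in the chart, y_{-J} are coordinates
   of the submanifold and lebesgue_off J is dy_{-J}. *)
Definition has_density_formula d (V : 'rV[R]_d -> R) (D : set 'rV[R]_d)
    (X : resolution_data R d) (lam : R) (m : nat)
    (rho : {measure set (borel (rd_space X)) -> \bar R}) :=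
  forall (A : {set rd_index X}), A \subset crit X lam -> #|A| = m ->
  forall c lab b, monomializing V X c lab b ->
  forall J : {set 'I_d}, (forall i, i \in J -> isSome (lab i)) ->
    stratum A `&` chart_dom c =
      [set p | chart_dom c p /\ forall i, i \in J -> chart_fwd c p ord0 i = 0] ->
  forall B : set (borel (rd_space X)), measurable B ->
    B `<=` Eset D X lam m `&` stratum A `&` chart_dom c ->
    rho B = (\int[lebesgue_off J]_(y in chart_fwd c @` B)
               (density_coef lab b lam m J y)%:E)%E.

End Conclusion.

(* Main.v *)
From HB Require Import structures.
Require Import Defs.
From mathcomp Require Import all_boot all_order all_algebra.
From mathcomp Require Import all_classical all_reals all_analysis.
From mathcomp Require Import measurable_realfun.
From mathcomp Require Import ring lra.
(** The singularities of [V] are resolved by [pi], so that the integral of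
    [f * exp (- beta * V)] becomes, away from a remainder, an integral over the
    resolution of [f (pi y) * |det D pi| * exp (- beta * V (pi y))]. In a
    monomializing chart the integrand is [exp (- beta * prod y_i ^ (2 * k_i))]
    times [prod |y_i| ^ h_i] times a smooth function.

    Such an integral is computed over a cube by splitting the coordinates. A
    coordinate is critical when [h + 1 = 2 * k * lam]; the substitution
    [w = beta * t ^ (2 * k)] turns [t ^ h dt] into a multiple of
    [w ^ lam * dw / w], so that the first critical coordinate produces
    [Gamma lam] and each further one a primitive against [dw / w], that is one
    more power of [ln beta] divided by the number of the step ([crit_box]). The
    critical integral concentrates at the origin of its coordinates, and the
    other coordinates only rescale [beta]; dominated convergence in them yields
    the density on the face of the critical coordinates ([mono_limit]). Faces of
    codimension less than [m] are negligible, and larger codimensions or smaller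
    exponents are excluded on the set [Dreg] from which the images of the worse
    strata have been removed. Transported by [change_of_variables], this gives
    the limit for test functions supported in a small cube of a chart
    ([local_limit]).

    The limit of an integral does not depend on the chart in which it is
    computed. Therefore the face measures of two cubes agree where the cubes
    overlap ([cube_agree]), and they glue to one measure [rho] on the resolution
    ([global_density]), from which the density formula in an arbitrary chart is
    read off. The measure [mu] is its pushforward; it is Radon since the
    projection is proper, and it has full support since the density is positive
    almost everywhere on the stratum.

    For a continuous [f] with compact support, finitely many cubes cover the
    part of the divisor over the support, and a partition of [f] along them
    ([partition_cubes]) reduces the limit to [local_limit], provided that [V] is
    bounded below on the rest of the support. This holds up to a null set if the
    projection is onto a neighbourhood of every zero of [V] in [D], which is the
    remaining point ([proj_onto]). The image of the projection is closed, and
    its boundary consists of zeros. If a point near a zero were missed, almost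
    every segment from a small ball of the image to a ball around that point
    would leave the image at a zero. But the lemma of Sard, contained in the
    area inequality, shows that almost every line crosses the images of the
    divisors transversally at points on a single divisor; the preimage of the
    line is then a curve across the divisor, along which the position on the
    line is continuous and, as the projection is injective off the divisor,
    injective, hence monotone ([line_crossing]). So the image is open in the
    line at such a point, a contradiction. *)

Set Implicit Arguments.
Unset Strict Implicit.
Unset Printing Implicit Defensive.
Import Order.TTheory GRing.Theory Num.Theory.
Import numFieldNormedType.Exports.
Local Open Scope classical_set_scope.
Local Open Scope ring_scope.

(** * Borel sets and continuity *)

Section BorelSpaces.
Context {R : realType}.

Lemma open_borel (T : ptopologicalType) (A : set T) :
  open A -> measurable (A : set (borel T)).
Proof. by move=> oA; exact: sub_sigma_algebra. Qed.

Lemma closed_borel (T : ptopologicalType) (A : set T) :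
  closed A -> measurable (A : set (borel T)).
Proof.
by move=> cA; rewrite -[A]setCK; apply: measurableC; apply: open_borel; rewrite openC.
Qed.

Lemma borel_continuous_within (T U : ptopologicalType) (D : set T) (f : T -> U) :
  measurable (D : set (borel T)) -> {within D, continuous f} ->
  measurable_fun (D : set (borel T)) (f : borel T -> borel U).
Proof.
move=> mD /continuousP cf.
apply: (@measurability _ _ (borel T) (borel U) D f (@open U)) => //.
move=> _ [ O oO <-]; have /open_subspaceP[B oB BD] := cf O oO.
by rewrite setIC -BD; apply: measurableI => //; exact: open_borel.
Qed.

Lemma borel_continuous (T U : ptopologicalType) (f : T -> U) :
  continuous f -> measurable_fun setT (f : borel T -> borel U).
Proof.
by move=> cf; apply: borel_continuous_within => //; exact: continuous_subspaceT.
Qed.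

Lemma borel_realE : (@measurable _ (borel R) : set (set R)) =
  @measurable _ (measurableTypeR R).
Proof.
apply/seteqP; split=> A mA.
  have h : measurable_fun setT (id : measurableTypeR R -> borel R).
    apply: (@measurability _ _ (measurableTypeR R) (borel R) setT _ (@open R)) => //.
    by move=> _ [ O oO <-]; rewrite setTI; exact: measurable_realfun.open_measurable.
  by have := h measurableT A mA; rewrite setTI.
move: A mA.
have : measurable_fun setT (id : borel R -> measurableTypeR R).
  pose f := (id : borel R -> measurableTypeR R); rewrite -/f.
  apply: (@measurability _ _ (borel R) (measurableTypeR R) setT f (@measurable_realfun.RGenOInfty.G R)).
    exact: (measurable_realfun.RGenOInfty.measurableE R).
  by move=> _ [_ [x ->] <-]; rewrite setTI; apply: open_borel; exact: interval_open.
by move=> h A mA; have := h measurableT A mA; rewrite setTI.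
Qed.

Lemma borel_real_measurable_fun (T : ptopologicalType) (D : set T) (f : T -> R) :
  measurable_fun (D : set (borel T)) (f : borel T -> borel R) ->
  measurable_fun (D : set (borel T)) (f : borel T -> measurableTypeR R).
Proof. by move=> mf mD A; rewrite -borel_realE; exact: mf. Qed.

Lemma continuous_borel_fun (T : ptopologicalType) (f : T -> R) :
  continuous f -> measurable_fun setT (f : borel T -> measurableTypeR R).
Proof. by move=> cf; apply: borel_real_measurable_fun; exact: borel_continuous. Qed.

Lemma within_borel_fun (T : ptopologicalType) (D : set T) (f : T -> R) :
  measurable (D : set (borel T)) -> {within D, continuous f} ->
  measurable_fun (D : set (borel T)) (f : borel T -> measurableTypeR R).
Proof.
by move=> mD cf; apply: borel_real_measurable_fun; exact: borel_continuous_within.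
Qed.

Lemma rV_coord_measurable n (i : 'I_n) :
  measurable_fun setT ((fun y => y ord0 i) : borel 'rV[R]_n -> measurableTypeR R).
Proof. by apply: continuous_borel_fun; exact: coord_continuous. Qed.

Lemma rV_continuous (T : topologicalType) n (f : T -> 'rV[R]_n) (x : T) :
  (forall j, {for x, continuous (fun t => f t ord0 j)}) -> {for x, continuous f}.
Proof.
move=> cf; apply/cvgrPdist_lt => e e0.
have h j : \forall t \near x, `|f x ord0 j - f t ord0 j| < e.
  by have /cvgrPdist_lt := cf j; exact.
near=> t.
rewrite [ltLHS]/Num.norm/= mx_normrE (bigmax_lt _ _)//= => -[i j] _ /=.
rewrite !mxE (ord1 i).
by move: j {i}; near: t; apply: filter_forall.
Unshelve. all: by end_near.
Qed.

End BorelSpaces.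

(** * Product measures on row vectors *)

Section ProductMeasureTheory.
Context {R : realType}.
Local Open Scope ereal_scope.

Lemma cons_row0 n (t : measurableTypeR R) (u : borel 'rV[R]_n) :
  (cons_row (t, u) : 'rV[R]_n.+1) ord0 ord0 = t.
Proof.
transitivity ((cons_row (t, u) : 'rV[R]_(1 + n)) ord0 (lshift n ord0)).
  by congr (_ _ _); exact/val_inj.
by rewrite /cons_row/= row_mxEl !mxE eqxx mulr1n.
Qed.

Lemma cons_rowS n (t : measurableTypeR R) (u : borel 'rV[R]_n) (i : 'I_n) :
  (cons_row (t, u) : 'rV[R]_n.+1) ord0 (lift ord0 i) = (u : 'rV[R]_n) ord0 i.
Proof.
transitivity ((cons_row (t, u) : 'rV[R]_(1 + n)) ord0 (rshift 1 i)).
  by congr (_ _ _); exact/val_inj.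
by rewrite /cons_row/= row_mxEr.
Qed.

Lemma rV_consP n (y : 'rV[R]_n.+1) :
  y = cons_row (y ord0 ord0 : measurableTypeR R, (rsubmx (y : 'rV[R]_(1 + n)) : borel 'rV[R]_n)).
Proof.
apply/rowP => i; case: (unliftP ord0 i) => [j|] ->; last by rewrite cons_row0.
by rewrite cons_rowS mxE; congr (_ _ _); exact/val_inj.
Qed.

Lemma measurable_rsubmx n : measurable_fun setT
  ((fun y => rsubmx (y : 'rV[R]_(1 + n))) : borel 'rV[R]_n.+1 -> borel 'rV[R]_n).
Proof.
apply: borel_continuous => x; apply: rV_continuous => j.
rewrite /prop_for (_ : (fun t => _) = (fun t : 'rV[R]_n.+1 => t ord0 (lift ord0 j))).
  exact: coord_continuous.
by apply/funext => t; rewrite mxE; congr (_ _ _); exact/val_inj.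
Qed.

(** The products of the members of exhausting sequences of the factors exhaust
    the product; sigma-finiteness is what Tonelli needs in the recursion on the
    dimension. *)
Lemma sigma_finite_prod_measure n
    (nu : 'I_n -> {sigma_finite_measure set (measurableTypeR R) -> \bar R}) :
  sigma_finite setT (prod_measure nu).
Proof.
elim: n nu => [|n IH] nu.
  exists (fun=> setT); first by rewrite bigcup_const//; exists 0%N.
  by move=> _; split => //=; rewrite diracT ltry.
have /sigma_finiteP[F [TF ndF Foo]] := sigma_finiteT (nu ord0).
have /sigma_finiteP[G [TG ndG Goo]] := IH (fun i => nu (lift ord0 i)).
exists (fun k => [set y : borel 'rV[R]_n.+1 | F k (y ord0 ord0)] `&`
  [set y : borel 'rV[R]_n.+1 | G k (rsubmx (y : 'rV[R]_(1 + n)))]).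
  apply/seteqP; split => // y _.
  have [k _ Fk] : (\bigcup_i F i) (y ord0 ord0) by rewrite -TF.
  have [l _ Gl] : (\bigcup_i G i) (rsubmx (y : 'rV[R]_(1 + n))) by rewrite -TG.
  exists (maxn k l) => //; split.
    by have /subsetPset := ndF _ _ (leq_maxl k l); exact.
  by have /subsetPset := ndG _ _ (leq_maxr k l); exact.
move=> k; have [mF Fk] := Foo k; have [mG Gk] := Goo k; split.
  apply: measurableI.
    by have := rV_coord_measurable (ord0 : 'I_n.+1) measurableT mF; rewrite setTI.
  by have := measurable_rsubmx measurableT mG; rewrite setTI.
rewrite /= /cons_measure /pushforward.
rewrite (_ : _ @^-1` _ = F k `*` G k).
  by rewrite product_measure2E// lte_mul_pinfty// ge0_fin_numE.
apply/seteqP; split=> -[t u] /=; rewrite cons_row0;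
  rewrite (_ : rsubmx _ = u)// /cons_row ?row_mxKr//.
Qed.

Definition prod_sfm n
    (nu : 'I_n -> {sigma_finite_measure set (measurableTypeR R) -> \bar R}) :
    set (borel 'rV[R]_n) -> \bar R := prod_measure nu.

HB.instance Definition _ n nu := Measure.copy (@prod_sfm n nu) (prod_measure nu).
HB.instance Definition _ n nu := Measure_isSigmaFinite.Build _ _ _ (@prod_sfm n nu)
  (sigma_finite_prod_measure nu).

Section cons.
Variables (n : nat) (nu : 'I_n.+1 -> {sigma_finite_measure set (measurableTypeR R) -> \bar R}).
Let nu' i := nu (lift ord0 i).
Variable f : 'rV[R]_n.+1 -> \bar R.
Hypothesis mf : measurable_fun setT (f : borel 'rV[R]_n.+1 -> \bar R).

Lemma measurable_cons_comp : measurable_fun setT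
  (fun z : measurableTypeR R * borel 'rV[R]_n => f (cons_row z)).
Proof. by apply: (measurableT_comp mf); exact: measurable_cons_row. Qed.

Lemma measurable_cons_l (t : R) : measurable_fun setT
  (fun u : borel 'rV[R]_n => f (cons_row (t : measurableTypeR R, u))).
Proof.
apply: (measurableT_comp measurable_cons_comp (g := fun u : borel 'rV[R]_n => (t : measurableTypeR R, u))).
exact: measurable_fun_pair.
Qed.

Hypothesis f0 : forall y, 0 <= f y.

Lemma ge0_integral_cons :
  \int[prod_measure nu]_y f y =
  \int[nu ord0]_t \int[prod_measure nu']_u f (cons_row (t, u)).
Proof.
rewrite /= ge0_integral_pushforward//; last exact: measurable_cons_row.
rewrite preimage_setT; transitivity (\int[nu ord0 \x prod_sfm nu']_z f (cons_row z)).
  apply: eq_measure_integral => A mA _; apply/esym.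
  by apply: product_measure_unique => // B C mB mC; exact: product_measure2E.
by rewrite fubini_tonelli1//; exact: measurable_cons_comp.
Qed.

(** Both orders of integration are needed: a shear acts on the first coordinate
    along fixed remaining ones. *)
Lemma ge0_integral_consC :
  \int[prod_measure nu]_y f y =
  \int[prod_measure nu']_u \int[nu ord0]_t f (cons_row (t, u)).
Proof.
rewrite ge0_integral_cons.
by apply: (@fubini_tonelli _ _ _ _ _ (nu ord0) (prod_sfm nu') _ measurable_cons_comp).
Qed.

Lemma measurable_fubini_cons : measurable_fun setT
  (fun t : measurableTypeR R => \int[prod_measure nu']_u f (cons_row (t, u))).
Proof.
by apply: (@measurable_fun_fubini_tonelli_F _ _ _ _ _ (prod_sfm nu') _ measurable_cons_comp).
Qed.

End cons.

Lemma prod_measure_cons n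
    (nu : 'I_n.+1 -> {sigma_finite_measure set (measurableTypeR R) -> \bar R})
    (A : set 'rV[R]_n.+1) : measurable (A : set (borel 'rV[R]_n.+1)) ->
  prod_measure nu A = \int[nu ord0]_t prod_measure (fun i => nu (lift ord0 i))
    [set u : borel 'rV[R]_n | A (cons_row (t : measurableTypeR R, u))].
Proof.
move=> mA; transitivity (\int[prod_measure nu]_y (\1_A y)%:E).
  by rewrite integral_indic// setIT.
rewrite ge0_integral_cons//; last first.
  by apply/measurable_EFinP; exact: measurable_indic.
apply: eq_integral => t _.
have mt : measurable [set u : borel 'rV[R]_n | A (cons_row (t : measurableTypeR R, u))].
  have := @measurable_cons_l n (fun y => (\1_A y)%:E) _ t.
  have mA' : measurable_fun setT (fun y : borel 'rV[R]_n.+1 => (\1_A y)%:E : \bar R).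
    by apply/measurable_EFinP; exact: measurable_indic.
  move=> /(_ mA' measurableT [set 1] (emeasurable_set1 _)); rewrite setTI.
  congr measurable; apply/seteqP; split=> u /=; rewrite indicE.
    by case: (asboolP (A (cons_row (t : measurableTypeR R, u)))) => // h [];
      rewrite memNset// => /eqP; rewrite eq_sym oner_eq0.
  by move=> h; rewrite mem_set.
transitivity (\int[prod_measure (fun i => nu (lift ord0 i))]_u
    (\1_[set u : borel 'rV[R]_n | A (cons_row (t : measurableTypeR R, u))] u)%:E) => //.
by rewrite integral_indic// setIT.
Qed.

(** By induction on the dimension, since Tonelli pulls the first factor out of
    the integral over the others. *)
Lemma ge0_integral_prod_measure n
    (nu : 'I_n -> {sigma_finite_measure set (measurableTypeR R) -> \bar R})
    (f : 'I_n -> R -> \bar R) :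
  (forall i, measurable_fun setT (f i)) -> (forall i x, 0 <= f i x) ->
  \int[prod_measure nu]_y \prod_i f i (y ord0 i) = \prod_i \int[nu i]_t f i t.
Proof.
elim: n nu f => [|n IH] nu f mf f0.
  rewrite big_ord0 (eq_integral (fun=> 1)).
    by rewrite integral_cst//= diracT mul1e.
  by move=> y _; rewrite big_ord0.
have mprod k (g : 'I_k -> R -> \bar R) : (forall i, measurable_fun setT (g i)) ->
    measurable_fun setT (fun y : borel 'rV[R]_k => \prod_i g i (y ord0 i)).
  move=> mg.
  rewrite (_ : (fun y => _) = (\big[(fun f g y => f y * g y)/(fun=> 1)]_i (fun y : borel 'rV[R]_k => g i (y ord0 i)))); last first.
    by apply/funext => y; elim/big_rec2: _ => // i u v _ ->.
  elim/big_ind: _ => //; first by exact: emeasurable_funM.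
  by move=> i _; apply: (measurableT_comp (mg i)); exact: rV_coord_measurable.
rewrite ge0_integral_cons; last 2 first.
- exact: mprod.
- by move=> y; apply: prode_ge0.
rewrite big_ord_recl -IH//.
under eq_integral do (under eq_integral do rewrite big_ord_recl cons_row0).
rewrite -ge0_integralZr//; last first.
  by apply: integral_ge0 => y _; apply: prode_ge0.
  exact: mf.
apply: eq_integral => t _; rewrite -ge0_integralZl//.
- by apply: eq_integral => u _; congr (_ * _); apply: eq_bigr => i _; rewrite cons_rowS.
- by apply: (mprod n (fun i => f (lift ord0 i))) => i; exact: mf.
- by move=> y _; apply: prode_ge0.
Qed.

Lemma prod_measure_box n
    (nu : 'I_n -> {sigma_finite_measure set (measurableTypeR R) -> \bar R})
    (A : 'I_n -> set R) : (forall i, measurable (A i)) ->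
  prod_measure nu [set y : 'rV[R]_n | forall i, A i (y ord0 i)] = \prod_i nu i (A i).
Proof.
move=> mA.
have mB : measurable ([set y : 'rV[R]_n | forall i, A i (y ord0 i)] : set (borel 'rV[R]_n)).
  rewrite (_ : [set y | _] = \bigcap_(i in [set` finset.setT]) (fun y : borel 'rV[R]_n => y ord0 i) @^-1` A i).
    apply: fin_bigcap_measurable => // i _; rewrite -[X in measurable X]setTI.
    exact: (rV_coord_measurable i measurableT (mA i)).
  by apply/seteqP; split=> y /= h i; [move=> _|]; apply: h; rewrite /= ?inE.
transitivity (\int[prod_measure nu]_y \prod_i (\1_(A i) (y ord0 i))%:E).
  rewrite -[X in prod_measure nu X]setIT -integral_indic//; apply: eq_integral => y _.
  rewrite prodEFin; congr (_%:E).
  rewrite indicE; case: (asboolP (forall i, A i (y ord0 i))) => h.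
    by rewrite mem_set// big1// => i _; rewrite indicE mem_set.
  rewrite memNset//; move/existsNP: h => [i hi].
  by rewrite (bigD1 i)//= indicE memNset// mul0r.
rewrite (ge0_integral_prod_measure nu (f := fun i t => (\1_(A i) t)%:E)).
- apply: eq_bigr => i _; rewrite (@integral_indic _ (measurableTypeR R) R (nu i) setT measurableT _ (mA i)).
  by rewrite setIT.
- by move=> i; apply/measurable_EFinP; apply: measurable_indic.
- by move=> i x; rewrite lee_fin.
Qed.

End ProductMeasureTheory.

(** * Linear changes of variables *)

(* The canonical measure structure of a pushforward cannot be inferred, as it
   depends on a proof that the map is measurable. *)
Definition push_measure (d d' : measure_display) (T1 : measurableType d)
    (T2 : measurableType d') (R : realType) (m : {measure set T1 -> \bar R})
    (f : T1 -> T2) (mf : measurable_fun setT f) : {measure set T2 -> \bar R} :=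
  measure_function_pushforward__canonical__measure_function_Measure m mf.

Section AffineLine.
Context {R : realType}.
Local Open Scope ereal_scope.
Notation leb := (@lebesgue_measure R).

Definition affine_line (a b : R) : measurableTypeR R -> measurableTypeR R :=
  fun t => (a * t + b)%R.

Lemma measurable_affine_line a b : measurable_fun setT (affine_line a b).
Proof.
by apply: measurable_funD => //; apply: measurable_funM => //.
Qed.

Lemma lebesgue_affine (a b : R) (A : set R) : a != 0%R ->
  measurable (A : set (measurableTypeR R)) ->
  leb [set t : R | A (a * t + b)%R] = (`|a|^-1)%:E * leb A.
Proof.
move=> a0 mA; pose m := push_measure leb (measurable_affine_line a b).
have aa0 : (0 < `|a|)%R by rewrite normr_gt0.
suff -> : leb A = mscale (NngNum (normr_ge0 a)) m A.
  by rewrite /mscale/= /pushforward muleA -EFinM mulVf ?gt_eqF// mul1e.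
apply: lebesgue_measure_unique mA => X /ocitvP[->|[[x y]/= xy ->]].
  by rewrite !measure0.
rewrite /mscale/= /pushforward lebesgue_measure_itv/= lte_fin xy -EFinD.
have [a_gt0|a_lt0|a_eq0] := ltgtP 0%R a; last by rewrite -a_eq0 eqxx in a0.
  rewrite (_ : _ @^-1` _ = `](x - b) / a, (y - b) / a]%classic)%R; last first.
    apply/seteqP; split=> t /=; rewrite /affine_line !in_itv/=;
    by rewrite ler_pdivlMr// ltr_pdivrMr// lerBrDr ltrBlDr mulrC.
  rewrite lebesgue_measure_itv/= lte_fin ltr_pM2r ?invr_gt0// ltrD2r xy -EFinD -EFinM.
  rewrite gtr0_norm//; congr (_%:E); by field.
rewrite (_ : _ @^-1` _ = `[(y - b) / a, (x - b) / a[%classic)%R; last first.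
  apply/seteqP; split=> t /=; rewrite /affine_line !in_itv/=;
  by rewrite ler_ndivrMr// ltr_ndivlMr// lerBrDr ltrBlDr [(t * a)%R]mulrC andbC.
rewrite lebesgue_measure_itv/= lte_fin ltr_nM2r ?invr_lt0// ltrD2r xy -EFinD -EFinM.
rewrite ltr0_norm//; congr (_%:E); by field.
Qed.

Lemma ge0_integral_affine (a b : R) (f : R -> \bar R) : a != 0%R ->
  measurable_fun setT (f : measurableTypeR R -> \bar R) -> (forall x, 0 <= f x) ->
  \int[leb]_t f (a * t + b)%R = (`|a|^-1)%:E * \int[leb]_t f t.
Proof.
move=> a0 mf f0.
have aV0 : (0 <= `|a|^-1)%R by rewrite invr_ge0.
transitivity (\int[push_measure leb (measurable_affine_line a b)]_t f t).
  by rewrite ge0_integral_pushforward//; exact: measurable_affine_line.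
rewrite -(ge0_integral_mscale leb measurableT (NngNum aV0))//.
apply: eq_measure_integral => A mA _.
by rewrite /= /pushforward lebesgue_affine.
Qed.

End AffineLine.

Section LinearChange.
Context {R : realType}.
Local Open Scope ereal_scope.
Notation leb := (@lebesgue_rV R).

Lemma continuous_mulmx m n (A : 'M[R]_(m, n)) :
  continuous (fun y : 'rV[R]_m => y *m A).
Proof.
move=> x; apply: rV_continuous => j.
rewrite /prop_for (_ : (fun t => _) = (fun t : 'rV[R]_m => \sum_i t ord0 i * A i j)%R); last first.
  by apply/funext => t; rewrite mxE.
elim: (index_enum _) => [|i s IH].
  rewrite (_ : (fun t => _) = cst 0%R); last by apply/funext => t; rewrite big_nil.
  exact: cst_continuous.
rewrite (_ : (fun t => _) = (fun t : 'rV[R]_m => (t ord0 i * A i j) + \sum_(i <- s) t ord0 i * A i j)%R); last first.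
  by apply/funext => t; rewrite big_cons.
apply: (continuousD _ IH); apply: continuousM; last exact: cst_continuous.
exact: coord_continuous.
Qed.

Lemma measurable_mulmx_preimage n (A : 'M[R]_n) (b : 'rV[R]_n) (S : set 'rV[R]_n) :
  measurable (S : set (borel 'rV[R]_n)) ->
  measurable ([set y | S (y *m A + b)%R] : set (borel 'rV[R]_n)).
Proof.
move=> mS.
have : continuous (fun y : 'rV[R]_n => y *m A + b)%R.
  have cx (x : 'rV[R]_n) : (y *m A + b @[y --> x] --> x *m A + b)%R.
    have h1 : y *m A @[y --> x] --> (x *m A)%R by exact: continuous_mulmx.
    have h2 : b @[_ --> x] --> b by exact: cst_continuous.
    exact: (cvgD h1 h2).
  exact: cx.
by move=> /borel_continuous /(_ measurableT _ mS); rewrite setTI.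
Qed.

Lemma lebesgue_cons n (A : set 'rV[R]_n.+1) :
  measurable (A : set (borel 'rV[R]_n.+1)) ->
  leb n.+1 A = \int[lebesgue_measure]_t
    leb n [set u : 'rV[R]_n | A (row_mx (t%:M : 'rV_1) u : 'rV[R]_(1 + n))].
Proof. by move=> mA; rewrite [LHS]prod_measure_cons. Qed.

Lemma measurable_section_l n (A : set 'rV[R]_n.+1) (t : R) :
  measurable (A : set (borel 'rV[R]_n.+1)) ->
  measurable ([set u | A (row_mx (t%:M : 'rV_1) u : 'rV[R]_(1 + n))] : set (borel 'rV[R]_n)).
Proof.
move=> mA; have mB := @measurable_cons_row R n measurableT _ mA.
rewrite setTI in mB; have := measurable_xsection (t : measurableTypeR R) mB.
by congr measurable; apply/seteqP; split=> u; rewrite /xsection/= inE.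
Qed.

Lemma measurable_lebesgue_section n (A : set 'rV[R]_n.+1) :
  measurable (A : set (borel 'rV[R]_n.+1)) -> measurable_fun setT
  (fun t : measurableTypeR R => leb n [set u | A (row_mx (t%:M : 'rV_1) u : 'rV[R]_(1 + n))]).
Proof.
move=> mA; have mB := @measurable_cons_row R n measurableT _ mA.
rewrite setTI in mB.
have := @measurable_fun_xsection _ _ (measurableTypeR R) _ R (prod_sfm (fun=> lebesgue_measure)) _ mB.
congr measurable_fun; apply/funext => t /=; congr (prod_measure _ _).
by apply/seteqP; split=> u; rewrite /xsection/= inE.
Qed.

Lemma lebesgue_consC n (A : set 'rV[R]_n.+1) :
  measurable (A : set (borel 'rV[R]_n.+1)) ->
  leb n.+1 A = \int[leb n]_u
    lebesgue_measure [set t : R | A (row_mx (t%:M : 'rV_1) u : 'rV[R]_(1 + n))].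
Proof.
move=> mA; rewrite /lebesgue_rV/= /cons_measure /pushforward /product_measure2.
apply: eq_integral => u _ /=; congr (lebesgue_measure _).
by apply/seteqP; split=> t; rewrite /ysection/= inE.
Qed.

Lemma measurable_section_r n (A : set 'rV[R]_n.+1) (u : 'rV[R]_n) :
  measurable (A : set (borel 'rV[R]_n.+1)) ->
  measurable ([set t : R | A (row_mx (t%:M : 'rV_1) u : 'rV[R]_(1 + n))] : set (measurableTypeR R)).
Proof.
move=> mA; have mB := @measurable_cons_row R n measurableT _ mA.
rewrite setTI in mB; have := measurable_ysection (u : borel 'rV[R]_n) mB.
by congr measurable; apply/seteqP; split=> t; rewrite /ysection/= inE.
Qed.

Lemma row_mxD1 n (t s : R) (u v : 'rV[R]_n) :
  (row_mx t%:M u + row_mx s%:M v = row_mx (t + s)%:M (u + v) :> 'rV_(1 + n))%R.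
Proof. by rewrite add_row_mx raddfD. Qed.

Lemma row_mx1P n (b : 'rV[R]_(1 + n)) :
  exists s v, b = row_mx (s%:M : 'rV_1) v.
Proof.
exists (lsubmx b ord0 ord0), (rsubmx b); rewrite -[LHS]hsubmxK; congr row_mx.
exact: mx11_scalar.
Qed.

(** Translations act separately on the first and on the remaining coordinates. *)
Lemma lebesgue_translate n (b : 'rV[R]_n) (S : set 'rV[R]_n) :
  measurable (S : set (borel 'rV[R]_n)) -> leb n [set y | S (y + b)%R] = leb n S.
Proof.
elim: n b S => [|n IH] b S mS.
  congr (leb 0 _); apply/seteqP; split=> y /=; rewrite (_ : (y + b)%R = y)//;
  by apply/rowP => -[].
have mS' : measurable ([set y | S (y + b)%R] : set (borel 'rV[R]_n.+1)).
  have := measurable_mulmx_preimage 1%:M b mS.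
  by congr measurable; apply/seteqP; split=> y /=; rewrite mulmx1.
rewrite !lebesgue_cons//; have [s [v bE]] := row_mx1P (b : 'rV_(1 + n)).
have mphi := measurable_lebesgue_section mS.
have := ge0_integral_affine s (@oner_neq0 R) mphi (fun=> measure_ge0 _ _).
rewrite normr1 invr1 mul1e => <-; apply: eq_integral => t _ /=.
rewrite mul1r -[RHS](IH v); last exact: (measurable_section_l _ mS).
by congr (leb n _); apply/seteqP; split=> u /=; rewrite -row_mxD1 bE.
Qed.

(** The inverse factor appears because the statement is about preimages, which
    are measurable without further argument. *)
Definition scales_lebesgue n (A : 'M[R]_n) := forall S : set 'rV[R]_n,
  measurable (S : set (borel 'rV[R]_n)) ->
  leb n [set y | S (y *m A)] = (`|\det A|^-1)%:E * leb n S.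

Lemma measurable_mulmx n (A : 'M[R]_n) (S : set 'rV[R]_n) :
  measurable (S : set (borel 'rV[R]_n)) ->
  measurable ([set y | S (y *m A)] : set (borel 'rV[R]_n)).
Proof.
move=> /(measurable_mulmx_preimage A 0).
by congr measurable; apply/seteqP; split=> y /=; rewrite addr0.
Qed.

Lemma scales_lebesgueM n (A B : 'M[R]_n) :
  scales_lebesgue A -> scales_lebesgue B -> scales_lebesgue (A *m B).
Proof.
move=> hA hB S mS; have := hA _ (measurable_mulmx B mS).
rewrite hB// muleA -EFinM -invfM -normrM -det_mulmx => <-.
by congr (leb n _); apply/seteqP; split=> y /=; rewrite mulmxA.
Qed.

(** In each section at a fixed first coordinate the matrix acts as [B] up to a
    translation. *)
Lemma scales_lebesgue_ublock n (a : R) (w : 'rV[R]_n) (B : 'M[R]_n) :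
  a != 0%R -> scales_lebesgue B ->
  @scales_lebesgue (1 + n) (block_mx a%:M w 0 B).
Proof.
move=> a0 hB S mS; rewrite det_ublock det_scalar1.
have mS' := measurable_mulmx (block_mx a%:M w 0 B) mS.
rewrite [LHS](lebesgue_cons mS') [in RHS](lebesgue_cons mS).
have mphi := measurable_lebesgue_section mS.
have := ge0_integral_affine 0 a0 mphi (fun=> measure_ge0 _ _).
rewrite normrM invfM mulrC EFinM -muleA => <-.
rewrite -ge0_integralZl//; last first.
  apply: (measurableT_comp mphi (g := affine_line a 0)).
  exact: measurable_affine_line.
apply: eq_integral => t _ /=; rewrite addr0.
rewrite -[X in _ = _ * X](lebesgue_translate (t *: w)); last exact: (measurable_section_l _ mS).
rewrite -hB.
  congr (leb n _); apply/seteqP; split=> u /=;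
  by rewrite mul_row_block mulmx0 addr0 -scalar_mxM mulrC mul_scalar_mx addrC.
have := measurable_section_l (t * a)%R mS => /(measurable_mulmx_preimage 1%:M (t *: w)).
by congr measurable; apply/seteqP; split=> y /=; rewrite mulmx1 mulrC.
Qed.

(** In each section at fixed last coordinates a transvection acts as a
    translation. *)
Lemma scales_lebesgue_lblock n (v : 'cV[R]_n) :
  @scales_lebesgue (1 + n) (block_mx 1%:M 0 v 1%:M).
Proof.
move=> S mS; rewrite det_lblock !det1 mulr1 normr1 invr1 mul1e.
have mS' := measurable_mulmx (block_mx 1%:M 0 v 1%:M) mS.
rewrite [LHS](lebesgue_consC mS') [in RHS](lebesgue_consC mS).
apply: eq_integral => u _ /=.
have := lebesgue_affine ((u *m v) ord0 ord0) (@oner_neq0 R) (measurable_section_r u mS).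
rewrite normr1 invr1 mul1e => <-; congr (lebesgue_measure _).
apply/seteqP; split=> t /=;
by rewrite mul_row_block !mulmx1 mulmx0 add0r mul1r raddfD /= -mx11_scalar.
Qed.

(** Every invertible matrix is, up to a transvection that brings a nonzero
    entry to the corner, the product of the two block forms above. *)
Lemma lebesgue_linear n (A : 'M[R]_n) : A \in unitmx -> scales_lebesgue A.
Proof.
elim: n A => [|n IH] A uA.
  move=> S _; rewrite det_mx00 normr1 invr1 mul1e; congr (leb 0 _).
  apply/seteqP; split=> y /=; rewrite (_ : (y *m A)%R = y)//; by apply/rowP => -[].
have pivot (B : 'M[R]_(1 + n)) : B \in unitmx -> B ord0 ord0 != 0%R ->
    scales_lebesgue B.
  move=> uB B0; set a := B ord0 ord0 in B0.
  pose w := ursubmx B; pose v := dlsubmx B; pose C := (drsubmx B - a^-1 *: (v *m w))%R.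
  have BE : B = block_mx 1%:M 0 (a^-1 *: v) 1%:M *m block_mx a%:M w 0 C.
    rewrite mulmx_block !mul1mx !mul0mx !addr0 -[LHS]submxK.
    have -> : ulsubmx B = a%:M.
      rewrite [LHS]mx11_scalar !mxE; congr (_%:M); congr (B _ _); exact/val_inj.
    congr block_mx; first by rewrite -scalemxAl mul_mx_scalar scalerA mulVf// scale1r.
    by rewrite -scalemxAl /C addrC subrK.
  rewrite BE; apply: scales_lebesgueM; first exact: scales_lebesgue_lblock.
  apply: scales_lebesgue_ublock => //; apply: IH.
  move: uB; rewrite BE !unitmxE det_mulmx det_lblock !det1 !mul1r det_ublock.
  by rewrite unitrM => /andP[].
have [A0|A0] := eqVneq (A ord0 ord0) 0%R; last exact: pivot.
have [i Ai0] : exists i, A i ord0 != 0%R.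
  apply/existsP; apply: contraT => /existsPn h.
  move: uA; rewrite unitmxE (expand_det_col _ ord0) big1 ?unitr0// => j _.
  by have := h j; rewrite negbK => /eqP ->; rewrite mul0r.
have [j ij] : exists j, i = lift ord0 j.
  by case: (unliftP ord0 i) => [j ->|i0]; [exists j|rewrite i0 A0 eqxx in Ai0].
pose e : 'rV[R]_n := delta_mx ord0 j.
pose E : 'M[R]_(1 + n) := block_mx 1%:M e 0 1%:M.
pose E' : 'M[R]_(1 + n) := block_mx 1%:M (- e)%R 0 1%:M.
have E'E : E' *m E = 1%:M.
  rewrite mulmx_block !mul1mx !mulmx1 !mul0mx !mulmx0 !addr0 add0r subrr.
  by rewrite -scalar_mx_block.
have -> : A = E' *m (E *m A) by rewrite mulmxA E'E mul1mx.
apply: scales_lebesgueM.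
  apply: scales_lebesgue_ublock; first exact: oner_neq0.
  by move=> S mS; rewrite det1 normr1 invr1 mul1e; congr (leb n _); apply/seteqP; split=> y /=; rewrite mulmx1.
apply: pivot.
  by rewrite unitmx_mul uA andbT unitmxE det_ublock !det1 mulr1 unitr1.
have Ek k : E ord0 (lift ord0 k) = (k == j)%:R.
  transitivity (E (lshift n ord0) (rshift 1 k)); first by congr (E _ _); exact/val_inj.
  by rewrite block_mxEur mxE eqxx.
have -> // : (E *m A) ord0 ord0 = A i ord0.
rewrite mxE big_ord_recl A0 mulr0 add0r (bigD1 j)//= ij Ek eqxx mul1r.
by rewrite big1 ?addr0// => k kj; rewrite Ek (negbTE kj) mul0r.
Qed.

Lemma lebesgue_hyperplane n (i : 'I_n) :
  leb n [set y : 'rV[R]_n | y ord0 i = 0%R] = 0.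
Proof.
have := @prod_measure_box R n (fun=> lebesgue_measure)
  (fun k => if k == i then [set 0%R] else setT).
rewrite /= => h; rewrite /lebesgue_rV (_ : mkset _ = [set y : 'rV[R]_n |
   forall k, (if k == i then [set 0%R] else setT) (y ord0 k)]).
  rewrite h; last by move=> k; case: ifP.
  by rewrite (bigD1 i)//= eqxx lebesgue_measure_set1 mul0e.
apply/seteqP; split=> y /=; last by move=> /(_ i); rewrite eqxx.
by move=> y0 k; case: eqP => [->|].
Qed.

Lemma measurable_hyperplane n (i : 'I_n) :
  measurable ([set y : 'rV[R]_n | y ord0 i = 0%R] : set (borel 'rV[R]_n)).
Proof.
have := rV_coord_measurable i measurableT (measurable_set1 (0%R : R)).
by rewrite setTI.
Qed.

(** A singular linear image lies in a hyperplane, which some invertible matrix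
    maps to a coordinate hyperplane. *)
Lemma lebesgue_singular n (A : 'M[R]_n) (S : set 'rV[R]_n) : \det A = 0%R ->
  measurable (S : set (borel 'rV[R]_n)) ->
  S `<=` range (fun y => y *m A)%R -> leb n S = 0.
Proof.
case: n A S => [|n] A S; first by rewrite det_mx00 => /eqP; rewrite oner_eq0.
move=> A0 mS SA.
have [v v0 Av] : exists2 v : 'rV[R]_n.+1, v != 0%R & v *m A^T = 0%R.
  by apply/det0P; rewrite det_tr A0.
pose P := (row_ebase v)^T.
have uP : P \in unitmx by rewrite unitmx_tr row_ebase_unit.
apply: (@subset_measure0 _ _ _ (leb n.+1) _ [set y | (y *m P) ord0 ord0 = 0%R]) => //.
- exact: measurable_mulmx (measurable_hyperplane ord0).
- have rv : \rank v = 1%N by rewrite rank_rV v0.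
  have [c c0 cE] : exists2 c : R, c != 0%R & c *: row ord0 (row_ebase v) = v.
    exists (col_ebase v ord0 ord0).
      by have := col_ebase_unit v; rewrite unitmxE [col_ebase v]mx11_scalar det_scalar1 unitfE mxE eqxx mulr1n.
    rewrite -[RHS]mulmx_ebase rv {2}[col_ebase v]mx11_scalar mul_scalar_mx -scalemxAl.
    congr (_ *: _); rewrite rowE; congr (_ *m _).
    by apply/matrixP => k l; rewrite !mxE (ord1 k) /= andbT eq_sym.
  move=> _ /SA[y _ <-] /=; apply: (mulfI c0); rewrite mulr0.
  transitivity ((y *m A *m v^T) ord0 ord0).
    rewrite -cE linearZ/= -scalemxAr [in RHS]mxE; congr (_ * _)%R.
    by rewrite !mxE; apply: eq_bigr => k _; rewrite !mxE.
  by rewrite -mulmxA -[A]trmxK -trmx_mul Av trmx0 mulmx0 mxE.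
- by rewrite [LHS](lebesgue_linear uP (measurable_hyperplane ord0)) lebesgue_hyperplane mule0.
Qed.

End LinearChange.

(** * Strict differentiability *)

Section RowNorm.
Context {R : realType}.

Lemma rV_norm_le n (v : 'rV[R]_n) (c : R) : 0 <= c ->
  (forall j, `|v ord0 j| <= c) -> `|v| <= c.
Proof.
move=> c0 h; rewrite [leLHS]/Num.norm/= mx_normrE.
by apply: bigmax_le => //= -[i j] _ /=; rewrite (ord1 i).
Qed.

Lemma rV_coord_le n (v : 'rV[R]_n) j : `|v ord0 j| <= `|v|.
Proof.
rewrite [leRHS]/Num.norm/= mx_normrE.
exact: (le_bigmax_cond _ (j := (ord0, j)) (fun i : 'I_1 * 'I_n => `|v i.1 i.2|)).
Qed.

Lemma rV_norm_lt n (v : 'rV[R]_n) (c : R) : 0 < c ->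
  (forall j, `|v ord0 j| < c) -> `|v| < c.
Proof.
move=> c0 h; rewrite [ltLHS]/Num.norm/= mx_normrE.
by apply: bigmax_lt => //= -[i j] _ /=; rewrite (ord1 i).
Qed.

Lemma mulmx_norm_le m n (A : 'M[R]_(m, n)) :
  exists2 K, 0 < K & forall v : 'rV[R]_m, `|v *m A| <= K * `|v|.
Proof.
exists (1 + \sum_j \sum_i `|A i j|) => [|v].
  by rewrite ltr_pwDl//; do 2 (apply: sumr_ge0 => ? _).
have S0 : 0 <= \sum_j \sum_i `|A i j| by do 2 (apply: sumr_ge0 => ? _).
apply: rV_norm_le => [|j]; first by rewrite mulr_ge0// addr_ge0.
rewrite mxE (le_trans (ler_norm_sum _ _ _))//.
apply: (@le_trans _ _ (\sum_i `|v| * `|A i j|)).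
  by apply: ler_sum => i _; rewrite normrM ler_wpM2r// rV_coord_le.
rewrite -mulr_sumr mulrC ler_wpM2r// (bigD1 j)//= addrCA lerDl addr_ge0//.
by do 2 (apply: sumr_ge0 => ? _).
Qed.

Lemma continuous_at_normP (V W : normedModType R) (f : V -> W) (x : V) :
  {for x, continuous f} <->
  forall e, 0 < e -> exists2 d, 0 < d & forall y, `|y - x| < d -> `|f y - f x| < e.
Proof.
split=> [cf e e0|h].
  have /cvgrPdist_lt/(_ _ e0)/nbhs_ballP[d d0 hd] : f y @[y --> x] --> f x := cf.
  by exists d => // y yx; rewrite distrC; apply: hd; rewrite -ball_normE /ball_/= distrC.
suff : f y @[y --> x] --> f x by [].
apply/cvgrPdist_lt => e e0; have [d d0 hd] := h e e0.
by apply/nbhs_ballP; exists d => // y; rewrite -ball_normE /ball_/= distrC => /hd; rewrite distrC.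
Qed.

Lemma continuous_at_sum (T : topologicalType) (I : Type) (r : seq I)
    (f : I -> T -> R) (x : T) : (forall i, {for x, continuous (f i)}) ->
  {for x, continuous (fun y => \sum_(i <- r) f i y)}.
Proof.
move=> cf; elim: r => [|i r IH].
  rewrite (_ : (fun _ => _) = cst 0); first exact: cst_continuous.
  by apply/funext => y; rewrite big_nil.
rewrite (_ : (fun _ => _) = f i + (fun y => \sum_(i <- r) f i y)).
  exact: (continuousD (cf i) IH).
by apply/funext => y; rewrite big_cons.
Qed.

Lemma continuous_at_prod (T : topologicalType) (I : Type) (r : seq I)
    (f : I -> T -> R) (x : T) : (forall i, {for x, continuous (f i)}) ->
  {for x, continuous (fun y => \prod_(i <- r) f i y)}.
Proof.
move=> cf; elim: r => [|i r IH].
  rewrite (_ : (fun _ => _) = cst 1); first exact: cst_continuous.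
  by apply/funext => y; rewrite big_nil.
rewrite (_ : (fun _ => _) = f i \* (fun y => \prod_(i <- r) f i y)).
  exact: (continuousM (cf i) IH).
by apply/funext => y; rewrite big_cons.
Qed.

Lemma hyperplane_closed n (i : 'I_n) : closed [set y : 'rV[R]_n | y ord0 i = 0].
Proof. exact: (closed_comp (fun y _ => @coord_continuous _ _ _ ord0 i y) (closed_eq (y := (0 : R)))). Qed.

(** A neighbourhood of [y] of this radius meets only those coordinate
    hyperplanes that contain [y]. *)
Lemma coord_gap n (y : 'rV[R]_n) : exists2 r : R, 0 < r & forall i : 'I_n, y ord0 i != 0 -> r < `|y ord0 i|.
Proof.
pose s := \big[Num.min/1]_(i | y ord0 i != 0) `|y ord0 i|.
have s0 : 0 < s.
  rewrite /s; elim/big_ind : _ => //; last by move=> i; rewrite normr_gt0.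
  by move=> x1 x2 h1' h2'; rewrite lt_min h1' h2'.
exists (s / 2); first exact: divr_gt0.
move=> i yi; apply: (@lt_le_trans _ _ s); first by rewrite ltr_pdivrMr// ltr_pMr// ltr1n.
by rewrite /s (bigminD1 i)// ge_min lexx.
Qed.

End RowNorm.

Section StrictDerivative.
Context {R : realType}.

(** Strict differentiability: the derivative approximates differences of values
    at all pairs of points near [x]. Analytic maps have this property, which
    makes the derivative continuous and yields local inverses without any
    reference to a neighbourhood on which the map is differentiable. *)
Definition sdiff n m (f : 'rV[R]_n -> 'rV[R]_m) (x : 'rV[R]_n) (A : 'M[R]_(n, m)) :=
  forall e, 0 < e -> exists2 d, 0 < d & forall y z, `|y - x| < d -> `|z - x| < d ->
    `|f y - f z - (y - z) *m A| <= e * `|y - z|.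

Definition sdiff1 n (f : 'rV[R]_n -> R) (x : 'rV[R]_n) (a : 'cV[R]_n) :=
  forall e, 0 < e -> exists2 d, 0 < d & forall y z, `|y - x| < d -> `|z - x| < d ->
    `|f y - f z - ((y - z) *m a) ord0 ord0| <= e * `|y - z|.

Lemma sdiff_coord n m (f : 'rV[R]_n -> 'rV[R]_m) x A :
  (forall j, sdiff1 (fun y => f y ord0 j) x (col j A)) -> sdiff f x A.
Proof.
move=> h e e0.
have /choice[d hd] : forall j, exists d, 0 < d /\ forall y z, `|y - x| < d -> `|z - x| < d ->
    `|f y ord0 j - f z ord0 j - ((y - z) *m col j A) ord0 ord0| <= e * `|y - z|.
  by move=> j; have [d d0 hd] := h j e e0; exists d.
exists (\big[Num.min/1]_j d j) => [|y z hy hz].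
  by apply: lt_bigmin => // j _; have [] := hd j.
apply: rV_norm_le => [|j]; first by rewrite mulr_ge0// ltW.
have [_] := hd j; have dj : \big[Num.min/1]_j d j <= d j by exact: bigmin_le.
move=> /(_ y z (lt_le_trans hy dj) (lt_le_trans hz dj)); rewrite !mxE.
by congr (`| _ - _ | <= _); apply: eq_bigr => i _; rewrite !mxE.
Qed.

Lemma sdiff_continuous n m (f : 'rV[R]_n -> 'rV[R]_m) x A :
  sdiff f x A -> {for x, continuous f}.
Proof.
move=> h; have [d d0 hd] := h 1 ltr01.
have [K K0 hK] := mulmx_norm_le A.
apply/continuous_at_normP => e e0.
exists (Num.min d (e / (1 + K))) => [|y]; first by rewrite lt_min d0 divr_gt0// addr_gt0.
rewrite lt_min => /andP[yd ye].
rewrite -(subrK ((y - x) *m A) (f y - f x)) (le_lt_trans (ler_normD _ _))//.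
have := hd y x yd; rewrite subrr normr0 => /(_ d0) h1.
rewrite (le_lt_trans (lerD h1 (hK _)))// -mulrDl -ltr_pdivlMl ?addr_gt0//.
by rewrite mulrC.
Qed.

Lemma sdiff_comp n m p (f : 'rV[R]_n -> 'rV[R]_m) (g : 'rV[R]_m -> 'rV[R]_p) x A B :
  sdiff f x A -> sdiff g (f x) B -> sdiff (g \o f) x (A *m B).
Proof.
move=> hf hg e e0.
have [KA KA0 hA] := mulmx_norm_le A; have [KB KB0 hB] := mulmx_norm_le B.
have e1 : 0 < e / (2 * (1 + KA)) by rewrite divr_gt0// mulr_gt0// addr_gt0.
have e2 : 0 < Num.min 1 (e / (2 * KB)) by rewrite lt_min ltr01 divr_gt0// mulr_gt0.
have [dg dg0 Hg] := hg _ e1; have [df df0 Hf] := hf _ e2.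
have /continuous_at_normP/(_ _ dg0)[r r0 hr] := sdiff_continuous hf.
exists (Num.min df r) => [|y z]; first by rewrite lt_min df0.
rewrite !lt_min => /andP[yd yr] /andP[zd zr].
have fy : `|f y - f x| < dg by exact: hr.
have fz : `|f z - f x| < dg by exact: hr.
have Ey := Hf _ _ yd zd.
have E2 : `|f y - f z - (y - z) *m A| <= e / (2 * KB) * `|y - z|.
  by rewrite (le_trans Ey)// ler_wpM2r// ge_min lexx orbT.
have E1 : `|f y - f z| <= (1 + KA) * `|y - z|.
  rewrite -(subrK ((y - z) *m A) (f y - f z)) (le_trans (ler_normD _ _))// mulrDl lerD//.
  by rewrite (le_trans Ey)// ler_wpM2r// ge_min lexx.
rewrite /= -(subrK ((f y - f z) *m B) (g (f y) - g (f z))) -addrA mulmxA -mulmxBl.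
rewrite (le_trans (ler_normD _ _))// (splitr e) mulrDl lerD//.
  rewrite (le_trans (Hg _ _ fy fz))//.
  apply: le_trans (ler_wpM2l (ltW e1) E1) _.
  by rewrite mulrA ler_wpM2r// le_eqVlt; apply/orP; left; apply/eqP; field; rewrite gt_eqF// addr_gt0.
rewrite (le_trans (hB _))//; apply: le_trans (ler_wpM2l (ltW KB0) E2) _.
by rewrite mulrA ler_wpM2r// le_eqVlt; apply/orP; left; apply/eqP; field; rewrite gt_eqF.
Qed.

Lemma sdiff_near n m (f g : 'rV[R]_n -> 'rV[R]_m) x A :
  (\forall y \near x, f y = g y) -> sdiff f x A -> sdiff g x A.
Proof.
move=> /nbhs_ballP[r r0 hr] hf e e0; have [d d0 hd] := hf e e0.
exists (Num.min d r) => [|y z]; first by rewrite lt_min d0.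
rewrite !lt_min => /andP[yd yr] /andP[zd zr].
by rewrite -!hr ?mx_norm_ball /ball_/= ?(distrC x)//; exact: hd.
Qed.

Lemma sdiff_id n x : sdiff (@id 'rV[R]_n) x 1%:M.
Proof.
by move=> e e0; exists 1 => // y z _ _; rewrite mulmx1 subrr normr0 mulr_ge0// ltW.
Qed.

Lemma sdiff_uniq n m (f : 'rV[R]_n -> 'rV[R]_m) x A B :
  sdiff f x A -> sdiff f x B -> A = B.
Proof.
move=> hA hB; apply/eqP; rewrite -subr_eq0; apply/eqP/row_matrixP => i.
rewrite row0; apply/eqP; rewrite -normr_le0; apply/ler_addgt0Pr => e e0.
have e20 : 0 < e / 2 by rewrite divr_gt0.
have [d d0 Hd] := hA _ e20; have [d' d'0 Hd'] := hB _ e20.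
pose t := Num.min d d' / 2.
have t0 : 0 < t by rewrite divr_gt0// lt_min d0.
pose y := x + t *: delta_mx ord0 i.
have yx : y - x = t *: delta_mx ord0 i by rewrite /y addrAC subrr add0r.
have del : `|delta_mx ord0 i : 'rV[R]_n| <= 1.
  apply: rV_norm_le => // j; rewrite mxE eqxx /=.
  by case: eqP; rewrite ?normr0 ?normr1.
have yxn : `|y - x| <= t by rewrite yx normrZ gtr0_norm// ler_piMr// ltW.
have tmin : t < Num.min d d'.
  by rewrite /t ltr_pdivrMr// ltr_pMr ?ltr1n// lt_min d0.
move: (tmin); rewrite lt_min => /andP[td td'].
have h1 := Hd y x (le_lt_trans yxn td); rewrite subrr normr0 in h1.
have h2 := Hd' y x (le_lt_trans yxn td'); rewrite subrr normr0 in h2.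
rewrite add0r rowE -(ler_pM2l t0) -[X in X * `| _ |](gtr0_norm t0) -normrZ scalemxAl -yx.
have -> : (y - x) *m (A - B) = (f y - f x - (y - x) *m B) - (f y - f x - (y - x) *m A).
  by rewrite mulmxBr opprB [RHS]addrC addrA subrK.
rewrite (le_trans (ler_normB _ _))// (splitr e) mulrDr.
have tt : e / 2 * `|y - x| <= t * (e / 2) by rewrite mulrC ler_wpM2r// ltW.
by apply: lerD; [exact: le_trans (h2 d'0) tt|exact: le_trans (h1 d0) tt].
Qed.

Lemma sdiff_jacobian n m (f : 'rV[R]_n -> 'rV[R]_m) x A :
  sdiff f x A -> jacobian f x = A.
Proof.
move=> h; have dE : 'd f x = mulmxr A :> ('rV[R]_n -> 'rV[R]_m).
  apply: diff_unique; first exact: continuous_mulmx.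
  apply/eqaddoP => e e0; have [d d0 hd] := h e e0.
  apply/nbhs_ballP; exists d => // v; rewrite -ball_normE /ball_/= sub0r normrN => vd.
  have := hd (v + x) x; rewrite addrK subrr normr0 => /(_ vd d0).
  by rewrite !fctE /= opprD addrA.
by apply/row_matrixP => i; rewrite !rowE mul_rV_lin1 dE.
Qed.

(** Comparing the increments of [f] at [x] and at [y] on the same small segment
    near [y]. *)
Lemma sdiff_derivative_continuous n m (f : 'rV[R]_n -> 'rV[R]_m) (Df : 'rV[R]_n -> 'M[R]_(n, m)) (x : 'rV[R]_n) :
  (\forall y \near x, sdiff f y (Df y)) -> forall e : R, 0 < e ->
  exists2 d, 0 < d & forall y (v : 'rV[R]_n), `|y - x| < d -> `|v *m (Df y - Df x)| <= e * `|v|.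
Proof.
move=> /nbhs_ballP[r r0 hr] e e0.
have hD y : `|y - x| < r -> sdiff f y (Df y).
  by move=> yr; apply: hr; rewrite -ball_normE /ball_/= distrC.
have e20 : 0 < e / 2 by rewrite divr_gt0.
have [|d d0 Hd] := hD x _ _ e20; first by rewrite subrr normr0.
exists (Num.min d r) => [|y v]; first by rewrite lt_min d0.
rewrite lt_min => /andP[yd yr].
have [d' d'0 Hd'] := hD y yr _ e20.
have [->|v0] := eqVneq v 0; first by rewrite mul0mx !normr0 mulr0.
have nv0 : 0 < `|v| by rewrite normr_gt0.
pose t := Num.min d' (d - `|y - x|) / (2 * `|v|).
have m0 : 0 < Num.min d' (d - `|y - x|) by rewrite lt_min d'0 subr_gt0.
have t0 : 0 < t by rewrite divr_gt0// mulr_gt0.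
pose z := y + t *: v.
have zy : z - y = t *: v by rewrite /z addrAC subrr add0r.
have tv : `|t *: v| < Num.min d' (d - `|y - x|).
  rewrite normrZ gtr0_norm//.
  have -> : t * `|v| = Num.min d' (d - `|y - x|) / 2 by rewrite /t; field; rewrite gt_eqF.
  by rewrite ltr_pdivrMr// ltr_pMr ?ltr1n.
move: (tv); rewrite lt_min => /andP[tv1 tv2].
have zx : `|z - x| < d.
  rewrite /z addrAC; apply: le_lt_trans (ler_normD _ _) _.
  by rewrite -ltrBrDl.
have h1 := Hd z y zx yd.
have := Hd' z y; rewrite subrr normr0 zy => /(_ tv1 d'0) h2.
rewrite -(ler_pM2l t0) -[X in X * `| _ |](gtr0_norm t0) -normrZ scalemxAl -zy.
have -> : (z - y) *m (Df y - Df x) = (f z - f y - (z - y) *m Df x) - (f z - f y - (z - y) *m Df y).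
  by rewrite mulmxBr opprB [RHS]addrC addrA subrK.
rewrite (le_trans (ler_normB _ _))//; rewrite zy in h1 *.
rewrite (le_trans (lerD h1 h2))// -mulrDl -splitr normrZ (gtr0_norm t0).
by rewrite mulrCA.
Qed.

Lemma sdiff_det_continuous n (f : 'rV[R]_n -> 'rV[R]_n) (Df : 'rV[R]_n -> 'M[R]_n) (x : 'rV[R]_n) :
  (\forall y \near x, sdiff f y (Df y)) -> {for x, continuous (fun y => \det (Df y))}.
Proof.
move=> h.
have cD i j : {for x, continuous (fun y => Df y i j)}.
  apply/continuous_at_normP => e e0; have e20 : 0 < e / 2 by rewrite divr_gt0.
  have [d d0 hd] := sdiff_derivative_continuous h e20.
  exists d => // y yx; have := hd y (delta_mx ord0 i) yx; rewrite -rowE => hh.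
  have del : `|delta_mx ord0 i : 'rV[R]_n| <= 1.
    apply: rV_norm_le => // k; rewrite mxE eqxx /=.
    by case: eqP; rewrite ?normr0 ?normr1.
  have := rV_coord_le (row i (Df y - Df x)) j; rewrite !mxE => h1.
  rewrite (le_lt_trans (le_trans h1 hh))//.
  by rewrite (le_lt_trans (ler_piMr (ltW e20) del))// ltr_pdivrMr// ltr_pMr ?ltr1n.
rewrite /determinant; apply: continuous_at_sum => /= s.
apply: continuousM; first exact: cst_continuous.
exact: continuous_at_prod.
Qed.

End StrictDerivative.

(** * Analytic functions are strictly differentiable *)

Section AnalyticStrictDerivative.
Context {R : realType}.

Lemma expr_diff_le (u v s e : R) k : 0 <= s -> 0 <= e ->
  `|u| <= s -> `|v| <= s -> `|u - v| <= e ->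
  s * `|u ^+ k - v ^+ k| <= k%:R * s ^+ k * e.
Proof.
move=> s0 e0 us vs uve; elim: k => [|k IH]; first by rewrite !expr0 subrr normr0 mulr0 !mul0r.
have -> : u ^+ k.+1 - v ^+ k.+1 = u ^+ k * (u - v) + (u ^+ k - v ^+ k) * v.
  by rewrite !exprSr; ring.
rewrite (le_trans (ler_wpM2l s0 (ler_normD _ _)))// mulrDr.
rewrite [X in _ <= X](_ : _ = s * (s ^+ k * e) + k%:R * s ^+ k * e * s); last first.
  by rewrite -natr1 exprS; ring.
apply: lerD; last by rewrite normrM mulrA ler_pM// mulr_ge0.
rewrite ler_wpM2l// normrM ler_pM// normrX.
by rewrite lerXn2r ?nnegrE.
Qed.

Lemma prod_expr_le (I : Type) (r : seq I) (a : I -> nat) (u : I -> R) (s : R) :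
  0 <= s -> (forall i, `|u i| <= s) ->
  `|\prod_(i <- r) u i ^+ a i| <= s ^+ (\sum_(i <- r) a i).
Proof.
move=> s0 us; elim: r => [|i r IH]; first by rewrite !big_nil normr1 expr0.
rewrite !big_cons normrM exprD ler_pM// normrX.
by rewrite lerXn2r ?nnegrE.
Qed.

(** Stated with a factor [s] on the left to stay free of divisions and of
    negative powers, which would arise for factors of degree zero. *)
Lemma prod_expr_diff_le (I : Type) (r : seq I) (a : I -> nat) (u v : I -> R) (s e : R) :
  0 <= s -> 0 <= e ->
  (forall i, `|u i| <= s) -> (forall i, `|v i| <= s) -> (forall i, `|u i - v i| <= e) ->
  s * `|\prod_(i <- r) u i ^+ a i - \prod_(i <- r) v i ^+ a i| <=
  (\sum_(i <- r) a i)%:R * s ^+ (\sum_(i <- r) a i) * e.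
Proof.
move=> s0 e0 us vs uve; elim: r => [|i r IH].
  by rewrite !big_nil subrr normr0 mulr0 !mul0r.
rewrite !big_cons; set P := \prod_(j <- r) u j ^+ a j; set Q := \prod_(j <- r) v j ^+ a j.
set S := (\sum_(j <- r) a j)%N; rewrite -/P -/Q -/S in IH *.
have -> : u i ^+ a i * P - v i ^+ a i * Q =
    (u i ^+ a i - v i ^+ a i) * P + v i ^+ a i * (P - Q) by ring.
rewrite (le_trans (ler_wpM2l s0 (ler_normD _ _)))// mulrDr.
rewrite [X in _ <= X](_ : _ = ((a i)%:R * s ^+ a i * e) * s ^+ S + s ^+ a i * (S%:R * s ^+ S * e)); last first.
  by rewrite natrD exprD; ring.
rewrite !normrM; apply: lerD.
  rewrite mulrA ler_pM ?mulr_ge0 ?expr_diff_le//; exact: prod_expr_le.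
rewrite mulrCA ler_pM ?mulr_ge0// normrX.
by rewrite lerXn2r ?nnegrE.
Qed.

Lemma lin_geom_le (q : R) j : 0 <= q -> q <= 2^-1 -> j.+2%:R * q ^+ j <= 2.
Proof.
move=> q0 q2; elim: j => [|j IH]; first by rewrite expr0 mulr1.
apply: le_trans IH; rewrite exprS mulrA ler_wpM2r ?exprn_ge0//.
have : j.+3%:R * q <= j.+3%:R * 2^-1 by rewrite ler_wpM2l.
have -> : (j.+3%:R = j.+2%:R + 1 :> R) by rewrite -natr1.
have : (1 : R) <= j.+2%:R by rewrite ler1n.
by move: (j.+2%:R) => t; lra.
Qed.

Definition mindex n (i : 'I_n) : {ffun 'I_n -> nat} := [ffun j => nat_of_bool (j == i)].

Lemma monomial_mindex n (i : 'I_n) (u : 'rV[R]_n) : monomial (mindex i) u = u ord0 i.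
Proof.
rewrite /monomial (bigD1 i)//= ffunE eqxx expr1 big1 ?mulr1// => j ji.
by rewrite ffunE (negbTE ji).
Qed.

Lemma sum1_mindex n (a : {ffun 'I_n -> nat}) : (\sum_i a i = 1)%N -> exists i, a = mindex i.
Proof.
move=> a1; have [i ai] : exists i, (a i != 0)%N.
  by apply/existsP; apply: contraT => /existsPn h; move: a1;
    rewrite big1// => i _; have := h i; rewrite negbK => /eqP.
exists i; apply/ffunP => j; rewrite ffunE.
move: a1; rewrite (bigD1 i)//=; case: eqVneq => [->|ji]; first by move: ai; case: (a i) => [|[|]].
rewrite (bigD1 j)//=; move: ai; case: (a i) => [|k]//; case: (a j) => //= l _.
by rewrite addSn addnS.
Qed.

(** Terms of degree at least two have differences that are small compared to [u
    - v]; the terms of degree one are the derivative. *)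
Lemma monomial_diff_le n (a : {ffun 'I_n -> nat}) (u v : 'rV[R]_n) (s r : R) :
  0 < s -> s <= r / 2 -> `|u| <= s -> `|v| <= s ->
  `|monomial a u - monomial a v - \sum_i (a == mindex i)%:R * (u - v) ord0 i| <=
  2 * s / r ^+ 2 * r ^+ (\sum_i a i) * `|u - v|.
Proof.
move=> s0 sr us vs.
have r0 : 0 < r by move: s0 sr; lra.
have rhs0 k : 0 <= 2 * s / r ^+ 2 * r ^+ k * `|u - v|.
  by rewrite mulr_ge0// mulr_ge0 ?exprn_ge0 ?(ltW r0)// divr_ge0 ?exprn_ge0 ?(ltW r0)// mulr_ge0// ltW.
have [/sum1_mindex[i ->]|a1] := eqVneq (\sum_i a i)%N 1%N.
  rewrite !monomial_mindex (bigD1 i)//= eqxx mul1r big1 ?addr0.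
    by rewrite !mxE subrr normr0.
  move=> j ji; rewrite (_ : (mindex i == mindex j) = false) ?mul0r//.
  apply/negP => /eqP/ffunP/(_ j); rewrite !ffunE eqxx (negbTE ji) //.
have -> : \sum_i (a == mindex i)%:R * (u - v) ord0 i = 0.
  apply: big1 => i _; case: eqP => [aE|_]; last by rewrite mul0r.
  move: a1; rewrite aE (bigD1 i)//= ffunE eqxx big1 ?addn0// => j ji.
  by rewrite ffunE (negbTE ji).
rewrite subr0.
have := @prod_expr_diff_le _ (index_enum 'I_n) a (fun i => u ord0 i) (fun i => v ord0 i) s `|u - v|
   (ltW s0) (normr_ge0 _) (fun i => le_trans (rV_coord_le u i) us) (fun i => le_trans (rV_coord_le v i) vs).
have uv i : `|u ord0 i - v ord0 i| <= `|u - v| by have := rV_coord_le (u - v) i; rewrite !mxE.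
move=> /(_ uv) h.
rewrite -(ler_pM2l s0); apply: le_trans h _.
rewrite [X in _ <= X](_ : _ = 2 * s ^+ 2 / r ^+ 2 * r ^+ (\sum_i a i) * `|u - v|); last first.
  by rewrite expr2; ring.
rewrite ler_wpM2r//.
case: (\sum_i a i)%N a1 => [|[|j]]// _.
  by rewrite mul0r mulr_ge0 ?exprn_ge0 ?(ltW r0)// divr_ge0 ?exprn_ge0 ?(ltW r0)// mulr_ge0// exprn_ge0// ltW.
have q0 : 0 <= s / r by rewrite divr_ge0// ltW.
have q2 : s / r <= 2^-1 by rewrite ler_pdivrMr// mulrC.
have h2 : j.+2%:R * (s / r) ^+ j * r ^+ j.+2 <= 2 * r ^+ j.+2.
  by rewrite ler_pM2r ?exprn_gt0// lin_geom_le.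
have s20 : 0 <= s ^+ 2 / r ^+ 2 by rewrite divr_ge0// exprn_ge0// ltW.
have := ler_wpM2l s20 h2; congr (_ <= _); last by ring.
have rn0 : r != 0 by rewrite gt_eqF.
have rjn0 : r ^+ j != 0 by rewrite expf_neq0.
by rewrite expr_div_n !exprS expr0 !mulr1; field; rewrite ?rn0 ?rjn0.
Qed.

(** Near the centre the series converges geometrically, so that the estimates
    of the differences of the monomials can be summed: the linear part is the
    strict derivative and the rest has a small Lipschitz constant. *)
Lemma analytic_sdiff1 n (f : 'rV[R]_n -> R) (x : 'rV[R]_n) :
  analytic_at f x -> exists a, sdiff1 f x a.
Proof.
move=> [c /nbhs_ballP[r0 r00 hc]].
pose r := r0 / 2; have r_gt0 : 0 < r by rewrite divr_gt0.
pose emb N (a : {ffun 'I_n -> 'I_N}) : {ffun 'I_n -> nat} := [ffun i => val (a i)].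
have embI N : injective (@emb N).
  by move=> a b /ffunP h; apply/ffunP => i; have := h i; rewrite !ffunE => /val_inj.
have [S S0 hS] : exists2 S, 0 < S & forall N,
    \sum_(a : {ffun 'I_n -> 'I_N}) `|c (emb N a)| * r ^+ (\sum_i emb N a i) <= S.
  have /hc[+ _] : ball x r0 (x + const_mx r).
    rewrite -ball_normE /ball_/= opprD addNKr normrN.
    apply: rV_norm_lt => // j; rewrite mxE gtr0_norm// /r ltr_pdivrMr// ltr_pMr ?ltr1n//.
  rewrite addrAC subrr add0r /summable => fin.
  have ge0 : (0 <= \esum_(i in setT) `|(c i * monomial i (const_mx r : 'rV[R]_n))%:E|)%E.
    exact: esum_ge0.
  exists (1 + fine (\esum_(i in setT) `|(c i * monomial i (const_mx r : 'rV[R]_n))%:E|)%E).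
    by rewrite ltr_pwDl// fine_ge0.
  move=> N; apply: ler_wpDl => //.
  rewrite -lee_fin fineK ?ge0_fin_numE//; apply: esum_ge.
  exists [set` [seq emb N a | a <- index_enum {ffun 'I_n -> 'I_N}]].
    by split => //; exact: finite_seq.
  rewrite -fsbig_seq; last by rewrite (map_inj_uniq (@embI N)) index_enum_uniq.
  rewrite big_map -sumEFin; apply: lee_sum => a _; rewrite lee_fin normrM.
  rewrite ler_wpM2l// expr_sum normr_prod; apply: ler_prod => i _.
  by rewrite exprn_ge0 ?(ltW r_gt0)//= mxE normrX gtr0_norm.
exists (\col_i c (mindex i)) => e e0.
pose s := Num.min (r / 2) (e * r ^+ 2 / (2 * S)).
have s0 : 0 < s by rewrite lt_min !divr_gt0// ?mulr_gt0// exprn_gt0.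
exists s => // y z yx zx.
have ball_s w : `|w - x| < s -> ball x r0 w.
  move=> wx; rewrite -ball_normE /ball_/= distrC (lt_trans wx)// gt_min.
  by apply/orP; left; rewrite /r; move: r00 => /=; lra.
have [_ cy] := hc y (ball_s y yx); have [_ cz] := hc z (ball_s z zx).
set L : R := ((y - z) *m _) ord0 ord0.
have cl : (fun N => \sum_(a : {ffun 'I_n -> 'I_N}) c (emb N a) * monomial (emb N a) (y - x)
    - \sum_(a : {ffun 'I_n -> 'I_N}) c (emb N a) * monomial (emb N a) (z - x) - L)
    @ \oo --> f y - f z - L.
  by apply: cvgB; [exact: cvgB|exact: cvg_cst].
have : closed [set t : R | `|t| <= e * `|y - z|].
  rewrite (_ : mkset _ = (fun t : R => `|t|) @^-1` [set t | t <= e * `|y - z|])//.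
  by apply: closed_comp => [t _|]; [exact: norm_continuous|exact: closed_le].
move=> cle; apply: (@closed_cvg _ _ \oo _ _ _ cle _ _ cl).
near=> N => /=.
have N2 : (1 < N)%N by near: N; exact: nbhs_infty_gt.
have -> : L = \sum_(a : {ffun 'I_n -> 'I_N}) c (emb N a) * \sum_i (emb N a == mindex i)%:R * (y - z) ord0 i.
  rewrite /L mxE; under [RHS]eq_bigr do rewrite mulr_sumr.
  rewrite exchange_big/=; apply: eq_bigr => i _.
  have [b bE] : exists b, emb N b = mindex i.
    exists [ffun j => Ordinal (leq_ltn_trans (leq_b1 (j == i)) N2)].
    by apply/ffunP => j; rewrite !ffunE.
  rewrite (bigD1 b)//= bE eqxx mul1r big1 ?addr0 ?mxE 1?mulrC//.
  move=> a ab; rewrite -bE (inj_eq (@embI N)) (negbTE ab) mul0r mulr0//.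
rewrite -!sumrB (le_trans (ler_norm_sum _ _ _))//.
apply: (@le_trans _ _ (\sum_(a : {ffun 'I_n -> 'I_N}) `|c (emb N a)| * r ^+ (\sum_i emb N a i) * (2 * s / r ^+ 2 * `|y - z|))).
  apply: ler_sum => a _; rewrite -!mulrBr normrM -mulrA ler_wpM2l//.
  have yzE : y - z = (y - x) - (z - x) by rewrite opprB addrA subrK.
  have := @monomial_diff_le n (emb N a) (y - x) (z - x) s r s0.
  rewrite -yzE => /(_ _ (ltW yx) (ltW zx)) h; apply: (le_trans (h _)).
    by rewrite ge_min lexx.
  by rewrite le_eqVlt; apply/orP; left; apply/eqP; ring.
rewrite -mulr_suml; apply: le_trans (ler_wpM2r _ (hS N)) _.
  by rewrite mulr_ge0// divr_ge0 ?exprn_ge0 ?(ltW r_gt0)// mulr_ge0// ltW.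
rewrite mulrA ler_wpM2r//.
have : s <= e * r ^+ 2 / (2 * S) by rewrite ge_min lexx orbT.
rewrite ler_pdivlMr ?mulr_gt0// => h.
by rewrite mulrA ler_pdivrMr ?exprn_gt0//; move: h; lra.
Unshelve. all: by end_near. Qed.

End AnalyticStrictDerivative.

(** * Weighted pushforwards and regularity of Borel measures *)

(** The image under [f] of the measure [w dm] on [D]. *)
Section WeightedPushforward.
Local Open Scope ereal_scope.
Context (d1 d2 : measure_display) (T1 : measurableType d1) (T2 : measurableType d2)
  (R : realType).
Variables (m : {measure set T1 -> \bar R}) (D : set T1) (f : T1 -> T2) (w : T1 -> R).
Hypotheses (mD : measurable D) (mf : measurable_fun D f) (mw : measurable_fun D w)
  (w0 : forall x, D x -> (0 <= w x)%R).

Import HBNNSimple.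

Definition wpush_fun of measurable D & measurable_fun D f & measurable_fun D w &
    (forall x, D x -> (0 <= w x)%R) : set T2 -> \bar R :=
  fun A => \int[m]_(x in D `&` f @^-1` A) (w x)%:E.

Local Notation wp := (wpush_fun mD mf mw w0).

Let wpush0 : wp set0 = 0.
Proof. by rewrite /wpush_fun preimage_set0 setI0 integral_set0. Qed.

Let wpush_ge0 A : 0 <= wp A.
Proof. by apply: integral_ge0 => x [Dx _]; rewrite lee_fin; exact: w0. Qed.

Let wpush_sigma_additive : semi_sigma_additive wp.
Proof.
move=> F mF tF mUF; rewrite /wpush_fun preimage_bigcup setI_bigcupr.
rewrite ge0_integral_bigcup//.
- apply: is_cvg_ereal_nneg_natsum_cond => n _ _.
  by apply: integral_ge0 => x [Dx _]; rewrite lee_fin; exact: w0.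
- by move=> k; exact: mf.
- by apply/measurable_EFinP; apply: measurable_funS mw => // x [k _ []].
- by move=> x [k _ [Dx _]]; rewrite lee_fin; exact: w0.
- apply/trivIsetP => i j _ _ ij.
  rewrite setIACA setIid -preimage_setI.
  by move/trivIsetP : tF => /(_ _ _ _ _ ij) ->//; rewrite preimage_set0 setI0.
Qed.

HB.instance Definition _ := isMeasure.Build _ _ _ wp
  wpush0 wpush_ge0 wpush_sigma_additive.

Definition wpush : {measure set T2 -> \bar R} := wp.

Lemma wpushE A : wpush A = \int[m]_(x in D `&` f @^-1` A) (w x)%:E.
Proof. by []. Qed.

Lemma integral_wpush_nnsfun (h : {nnsfun T2 >-> R}) :
  \int[wpush]_y (h y)%:E = \int[m]_(x in D) (h (f x) * w x)%:E.
Proof.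
have mi r : measurable_fun D (fun x => (\1_(h @^-1` [set r]) (f x) : R)).
  apply: (@measurableT_comp _ _ _ _ _ _ (\1_(h @^-1` [set r]) : T2 -> R)) => //.
transitivity (\int[m]_(x in D)
   (\sum_(r \in range h) (r * \1_(h @^-1` [set r]) (f x) * w x)%:E)); last first.
  apply: eq_integral => x _; rewrite [h (f x)]fimfunE fsumEFin//; congr (_%:E).
  by rewrite mulr_fsuml.
rewrite ge0_integral_fsum//; last 2 first.
- move=> r; apply/measurable_EFinP; apply: measurable_funM => //.
  by apply: measurable_funM.
- move=> r x Dx; have [hr|hr] := leP 0%R r.
    by rewrite lee_fin !mulr_ge0// w0.
  by rewrite indicE memNset ?mulr0 ?mul0r//= => hx; move: hr; rewrite -hx ltNge fun_ge0.
rewrite integralT_nnsfun sintegralE; apply: eq_fsbigr => r rr.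
have r0 : (0 <= r)%R by move: rr; rewrite inE => -[y _ <-]; exact: fun_ge0.
transitivity (\int[m]_(x in D) (r%:E * (\1_(h @^-1` [set r]) (f x) * w x)%:E)); last first.
  by apply: eq_integral => x _; rewrite -EFinM mulrA.
rewrite ge0_integralZl//; last 2 first.
- by apply/measurable_EFinP; apply: measurable_funM.
- by move=> x Dx; rewrite lee_fin mulr_ge0// w0.
congr (_ * _); rewrite /wpush/= /wpush_fun integral_mkcondr; apply: eq_integral => x _.
rewrite patchE indicE; case: ifPn => hx.
  by rewrite mem_set ?mul1r//; move: hx; rewrite inE.
by rewrite memNset ?mul0r//; move: hx; rewrite notin_setE.
Qed.

Lemma ge0_integral_wpush (g : T2 -> \bar R) :
  measurable_fun setT g -> (forall y, 0 <= g y) ->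
  \int[wpush]_y g y = \int[m]_(x in D) (g (f x) * (w x)%:E).
Proof.
move=> mg g0; pose g_ := nnsfun_approx measurableT mg.
have mg_f n : measurable_fun D (fun x => (g_ n (f x) * w x)%:E).
  by apply/measurable_EFinP; apply: measurable_funM => //; exact: measurableT_comp.
transitivity (limn (fun n => \int[wpush]_y (g_ n y)%:E)).
  rewrite -monotone_convergence//=.
  - by apply: eq_integral => x _; apply/esym/cvg_lim => //=; exact: cvg_nnsfun_approx.
  - by move=> n; exact/measurable_EFinP.
  - by move=> n x _; rewrite lee_fin.
  - by move=> x _ a b ab; rewrite lee_fin//; exact/lefP/nd_nnsfun_approx.
transitivity (limn (fun n => \int[m]_(x in D) (g_ n (f x) * w x)%:E)); last first.
  rewrite -monotone_convergence//=.
  - apply: eq_integral => x /[!inE] xD; apply/cvg_lim => //.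
    under eq_fun do rewrite EFinM.
    by apply: cvgeZr => //; exact: cvg_nnsfun_approx.
  - by move=> n x Dx; rewrite lee_fin mulr_ge0 ?w0.
  - move=> x Dx a b ab; rewrite lee_fin ler_wpM2r ?w0//; exact/lefP/nd_nnsfun_approx.
by congr (limn _); apply/funext => n; exact: integral_wpush_nnsfun.
Qed.

End WeightedPushforward.

Section Regularity.
Context {R : realType} {n : nat}.
Local Open Scope ereal_scope.
Implicit Types mu : {measure set (borel 'rV[R]_n) -> \bar R}.

Lemma open_rV_bigcup_closed (U : set 'rV[R]_n) : open U ->
  exists F : nat -> set 'rV[R]_n, [/\ forall k, closed (F k),
    {homo F : k l / (k <= l)%N >-> (k <= l)%O} & U = \bigcup_k F k].
Proof.
move=> oU; pose F k := [set y : 'rV[R]_n | forall z, ~ U z -> (k.+1%:R^-1 <= `|y - z|)%R].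
exists F; split.
- move=> k; rewrite (_ : F k = ~` (\bigcup_(z in ~` U) ball z (k.+1%:R^-1 : R))); last first.
    rewrite setC_bigcup; apply/seteqP; split=> y h z Uz.
      by have := h z Uz; rewrite leNgt => /negP; apply: contra_not; rewrite -ball_normE /ball_/= distrC.
    by have := h z Uz; rewrite -ball_normE /ball_/= distrC => /negP; rewrite -leNgt.
  by rewrite closedC; apply: bigcup_open => z _; exact: ball_open.
- move=> k l kl; apply/subsetPset => y h z Uz; apply: le_trans (h z Uz).
  by rewrite lef_pV2 ?posrE// ler_nat.
- apply/seteqP; split=> y.
    move=> Uy; have /nbhs_ballP[e /= e0 eU] : nbhs y U by exact: open_nbhs_nbhs.
    have [k ke] : exists k : nat, (k.+1%:R^-1 < e)%R.
      have := @near_infty_natSinv_lt R (PosNum e0).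
      by move=> [k _ /(_ k (leqnn k))] ?; exists k.
    exists k => // z; apply: contra_notP => /negP; rewrite -ltNge => zy.
    by apply: eU; rewrite -ball_normE /ball_/= (lt_trans zy ke).
  move=> [k _ h]; apply: contrapT => /h; rewrite subrr normr0 leNgt.
  by rewrite invr_gt0 ltr0n.
Qed.

Definition regular_set mu (B : set 'rV[R]_n) := forall e : R, (0 < e)%R ->
  exists F O : set 'rV[R]_n, [/\ closed F, open O, F `<=` B, B `<=` O & mu (O `\` F) < e%:E].

(** The regular sets form a sigma-algebra, and open sets are countable unions
    of closed sets. *)
Lemma borel_regular mu (B : set 'rV[R]_n) : mu setT < +oo ->
  measurable (B : set (borel 'rV[R]_n)) -> regular_set mu B.
Proof.
move=> mufin; have fin A : measurable (A : set (borel 'rV[R]_n)) -> mu A < +oo.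
  by move=> mA; apply: le_lt_trans mufin; apply: le_measure => //; rewrite inE.
have tail (F : nat -> set 'rV[R]_n) (O : set 'rV[R]_n) : open O -> (forall k, closed (F k)) ->
    {homo F : k l / (k <= l)%N >-> (k <= l)%O} ->
    (mu (O `\` F k)) @[k --> \oo] --> mu (O `\` \bigcup_k F k).
  move=> oO cF ndF; rewrite (_ : O `\` \bigcup_k F k = \bigcap_k (O `&` ~` F k)); last first.
    apply/seteqP; split=> y.
      by move=> [ Oy nF] k _; split => // Fk; apply: nF; exists k.
    by move=> h; split=> [|[k _ Fk]]; [have [] := h 0%N I|have [_] := h k I].
  apply: (@nonincreasing_cvg_mu _ _ _ mu (fun k => O `&` ~` F k)).
  - by apply: fin; apply: measurableI; [exact: open_borel|apply: measurableC; exact: closed_borel].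
  - by move=> k; apply: measurableI; [exact: open_borel|apply: measurableC; exact: closed_borel].
  - apply: bigcapT_measurable => k.
    by apply: measurableI; [exact: open_borel|apply: measurableC; exact: closed_borel].
  - by move=> k l /ndF/subsetPset h; apply/subsetPset => y [ Oy Fy]; split => // /h.
suff : <<s @open 'rV[R]_n >> `<=` regular_set mu by apply.
apply: smallest_sub; last first.
  move=> U oU e e0; have [F [cF ndF UF]] := open_rV_bigcup_closed oU.
  have := tail F U oU cF ndF; rewrite -UF setDv measure0.
  move=> /fine_cvgP[_ /cvgrPdist_lt/(_ _ e0)[N _ /(_ N (leqnn N))]].
  rewrite sub0r normrN ger0_norm ?fine_ge0// => h.
  exists (F N), U; split => //; first by rewrite UF; exact: bigcup_sup.
  rewrite -[ltLHS]fineK ?lte_fin// ge0_fin_numE//; apply: fin.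
  by apply: measurableD; [exact: open_borel|exact: closed_borel].
split.
- move=> e e0; exists set0, set0; split; [exact: closed0|exact: open0|by []|by []|].
  by rewrite setD0 measure0 lte_fin.
- move=> A rA e e0; have [F [ O [cF oO FA AO h]]] := rA e e0.
  exists (~` O), (setT `\` F); split.
  + by rewrite closedC.
  + by rewrite setTD openC.
  + by rewrite setTD; apply: subsetC.
  + by rewrite !setTD; apply: subsetC.
  + by rewrite setTD setDE setCK setIC -setDE.
- move=> A rA e e0; have e20 : (0 < e / 2)%R by rewrite divr_gt0.
  have pw k : (0 < e / 2 / (2 ^ k.+1)%:R)%R by rewrite divr_gt0// ltr0n expn_gt0.
  have /choice[F hF] := fun k => rA k _ (pw k).
  have /choice[ O hO] := hF.
  pose G k := \big[setU/set0]_(i < k.+1) F i.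
  have cG k : closed (G k).
    by apply: closed_bigsetU => i _; have [] := hO i.
  have ndG : {homo G : k l / (k <= l)%N >-> (k <= l)%O}.
    by move=> k l kl; apply/subsetPset; exact: subset_bigsetU.
  have oU : open (\bigcup_k O k) by apply: bigcup_open => k _; have [] := hO k.
  have UG : \bigcup_k G k = \bigcup_k F k.
    apply/seteqP; split=> y [k _]; last by move=> Fk; exists k => //; rewrite /G -bigcup_mkord; exists k => /=.
    by rewrite /G -bigcup_mkord => -[l _ Fl]; exists l.
  have := tail G _ oU cG ndG; rewrite UG => cv.
  have small : mu (\bigcup_k O k `\` \bigcup_k F k) <= (e / 2)%:E.
    apply: le_trans (epsilon_trick0 predT (ltW e20)).
    apply: (@le_trans _ _ (\sum_(k <oo) mu (O k `\` F k))).
      apply: measure_sigma_subadditive.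
      + by move=> k; have [? ? _ _ _] := hO k; apply: measurableD; [exact: open_borel|exact: closed_borel].
      + apply: measurableD; first exact: open_borel.
        by apply: bigcupT_measurable => k; have [? _ _ _ _] := hO k; exact: closed_borel.
      + by move=> y [[k _ Oy] Fy]; exists k => //; split => // Fk; apply: Fy; exists k.
    apply: lee_nneseries => // k _.
    by have [_ _ _ _ /ltW] := hO k.
  have m2 : mu (\bigcup_k O k `\` \bigcup_k F k) < +oo by rewrite (le_lt_trans small)// ltry.
  have m2f : mu (\bigcup_k O k `\` \bigcup_k F k) \is a fin_num by rewrite ge0_fin_numE.
  move: cv small; rewrite -(fineK m2f) lee_fin.
  move=> /fine_cvgP[_ /cvgrPdist_lt/(_ _ e20)[N _ /(_ N (leqnn N))]] h small.
  exists (G N), (\bigcup_k O k); split => //.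
  + move=> y; rewrite /G -bigcup_mkord => -[k /= _ Fk]; exists k => //.
    by have [_ _ + _ _] := hO k; exact.
  + by move=> y [k _ Ak]; exists k => //; have [_ _ _ + _] := hO k; exact.
  + have m1 : mu (\bigcup_k O k `\` G N) < +oo.
      by apply: fin; apply: measurableD; [exact: open_borel|exact: closed_borel].
    rewrite -(fineK (_ : mu (\bigcup_k O k `\` G N) \is a fin_num)) ?ge0_fin_numE// lte_fin.
    move: h small => /=.
    rewrite distrC => /ltr_normlW h1 h2.
    by rewrite (splitr e); move: h1; rewrite ltrBlDr => /lt_le_trans; apply; rewrite lerD2l.
Qed.

Lemma compact_rV_closed (K : set 'rV[R]_n) : compact K -> closed K.
Proof. by apply: compact_closed; exact: norm_hausdorff. Qed.

Lemma compact_borel (K : set 'rV[R]_n) : compact K -> measurable (K : set (borel 'rV[R]_n)).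
Proof. by move=> /compact_rV_closed; exact: closed_borel. Qed.

(** The measure restricted to a member of the sequence is finite, hence
    regular, and closed subsets of compact sets are compact. *)
Lemma inner_regular mu (Z : set 'rV[R]_n) (K : nat -> set 'rV[R]_n)
    (B : set 'rV[R]_n) :
  (forall k, compact (K k)) -> {homo K : k l / (k <= l)%N >-> (k <= l)%O} ->
  Z = \bigcup_k K k -> (forall k, mu (K k) < +oo) ->
  measurable (B : set (borel 'rV[R]_n)) -> B `<=` Z ->
  mu B = ereal_sup [set mu L | L in [set L : set 'rV[R]_n | compact L /\ L `<=` B]].
Proof.
move=> cK ndK ZK fK mB BZ; apply/eqP; rewrite eq_le; apply/andP; split; last first.
  apply: ge_ereal_sup => _ [L [cL LB] <-]; apply: le_measure => //; rewrite inE//.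
  exact: compact_borel.
have mK k := compact_borel (cK k).
have cv : mu (B `&` K k) @[k --> \oo] --> mu B.
  have BE : B = \bigcup_k (B `&` K k) by rewrite -setI_bigcupr -ZK setIidl.
  rewrite [X in _ --> mu X]BE.
  apply: nondecreasing_cvg_mu => //.
  - by move=> k; exact: measurableI.
  - by apply: bigcupT_measurable => k; exact: measurableI.
  - by move=> k l /ndK/subsetPset h; apply/subsetPset; exact: setIS.
apply: (cvge_to_le cv); near=> k.
pose muK : {measure set (borel 'rV[R]_n) -> \bar R} := mrestr mu (mK k).
have muKfin : muK setT < +oo by rewrite /muK/= /mrestr setTI.
apply/lee_addgt0Pr => e e0.
have [F [ O [cF oO FB BO h]]] := borel_regular muKfin mB e0.
have mF : measurable (F : set (borel 'rV[R]_n)) by exact: closed_borel.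
apply: (@le_trans _ _ (mu (F `&` K k) + e%:E)); last first.
  rewrite leeD2r//; apply: ereal_sup_ubound; exists (F `&` K k) => //; split.
    by rewrite setIC; exact: compact_closedI.
  by apply: subset_trans FB; exact: subIsetl.
rewrite -(setDUK (A := F `&` K k) (B := B `&` K k)); last exact: setSI.
apply: le_trans (measureU2 _ _ _) _ => //.
- exact: measurableI.
- by apply: measurableD; exact: measurableI.
rewrite leeD2l//; apply: le_trans (ltW h); rewrite /muK/= /mrestr.
apply: le_measure; rewrite ?inE.
- by apply: measurableD; exact: measurableI.
- by apply: measurableI => //; apply: measurableD => //; exact: open_borel.
- by move=> y [[By Ky] nF]; split => //; split; [exact: BO|move=> Fy; apply: nF].
Unshelve. all: by end_near. Qed.

(** Inner regularity of the first measure reduces the inequality to compact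
    subsets. *)
Lemma compact_le_measure mu1 mu2 (Z : set 'rV[R]_n) (K : nat -> set 'rV[R]_n) :
  (forall k, compact (K k)) -> {homo K : k l / (k <= l)%N >-> (k <= l)%O} ->
  Z = \bigcup_k K k -> (forall k, mu1 (K k) < +oo) ->
  (forall L, compact L -> L `<=` Z -> mu1 L <= mu2 L) ->
  forall B, measurable (B : set (borel 'rV[R]_n)) -> B `<=` Z -> mu1 B <= mu2 B.
Proof.
move=> cK ndK ZK fK h B mB BZ; rewrite (inner_regular cK ndK ZK fK mB BZ).
apply: ge_ereal_sup => _ [L [cL LB] <-].
apply: le_trans (h L cL (subset_trans LB BZ)) _.
by apply: le_measure => //; rewrite inE//; exact: compact_borel.
Qed.

Lemma closed_ballE_rV (x : 'rV[R]_n) (r : R) : closed [set y | `|y - x| <= r]%R.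
Proof.
rewrite (_ : mkset _ = (fun y : 'rV[R]_n => `|y - x|%R) @^-1` [set t | t <= r]%R)//.
apply: closed_comp; last exact: closed_le.
move=> y _; apply/continuous_at_normP => e e0; exists e => // u uy.
by rewrite (le_lt_trans (ler_dist_dist _ _))// opprB addrA subrK.
Qed.

Lemma compact_ball_rV (x : 'rV[R]_n) (r : R) : compact [set y | `|y - x| <= r]%R.
Proof.
apply: bounded_closed_compact; last exact: closed_ballE_rV.
exists (`|x| + r)%R; split; first exact: num_real.
move=> M xM y /= yx; rewrite (le_trans _ (ltW xM))// -(subrK x y) addrC.
by rewrite (le_trans (ler_normD _ _))// lerD2l.
Qed.

(** An open set is an increasing union of closed sets, which balls cut into
    compact sets. *)
Lemma open_sigma_compact (U : set 'rV[R]_n) : open U ->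
  exists K : nat -> set 'rV[R]_n, [/\ forall k, compact (K k),
    {homo K : k l / (k <= l)%N >-> (k <= l)%O} & U = \bigcup_k K k].
Proof.
move=> oU; have [F [cF ndF UF]] := open_rV_bigcup_closed oU.
exists (fun k => F k `&` [set y | `|y - 0| <= k%:R]%R); split.
- by move=> k; rewrite setIC; apply: compact_closedI => //; exact: compact_ball_rV.
- move=> k l kl; apply/subsetPset; apply: setISS.
    by apply/subsetPset; exact: ndF.
  by move=> y /= /le_trans; apply; rewrite ler_nat.
- rewrite UF; apply/seteqP; split=> y [k _]; last by move=> [Fk _]; exists k.
  move=> Fk; have yt := truncnS_gt `|y - 0|%R; set t := Num.trunc _ in yt.
  exists (maxn k t.+1) => //; split.
    by have /subsetPset := ndF _ _ (leq_maxl k t.+1); exact.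
  by rewrite /= (le_trans (ltW yt))// ler_nat leq_maxr.
Qed.

End Regularity.

(** * Cubes and linear images of balls *)

Section Cubes.
Context {R : realType} {n : nat}.
Notation leb := (@lebesgue_rV R n).

(** Half-open cubes, unlike balls, are partitioned exactly by the cells of a
    regular grid. *)
Definition hcube (c : 'rV[R]_n) (r : R) : set 'rV[R]_n :=
  [set y | forall i, c ord0 i - r <= y ord0 i < c ord0 i + r].

Definition cell_center (c : 'rV[R]_n) (r : R) N (j : {ffun 'I_n -> 'I_N}) : 'rV[R]_n :=
  \row_i (c ord0 i - r + (2 * (j i)%:R + 1) * (r / N%:R)).

Definition cell c r N (j : {ffun 'I_n -> 'I_N}) := hcube (cell_center c r j) (r / N%:R).

Lemma hcube_itv c r : hcube c r =
  [set y : 'rV[R]_n | forall i, [set` `[c ord0 i - r, c ord0 i + r[] (y ord0 i)].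
Proof. by apply/seteqP; split=> y /= h i; have := h i; rewrite /= in_itv/=. Qed.

Lemma measurable_hcube c r : measurable (hcube c r : set (borel 'rV[R]_n)).
Proof.
rewrite (_ : hcube c r = \bigcap_(i in [set` finset.setT])
    (fun y : borel 'rV[R]_n => y ord0 i) @^-1` [set` `[c ord0 i - r, c ord0 i + r[]).
  apply: fin_bigcap_measurable => // i _; rewrite -[X in measurable X]setTI.
  by apply: (rV_coord_measurable i measurableT); exact: measurable_itv.
apply/seteqP; split=> y /= h i; first by move=> _; have := h i; rewrite /= in_itv/=.
by have := h i; rewrite /= in_itv/=; apply; rewrite inE.
Qed.

Lemma lebesgue_hcube c r : 0 <= r -> leb (hcube c r) = ((2 * r) ^+ n)%:E.
Proof.
move=> r0; rewrite hcube_itv /lebesgue_rV.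
rewrite (prod_measure_box (fun=> lebesgue_measure) (A := fun i => [set` `[c ord0 i - r, c ord0 i + r[]))//.
rewrite (eq_bigr (fun=> (2 * r)%:E)) => [|i _].
  by rewrite prodEFin prodr_const card_ord.
rewrite [LHS](lebesgue_measure_itv (Interval (BLeft _) (BLeft _)))/= lte_fin; case: ltP => h.
  by rewrite -EFinD; congr (_%:E); ring.
by congr (_%:E); move: h r0; lra.
Qed.

Lemma hcube_norm c r y : 0 <= r -> hcube c r y -> `|y - c| <= r.
Proof.
move=> r0 h; apply: rV_norm_le => // i; rewrite !mxE ler_norml.
by have /andP[h1 h2] := h i; rewrite lerBrDl h1 lerBlDl ltW.
Qed.

Lemma norm_hcube c r y : `|y - c| < r -> hcube c r y.
Proof.
move=> yc i; have := le_lt_trans (rV_coord_le (y - c) i) yc.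
by rewrite !mxE ltr_norml => /andP[h1 h2]; rewrite -lerBrDl ltW//= -ltrBlDl.
Qed.

Lemma cell_cover c r N y : (0 < N)%N -> 0 < r -> hcube c r y -> exists j : {ffun 'I_n -> 'I_N}, cell c r j y.
Proof.
move=> N0 r0 h; have Nr : 0 < N%:R :> R by rewrite ltr0n.
have [s sE s0] : exists2 s, s = r / N%:R & 0 < s by exists (r / N%:R); rewrite ?divr_gt0.
have s20 : 0 < 2 * s by rewrite mulr_gt0.
have /choice[k hk] : forall i, exists k : 'I_N, k%:R <= (y ord0 i - (c ord0 i - r)) / (2 * s) < k.+1%:R.
  move=> i; have /andP[h1 h2] := h i.
  have q0 : 0 <= (y ord0 i - (c ord0 i - r)) / (2 * s) by rewrite divr_ge0 ?subr_ge0// ltW.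
  have /andP[k1 k2] := truncn_itv q0.
  suff kN : (Num.trunc ((y ord0 i - (c ord0 i - r)) / (2 * s)) < N)%N.
    by exists (Ordinal kN); rewrite /= k1.
  rewrite -(ltr_nat R); apply: (le_lt_trans k1); rewrite ltr_pdivrMr//.
  rewrite [X in _ < X](_ : _ = 2 * r); first by move: h2; lra.
  by rewrite sE; field; rewrite gt_eqF.
exists [ffun i => k i] => i; rewrite !mxE ffunE -sE; have /andP[k1 k2] := hk i.
rewrite ler_pdivlMr// in k1; rewrite ltr_pdivrMr// -natr1 in k2.
apply/andP; split; first by rewrite -subr_ge0; move: k1; rewrite -subr_ge0; congr (_ <= _); ring.
by rewrite -subr_gt0; move: k2; rewrite -subr_gt0; congr (_ < _); ring.
Qed.

Lemma cell_uniq c r N (j l : {ffun 'I_n -> 'I_N}) y : 0 < r -> cell c r j y -> cell c r l y -> j = l.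
Proof.
move=> r0 hj hl; apply/ffunP => i; apply/val_inj => /=.
have N0 : (0 < N)%N by case: N j {l hj hl} => // j; case: (j i).
have s0 : 0 < r / N%:R by rewrite divr_gt0// ltr0n.
have /andP[j1 j2] := hj i; have /andP[l1 l2] := hl i; rewrite !mxE in j1 j2 l1 l2.
apply/eqP; rewrite eqn_leq -[X in X && _]ltnS -[X in _ && X]ltnS -!(ltr_nat R).
rewrite -[X in X && _](ltr_pM2r s0) -[X in _ && X](ltr_pM2r s0).
rewrite -[X in _ < X * _]natr1 -[X in _ && (_ < X * _)]natr1.
by apply/andP; split; [move: j1 l2|move: l1 j2]; move: (r / N%:R) => s; lra.
Qed.

Lemma trivIset_cell c r N : 0 < r ->
  trivIset setT (fun j : {ffun 'I_n -> 'I_N} => cell c r j).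
Proof.
move=> r0; apply/trivIsetP => i j _ _ ij; rewrite -subset0 => y [hi hj].
by move/eqP: ij; apply; exact: cell_uniq hi hj.
Qed.

End Cubes.

Section LinearImages.
Context {R : realType} {n : nat}.
Notation leb := (@lebesgue_rV R n).

Lemma lebesgue_bounded (B : set 'rV[R]_n) r : measurable (B : set (borel 'rV[R]_n)) ->
  (forall y, B y -> `|y| < r) -> (leb B < +oo)%E.
Proof.
move=> mB Br; case: (leP r 0) => r0.
  rewrite (_ : B = set0) ?measure0//; rewrite -subset0 => y /Br.
  by rewrite ltNge (le_trans r0).
apply: (@le_lt_trans _ _ (leb (hcube 0 r))).
  apply: le_measure; rewrite ?inE//; first exact: measurable_hcube.
  by move=> y /Br yr; apply: norm_hcube; rewrite subr0.
by rewrite lebesgue_hcube ?ltry// ltW.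
Qed.

(** The image of the unit ball fattened by [e]. A small ball is mapped by a
    strictly differentiable map into a rescaled set of this form. *)
Definition fat_image (A : 'M[R]_n) (e : R) : set 'rV[R]_n :=
  [set w | exists2 u : 'rV[R]_n, `|u| <= 1 & `|w - u *m A| <= e].

Lemma compact_fat_image A e : compact (fat_image A e).
Proof.
have -> : fat_image A e = (fun p : 'rV[R]_n * 'rV[R]_n => p.1 *m A + p.2) @`
    ([set u | `|u - 0| <= 1] `*` [set v | `|v - 0| <= e]).
  apply/seteqP; split=> w.
    move=> [u u1 wu]; exists (u, w - u *m A) => /=; last by rewrite addrC subrK.
    by rewrite !subr0.
  by move=> [[u v] /= []]; rewrite !subr0 => u1 ve <-; exists u => //; rewrite addrAC subrr add0r.
apply: continuous_compact; last by apply: compact_setX; exact: compact_ball_rV.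
apply: continuous_subspaceT => p; apply/continuous_at_normP => e' e'0.
have [M M0 hM] := mulmx_norm_le A.
exists (e' / (M + 1)) => [|q]; first by rewrite divr_gt0// addr_gt0.
rewrite prod_normE gt_max => /andP[q1 q2].
rewrite (_ : _ - _ = (q - p).1 *m A + (q - p).2); last by rewrite mulmxBl opprD addrACA.
rewrite (le_lt_trans (ler_normD _ _))//.
have -> : e' = M * (e' / (M + 1)) + e' / (M + 1) by field; rewrite gt_eqF// addr_gt0.
by rewrite ler_ltD// (le_trans (hM _))// ler_wpM2l ?(ltW M0)// ltW.
Qed.

Arguments compact_fat_image : clear implicits.

Lemma measurable_fat_image A e : measurable (fat_image A e : set (borel 'rV[R]_n)).
Proof. by apply: compact_borel; exact: compact_fat_image. Qed.

Lemma lebesgue_compact (K : set 'rV[R]_n) : compact K -> (leb K < +oo)%E.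
Proof.
move=> cK; have [M [_ hM]] := compact_bounded cK.
apply: (@lebesgue_bounded _ (M + 2)); first exact: compact_borel.
move=> y Ky; have /hM/(_ y Ky) /= h : M < M + 1 by rewrite ltrDl.
by rewrite (le_lt_trans h)// ltrD2l ltr1n.
Qed.

Lemma lebesgue_unit_ball : leb [set u : 'rV[R]_n | `|u| <= 1] = (2 ^+ n)%:E.
Proof.
rewrite (_ : mkset _ = [set y : 'rV[R]_n | forall i, [set` `[(-1 : R), 1]] (y ord0 i)]).
  rewrite /lebesgue_rV (prod_measure_box (fun=> lebesgue_measure) (A := fun i => [set` `[(-1 : R), 1]]))//.
  rewrite (eq_bigr (fun=> (2 : R)%:E)) => [|i _].
    by rewrite prodEFin prodr_const card_ord.
  rewrite [LHS](lebesgue_measure_itv (Interval (BLeft _) (BRight _)))/= lte_fin.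
  by rewrite ifT ?gtrN// -EFinD; congr (_%:E); rewrite opprK.
apply/seteqP; split=> y /= h.
  by move=> i; rewrite in_itv/= -ler_norml (le_trans (rV_coord_le _ _)).
by apply: rV_norm_le => // i; have := h i; rewrite in_itv/= ler_norml.
Qed.

(** For singular matrices both sides vanish, which is how critical points are
    controlled. *)
Lemma lebesgue_ball_image A : leb (fat_image A 0) = (`|\det A| * 2 ^+ n)%:E.
Proof.
have [uA|uA] := boolP (A \in unitmx); last first.
  have A0 : \det A = 0 by apply/eqP; move: uA; rewrite unitmxE unitfE negbK.
  rewrite (lebesgue_singular A0 (measurable_fat_image A 0)).
    by rewrite A0 normr0 mul0r.
  by move=> w [u _]; rewrite normr_le0 subr_eq0 => /eqP ->; exists u.
have uV : invmx A \in unitmx by rewrite unitmx_inv.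
have mB : measurable ([set u : 'rV[R]_n | `|u| <= 1] : set (borel 'rV[R]_n)).
  have := closed_borel (@closed_ballE_rV R n 0 1).
  by congr measurable; apply/seteqP; split=> y /=; rewrite subr0.
have -> : fat_image A 0 = [set y | [set u | `|u| <= 1] (y *m invmx A)].
  apply/seteqP; split=> y /=.
    by move=> [u u1]; rewrite normr_le0 subr_eq0 => /eqP ->; rewrite mulmxK.
  by move=> y1; exists (y *m invmx A) => //; rewrite mulmxKV// subrr normr0.
rewrite (lebesgue_linear uV mB).
by rewrite lebesgue_unit_ball det_inv normfV invrK -EFinM.
Qed.

(** Continuity of the measure from above, as the compact fattenings decrease to
    the image of the ball. *)
Lemma lebesgue_fat_image A eta : 0 < eta -> exists2 e, 0 < e &
  (leb (fat_image A e) < (`|\det A| * 2 ^+ n + eta)%:E)%E.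
Proof.
move=> eta0; pose e k : R := k.+1%:R^-1.
have e0 k : 0 < e k by rewrite invr_gt0 ltr0n.
have capE : \bigcap_k fat_image A (e k) = fat_image A 0.
  apply/seteqP; split=> w; last first.
    by move=> [u u1 uw] k _; exists u => //; rewrite (le_trans uw)// ltW.
  move=> h; apply: contrapT => nw.
  have := compact_rV_closed (compact_fat_image A 0); rewrite -openC => oC.
  have /nbhs_ballP[r /= r0 rC] : nbhs w (~` fat_image A 0) by exact: open_nbhs_nbhs.
  have [k ke] : exists k : nat, e k < r.
    have := @near_infty_natSinv_lt R (PosNum r0).
    by move=> [k _ /(_ k (leqnn k))] ?; exists k.
  have [u u1 wu] := h k I; apply: (rC (u *m A)); last by exists u => //; rewrite subrr normr0.
  by rewrite -ball_normE /ball_/= (le_lt_trans wu).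
have : leb (fat_image A (e k)) @[k --> \oo] --> leb (\bigcap_k fat_image A (e k)).
  apply: (@nonincreasing_cvg_mu _ _ _ leb (fun k => fat_image A (e k))).
  - by apply: lebesgue_compact; exact: compact_fat_image.
  - by move=> k; exact: measurable_fat_image.
  - by apply: bigcapT_measurable => k; exact: measurable_fat_image.
  - move=> k l kl; apply/subsetPset => w [u u1 wu]; exists u => //.
    by rewrite (le_trans wu)// lef_pV2 ?posrE// ler_nat.
rewrite capE lebesgue_ball_image => /fine_cvgP[_ /cvgrPdist_lt/(_ _ eta0)[N _ /(_ N (leqnn N))]] h.
exists (e N) => //; have fin : leb (fat_image A (e N)) \is a fin_num.
  by rewrite ge0_fin_numE//; apply: lebesgue_compact; exact: compact_fat_image.
rewrite -(fineK fin) lte_fin; move: h => /=; rewrite distrC => /ltr_normlW.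
by rewrite ltrBlDr addrC.
Qed.

Lemma lebesgue_affine_image (z : 'rV[R]_n) (s : R) (T : set 'rV[R]_n) : 0 < s ->
  measurable (T : set (borel 'rV[R]_n)) ->
  leb [set y | T (s^-1 *: (y - z))] = ((s ^+ n)%:E * leb T)%E.
Proof.
move=> s0 mT.
have u : ((s^-1)%:M : 'M[R]_n) \in unitmx by rewrite unitmxE det_scalar unitrX// unitfE invr_eq0 gt_eqF.
have := lebesgue_linear u mT; rewrite det_scalar normrX normfV gtr0_norm// exprVn invrK => <-.
rewrite -(lebesgue_translate (- z) (measurable_mulmx (s^-1)%:M mT)).
by congr (leb _); apply/seteqP; split=> y /=; rewrite mul_mx_scalar.
Qed.

End LinearImages.

(** * The area inequality and change of variables *)

Lemma measure_bigsetU_le (d : measure_display) (T : measurableType d) (R : realType)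
    (mu : {measure set T -> \bar R}) (I : Type) (r : seq I) (A : I -> set T) :
  (forall i, measurable (A i)) ->
  (mu (\big[setU/set0]_(i <- r) A i) <= \sum_(i <- r) mu (A i))%E.
Proof.
move=> mA; elim: r => [|i r IH]; first by rewrite !big_nil measure0.
rewrite !big_cons; apply: le_trans (measureU2 _ _ _) _ => //.
  by elim/big_ind: _ => // *; exact: measurableU.
by rewrite leeD2l.
Qed.

Lemma measure_bigcup_null (d : measure_display) (T : measurableType d) (R : realType)
    (mu : {measure set T -> \bar R}) (A : nat -> set T) :
  (forall i, measurable (A i)) -> (forall i, mu (A i) = 0%E) -> mu (\bigcup_i A i) = 0%E.
Proof.
move=> mA A0; apply/eqP; rewrite eq_le measure_ge0 andbT.
apply: (@le_trans _ _ (\sum_(k <oo) mu (A k))%E).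
  by apply: measure_sigma_subadditive => //; exact: bigcupT_measurable.
by rewrite eseries0// => k _ _; rewrite A0.
Qed.

Section Area.
Context {R : realType} {n : nat}.
Notation leb := (@lebesgue_rV R n).
Variables (Omega : set 'rV[R]_n) (phi : 'rV[R]_n -> 'rV[R]_n) (Dphi : 'rV[R]_n -> 'M[R]_n).
Hypothesis oOmega : open Omega.
Hypothesis dphi : forall y, Omega y -> sdiff phi y (Dphi y).

Definition absdet (y : 'rV[R]_n) : R := `|\det (Dphi y)|.
Local Notation J := absdet.

Lemma sdiff_within : {within Omega, continuous phi}.
Proof.
apply: continuous_in_subspaceT => y; rewrite inE => Oy.
exact: sdiff_continuous (dphi Oy).
Qed.

Lemma absdet_continuous y : Omega y -> {for y, continuous J}.
Proof.
move=> Oy; have : {for y, continuous (fun z => \det (Dphi z))}.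
  apply: (sdiff_det_continuous (f := phi)).
  by apply: filterS (open_nbhs_nbhs (conj oOmega Oy)) => z; exact: dphi.
move=> /continuous_at_normP h; apply/continuous_at_normP => e e0.
have [d d0 hd] := h e e0; exists d => // z zy.
by rewrite (le_lt_trans (ler_dist_dist _ _))// hd.
Qed.

Lemma measurable_absdet (O : set 'rV[R]_n) : O `<=` Omega ->
  measurable (O : set (borel 'rV[R]_n)) ->
  measurable_fun (O : set (borel 'rV[R]_n)) (J : borel 'rV[R]_n -> R).
Proof.
move=> OO mO; apply: within_borel_fun => //; apply: continuous_in_subspaceT => y.
by rewrite inE => /OO; exact: absdet_continuous.
Qed.

Lemma compact_sdiff_image K : compact K -> K `<=` Omega -> compact (phi @` K).
Proof.
move=> cK KO; apply: continuous_compact => //.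
exact: continuous_subspaceW KO sdiff_within.
Qed.

(** Strict differentiability bounds the deviation from the linear map by a
    small multiple of the side of the cube, uniformly in the cubes near [a];
    the image is thus contained in a fattened linear image. *)
Lemma area_local a eta : Omega a -> 0 < eta -> exists2 d, 0 < d &
  forall z s, 0 < s -> (forall y, `|y - z| <= s -> `|y - a| < d) ->
  forall K, compact K -> K `<=` Omega -> (forall y, K y -> `|y - z| <= s) ->
  (leb (phi @` K) <= (s ^+ n * (J a * 2 ^+ n + eta))%:E)%E.
Proof.
move=> Oa eta0; have [e e0 he] := lebesgue_fat_image (Dphi a) eta0.
have [d d0 hd] := dphi Oa e0; exists d => // z s s0 zs K cK KO Kz.
have zd : `|z - a| < d by apply: zs; rewrite subrr normr0 ltW.
have mT := measurable_fat_image (Dphi a) e.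
have sub : phi @` K `<=` [set w | fat_image (Dphi a) e (s^-1 *: (w - phi z))].
  move=> _ [y Ky <-] /=; exists (s^-1 *: (y - z)).
    by rewrite normrZ gtr0_norm ?invr_gt0// ler_pdivrMl// mulr1 Kz.
  rewrite -scalemxAl -scalerBr normrZ gtr0_norm ?invr_gt0// ler_pdivrMl//.
  rewrite (le_trans (hd y z (zs y (Kz y Ky)) zd))// mulrC ler_wpM2r ?(ltW e0)//; exact: Kz.
apply: (@le_trans _ _ (leb [set w | fat_image (Dphi a) e (s^-1 *: (w - phi z))])).
  apply: le_measure => //; rewrite inE.
    by apply: compact_borel; exact: compact_sdiff_image.
  have := measurable_mulmx_preimage (s^-1)%:M (- (s^-1 *: phi z)) mT.
  by congr measurable; apply/seteqP; split=> w /=; rewrite mul_mx_scalar scalerBr.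
rewrite (lebesgue_affine_image _ s0 mT) EFinM lee_wpmul2l// ?lee_fin ?exprn_ge0 ?ltW//.
Qed.

(** The Jacobian is continuous, so that its value at [a] may be replaced by its
    integral over the cube. *)
Lemma area_cell (O : set 'rV[R]_n) a eta : open O -> O `<=` Omega -> O a -> 0 < eta ->
  exists2 d, 0 < d & forall z s, 0 < s -> (forall y, `|y - z| <= s -> `|y - a| < d) ->
  hcube z s `<=` O /\
  forall K, compact K -> K `<=` Omega -> (forall y, K y -> `|y - z| <= s) ->
  (leb (phi @` K) <= \int[leb]_(y in hcube z s) (J y)%:E + ((2 * s) ^+ n * eta)%:E)%E.
Proof.
move=> oO OO Oa eta0; have eta20 : 0 < eta / 2 by rewrite divr_gt0.
have eta30 : 0 < 2 ^+ n * (eta / 2) by rewrite mulr_gt0// exprn_gt0.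
have [d1 d10 h1] := area_local (OO _ Oa) eta30.
have /continuous_at_normP/(_ _ eta20)[d2 d20 h2] := absdet_continuous (OO _ Oa).
have /nbhs_ballP[d3 /= d30 h3] : nbhs a O by exact: open_nbhs_nbhs.
exists (Num.min d1 (Num.min d2 d3)) => [|z s s0 zs]; first by rewrite !lt_min d10 d20.
have {}zs y : `|y - z| <= s -> [/\ `|y - a| < d1, `|y - a| < d2 & `|y - a| < d3].
  by move=> /zs; rewrite !lt_min => /and3P[].
have zO : hcube z s `<=` O.
  move=> y /(hcube_norm (ltW s0))/zs[_ _ ya]; apply: h3.
  by rewrite -ball_normE /ball_/= distrC.
split => // K cK KO Kz.
have zs1 y : `|y - z| <= s -> `|y - a| < d1 by move=> /zs[].
apply: le_trans (h1 z s s0 zs1 K cK KO Kz) _.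
have mH := measurable_hcube z s.
have : ((J a - eta / 2)%:E * ((2 * s) ^+ n)%:E <= \int[leb]_(y in hcube z s) (J y)%:E)%E.
  rewrite -(lebesgue_hcube z (ltW s0)).
  apply: (@le_trans _ _ (\int[leb]_(y in hcube z s) (Num.max 0 (J a - eta / 2))%:E)%E).
    by rewrite integral_cst// lee_wpmul2r// lee_fin le_max lexx orbT.
  apply: ge0_le_integral => //.
  - by move=> y _; rewrite lee_fin le_max lexx.
  - by apply/measurable_EFinP; apply: measurable_absdet => //; exact: subset_trans OO.
  - move=> y /(hcube_norm (ltW s0))/zs[_ ya _]; rewrite lee_fin ge_max normr_ge0/=.
    by have := h2 y ya; rewrite distrC => /ltr_normlW; rewrite ltrBlDl -ltrBlDr => /ltW.
move=> h; apply: le_trans (leeD h (lexx _)); rewrite -EFinM -EFinD lee_fin exprMn.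
by rewrite le_eqVlt; apply/orP; left; apply/eqP; field.
Qed.

(** Compactness gives a grid so fine that the estimate for small cubes applies
    to each cell that meets [K]; summing over the cells loses only [eta] times
    the total volume. *)
Lemma area_open (K O : set 'rV[R]_n) : compact K -> open O -> K `<=` O -> O `<=` Omega ->
  (leb (phi @` K) <= \int[leb]_(y in O) (J y)%:E)%E.
Proof.
move=> cK oO KO OO.
have [rho rho0 Krho] : exists2 rho, 0 < rho & K `<=` hcube 0 rho.
  have [M [_ hM]] := compact_bounded cK; exists (`|M| + 2); first by rewrite ltr_wpDl.
  move=> y Ky; apply: norm_hcube; rewrite subr0.
  have /hM/(_ y Ky) /= h : M < `|M| + 1 by rewrite (le_lt_trans (ler_norm M))// ltrDl.
  by rewrite (le_lt_trans h)// ltrD2l ltr1n.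
apply/lee_addgt0Pr => e e0; pose eta := e / (2 * rho) ^+ n.
have r2 : 0 < (2 * rho) ^+ n by rewrite exprn_gt0// mulr_gt0.
have eta0 : 0 < eta by rewrite divr_gt0.
pose P (N : nat) (a : 'rV[R]_n) := forall z, `|a - z| <= rho / N%:R -> hcube z (rho / N%:R) `<=` O /\
  forall L, compact L -> L `<=` Omega -> (forall y, L y -> `|y - z| <= rho / N%:R) ->
  (leb (phi @` L) <= \int[leb]_(y in hcube z (rho / N%:R)) (J y)%:E + ((2 * (rho / N%:R)) ^+ n * eta)%:E)%E.
have : \forall N \near \oo, K `<=` P N.
  have /compact_near_coveringP := cK; apply => // a Ka.
  have [d d0 hd] := area_cell oO OO (KO _ Ka) eta0.
  have d30 : 0 < d / 3 by rewrite divr_gt0.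
  have [N0 hN0] : exists N0 : nat, forall N, (N0 <= N)%N -> (0 < N)%N /\ rho / N%:R < d / 3.
    exists (Num.trunc (3 * rho / d)).+1 => N hN.
    have N0 : (0 < N)%N by apply: leq_trans hN.
    split => //; rewrite ltr_pdivrMr ?ltr0n//.
    have := truncnS_gt (3 * rho / d); rewrite ltr_pdivrMr// => h.
    have : (Num.trunc (3 * rho / d)).+1%:R <= N%:R :> R by rewrite ler_nat.
    move=> /(ler_wpM2r (ltW d0)) h'; move: (lt_le_trans h h'); lra.
  exists (ball a (d / 3), [set N | (N0 <= N)%N]) => /=.
    by split; [exact: nbhsx_ballx|exists N0].
  move=> [a' N] /= []; rewrite -ball_normE /ball_/= => aa' /hN0[N_gt0 sd] z a'z.
  apply: hd; first by rewrite divr_gt0// ltr0n.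
  move=> y yz; rewrite (_ : y - a = (y - z) - (a' - z) - (a - a')); last by rewrite !opprB !addrA subrK subrK.
  rewrite (le_lt_trans (ler_normB _ _))//.
  have := ler_normB (y - z) (a' - z); move: yz a'z aa' sd; lra.
move=> [N0 _ hN]; pose N := N0.+1; have {}hN : K `<=` P N by apply: hN; rewrite /N /= leqnSn.
have N_gt0 : 0 < N%:R :> R by rewrite ltr0n.
have s0 : 0 < rho / N%:R by rewrite divr_gt0.
pose z j := cell_center (0 : 'rV[R]_n) rho (N := N) j.
pose meets j := `[< K `&` cell (0 : 'rV[R]_n) rho (N := N) j !=set0 >].
pose r := [seq j <- index_enum {ffun 'I_n -> 'I_N} | meets j].
pose L j := K `&` [set y | `|y - z j| <= rho / N%:R].
have cL j : compact (L j).
  by apply: compact_closedI => //; exact: closed_ballE_rV.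
have LO j : L j `<=` Omega by move=> y [/KO/OO].
have mL j : measurable (phi @` L j : set (borel 'rV[R]_n)).
  by apply: compact_borel; exact: compact_sdiff_image.
have good j : j \in r -> hcube (z j) (rho / N%:R) `<=` O /\
   (leb (phi @` L j) <= \int[leb]_(y in hcube (z j) (rho / N%:R)) (J y)%:E + ((2 * (rho / N%:R)) ^+ n * eta)%:E)%E.
  rewrite mem_filter => /andP[/asboolP[a [Ka ha]] _].
  have [|h1 h2] := hN a Ka (z j); first exact: hcube_norm (ltW s0) ha.
  by split => //; apply: h2 => // y [].
apply: (@le_trans _ _ (\sum_(j <- r) leb (phi @` L j))%E).
  apply: le_trans (measure_bigsetU_le leb r mL); apply: le_measure; rewrite ?inE.
  - by apply: compact_borel; apply: compact_sdiff_image => //; exact: subset_trans OO.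
  - by elim/big_ind: _ => // *; exact: measurableU.
  - move=> _ [y Ky <-]; have [j hj] := cell_cover (ltn0Sn N0) rho0 (Krho _ Ky).
    rewrite -bigcup_seq; exists j => /=.
      by rewrite mem_filter mem_index_enum andbT; apply/asboolP; exists y.
    by exists y => //; split => //; exact: hcube_norm (ltW s0) hj.
apply: (@le_trans _ _ (\sum_(j <- r) (\int[leb]_(y in hcube (z j) (rho / N%:R)) (J y)%:E + ((2 * (rho / N%:R)) ^+ n * eta)%:E))%E).
  by rewrite big_seq [leRHS]big_seq; apply: lee_sum => j /good[].
rewrite big_split/=; apply: leeD.
  have UO : \big[setU/set0]_(j <- r) hcube (z j) (rho / N%:R) `<=` O.
    by rewrite -bigcup_seq => y [j /= jr]; exact: (good j jr).1.
  have mU : measurable (\big[setU/set0]_(j <- r) hcube (z j) (rho / N%:R) : set (borel 'rV[R]_n)).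
    by elim/big_ind: _ => // *; [exact: measurableU|exact: measurable_hcube].
  rewrite -ge0_integral_bigsetU//.
  - apply: ge0_subset_integral => //; first exact: open_borel.
      by apply/measurable_EFinP; apply: measurable_absdet => //; exact: open_borel.
    by move=> y _; rewrite lee_fin normr_ge0.
  - by move=> j; exact: measurable_hcube.
  - by rewrite filter_uniq// index_enum_uniq.
  - have /trivIsetP tc := @trivIset_cell R n 0 rho N rho0.
    by apply/trivIsetP => i l _ _ il; exact: tc.
  - by apply/measurable_EFinP; apply: measurable_absdet => //; exact: subset_trans OO.
  - by move=> y _; rewrite lee_fin normr_ge0.
rewrite sumEFin lee_fin big_const_seq count_predT iter_addr_0 -[leLHS]mulr_natl.
have : (size r <= N ^ n)%N.
  rewrite size_filter (leq_trans (count_size _ _))//.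
  by rewrite -sum1_size sum1_card card_ffun !card_ord.
rewrite -(ler_nat R) => hs.
have c0 : 0 <= (2 * (rho / N%:R)) ^+ n * eta.
  by rewrite mulr_ge0 ?(ltW eta0)// exprn_ge0// mulr_ge0// ltW.
apply: le_trans (ler_wpM2r c0 hs) _.
have E : N%:R * (2 * (rho / N%:R)) = 2 * rho by field; rewrite gt_eqF.
by rewrite natrX [X in X <= _]mulrA -[X in X * eta]exprMn E /eta mulrC divfK// gt_eqF.
Qed.

(** Follows from the inequality for open neighbourhoods shrinking to [K]. As
    singular and noninjective maps are included, it contains the lemma of Sard
    and the fact that null sets have null images. *)
Lemma area_compact (K : set 'rV[R]_n) : compact K -> K `<=` Omega ->
  (leb (phi @` K) <= \int[leb]_(y in K) (J y)%:E)%E.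
Proof.
move=> cK KO.
have [k hk] : exists k : nat, forall a, K a -> forall y, `|y - a| < k.+1%:R^-1 -> Omega y /\ J y <= k%:R.
  have : \forall k \near \oo, K `<=` (fun a => forall y, `|y - a| < k.+1%:R^-1 -> Omega y /\ J y <= k%:R).
    have /compact_near_coveringP := cK; apply => // a Ka.
    have /continuous_at_normP/(_ _ ltr01)[d d0 hd] := absdet_continuous (KO _ Ka).
    have /nbhs_ballP[r /= r0 hr] : nbhs a Omega by apply: open_nbhs_nbhs; split => //; exact: KO.
    have m0 : 0 < Num.min d r / 2 by rewrite divr_gt0// lt_min d0.
    have [k0 hk0] : exists k0 : nat, forall k, (k0 <= k)%N -> k.+1%:R^-1 < Num.min d r / 2 /\ J a + 1 <= k%:R.
      have [k1 _ h1] := @near_infty_natSinv_lt R (PosNum m0).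
      exists (maxn k1 (Num.trunc (J a + 1)).+1) => k; rewrite geq_max => /andP[/h1 ? h2].
      by split => //; apply: le_trans (ltW (truncnS_gt _)) _; rewrite ler_nat.
    exists (ball a (Num.min d r / 2), [set k | (k0 <= k)%N]) => /=.
      by split; [exact: nbhsx_ballx|exists k0].
    move=> [a' k] /= []; rewrite -ball_normE /ball_/= => aa' /hk0[k1 k2] y ya'.
    have ya : `|y - a| < Num.min d r.
      rewrite (_ : y - a = (y - a') - (a - a')); last by rewrite opprB addrA subrK.
      by rewrite (le_lt_trans (ler_normB _ _))// (splitr (Num.min d r)) ltrD// (lt_trans ya').
    move: ya; rewrite lt_min => /andP[yd yr]; split.
      by apply: hr; rewrite -ball_normE /ball_/= distrC.
    by have := hd y yd => /ltr_normlW; rewrite ltrBlDr => /ltW h; apply: le_trans h _; rewrite addrC.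
  by move=> [k _ /(_ k (leqnn k))] h; exists k.
pose O1 := \bigcup_(a in K) ball a (k.+1%:R^-1 : R).
have oO1 : open O1 by apply: bigcup_open => a _; exact: ball_open.
have KO1 : K `<=` O1.
  by move=> a Ka; exists a => //; apply: ballxx; rewrite invr_gt0 ltr0n.
have O1k y : O1 y -> Omega y /\ J y <= k%:R.
  by move=> [a Ka]; rewrite -ball_normE /ball_/= distrC; exact: hk.
have mO1 := open_borel oO1.
have mJ : measurable_fun (O1 : set (borel 'rV[R]_n)) (J : borel 'rV[R]_n -> R).
  by apply: measurable_absdet => // y /O1k[].
pose lam := wpush leb mO1 (@measurable_id _ (borel 'rV[R]_n) O1) mJ (fun y _ => normr_ge0 _).
have lamfin : (lam setT < +oo)%E.
  rewrite wpushE setIT.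
  apply: (@le_lt_trans _ _ (\int[leb]_(y in O1) (k%:R)%:E)%E).
    apply: ge0_le_integral => //; try exact/measurable_EFinP.
      by move=> y _; rewrite lee_fin normr_ge0.
    by move=> y /O1k[_]; rewrite lee_fin.
  rewrite integral_cst// lte_mul_pinfty ?lee_fin//.
  have [M [_ hM]] := compact_bounded cK.
  apply: (@lebesgue_bounded _ _ _ (M + 3)) => // y [a Ka]; rewrite -ball_normE /ball_/= => ay.
  have /hM/(_ a Ka) /= h : M < M + 1 by rewrite ltrDl.
  have k1 : k.+1%:R^-1 <= 1 :> R by rewrite invf_le1 ?ltr0n// ler1n.
  rewrite -(subrK a y) (le_lt_trans (ler_normD _ _))// distrC.
  by have := lt_le_trans ay k1; move: h; lra.
apply/lee_addgt0Pr => e e0.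
have [F [ O [cF oO FK KOO h]]] := borel_regular lamfin (compact_borel cK) e0.
have mlam A : measurable (A : set (borel 'rV[R]_n)) -> A `<=` O1 -> lam A = (\int[leb]_(y in A) (J y)%:E)%E.
  by move=> mA AO; rewrite wpushE preimage_id setIidr.
apply: (@le_trans _ _ (\int[leb]_(y in O `&` O1) (J y)%:E)%E).
  apply: area_open => //; first exact: openI.
  - by move=> y Ky; split; [exact: KOO|exact: KO1].
  - by move=> y [_ /O1k[]].
have mF := closed_borel cF; have mO := open_borel oO; have mK := compact_borel cK.
rewrite -mlam//; last exact: measurableI.
rewrite -(mlam K)//; apply: (@le_trans _ _ (lam (K `|` (O `\` F)))).
  apply: le_measure; rewrite ?inE.
  - exact: measurableI.
  - by apply: measurableU => //; exact: measurableD.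
  - move=> y [Oy _]; have [Fy|Fy] := pselect (F y); first by left; exact: FK.
    by right.
apply: le_trans (measureU2 _ _ _) _ => //; first exact: measurableD.
by rewrite leeD2l// ltW.
Qed.

Lemma area_null (N : set 'rV[R]_n) : closed N ->
  (forall K, compact K -> K `<=` Omega `&` N -> (\int[leb]_(y in K) (J y)%:E = 0)%E) ->
  exists T : set 'rV[R]_n, [/\ measurable (T : set (borel 'rV[R]_n)),
    leb T = 0%E & phi @` (Omega `&` N) `<=` T].
Proof.
move=> cN h; have [K [cK ndK OK]] := open_sigma_compact oOmega.
have cKN k : compact (K k `&` N) by exact: compact_closedI.
have KNO k : K k `&` N `<=` Omega by move=> y [Ky _]; rewrite OK; exists k.
have mI k : measurable (phi @` (K k `&` N) : set (borel 'rV[R]_n)).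
  by apply: compact_borel; exact: compact_sdiff_image.
exists (\bigcup_k phi @` (K k `&` N)); split; first exact: bigcupT_measurable.
  apply: measure_bigcup_null => // k; apply/eqP; rewrite eq_le measure_ge0 andbT.
  rewrite -(h (K k `&` N)) ?area_compact//.
  by move=> y [Ky Ny]; split => //; apply: (KNO k).
move=> _ [y [Oy Ny] <-]; move: (Oy); rewrite OK => -[k _ Ky].
by exists k => //; exists y.
Qed.

Lemma area_null_set (N : set 'rV[R]_n) : closed N -> leb N = 0%E ->
  exists T : set 'rV[R]_n, [/\ measurable (T : set (borel 'rV[R]_n)),
    leb T = 0%E & phi @` (Omega `&` N) `<=` T].
Proof.
move=> cN N0; apply: area_null => // K cK KN; apply: null_set_integral.
- exact: compact_borel.
- apply/measurable_EFinP; apply: measurable_absdet; last exact: compact_borel.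
  by move=> y /KN[].
- apply: subset_measure0 N0; [exact: compact_borel|exact: closed_borel|].
  by move=> y /KN[].
Qed.

(** The lemma of Sard in equal dimensions, by the area inequality on compact
    pieces of the critical set, where the Jacobian vanishes. *)
Lemma area_critical : exists T : set 'rV[R]_n, [/\ measurable (T : set (borel 'rV[R]_n)),
    leb T = 0%E & forall y, Omega y -> \det (Dphi y) = 0 -> T (phi y)].
Proof.
have [K [cK ndK OK]] := open_sigma_compact oOmega.
have cC k : compact (K k `&` [set y | \det (Dphi y) = 0]).
  have KO : K k `<=` Omega by move=> y Ky; rewrite OK; exists k.
  have cJ : {within K k, continuous J}.
    by apply: continuous_in_subspaceT => y; rewrite inE => /KO; exact: absdet_continuous.
  have /continuous_closedP/(_ _ (closed_eq (y := 0)))/closed_subspaceP[C cC CE] := cJ.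
 rewrite (_ : _ `&` _ = C `&` K k).
    by rewrite setIC; exact: compact_closedI.
  rewrite CE setIC; apply/seteqP; split=> y [/= h Ky]; split => //.
    by rewrite /from_subspace /absdet /= h normr0.
  by move: h => /eqP; rewrite normr_eq0 => /eqP.
have KO k : K k `&` [set y | \det (Dphi y) = 0] `<=` Omega by move=> y [Ky _]; rewrite OK; exists k.
have mI k : measurable (phi @` (K k `&` [set y | \det (Dphi y) = 0]) : set (borel 'rV[R]_n)).
  by apply: compact_borel; exact: compact_sdiff_image.
exists (\bigcup_k phi @` (K k `&` [set y | \det (Dphi y) = 0])); split; first exact: bigcupT_measurable.
  apply: measure_bigcup_null => // k; apply/eqP; rewrite eq_le measure_ge0 andbT.
  apply: le_trans (area_compact (cC k) (KO k)) _.
  by rewrite integral0_eq// => y [_ /= h]; rewrite /absdet h normr0.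
by move=> y Oy dy; move: (Oy); rewrite {1}OK => -[k _ Ky]; exists k => //; exists y.
Qed.

End Area.

Section ChangeOfVariables.
Context {R : realType} {n : nat}.
Notation leb := (@lebesgue_rV R n).
Notation rV := 'rV[R]_n.

Lemma measurable_sdiff (Omega : set rV) (phi : rV -> rV) (Dphi : rV -> 'M[R]_n) :
  open Omega -> (forall y, Omega y -> sdiff phi y (Dphi y)) ->
  measurable_fun (Omega : set (borel rV)) (phi : borel rV -> borel rV).
Proof.
move=> oO dphi; apply: borel_continuous_within; first exact: open_borel.
exact: (sdiff_within dphi).
Qed.

Definition push_open (Omega : set rV) (oO : open Omega) (psi : rV -> rV)
    (mpsi : measurable_fun (Omega : set (borel rV)) (psi : borel rV -> borel rV))
    (w : rV -> R) (mw : measurable_fun (Omega : set (borel rV)) (w : borel rV -> R))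
    (w0 : forall x, Omega x -> 0 <= w x) : {measure set (borel rV) -> \bar R} :=
  wpush leb (open_borel oO) mpsi mw w0.

(** Inner regularity reduces the inequality to compact sets, for which it is
    the area inequality. *)
Lemma push_absdet_le (O1 O2 : set rV) (o1 : open O1) (o2 : open O2)
    (phi psi : rV -> rV) (Dphi : rV -> 'M[R]_n) :
  (forall y, O1 y -> sdiff phi y (Dphi y)) ->
  measurable_fun (O2 : set (borel rV)) (psi : borel rV -> borel rV) ->
  O2 = phi @` O1 -> (forall y, O1 y -> psi (phi y) = y) ->
  forall B, measurable (B : set (borel rV)) -> B `<=` O1 ->
  (leb (O2 `&` psi @^-1` B) <= \int[leb]_(y in B) (absdet Dphi y)%:E)%E.
Proof.
move=> dphi mpsi O2E psiK.
have mJ := measurable_absdet o1 dphi (@subset_refl _ O1) (open_borel o1).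
pose nu := push_open o2 mpsi (measurable_cst (1 : R)) (fun _ _ => ler01).
pose lam := push_open o1 (@measurable_id _ (borel rV) O1) mJ (fun y _ => normr_ge0 _).
have nuE B : measurable (B : set (borel rV)) -> nu B = leb (O2 `&` psi @^-1` B).
  move=> mB; rewrite /nu wpushE -[RHS]mul1e -integral_cst//; exact: (mpsi (open_borel o2) _ mB).
have lamE B : B `<=` O1 -> lam B = (\int[leb]_(y in B) (absdet Dphi y)%:E)%E.
  by move=> BO; rewrite /lam wpushE preimage_id setIidr.
have [K [cK ndK OK]] := open_sigma_compact o1.
have imE L : L `<=` O1 -> O2 `&` psi @^-1` L = phi @` L.
  move=> LO; rewrite O2E; apply/seteqP; split=> x.
    by move=> [[y Oy <-] /=]; rewrite psiK// => Ly; exists y.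
  by move=> [y Ly <-]; split; [exists y => //; exact: LO|rewrite /= psiK//; exact: LO].
have KO k : K k `<=` O1 by move=> y Ky; rewrite OK; exists k.
move=> B mB BO; apply: (@le_trans _ _ (nu B)); first by rewrite nuE.
apply: (@le_trans _ _ (lam B)); last by rewrite lamE.
apply: (compact_le_measure cK ndK OK) => // [k|L cL LO].
  by rewrite nuE ?imE//; [apply: lebesgue_compact; exact: (compact_sdiff_image dphi)|exact: compact_borel].
by rewrite nuE ?imE// ?lamE//; [exact: (area_compact o1 dphi)|exact: compact_borel].
Qed.

Section change.
Variables (O1 O2 : set rV) (phi psi : rV -> rV) (Dphi Dpsi : rV -> 'M[R]_n).
Hypotheses (o1 : open O1) (o2 : open O2) (O2E : O2 = phi @` O1).
Hypothesis dphi : forall y, O1 y -> sdiff phi y (Dphi y).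
Hypothesis dpsi : forall x, O2 x -> sdiff psi x (Dpsi x).
Hypothesis psiK : forall y, O1 y -> psi (phi y) = y.

Let phiK x : O2 x -> phi (psi x) = x.
Proof. by rewrite O2E => -[y Oy <-]; rewrite psiK. Qed.

Let psiO x : O2 x -> O1 (psi x).
Proof. by rewrite O2E => -[y Oy <-]; rewrite psiK. Qed.

Lemma absdet_inverse x : O2 x -> absdet Dpsi x * absdet Dphi (psi x) = 1.
Proof.
move=> Ox; have Oy := psiO Ox.
have h : sdiff (phi \o psi) x (Dpsi x *m Dphi (psi x)).
  by apply: sdiff_comp; [exact: dpsi|exact: dphi].
have : sdiff (phi \o psi) x 1%:M.
  apply: (sdiff_near _ (@sdiff_id _ _ _)).
  by apply: filterS (open_nbhs_nbhs (conj o2 Ox)) => z Oz; rewrite /= phiK.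
move=> /(sdiff_uniq h) /(congr1 (fun A => `|\det A|)).
by rewrite det_mulmx det1 normrM normr1.
Qed.

(** The area inequality for the map and for its inverse bounds the two sides by
    each other, since the Jacobians are inverse to each other. *)
Lemma change_of_variables (g : rV -> \bar R) :
  measurable_fun setT (g : borel rV -> \bar R) -> (forall y, (0 <= g y)%E) ->
  (\int[leb]_(x in O2) g (psi x) = \int[leb]_(y in O1) (g y * (absdet Dphi y)%:E))%E.
Proof.
have O1E : O1 = psi @` O2.
  apply/seteqP; split=> y.
    by move=> Oy; exists (phi y); rewrite ?psiK// O2E; exists y.
  by move=> [x Ox <-]; exact: psiO.
have mphi := measurable_sdiff o1 dphi; have mpsi := measurable_sdiff o2 dpsi.
have mJ := measurable_absdet o1 dphi (@subset_refl _ O1) (open_borel o1).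
have mJ' := measurable_absdet o2 dpsi (@subset_refl _ O2) (open_borel o2).
have mO1 := open_borel o1; have mO2 := open_borel o2.
pose nu := push_open o2 mpsi (measurable_cst (1 : R)) (fun _ _ => ler01).
pose lam := push_open o1 (@measurable_id _ (borel rV) O1) mJ (fun y _ => normr_ge0 _).
pose kap := push_open o2 mpsi mJ' (fun y _ => normr_ge0 _).
pose leb1 := push_open o1 (@measurable_id _ (borel rV) O1) (measurable_cst (1 : R)) (fun _ _ => ler01).
have nuE B : measurable (B : set (borel rV)) -> nu B = leb (O2 `&` psi @^-1` B).
  by move=> mB; rewrite /nu wpushE -[RHS]mul1e -integral_cst//; exact: (mpsi mO2 _ mB).
have nu_lam B : measurable (B : set (borel rV)) -> (nu B <= lam B)%E.
  move=> mB; rewrite nuE// (_ : _ `&` _ = O2 `&` psi @^-1` (O1 `&` B)); last first.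
    apply/seteqP; split=> x [Ox Bx]; split => //; last by case: Bx.
    by split => //; exact: psiO.
  rewrite /lam wpushE preimage_id.
  apply: (push_absdet_le o1 o2 dphi mpsi O2E psiK); last by move=> y [].
  exact: measurableI.
have leb_kap B : measurable (B : set (borel rV)) -> (leb1 B <= kap B)%E.
  move=> mB; have -> : leb1 B = leb (B `&` O1).
    rewrite /leb1 wpushE preimage_id setIC -[RHS]mul1e -integral_cst//.
    exact: measurableI.
  rewrite /kap wpushE.
  rewrite (_ : B `&` O1 = O1 `&` phi @^-1` (O2 `&` psi @^-1` B)); last first.
    apply/seteqP; split=> y; last by move=> [Oy [_]] /=; rewrite psiK.
    by move=> [By Oy]; split => //; split => /=; [rewrite O2E; exists y|rewrite psiK].
  apply: (push_absdet_le o2 o1 dpsi mphi O1E phiK); last by move=> x [].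
  exact: (mpsi mO2 _ mB).
have lam_nu B : measurable (B : set (borel rV)) -> (lam B <= nu B)%E.
  move=> mB; pose g1 (y : rV) := ((absdet Dphi \_ (O1 `&` B)) y)%:E.
  have mg1 : measurable_fun setT (g1 : borel rV -> \bar R).
    apply/measurable_EFinP; apply/(measurable_restrictT _ _).1; first exact: measurableI.
    by apply: (measurable_funS mO1 _ mJ) => y [].
  have g10 y : (0 <= g1 y)%E.
    by rewrite /g1 patchE; case: ifP => _; rewrite lee_fin// normr_ge0.
  apply: (@le_trans _ _ (\int[leb1]_y g1 y)%E).
    rewrite ge0_integral_wpush// /lam wpushE preimage_id.
    under [leRHS]eq_integral do rewrite mule1.
    rewrite le_eqVlt; apply/orP; left; apply/eqP.
    rewrite integral_mkcondr; apply: eq_integral => y; rewrite inE => Oy.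
    rewrite /g1 !patchE; have [yB|yB] := boolP (y \in B).
      by rewrite mem_set//; split => //; exact: set_mem yB.
    by rewrite memNset// => -[_ By]; move: yB; rewrite mem_set.
  apply: le_trans (ge0_le_measure_integral leb_kap measurableT g10 mg1) _.
  rewrite ge0_integral_wpush// nuE// -[leRHS]mul1e -integral_cst; last exact: (mpsi mO2 _ mB).
  rewrite integral_mkcondr le_eqVlt; apply/orP; left; apply/eqP.
  apply: eq_integral => x; rewrite inE => Ox; rewrite /g1 !patchE.
  have [xB|xB] := boolP (x \in psi @^-1` B).
    rewrite mem_set; last by split; [exact: psiO|exact: set_mem xB].
    by rewrite -EFinM mulrC absdet_inverse.
  by rewrite memNset ?mul0e// => -[_ By]; move: xB; rewrite mem_set.
move=> mg g0.
transitivity (\int[nu]_y g y)%E.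
  rewrite ge0_integral_wpush//; by apply: eq_integral => x _; rewrite mule1.
transitivity (\int[lam]_y g y)%E; last by rewrite ge0_integral_wpush.
apply: eq_measure_integral => B mB _; apply/eqP; rewrite eq_le.
by rewrite nu_lam//= lam_nu.
Qed.

End change.
End ChangeOfVariables.

(** * One-variable integrals and the Gamma function *)

Section OneVariable.
Context {R : realType}.
Notation mu := (@lebesgue_measure R).

(** Integration by a primitive on intervals away from zero, where the powers
    below are smooth. *)
Lemma FTC_pos (F f : R -> R) (a b : R) : 0 < a -> a < b ->
  (forall t : R, 0 < t -> is_derive t (1 : R) F (f t)) ->
  (forall t : R, 0 < t -> {for t, continuous f}) ->
  (\int[mu]_(t in `[a, b]) (f t)%:E = (F b - F a)%:E)%E.
Proof.
move=> a0 ab dF cf; rewrite EFinB; apply: continuous_FTC2 => //.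
- apply: continuous_in_subspaceT => t; rewrite inE/= in_itv/= => /andP[at_ _].
  by apply: cf; exact: lt_le_trans at_.
- have cF t : 0 < t -> {for t, continuous F}.
    move=> t0; apply: differentiable_continuous; apply/derivable1_diffP.
    by have := dF t t0 => -[].
  split.
  + move=> t; rewrite in_itv/= => /andP[at_ _].
    by have := dF t (lt_trans a0 at_) => -[].
  + by apply: cvg_at_right_filter; exact: cF.
  + by apply: cvg_at_left_filter; apply: cF; exact: lt_trans ab.
- move=> t; rewrite in_itv/= => /andP[at_ _].
  by have [_ <-] := dF t (lt_trans a0 at_); rewrite derive1E.
Qed.

Lemma is_derive_powR (s t : R) : 0 < t ->
  is_derive t (1 : R) (fun x => x `^ s) (s * t `^ (s - 1)).
Proof.
move=> t0; apply: DeriveDef.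
  by apply: derivable_powR; rewrite in_itv/= t0.
by rewrite -derive1E powR_derive1// in_itv/= t0.
Qed.

Lemma is_derive_cpowR (c s t : R) : 0 < t ->
  is_derive t (1 : R) (fun x => c * x `^ s) (c * (s * t `^ (s - 1))).
Proof.
move=> t0; have hd := is_derive_powR s t0.
rewrite (_ : (fun x => c * x `^ s) = c \*: (fun x => x `^ s)); last exact/funext.
by apply: is_derive_eq.
Qed.

Lemma continuous_powR (s t : R) : 0 < t -> {for t, continuous (fun x => x `^ s)}.
Proof.
move=> t0; apply: differentiable_continuous; apply/derivable1_diffP.
by have := is_derive_powR s t0 => -[].
Qed.

(** Monotone convergence: the integrands are singular at zero and primitives
    are only available away from it. *)
Lemma cvg_integral_away0 (f : R -> R) (r : R) : 0 < r ->
  measurable_fun `]0, r]%classic f -> (forall t : R, 0 < t -> t <= r -> 0 <= f t) ->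
  (\int[mu]_(t in `[(r / k.+2%:R)%R, r]) (f t)%:E)%E @[k --> \oo] -->
  (\int[mu]_(t in `]0%R, r]) (f t)%:E)%E.
Proof.
move=> r0 mf f0.
have mD : measurable (`]0, r]%classic : set (measurableTypeR R)) by exact: measurable_itv.
have f0' t : `]0, r]%classic t -> 0 <= f t.
  by rewrite /= in_itv/= => /andP[]; exact: f0.
pose nu := wpush mu mD (@measurable_id _ (measurableTypeR R) _) mf f0'.
have nuE k : nu `[r / k.+2%:R, r]%classic = (\int[mu]_(t in `[(r / k.+2%:R)%R, r]) (f t)%:E)%E.
  rewrite wpushE preimage_id setIidr// => t; rewrite /= !in_itv/= => /andP[h ->].
  by rewrite andbT (lt_le_trans _ h)// divr_gt0// ltr0n.
have -> : (\int[mu]_(t in `]0%R, r]) (f t)%:E)%E = nu (\bigcup_k `[r / k.+2%:R, r]%classic).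
  rewrite wpushE preimage_id; congr (\int[mu]_(t in _) _)%E.
  apply/seteqP; split=> t; last by case.
  move=> h; split => //; move: h; rewrite /= in_itv/= => /andP[t0 tr].
  exists (Num.trunc (r / t)) => //; rewrite /= in_itv/= tr andbT.
  have := truncnS_gt (r / t); rewrite ltr_pdivrMr// mulrC => h.
  rewrite ler_pdivrMr ?ltr0n// (le_trans (ltW h))// ler_wpM2l ?(ltW t0)// ler_nat//.
have : nu `[r / k.+2%:R, r]%classic @[k --> \oo] --> nu (\bigcup_k `[r / k.+2%:R, r]%classic).
  apply: (nondecreasing_cvg_mu (mu := nu) (F := fun k => `[r / k.+2%:R, r]%classic)).
  - by move=> k; exact: measurable_itv.
  - by apply: bigcupT_measurable => k; exact: measurable_itv.
  - move=> k l kl; apply/subsetPset => t; rewrite /= !in_itv/= => /andP[h ->].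
    rewrite andbT (le_trans _ h)// ler_wpM2l ?(ltW r0)// lef_pV2 ?posrE ?ltr0n// ler_nat.
    by rewrite !ltnS.
by under eq_fun do rewrite nuE.
Qed.

(** The primitive of the power vanishes at zero, as [s] is positive. *)
Lemma integral_powR (s r : R) : 0 < s -> 0 < r ->
  (\int[mu]_(t in `]0%R, r]) (t `^ (s - 1))%:E = (r `^ s / s)%:E)%E.
Proof.
move=> s0 r0.
have mp : measurable_fun `]0, r]%classic (fun t : R => t `^ (s - 1)).
  by apply: measurable_funTS; exact: measurable_powR.
have h := cvg_integral_away0 r0 mp (fun _ _ _ => powR_ge0 _ _).
apply/esym; apply: (cvg_unique _ _ h) => //.
rewrite (_ : (fun k => _) = EFin \o (fun k => r `^ s / s - (r / k.+2%:R) `^ s / s)); last first.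
  apply/funext => k /=; apply: (@FTC_pos (fun t => t `^ s / s)).
  - by rewrite divr_gt0 ?ltr0n.
  - by rewrite ltr_pdivrMr ?ltr0n// ltr_pMr// ltr1n.
  - move=> t t0; have := is_derive_cpowR s^-1 s t0.
    rewrite mulrA mulVf ?gt_eqF// mul1r.
    by congr is_derive; apply/funext => x; rewrite mulrC.
  - by move=> t t0; exact: continuous_powR.
apply: cvg_EFin; first exact: nearW.
apply/cvgrPdist_lt => e e0; have es : 0 < e * s by rewrite mulr_gt0.
pose d := (e * s) `^ s^-1; have d0 : 0 < d by rewrite powR_gt0.
near=> k; rewrite /= opprB addrCA subrr addr0 ger0_norm ?divr_ge0 ?powR_ge0 ?(ltW s0)//.
rewrite ltr_pdivrMr//.
have -> : e * s = d `^ s by rewrite /d -powRrM mulVf ?gt_eqF// powRr1// ltW.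
apply: gt0_ltr_powR; rewrite ?nnegrE ?divr_ge0 ?(ltW r0) ?(ltW d0) ?ler0n//.
rewrite ltr_pdivrMr ?ltr0n// mulrC -ltr_pdivrMr//.
apply: lt_le_trans (truncnS_gt _) _; rewrite ler_nat.
near: k; exists (Num.trunc (r / d)) => // k /=; by rewrite ltnS => /leqW.
Unshelve. all: by end_near. Qed.

(** From [w / N <= exp (w / N)] raised to the power [N]. *)
Lemma expR_ge_expr (N : nat) (w : R) : 0 <= w -> (0 < N)%N -> w ^+ N <= N%:R ^+ N * expR w.
Proof.
move=> w0 N0; have N1 : 0 < N%:R :> R by rewrite ltr0n.
have h : w / N%:R <= expR (w / N%:R).
  by apply: le_trans (expR_ge1Dx _); rewrite lerDr.
rewrite -[w in X in X <= _](@divfK _ N%:R) ?gt_eqF// exprMn mulrC ler_wpM2l ?exprn_ge0 ?(ltW N1)//.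
have -> : expR w = expR (w / N%:R) ^+ N by rewrite -expRM_natl mulrC divfK// gt_eqF.
by rewrite lerXn2r// nnegrE ?expR_ge0// divr_ge0// ltW.
Qed.

Definition gamma_density (lam w : R) := w `^ (lam - 1) * expR (- w).

Lemma gamma_density_ge0 lam w : 0 <= gamma_density lam w.
Proof. by rewrite mulr_ge0 ?powR_ge0// expR_ge0. Qed.

Lemma measurable_gamma_density lam : measurable_fun setT (gamma_density lam).
Proof.
apply: measurable_funM; first exact: measurable_powR.
by apply: measurableT_comp => //; exact: measurable_expR.
Qed.

(** The power dominates near zero and the exponential at infinity. *)
Lemma gamma_integral_fin (lam : R) : 0 < lam ->
  (\int[mu]_(w in `]0%R, +oo[) (gamma_density lam w)%:E < +oo)%E.
Proof.
move=> lam0; pose N := (Num.trunc lam).+2.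
pose C : R := N%:R ^+ N; have C0 : 0 <= C by rewrite exprn_ge0.
have md D : measurable D -> measurable_fun D (fun w => (gamma_density lam w)%:E).
  by move=> mD; apply/measurable_EFinP; apply: measurable_funTS; exact: measurable_gamma_density.
have -> : `]0%R, +oo[%classic = `]0, 1]%classic `|` `]1, +oo[%classic :> set R.
  apply/seteqP; split=> t; rewrite /= !in_itv/= !andbT.
    by move=> t0; case: (leP t 1) => h; [left|right]; rewrite ?t0.
  by move=> [/andP[]//|]; exact: lt_trans.
rewrite ge0_integral_setU//=; last 3 first.
- by apply: md; exact: measurableU.
- by move=> w _; rewrite lee_fin gamma_density_ge0.
- by rewrite disj_set2E; apply/eqP; rewrite -subset0 => t /=; rewrite !in_itv/= andbT => -[/andP[_ h1] h2]; move: (le_lt_trans h1 h2); rewrite ltxx.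
apply: lte_add_pinfty.
  apply: (@le_lt_trans _ _ (\int[mu]_(t in `]0%R, 1%R]) (t `^ (lam - 1))%:E)%E).
    apply: ge0_le_integral => //.
    - by move=> w _; rewrite lee_fin gamma_density_ge0.
    - exact: md.
    - by apply/measurable_EFinP; apply: measurable_funTS; exact: measurable_powR.
    - move=> w; rewrite /= in_itv/= => /andP[w0 _]; rewrite lee_fin ler_piMr ?powR_ge0//.
      by rewrite -expR0 ler_expR oppr_le0 ltW.
  by rewrite integral_powR// ltry.
apply: (@le_lt_trans _ _ (\int[mu]_(t in `]1%R, +oo[) (C * t `^ (- 2))%:E)%E).
  apply: ge0_le_integral => //.
  - by move=> w _; rewrite lee_fin gamma_density_ge0.
  - exact: md.
  - by apply/measurable_EFinP; apply: measurable_funM => //; apply: measurable_funTS; exact: measurable_powR.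
  - move=> w; rewrite /= in_itv/= andbT => w1; rewrite lee_fin.
    have w0 : 0 < w by exact: lt_trans w1.
    have hN : w ^+ N <= C * expR w by apply: expR_ge_expr => //; exact: ltW.
    rewrite /gamma_density expRN ler_pdivrMr ?expR_gt0//.
    have : w `^ (lam - 1) <= w `^ (N%:R - 2).
      apply: ler_powR; first exact: ltW.
      rewrite /N; have := truncnS_gt lam; rewrite -[(Num.trunc lam).+2]addn1 natrD; lra.
    move=> h; apply: (le_trans h); rewrite powRD; last by apply/implyP => _; rewrite gt_eqF.
    rewrite powR_mulrn ?(ltW w0)// [leRHS]mulrAC; apply: ler_wpM2r; first exact: powR_ge0.
    exact: hN.
rewrite [X in (X < _)%E](_ : _ = (\int[mu]_(t in `[1%R, +oo[) (C * t `^ (- 2))%:E)%E); last first.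
  apply: integral_itv_obnd_cbnd; apply/measurable_EFinP; apply: measurable_funM => //.
  by apply: measurable_funTS; exact: measurable_powR.
have hc (t : R) : 0 < t -> {for t, continuous (fun x : R => C * x `^ (- 2))}.
  by move=> t0; apply: continuousM; [exact: cst_continuous|exact: continuous_powR].
have hc' (t : R) : 0 < t -> {for t, continuous (fun x : R => - C * x `^ (- 1))}.
  by move=> t0; apply: continuousM; [exact: cst_continuous|exact: continuous_powR].
rewrite (@ge0_continuous_FTC2y _ _ (fun t => - C * t `^ (- 1)) 1 0).
- by rewrite -EFinD ltry.
- by move=> t t1; rewrite mulr_ge0// powR_ge0.
- apply: continuous_in_subspaceT => t; rewrite inE/= in_itv/= andbT => t1.
  by apply: hc; exact: lt_le_trans t1.
- apply/cvgrPdist_lt => e e0; near=> t.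
  have t0 : 0 < t by near: t; exact: nbhs_pinfty_gt.
  rewrite sub0r mulNr opprK powR_inv1 ?(ltW t0)// ger0_norm ?divr_ge0 ?(ltW t0)//.
  rewrite ltr_pdivrMr// mulrC -ltr_pdivrMr//.
  by near: t; apply: nbhs_pinfty_gt; exact: num_real.
- by move=> t t1; have := is_derive_cpowR (- C) (- 1) (lt_trans ltr01 t1) => -[].
- by apply: cvg_at_right_filter; exact: (hc' 1 ltr01).
- move=> t; rewrite in_itv/= andbT => t1.
  have := is_derive_cpowR (- C) (- 1) (lt_trans ltr01 t1) => -[_ hd].
  rewrite derive1E hd mulrA mulrNN mulr1; congr (_ * _ `^ _); ring.
Unshelve. all: by end_near. Qed.

Lemma GammaE (lam : R) : 0 < lam ->
  (\int[mu]_(w in `]0%R, +oo[) (gamma_density lam w)%:E = (Gamma lam)%:E)%E.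
Proof.
move=> lam0; rewrite /Gamma /Rintegral fineK// ge0_fin_numE.
  exact: gamma_integral_fin.
by apply: integral_ge0 => w _; rewrite lee_fin gamma_density_ge0.
Qed.

Lemma Gamma_gt0 (lam : R) : 0 < lam -> 0 < Gamma lam.
Proof.
move=> lam0; rewrite -lte_fin -GammaE//.
have md D : measurable D -> measurable_fun D (fun w => (gamma_density lam w)%:E).
  by move=> mD; apply/measurable_EFinP; apply: measurable_funTS; exact: measurable_gamma_density.
have c0 : 0 < Num.min 1 (2 `^ (lam - 1)) * expR (- 2) :> R.
  by rewrite mulr_gt0 ?expR_gt0// lt_min ltr01 powR_gt0.
apply: (@lt_le_trans _ _ (\int[mu]_(w in `[1%R, 2%R]) (Num.min 1 (2 `^ (lam - 1)) * expR (- 2))%:E)%E).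
  rewrite integral_cst//= lebesgue_measure_itv/= lte_fin ltr1n -EFinD -EFinM lte_fin mulr_gt0// subr_gt0 ltr1n.
apply: (@le_trans _ _ (\int[mu]_(w in `[1%R, 2%R]) (gamma_density lam w)%:E)%E).
  apply: ge0_le_integral => //.
  - exact: md.
  - move=> w; rewrite /= in_itv/= => /andP[w1 w2]; rewrite lee_fin; apply: ler_pM; [|exact: expR_ge0| |by rewrite ler_expR lerN2].
      by rewrite le_min ler01 powR_ge0.
    rewrite ge_min; have [l1|l1] := leP 1 lam.
      apply/orP; left; apply: (@le_trans _ _ (1 `^ (lam - 1))); first by rewrite powR1.
      by rewrite ge0_ler_powR ?subr_ge0// ?nnegrE// (le_trans _ w1).
    apply/orP; right; rewrite -(opprB 1 lam) !powRN lef_pV2 ?posrE ?powR_gt0 ?(lt_le_trans _ w1)//.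
    by rewrite ge0_ler_powR ?subr_ge0 ?(ltW l1)// ?nnegrE// (le_trans _ w1).
apply: ge0_subset_integral => //; first exact: md.
  by move=> w _; rewrite lee_fin gamma_density_ge0.
by move=> w; rewrite /= !in_itv/= andbT => /andP[w1 _]; rewrite (lt_le_trans _ w1).
Qed.

End OneVariable.

(** * Primitives of functions of logarithmic growth *)

Section LogGrowth.
Context {R : realType}.
Notation mu := (@lebesgue_measure R).

(** After an integration over critical coordinates the result has the form [w ^
    - lam * H w], where [H] grows like [c * ln w ^ p]. The bound by a power at
    all [w] controls [H] near zero, where the logarithm says nothing, and makes
    [H t / t] integrable. *)
Definition log_growth (lam : R) (H : R -> R) (p : nat) (c : R) : Prop :=
  [/\ forall w, 0 < w -> 0 <= H w,
      forall w : R, 0 < w -> {for w, continuous H},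
      exists C, forall w, 0 < w -> H w <= C * w `^ lam &
      (fun w => H w / ln w ^+ p) @ +oo%R --> c].

Lemma near_pinfty_ln (A : R) : \forall w \near +oo%R, A < ln w.
Proof.
exists (expR A); split; first exact: num_real.
by move=> w hw; rewrite -ltr_expR lnK// posrE (lt_trans _ hw)// expR_gt0.
Qed.

Lemma cvg_div_ln (C : R) (p : nat) : (0 < p)%N -> (fun w => C / ln w ^+ p) @ +oo%R --> 0.
Proof.
move=> p0; apply/cvgrPdist_lt => e e0; near=> w.
have l1 : 1 < ln w by near: w; exact: near_pinfty_ln.
have l0 : 0 < ln w by exact: lt_trans l1.
rewrite sub0r normrN normrM normfV [`|ln w ^+ p|]gtr0_norm ?exprn_gt0//.
rewrite ltr_pdivrMr ?exprn_gt0// mulrC -ltr_pdivrMr//.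
apply: (@lt_le_trans _ _ (ln w)); last first.
  by rewrite -[leLHS]expr1; apply: ler_weXn2l => //; exact: ltW.
by near: w; exact: near_pinfty_ln.
Unshelve. all: by end_near. Qed.

(** A lower power of the logarithm is negligible against a higher one: this is
    why only the coordinates of maximal multiplicity contribute. *)
Lemma log_growth_raise lam H p c : log_growth lam H p c -> log_growth lam H p.+1 0.
Proof.
move=> [h1 h2 h3 h4]; split => //.
have h : (fun w => (H w / ln w ^+ p) * (1 / ln w ^+ 1)) @ +oo%R --> c * 0.
  by apply: cvgM => //; exact: cvg_div_ln.
rewrite mulr0 in h; apply: cvg_trans h; apply: near_eq_cvg; near=> w.
by rewrite expr1 exprSr invfM mul1r mulrA.
Unshelve. all: by end_near. Qed.

Lemma log_growth_raise_le lam H p q : log_growth lam H p 0 -> (p <= q)%N -> log_growth lam H q 0.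
Proof.
move=> h; elim: q => [|q IH]; first by rewrite leqn0 => /eqP <-.
by rewrite leq_eqVlt => /orP[/eqP <-//|/IH/log_growth_raise].
Qed.

(** The bound by a power near zero and the asymptotics at infinity leave a
    compact interval, where continuity applies. A bound valid for all [w] is
    needed for dominated convergence. *)
Lemma log_growth_bound lam H p c : 0 < lam -> log_growth lam H p c ->
  exists C, 0 <= C /\ forall w, 0 < w -> H w <= C * (1 + ln (1 + w)) ^+ p.
Proof.
move=> lam0 [h1 h2 [C hC] h4].
have /cvgrPdist_lt /(_ _ ltr01) h5 := h4.
have [w0 [w0r hw0]] : exists w0 : R, 1 <= w0 /\ forall w, w0 < w -> 1 < ln w /\ `|c - H w / ln w ^+ p| < 1.
  have hh : \forall w \near +oo%R, 1 < ln w /\ `|c - H w / ln w ^+ p| < 1.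
    by near=> w; split; near: w => //; exact: near_pinfty_ln.
  case: hh => M [_ hM]; exists (Num.max 1 M); split; first by rewrite le_max lexx.
  by move=> w; rewrite gt_max => /andP[_]; exact: hM.
exists (`|C| * w0 `^ lam + (`|c| + 1)); split.
  by rewrite addr_ge0 ?mulr_ge0 ?powR_ge0// addr_ge0.
move=> w wp.
have one_le : 1 <= (1 + ln (1 + w)) ^+ p.
  by apply: exprn_ege1; rewrite lerDl ln_ge0// lerDl ltW.
have [ww0|ww0] := leP w w0.
  apply: (le_trans (hC w wp)).
  apply: (@le_trans _ _ (`|C| * w0 `^ lam)).
    apply: (le_trans (ler_wpM2r (powR_ge0 _ _) (ler_norm C))).
    by rewrite ler_wpM2l// ge0_ler_powR ?nnegrE ?(ltW lam0) ?(ltW wp)// (le_trans ler01).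
  apply: (@le_trans _ _ (`|C| * w0 `^ lam + (`|c| + 1))); first by rewrite lerDl addr_ge0.
  by rewrite ler_peMr// addr_ge0 ?mulr_ge0 ?powR_ge0// addr_ge0.
have [l1 hc] := hw0 _ ww0; have l0 : 0 < ln w by exact: lt_trans l1.
have hw : H w <= (`|c| + 1) * ln w ^+ p.
  rewrite -ler_pdivrMr ?exprn_gt0//.
  have := ler_norm c; move: hc; rewrite ltr_norml => /andP[hc1 hc2] hc3; lra.
apply: (le_trans hw); apply: ler_pM; rewrite ?exprn_ge0 ?addr_ge0 ?(ltW l0)//.
  by rewrite lerDr mulr_ge0 ?powR_ge0.
apply: lerXn2r; rewrite ?nnegrE ?(ltW l0)//.
  by rewrite addr_ge0// ln_ge0// lerDl ltW.
apply: (@le_trans _ _ (ln (1 + w))); last by rewrite lerDr.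
by rewrite ler_ln ?posrE// ?lerDr// addr_gt0.
Unshelve. all: by end_near. Qed.

(** Integration over a critical coordinate reduces, by the substitution [w =
    beta * t ^ (2 * k)], to the primitive of [H] against [dt / t]. *)
Definition log_primitive (H : R -> R) (x : R) : R :=
  \int[mu]_(t in `]0, x]) (H t / t).

Lemma integral_cpowR (C s r : R) : 0 <= C -> 0 < s -> 0 < r ->
  (\int[mu]_(t in `]0%R, r]) (C * t `^ (s - 1))%:E = (C * (r `^ s / s))%:E)%E.
Proof.
move=> C0 s0 r0.
have mp : measurable_fun (`]0, r]%classic : set (measurableTypeR R)) (fun t => (t `^ (s - 1))%:E).
  by apply/measurable_EFinP; apply: measurable_funTS; exact: measurable_powR.
rewrite EFinM -integral_powR// -ge0_integralZl// => t _; rewrite lee_fin; exact: powR_ge0.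
Qed.

Section Primitive.
Variables (lam : R) (H : R -> R) (p : nat) (c : R).
Hypothesis lam0 : 0 < lam.
Hypothesis HH : log_growth lam H p c.

Lemma log_primitive_measurable : measurable_fun (`]0, +oo[%classic : set (measurableTypeR R)) (fun t => H t / t).
Proof.
have [h1 h2 h3 h4] := HH.
apply: measurable_realfun.open_continuous_measurable_fun; first exact: interval_open.
move=> t; rewrite inE/= in_itv/= andbT => t0.
apply: continuousM; first exact: h2.
by apply: continuousV; [rewrite gt_eqF|exact: cvg_id].
Qed.

Lemma log_primitive_bound : exists C, 0 <= C /\ forall t, 0 < t -> H t / t <= C * t `^ (lam - 1).
Proof.
have [h1 h2 [C hC] h4] := HH; exists `|C|; split => // t t0.
have -> : t `^ (lam - 1) = t `^ lam / t.
  by rewrite powRD; [rewrite powR_inv1 ?(ltW t0)|apply/implyP => _; rewrite gt_eqF].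
rewrite mulrA ler_wpM2r ?invr_ge0 ?(ltW t0)//.
by apply: (le_trans (hC _ t0)); rewrite ler_wpM2r ?powR_ge0// ler_norm.
Qed.

Lemma log_primitive_integrable x : mu.-integrable `]0, x]%classic (EFin \o (fun t => H t / t)).
Proof.
have [h1 h2 h3 h4] := HH; have [C [C0 hC]] := log_primitive_bound.
have sub : `]0, x]%classic `<=` (`]0, +oo[%classic : set R).
  by move=> t; rewrite /= !in_itv/= andbT => /andP[].
have [x0|x0] := leP x 0.
  by rewrite set_itv_ge ?bnd_simp -?leNgt//; exact: integrable_set0.
apply: (@le_integrable _ _ _ mu _ _ _ (EFin \o (fun t => C * t `^ (lam - 1)))) => //.
- by apply/measurable_EFinP; apply: measurable_funS sub log_primitive_measurable.
- move=> t /= ; rewrite in_itv/= => /andP[t0 _]; rewrite lee_fin !ger0_norm ?hC//.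
    by rewrite mulr_ge0 ?powR_ge0.
  by rewrite mulr_ge0 ?h1// invr_ge0 ltW.
- apply/integrableP; split.
    apply/measurable_EFinP; apply: measurable_funM => //.
    by apply: measurable_funTS; exact: measurable_powR.
  rewrite [X in (X < _)%E](_ : _ = (\int[mu]_(t in `]0%R, x]) (C * t `^ (lam - 1))%:E)%E).
    by rewrite integral_cpowR// ltry.
  by apply: eq_integral => t _ /=; rewrite ger0_norm ?mulr_ge0 ?powR_ge0.
Qed.

Lemma log_primitiveE x : (\int[mu]_(t in `]0%R, x]) (H t / t)%:E = (log_primitive H x)%:E)%E.
Proof.
rewrite /log_primitive /Rintegral fineK//.
have /integrable_fin_num := log_primitive_integrable x; exact.
Qed.

Lemma log_primitive_ge0 x : 0 <= log_primitive H x.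
Proof.
have [h1 h2 h3 h4] := HH.
rewrite -lee_fin -log_primitiveE; apply: integral_ge0 => t; rewrite /= in_itv/= => /andP[t0 _].
by rewrite lee_fin mulr_ge0 ?h1// invr_ge0 ltW.
Qed.

Lemma log_primitive_le : exists C, forall x, 0 < x -> log_primitive H x <= C * x `^ lam.
Proof.
have [h1 h2 h3 h4] := HH; have [C [C0 hC]] := log_primitive_bound.
exists (C / lam) => x x0; rewrite -lee_fin -log_primitiveE.
have sub : `]0, x]%classic `<=` (`]0, +oo[%classic : set R).
  by move=> t; rewrite /= !in_itv/= andbT => /andP[].
have mp : measurable_fun (`]0, x]%classic : set (measurableTypeR R)) (fun t => (t `^ (lam - 1))%:E).
  by apply/measurable_EFinP; apply: measurable_funTS; exact: measurable_powR.
apply: (@le_trans _ _ (\int[mu]_(t in `]0%R, x]) (C * t `^ (lam - 1))%:E)%E).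
  apply: ge0_le_integral => //.
  - move=> t; rewrite /= in_itv/= => /andP[t0 _].
    by rewrite lee_fin mulr_ge0 ?h1// invr_ge0 ltW.
  - by apply/measurable_EFinP; apply: measurable_funS sub log_primitive_measurable.
  - by apply/measurable_EFinP; apply: measurable_funM => //; apply/measurable_EFinP.
  - by move=> t; rewrite /= in_itv/= => /andP[t0 _]; rewrite lee_fin hC.
by rewrite integral_cpowR// lee_fin mulrA mulrAC.
Qed.

Lemma log_primitive_derive (x : R) : 0 < x -> is_derive x (1 : R) (log_primitive H) (H x / x).
Proof.
move=> x0; have [h1 h2 h3 h4] := HH.
have xx : x < x + 1 by rewrite ltrDl.
have ct : {for x, continuous (fun t => H t / t)}.
  apply: continuousM; first exact: h2.
  by apply: continuousV; [rewrite gt_eqF|exact: cvg_id].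
have [|d1 d2] := continuous_FTC1 xx (log_primitive_integrable (x + 1)) _ ct.
  exact: x0.
apply: DeriveDef; first exact: d1.
by rewrite -derive1E; exact: d2.
Qed.

Lemma log_primitive_cvg0 (u : nat -> R) : (forall k, 0 < u k) -> u @ \oo --> 0 ->
  (fun k => log_primitive H (u k)) @ \oo --> 0.
Proof.
move=> u0 ul; have [C hC] := log_primitive_le.
have [C' [C'0 hC']] : exists C', 0 < C' /\ forall x, 0 < x -> log_primitive H x <= C' * x `^ lam.
  exists (`|C| + 1); split; first by rewrite ltr_wpDl.
  move=> x x0; apply: (le_trans (hC x x0)); rewrite ler_wpM2r ?powR_ge0//.
  by rewrite (le_trans (ler_norm _))// lerDl.
apply/cvgrPdist_lt => e e0.
have d0 : 0 < (e / C') `^ lam^-1 by rewrite powR_gt0// divr_gt0.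
have /cvgrPdist_lt /(_ _ d0) hu := ul.
near=> k; rewrite sub0r normrN ger0_norm ?log_primitive_ge0//.
apply: (le_lt_trans (hC' _ (u0 k))); rewrite mulrC -ltr_pdivlMr//.
have -> : e / C' = ((e / C') `^ lam^-1) `^ lam.
  by rewrite -powRrM mulVf ?gt_eqF// powRr1// divr_ge0// ltW.
apply: gt0_ltr_powR; rewrite ?nnegrE ?(ltW d0) ?(ltW (u0 k))//.
have : `|0 - u k| < (e / C') `^ lam^-1 by near: k.
by rewrite sub0r normrN gtr0_norm.
Unshelve. all: by end_near. Qed.

Lemma is_derive_ln_pow (q : nat) (a t : R) : 1 < t ->
  is_derive t (1 : R) (fun x => a * ln x ^+ q.+1 / q.+1%:R) (a * ln t ^+ q / t).
Proof.
move=> t1; have t0 : 0 < t by exact: lt_trans t1.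
have dl := @is_derive1_ln R t t0.
rewrite (_ : (fun x => _) = ((a / q.+1%:R) \*: ((@ln R) ^+ q.+1))); last first.
  by apply/funext => x; rewrite /GRing.scale/= exprfctE mulrAC.
apply: is_derive_eq; rewrite /GRing.scale/= -[(_ *+ _)]mulr_natr.
have q0 : q.+1%:R != 0 :> R by rewrite pnatr_eq0.
by move: (q.+1%:R : R) q0 => Q q0; field; rewrite q0 gt_eqF.
Qed.

(** A form of the rule of de l Hospital: the primitive of [ln t ^ p / t] is [ln
    t ^ p.+1 / p.+1], and the primitives of two comparable functions compare up
    to a constant, which is negligible since the logarithm diverges. *)
Lemma log_primitive_asymp :
  (fun x => log_primitive H x / ln x ^+ p.+1) @ +oo%R --> c / p.+1%:R.
Proof.
have [h1 h2 h3 h4] := HH.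
apply/cvgrPdist_le => e e0; have e20 : 0 < e / 2 by rewrite divr_gt0.
have /cvgrPdist_lt /(_ _ e20) h5 := h4.
have [w0 [w0r hw0]] : exists w0 : R, 1 < w0 /\ forall w, w0 <= w -> 0 < ln w /\ `|c - H w / ln w ^+ p| < e / 2.
  have hh : \forall w \near +oo%R, 0 < ln w /\ `|c - H w / ln w ^+ p| < e / 2.
    by near=> w; split; near: w => //; exact: near_pinfty_ln.
  case: hh => M [_ hM]; exists (Num.max 1 M + 1); split; first by rewrite ltr_pwDr// le_max lexx.
  move=> w hw; apply: hM; apply: lt_le_trans hw.
  by rewrite ltr_pwDr// le_max lexx orbT.
pose L := log_primitive H.
(* L minus a log power is monotone past w0 *)
have cmp (a s : R) : (forall w, w0 <= w -> s * (H w - a * ln w ^+ p) <= 0) ->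
    forall x, w0 <= x -> s * (L x - a * ln x ^+ p.+1 / p.+1%:R) <= s * (L w0 - a * ln w0 ^+ p.+1 / p.+1%:R).
  move=> ha x w0x; pose G x := s * (L x - a * ln x ^+ p.+1 / p.+1%:R).
  have dG (t : R) : w0 <= t -> is_derive t (1 : R) G (s * (H t / t - a * ln t ^+ p / t)).
    move=> w0t; have t1 : 1 < t by exact: lt_le_trans w0t.
    have d1 := log_primitive_derive (lt_trans ltr01 t1).
    have d2 := is_derive_ln_pow p a t1.
    rewrite (_ : G = s \*: (L - (fun x => a * ln x ^+ p.+1 / p.+1%:R)))//.
    exact: is_derive_eq.
  rewrite -/(G x) -/(G w0).
  have cG (t : R) : w0 <= t -> {for t, continuous G}.
    move=> w0t; apply: differentiable_continuous; apply/derivable1_diffP.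
    by have := dG t w0t => -[].
  move: w0x; rewrite le_eqVlt => /orP[/eqP->//|w0x].
  apply: (@ler0_derive1_nincr R G w0 x) => //; last exact: ltW.
  - by move=> t; rewrite in_itv/= => /andP[h _]; have := dG t (ltW h) => -[].
  - move=> t; rewrite in_itv/= => /andP[h _]; have [_] := dG t (ltW h).
    rewrite derive1E => ->; have t0 : 0 < t by apply: lt_trans h; exact: lt_trans w0r.
    by rewrite -mulrBl mulrA mulr_le0_ge0 ?invr_ge0 ?(ltW t0)// ha// ltW.
  - by apply: continuous_in_subspaceT => t; rewrite inE/= in_itv/= => /andP[h _]; exact: cG.
have p1 : 0 < p.+1%:R :> R by rewrite ltr0n.
pose K1 := L w0 - (c + e / 2) * ln w0 ^+ p.+1 / p.+1%:R.
pose K2 := L w0 - (c - e / 2) * ln w0 ^+ p.+1 / p.+1%:R.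
have up x : w0 <= x -> L x - (c + e / 2) * ln x ^+ p.+1 / p.+1%:R <= K1.
  move=> hx; have := @cmp (c + e / 2) 1 _ x hx; rewrite !mul1r; apply => w hw.
  rewrite mul1r subr_le0; have [l0] := hw0 w hw; rewrite ltr_norml => /andP[hc1 hc2].
  by rewrite -ler_pdivrMr ?exprn_gt0//; lra.
have dn x : w0 <= x -> K2 <= L x - (c - e / 2) * ln x ^+ p.+1 / p.+1%:R.
  move=> hx; have := @cmp (c - e / 2) (-1) _ x hx; rewrite !mulN1r lerN2; apply => w hw.
  rewrite mulN1r oppr_le0 subr_ge0; have [l0] := hw0 w hw; rewrite ltr_norml => /andP[hc1 hc2].
  by rewrite -ler_pdivlMr ?exprn_gt0//; lra.
have k1 := @cvg_div_ln K1 p.+1 isT; have k2 := @cvg_div_ln K2 p.+1 isT.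
have /cvgrPdist_lt /(_ _ e20) k1e := k1.
have /cvgrPdist_lt /(_ _ e20) k2e := k2.
near=> x.
have xw : w0 <= x by near: x; apply: nbhs_pinfty_ge; exact: num_real.
have [l0 _] := hw0 _ xw; have lp : 0 < ln x ^+ p.+1 by rewrite exprn_gt0.
have u1 : L x / ln x ^+ p.+1 <= K1 / ln x ^+ p.+1 + (c + e / 2) / p.+1%:R.
  rewrite ler_pdivrMr// mulrDl divfK ?gt_eqF// [_ / p.+1%:R * _]mulrAC; rewrite -lerBlDr; exact: up.
have u2 : K2 / ln x ^+ p.+1 + (c - e / 2) / p.+1%:R <= L x / ln x ^+ p.+1.
  rewrite ler_pdivlMr// mulrDl divfK ?gt_eqF// [_ / p.+1%:R * _]mulrAC; rewrite -lerBrDr; exact: dn.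
have : `|0 - K1 / ln x ^+ p.+1| < e / 2 by near: x.
have : `|0 - K2 / ln x ^+ p.+1| < e / 2 by near: x.
rewrite !ltr_norml => /andP[a1 a2] /andP[a3 a4].
have ep : e / 2 / p.+1%:R <= e / 2.
  by rewrite ler_pdivrMr// ler_peMr ?(ltW e20)// ler1n.
have aux (X Y A B Z : R) : Z <= A + (Y + X) -> B + (Y - X) <= Z -> - (e / 2) < 0 - A ->
    0 - B < e / 2 -> X <= e / 2 -> `|Y - Z| <= e.
  by move=> *; rewrite ler_norml; apply/andP; split; lra.
rewrite (mulrDl c (e / 2) p.+1%:R^-1) in u1; rewrite (mulrBl p.+1%:R^-1 c (e / 2)) in u2.
exact: (aux _ _ _ _ _ u1 u2 a3 a2 ep).
Unshelve. all: by end_near. Qed.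

End Primitive.

End LogGrowth.

(** * Critical integrations in one variable *)

Section LogGrowthStep.
Context {R : realType}.
Notation mu := (@lebesgue_measure R).

Section Primitive.
Variables (lam : R) (H : R -> R) (p : nat) (c : R).
Hypothesis lam0 : 0 < lam.
Hypothesis HH : log_growth lam H p c.
Let log_primitive_ge0 := log_primitive_ge0 lam0 HH.
Let log_primitive_derive := log_primitive_derive lam0 HH.
Let log_primitive_le := log_primitive_le lam0 HH.
Let log_primitive_asymp := log_primitive_asymp lam0 HH.
Let log_primitive_cvg0 := log_primitive_cvg0 lam0 HH.

(** One critical integration raises the power of the logarithm by one and
    divides the constant by it; iterating produces the factorial of the limit
    density. *)
Lemma log_growth_step (rho k : R) : 0 < rho -> 0 < k ->
  log_growth lam (fun w => log_primitive H (w * rho) / k) p.+1 (c / (k * p.+1%:R)).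
Proof.
move=> rho0 k0; split.
- by move=> w w0; rewrite divr_ge0 ?log_primitive_ge0// ltW.
- move=> w w0.
  have wr0 : 0 < w * rho by rewrite mulr_gt0.
  have d1 := log_primitive_derive wr0.
  have c1 : {for w * rho, continuous (log_primitive H)}.
    by apply: differentiable_continuous; apply/derivable1_diffP; have := d1 => -[].
  have c2 : {for w, continuous (fun w : R => w * rho)} by apply: mulrr_continuous.
  have c3 := continuous_comp c2 c1.
  have c4 : {for w, continuous (fun _ : R => k^-1)} by exact: cst_continuous.
  exact: (continuousM c3 c4).
- have [C hC] := log_primitive_le.
  exists (C * rho `^ lam / k) => w w0.
  rewrite mulrAC ler_wpM2r ?invr_ge0 ?(ltW k0)//.
  by rewrite -mulrA -powRM ?(ltW rho0) ?(ltW w0)// [rho * w]mulrC hC// mulr_gt0.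
- have h := log_primitive_asymp.
  have lim1 : (fun w => log_primitive H (w * rho) / ln (w * rho) ^+ p.+1) @ +oo%R --> c / p.+1%:R.
    have : (fun w : R => w * rho) @ +oo%R --> +oo%R.
      apply/cvgryPge => A; near=> w.
      rewrite -ler_pdivrMr//; near: w; apply: nbhs_pinfty_ge; exact: num_real.
    by move=> h'; exact: cvg_comp h' h.
  have lim2 : (fun w : R => (1 + ln rho / ln w ^+ 1) ^+ p.+1) @ +oo%R --> ((1 + 0) ^+ p.+1 : R).
    have hb : (fun w : R => 1 + ln rho / ln w ^+ 1) @ +oo%R --> (1 + 0 : R).
      by apply: cvgD; [exact: cvg_cst|exact: cvg_div_ln].
    have e1 := @exprn_continuous R p.+1 (1 + 0).
    exact: (continuous_cvg _ e1 hb).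
  have lim : (fun w : R => log_primitive H (w * rho) / ln (w * rho) ^+ p.+1 *
      (1 + ln rho / ln w ^+ 1) ^+ p.+1 * k^-1) @ +oo%R --> (c / p.+1%:R * (1 + 0) ^+ p.+1 * k^-1 : R).
    exact: (cvgM (cvgM lim1 lim2) (cvg_cst k^-1)).
  rewrite addr0 expr1n mulr1 in lim.
  rewrite (_ : c / (k * p.+1%:R) = c / p.+1%:R / k); last first.
    have p1 : p.+1%:R != 0 :> R by rewrite pnatr_eq0.
    by move: (p.+1%:R : R) p1 => Q q0; field; rewrite q0 gt_eqF.
  apply: cvg_trans lim; apply: near_eq_cvg; near=> w.
  have w0 : 0 < w by near: w; exact: nbhs_pinfty_gt.
  have l0 : 0 < ln w by near: w; exact: near_pinfty_ln.
  have lr : 0 < ln w + ln rho by rewrite -ltrBlDr sub0r; near: w; exact: near_pinfty_ln.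
  rewrite /= lnM ?posrE// expr1.
  have -> : 1 + ln rho / ln w = (ln w + ln rho) / ln w by field; rewrite gt_eqF.
  rewrite expr_div_n; field; rewrite !expf_neq0 ?gt_eqF//.
Unshelve. all: by end_near. Qed.

(** The chain rule shows that both sides have the same derivative in the upper
    limit; this replaces a substitution rule for a power that is singular at
    zero. *)
Lemma integral_log_primitive (beta r : R) (k : nat) : 0 < beta -> 0 < r -> (0 < k)%N ->
  (\int[mu]_(t in `]0%R, r]) (H (beta * t ^+ k) / t)%:E =
   (log_primitive H (beta * r ^+ k) / k%:R)%:E)%E.
Proof.
move=> b0 r0 k0; have [h1 h2 h3 h4] := HH.
have cH (t : R) : 0 < t -> {for t, continuous (fun t : R => H (beta * t ^+ k) / t)}.
  move=> t0; apply: continuousM; last by apply: continuousV; [rewrite gt_eqF|exact: cvg_id].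
  have c1 : {for t, continuous (fun t : R => beta * t ^+ k)}.
    by apply: continuousM; [exact: cst_continuous|exact: exprn_continuous].
  have c2 : {for beta * t ^+ k, continuous H} by apply: h2; rewrite mulr_gt0 ?exprn_gt0.
  exact: (continuous_comp c1 c2).
have mf : measurable_fun (`]0, r]%classic : set (measurableTypeR R)) (fun t : R => H (beta * t ^+ k) / t).
  have sub : `]0, r]%classic `<=` (`]0, +oo[%classic : set R).
    by move=> t; rewrite /= !in_itv/= andbT => /andP[].
  suff mf' : measurable_fun (`]0, +oo[%classic : set (measurableTypeR R)) (fun t : R => H (beta * t ^+ k) / t).
    by apply: measurable_funS sub mf'; exact: measurable_itv.
  apply: measurable_realfun.open_continuous_measurable_fun; first exact: interval_open.
  by move=> t; rewrite inE/= in_itv/= andbT; exact: cH.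
have f0 (t : R) : 0 < t -> t <= r -> 0 <= H (beta * t ^+ k) / t.
  by move=> t0 _; rewrite mulr_ge0 ?h1 ?mulr_gt0 ?exprn_gt0// invr_ge0 ltW.
have h := cvg_integral_away0 r0 mf f0.
have kR : 0 < k%:R :> R by rewrite ltr0n.
apply/esym; apply: (cvg_unique _ _ h) => //.
have FT a b : 0 < a -> a < b -> (\int[mu]_(t in `[a, b]) (H (beta * t ^+ k) / t)%:E =
    (log_primitive H (beta * b ^+ k) / k%:R - log_primitive H (beta * a ^+ k) / k%:R)%:E)%E.
  move=> a0 ab; apply: (FTC_pos (F := fun t : R => log_primitive H (beta * t ^+ k) / k%:R) a0 ab); last exact: cH.
  - move=> t t0.
    have bt : 0 < beta * t ^+ k by rewrite mulr_gt0 ?exprn_gt0.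
    have d1 := log_primitive_derive bt.
    have d2 : is_derive t (1 : R) (fun t : R => beta * t ^+ k) (beta * (k%:R * t ^+ k.-1)).
      have -> : (fun t : R => beta * t ^+ k) = beta \*: ((id : R -> R) ^+ k) by apply/funext => x; rewrite /GRing.scale/= exprfctE.
      case: k k0 {mf f0 h kR bt d1 cH} => // k _; apply: is_derive_eq.
      by rewrite /GRing.scale/= mulr1 -[_ *+ k.+1]mulr_natl.
    have d3 := @is_derive1_comp R (log_primitive H) (fun t : R => beta * t ^+ k) t _ _ d1 d2.
    rewrite (_ : (fun t => _) = k%:R^-1 \*: (log_primitive H \o (fun t : R => beta * t ^+ k))); last first.
      by apply/funext => x /=; rewrite mulrC.
    apply: is_derive_eq; rewrite /GRing.scale/=.
    case: k k0 {mf f0 h bt d1 d2 d3 cH} kR => // k _ kR; rewrite exprS /=.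
    move: (k.+1%:R : R) kR => K kR.
    by field; rewrite !gt_eqF// exprn_gt0.
pose u j := beta * (r / j.+2%:R) ^+ k.
rewrite (_ : (fun j => _) = EFin \o (fun j => log_primitive H (beta * r ^+ k) / k%:R - log_primitive H (u j) / k%:R)); last first.
  by apply/funext => j /=; rewrite FT// ?divr_gt0 ?ltr0n// ltr_pdivrMr ?ltr0n// ltr_pMr// ltr1n.
have u0 j : 0 < u j by rewrite mulr_gt0// exprn_gt0// divr_gt0// ltr0n.
have ul : u @ \oo --> 0.
  have hr : (fun j : nat => r / j.+2%:R) @ \oo --> 0.
    apply/cvgrPdist_lt => e e0; near=> j.
    rewrite sub0r normrN ger0_norm ?divr_ge0 ?(ltW r0)//.
    rewrite ltr_pdivrMr ?ltr0n// mulrC -ltr_pdivrMr//.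
    apply: lt_le_trans (truncnS_gt _) _; rewrite ler_nat.
    near: j; exists (Num.trunc (r / e)) => // j /=; by rewrite ltnS => /leqW.
  have e1 := @exprn_continuous R k 0.
  have h5 : u @ \oo --> (beta * 0 ^+ k : R) by exact: (cvgM (cvg_cst beta) (continuous_cvg _ e1 hr)).
  by rewrite expr0n gtn_eqF// mulr0 in h5.
apply: cvg_EFin; first exact: nearW.
have l1 : (fun j => log_primitive H (u j) / k%:R) @ \oo --> (0 * k%:R^-1 : R).
  by apply: cvgM; [exact: log_primitive_cvg0|exact: cvg_cst].
have l2 : (fun j => log_primitive H (beta * r ^+ k) / k%:R - log_primitive H (u j) / k%:R) @ \oo -->
    (log_primitive H (beta * r ^+ k) / k%:R - 0 * k%:R^-1 : R).
  exact: (cvgB (cvg_cst _) l1).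
by rewrite mul0r subr0 in l2.
Unshelve. all: by end_near. Qed.

End Primitive.

(** The recursion over the critical coordinates starts from the integrand
    itself, as a function of [w = beta * V]. *)
Definition exp_growth (lam w : R) := w `^ lam * expR (- w).

Lemma log_growth_exp (lam : R) : 0 < lam -> log_growth lam (exp_growth lam) 0 0.
Proof.
move=> lam0; split.
- by move=> w _; rewrite mulr_ge0 ?powR_ge0 ?expR_ge0.
- move=> w w0; apply: continuousM; first exact: continuous_powR.
  apply: continuous_comp; [exact: opp_continuous|exact: continuous_expR].
- exists 1 => w w0; rewrite mul1r ler_piMr ?powR_ge0//.
  by rewrite -expR0 ler_expR oppr_le0 ltW.
- pose N := (Num.trunc lam).+2; pose C : R := N%:R ^+ N.
  apply/cvgrPdist_lt => e e0; near=> w.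
  have w1 : 1 < w by near: w; exact: nbhs_pinfty_gt.
  have w0 : 0 < w by exact: lt_trans w1.
  rewrite expr0 divr1 sub0r normrN ger0_norm ?mulr_ge0 ?powR_ge0 ?expR_ge0//.
  have hN : w ^+ N <= C * expR w by apply: expR_ge_expr => //; exact: ltW.
  rewrite /exp_growth expRN ltr_pdivrMr ?expR_gt0//.
  have h : w `^ lam <= w `^ (N%:R - 1).
    apply: ler_powR; first exact: ltW.
    by rewrite /N; have := truncnS_gt lam; rewrite -[(Num.trunc lam).+2]addn1 natrD; lra.
  apply: (le_lt_trans h); rewrite powRD; last by apply/implyP => _; rewrite gt_eqF.
  rewrite powR_mulrn ?(ltW w0)// powR_inv1 ?(ltW w0)// ltr_pdivrMr//.
  apply: (le_lt_trans hN); rewrite [ltRHS]mulrAC ltr_pM2r ?expR_gt0// mulrC -ltr_pdivrMr//.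
  by near: w; apply: nbhs_pinfty_gt; exact: num_real.
Unshelve. all: by end_near. Qed.

(** The first critical integration is complete, as the exponential decays: it
    yields the Gamma integral instead of a logarithm. *)
Lemma log_growth_first (lam rho k : R) : 0 < lam -> 0 < rho -> 0 < k ->
  log_growth lam (fun w => log_primitive (exp_growth lam) (w * rho) / k) 0 (Gamma lam / k).
Proof.
move=> lam0 rho0 k0.
have HH := log_growth_exp lam0.
have [h1 h2 h3 _] := log_growth_step lam0 HH rho0 k0.
split => //.
rewrite (_ : (fun w => _) = (fun w => log_primitive (exp_growth lam) (w * rho) / k)); last first.
  by apply/funext => w; rewrite expr0 divr1.
apply: cvgM; last exact: cvg_cst.
apply/cvg_pinftyP => u ul.
have md D : measurable D -> measurable_fun D (fun w => (gamma_density lam w)%:E).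
  by move=> mD; apply/measurable_EFinP; apply: measurable_funTS; exact: measurable_gamma_density.
have EG x : ((log_primitive (exp_growth lam) x)%:E = \int[mu]_(t in `]0%R, x]) (gamma_density lam t)%:E)%E.
  rewrite -(log_primitiveE lam0 HH); apply: eq_integral => t; rewrite inE/= in_itv/= => /andP[t0 _].
  rewrite /exp_growth /gamma_density powRD; last by apply/implyP => _; rewrite gt_eqF.
  by rewrite powR_inv1 ?(ltW t0)// mulrAC.
have mD : measurable (`]0, +oo[%classic : set (measurableTypeR R)) by exact: measurable_itv.
pose f n (t : measurableTypeR R) : \bar R := if t <= u n * rho then (gamma_density lam t)%:E else 0%E.
have E n : ((log_primitive (exp_growth lam) (u n * rho))%:E = \int[mu]_(t in `]0%R, +oo[) f n t)%E.
  rewrite EG integral_mkcond [RHS]integral_mkcond; apply: eq_integral => t _.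
  rewrite /f !patchE !mem_setE !in_itv/= andbT; case: (0 < t) => //=.
have urho : (fun n => u n * rho) @ \oo --> +oo%R.
  apply/cvgryPge => A; move/cvgryPge : ul => /(_ (A / rho)); apply: filterS => n.
  by rewrite ler_pdivrMr.
have [|||||_ _ hc] := @dominated_convergence _ _ R mu _ mD f (fun t => (gamma_density lam t)%:E) (fun t => (gamma_density lam t)%:E).
- move=> n; apply: measurable_funTS; apply: measurable_fun_ifT.
  + by apply: measurable_fun_ler => //; exact: measurable_cst.
  + exact: md.
  + exact: measurable_cst.
- exact: md.
- apply: aeW => t; rewrite /= in_itv/= andbT => t0.
  apply: cvg_near_cst; move/cvgryPge : urho => /(_ t); apply: filterS => n h.
  by rewrite /f h.
- apply/integrableP; split; first exact: md.
  rewrite [X in (X < _)%E](_ : _ = (\int[mu]_(w in `]0%R, +oo[) (gamma_density lam w)%:E)%E).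
    exact: gamma_integral_fin.
  by apply: eq_integral => t _ /=; rewrite ger0_norm ?gamma_density_ge0.
- apply: aeW => t n _; rewrite /f; case: ifP => _; rewrite ?abse0 ?lee_fin ?gamma_density_ge0//=.
  by rewrite ger0_norm ?gamma_density_ge0.
move: hc; rewrite GammaE//; under eq_fun do rewrite -E.
by move=> /fine_cvgP[_].
Qed.

End LogGrowthStep.

(** * Boxes all of whose coordinates are critical *)

Section Split.
Context {R : realType}.

Lemma measurable_rV d (T : measurableType d) n (F : T -> 'rV[R]_n) :
  (forall i, measurable_fun setT ((fun x => F x ord0 i) : T -> measurableTypeR R)) ->
  measurable_fun setT (F : T -> borel 'rV[R]_n).
Proof.
elim: n F => [|n IH] F mF.
  by rewrite (_ : F = fun=> 0); [exact: measurable_cst|apply/funext => x; exact: thinmx0].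
have m2 : measurable_fun setT ((fun x => rsubmx (F x : 'rV[R]_(1 + n))) : T -> borel 'rV[R]_n).
  apply: IH => i; have := mF (lift ord0 i); congr measurable_fun; apply/funext => x.
  by rewrite mxE; congr (_ _ _); exact/val_inj.
have m1 := measurable_fun_pair (mF ord0) m2.
have := measurableT_comp (@measurable_cons_row R n) m1.
by congr measurable_fun; apply/funext => x; rewrite [RHS]rV_consP.
Qed.

Lemma measurable_rVD n : measurable_fun setT
  ((fun z => (z.1 : 'rV[R]_n) + z.2) : borel 'rV[R]_n * borel 'rV[R]_n -> borel 'rV[R]_n).
Proof.
apply: measurable_rV => i.
have m1 : measurable_fun setT ((fun z => (z.1 : 'rV[R]_n) ord0 i) : borel 'rV[R]_n * borel 'rV[R]_n -> measurableTypeR R).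
  exact: (measurableT_comp (rV_coord_measurable i) measurable_fst).
have m2 : measurable_fun setT ((fun z => (z.2 : 'rV[R]_n) ord0 i) : borel 'rV[R]_n * borel 'rV[R]_n -> measurableTypeR R).
  exact: (measurableT_comp (rV_coord_measurable i) measurable_snd).
by have := measurable_funD m1 m2; congr measurable_fun; apply/funext => z; rewrite mxE.
Qed.

(** A family of booleans in place of a finite set, so that coordinates can be
    split off one by one in a recursion on the dimension. *)
Definition off n (s : 'I_n -> bool) : {measure set (borel 'rV[R]_n) -> \bar R} :=
  prod_measure (fun i => coord_measure (s i)).

Lemma measurable_add_comp n d (T : measurableType d) (f : 'rV[R]_n -> \bar R) (F G : T -> 'rV[R]_n) :
  measurable_fun setT (f : borel 'rV[R]_n -> \bar R) ->
  measurable_fun setT (F : T -> borel 'rV[R]_n) -> measurable_fun setT (G : T -> borel 'rV[R]_n) ->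
  measurable_fun setT (fun x => f (F x + G x)).
Proof.
move=> mf mF mG; have m1 := measurableT_comp mf (@measurable_rVD n).
exact: (measurableT_comp m1 (measurable_fun_pair mF mG)).
Qed.

Lemma measurable_add_l n (f : 'rV[R]_n -> \bar R) (u : 'rV[R]_n) :
  measurable_fun setT (f : borel 'rV[R]_n -> \bar R) ->
  measurable_fun setT (fun v : borel 'rV[R]_n => f (u + (v : 'rV[R]_n))).
Proof.
move=> mf; apply: (measurable_add_comp (T := borel 'rV[R]_n) (F := fun=> u) (G := id) mf).
  exact: measurable_cst.
exact: measurable_id.
Qed.

Lemma measurable_integral_add n p (nu : 'I_p -> {sigma_finite_measure set (measurableTypeR R) -> \bar R})
    (f : 'rV[R]_n -> \bar R) (F : 'rV[R]_p -> 'rV[R]_n) :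
  measurable_fun setT (f : borel 'rV[R]_n -> \bar R) -> (forall y, 0 <= f y)%E ->
  measurable_fun setT (F : borel 'rV[R]_p -> borel 'rV[R]_n) ->
  measurable_fun setT (fun u : borel 'rV[R]_n => (\int[prod_measure nu]_v f ((u : 'rV[R]_n) + F v)%R)%E).
Proof.
move=> mf f0 mF.
have m1 := @measurable_add_comp n _ (borel 'rV[R]_n * borel 'rV[R]_p)%type f _ _ mf measurable_fst (measurableT_comp mF measurable_snd).
exact: (@measurable_fun_fubini_tonelli_F _ _ _ _ _ (prod_sfm nu) _ m1).
Qed.

Lemma cons_rowD n (t s : R) (u v : 'rV[R]_n) :
  (cons_row (t : measurableTypeR R, u : borel 'rV[R]_n) : 'rV[R]_n.+1) +
  (cons_row (s : measurableTypeR R, v : borel 'rV[R]_n) : 'rV[R]_n.+1) =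
  cons_row ((t + s : R) : measurableTypeR R, (u + v : 'rV[R]_n) : borel 'rV[R]_n).
Proof.
by apply/rowP => i; rewrite mxE; case: (unliftP ord0 i) => [j|] ->;
  rewrite ?cons_row0 ?cons_rowS ?mxE.
Qed.

Lemma integral_coord_dirac (g : R -> \bar R) :
  measurable_fun setT (g : measurableTypeR R -> \bar R) ->
  (\int[coord_measure true]_t g t = g 0%R)%E.
Proof. by move=> mg; rewrite /coord_measure integral_dirac// diracT mul1e. Qed.

(** Tonelli for the splitting of the coordinates into two groups, which keeps
    the dimension of the ambient space and so avoids reindexing. *)
Lemma integral_lebesgue_split n (s : 'I_n -> bool) (f : 'rV[R]_n -> \bar R) :
  measurable_fun setT (f : borel 'rV[R]_n -> \bar R) -> (forall y, 0 <= f y)%E ->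
  (\int[lebesgue_rV n]_y f y =
   \int[off s]_u \int[off (fun i => ~~ s i)]_v f ((u : 'rV[R]_n) + (v : 'rV[R]_n))%R)%E.
Proof.
elim: n s f => [|n IH] s f mf f0.
  have hc (F : 'rV[R]_0 -> \bar R) : measurable_fun setT (F : borel 'rV[R]_0 -> \bar R).
    rewrite (_ : F = fun=> F 0%R); first exact: measurable_cst.
    by apply/funext => x; rewrite [x]thinmx0.
  rewrite /off /= [LHS]integral_dirac//.
  rewrite [in RHS]integral_dirac//.
  by rewrite /= integral_dirac ?diracT ?mul1e ?addr0//; exact: measurable_add_l.
set s' := fun i => s (lift ord0 i).
set nu := fun i => @coord_measure R (s' i); set nu' := fun i => @coord_measure R (~~ s' i).
pose K (y : 'rV[R]_n.+1) : \bar R := (\int[off (fun i => ~~ s i)]_v f (y + (v : 'rV[R]_n.+1))%R)%E.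
have mK : measurable_fun setT (K : borel 'rV[R]_n.+1 -> \bar R).
  exact: (measurable_integral_add (F := fun v => v) (fun i => coord_measure (~~ s i)) mf f0 (@measurable_id _ _ _)).
have K0 y : (0 <= K y)%E by apply: integral_ge0.
have KE t u : K (cons_row (t : measurableTypeR R, u : borel 'rV[R]_n)) =
    (\int[coord_measure (~~ s ord0)]_r \int[prod_measure nu']_v
      f (cons_row (((t : R) + r)%R : measurableTypeR R, ((u : 'rV[R]_n) + (v : 'rV[R]_n))%R : borel 'rV[R]_n)))%E.
  rewrite /K /off ge0_integral_cons//.
    apply: eq_integral => r _; apply: eq_integral => v _.
    by rewrite -cons_rowD.
  exact: measurable_add_l.
have mKr t u : measurable_fun setT (fun r : measurableTypeR R => (\int[prod_measure nu']_v
      f (cons_row (((t : R) + r)%R : measurableTypeR R, ((u : 'rV[R]_n) + (v : 'rV[R]_n))%R : borel 'rV[R]_n)))%E).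
  have m1 := measurable_add_l (cons_row (t : measurableTypeR R, u : borel 'rV[R]_n) : 'rV[R]_n.+1) mf.
  have := @measurable_fubini_cons R n (fun i => coord_measure (~~ s i)) _ m1 (fun y => f0 _).
  congr measurable_fun; apply/funext => r; apply: eq_integral => v _.
  by rewrite -cons_rowD.
have -> : (\int[off s]_u K u = \int[coord_measure (s ord0)]_t \int[prod_measure nu]_u K (cons_row (t, u)))%E.
  exact: (ge0_integral_cons _ mK K0).
have -> : (\int[lebesgue_rV n.+1]_y f y = \int[lebesgue_measure]_t \int[lebesgue_rV n]_y f (cons_row (t, y)))%E.
  exact: (ge0_integral_cons _ mf f0).
have secE t : (\int[lebesgue_rV n]_y f (cons_row (t, y)) =
   \int[prod_measure nu]_u \int[prod_measure nu']_v f (cons_row (t : measurableTypeR R, ((u : 'rV[R]_n) + (v : 'rV[R]_n))%R : borel 'rV[R]_n)))%E.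
  by apply: (IH s' (fun y => f (cons_row (t, y)))) => //; exact: measurable_cons_l.
case E : (s ord0).
- rewrite integral_coord_dirac; last first.
    exact: (@measurable_fubini_cons R n (fun i => coord_measure (s i)) _ mK K0).
  pose G (y : 'rV[R]_n.+1) : \bar R := (\int[prod_measure nu']_v f (y + (cons_row (0%R : measurableTypeR R, v) : 'rV[R]_n.+1))%R)%E.
  have mG : measurable_fun setT (G : borel 'rV[R]_n.+1 -> \bar R).
    apply: (measurable_integral_add nu' mf f0 (F := fun v : 'rV[R]_n => (cons_row (0%R : measurableTypeR R, v : borel 'rV[R]_n) : 'rV[R]_n.+1))).
    have mp : measurable_fun setT ((fun v => (0%R : measurableTypeR R, v)) : borel 'rV[R]_n -> measurableTypeR R * borel 'rV[R]_n).
      by apply: measurable_fun_pair; [exact: measurable_cst|exact: measurable_id].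
    exact: (measurableT_comp (@measurable_cons_row R n) mp).
  have G0 y : (0 <= G y)%E by apply: integral_ge0.
  have GE t u : G (cons_row (t : measurableTypeR R, u : borel 'rV[R]_n)) =
     (\int[prod_measure nu']_v f (cons_row (t : measurableTypeR R, ((u : 'rV[R]_n) + (v : 'rV[R]_n))%R : borel 'rV[R]_n)))%E.
    by apply: eq_integral => v _; rewrite cons_rowD addr0.
  pose nu2 (i : 'I_n.+1) := if unlift ord0 i is Some j then nu j else @coord_measure R false.
  have e0 : nu2 ord0 = coord_measure false by rewrite /nu2 unlift_none.
  have e1 : (fun i => nu2 (lift ord0 i)) = nu by apply/funext => i; rewrite /nu2 liftK.
  have h1 := ge0_integral_cons nu2 mG G0; have h2 := ge0_integral_consC nu2 mG G0.
  rewrite h1 e0 e1 in h2.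
  transitivity (\int[coord_measure false]_t \int[prod_measure nu]_u G (cons_row (t, u)))%E.
    by apply: eq_integral => t _; rewrite secE; apply: eq_integral => u _; rewrite GE.
  rewrite h2; apply: eq_integral => u _; rewrite KE E; apply: eq_integral => t _.
  by rewrite GE; apply: eq_integral => v _; rewrite add0r.
- apply: eq_integral => t _; rewrite secE; apply: eq_integral => u _.
  rewrite KE E integral_coord_dirac; last exact: mKr.
  by apply: eq_integral => v _; rewrite addr0.
Qed.

End Split.

Section CriticalBox.
Context {R : realType}.
Variable lam : R.
Hypothesis lam0 : 0 < lam.

Definition crit_count n (s : 'I_n -> bool) : nat := (\sum_(i < n) ~~ s i)%N.

(** The factors of the critical coordinates with the smooth amplitude left out. *)
Definition crit_integrand n (k h : 'I_n -> nat) (r : 'I_n -> R) (w : R) (v : 'rV[R]_n) : \bar R :=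
  ((\prod_i (\1_`[- r i, r i]%classic (v ord0 i) * `|v ord0 i| ^+ h i)) *
   expR (- (w * \prod_i `|v ord0 i| ^+ (2 * k i))))%:E.

Lemma measurable_crit_integrand n (k h : 'I_n -> nat) (r : 'I_n -> R) (w : R) :
  measurable_fun setT (crit_integrand k h r w : borel 'rV[R]_n -> \bar R).
Proof.
apply/measurable_EFinP.
have mc i : measurable_fun setT ((fun v => v ord0 i) : borel 'rV[R]_n -> measurableTypeR R) := rV_coord_measurable i.
have mp q i : measurable_fun setT ((fun v => `|v ord0 i| ^+ q) : borel 'rV[R]_n -> measurableTypeR R).
  by apply: measurable_funX; apply: measurableT_comp (mc i); exact: normr_measurable.
apply: measurable_funM.
  apply: measurable_prod => i _; apply: measurable_funM; [|exact: mp].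
  by apply: measurableT_comp (mc i); exact: measurable_indic.
apply: measurableT_comp; first exact: measurable_expR.
apply: measurableT_comp; first exact: oppr_measurable.
apply: measurable_funM => //.
by apply: measurable_prod => i _; exact: mp.
Qed.

Lemma crit_integrand_ge0 n (k h : 'I_n -> nat) (r : 'I_n -> R) (w : R) v : (0 <= crit_integrand k h r w v)%E.
Proof.
rewrite lee_fin; apply: mulr_ge0; last exact: expR_ge0.
by apply: prodr_ge0 => i _; rewrite mulr_ge0// exprn_ge0.
Qed.

Lemma integral_even (f : R -> \bar R) :
  measurable_fun setT (f : measurableTypeR R -> \bar R) -> (forall t, 0 <= f t)%E ->
  (forall t, f (- t)%R = f t) ->
  (\int[lebesgue_measure]_t f t = 2%:E * \int[lebesgue_measure]_(t in `]0%R, +oo[) f t)%E.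
Proof.
move=> mf f0 ef; set mu := lebesgue_measure.
have mD : measurable (`]0, +oo[%classic : set (measurableTypeR R)) by exact: measurable_itv.
pose g := (f \_ `]0, +oo[%classic).
have mg : measurable_fun setT (g : measurableTypeR R -> \bar R).
  apply/(measurable_restrictT _ mD); exact: measurable_funS mf.
have mgN : measurable_fun setT ((fun t => g (- t)%R) : measurableTypeR R -> \bar R).
  by apply: (measurableT_comp mg); exact: oppr_measurable.
have g0 t : (0 <= g t)%E by rewrite /g patchE; case: ifP.
have e1 : (\int[mu]_(t in `]0%R, +oo[) f t = \int[mu]_t g t)%E by rewrite integral_mkcond.
have e2 : (\int[mu]_t g (- t)%R = \int[mu]_t g t)%E.
  have n1 : (-1 : R) != 0 by rewrite oppr_eq0 oner_eq0.
  have := ge0_integral_affine 0 n1 mg g0; rewrite normrN normr1 invr1 mul1e => <-.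
  by apply: eq_integral => t _; rewrite mulN1r addr0.
have e3 : (\int[mu]_t f t = \int[mu]_t (g t + g (- t)%R))%E.
  apply: ae_eq_integral => //.
  - exact: emeasurable_funD.
  - exists [set 0]; split => //.
      exact: lebesgue_measure_set1.
    move=> t /=; apply: contra_notP => t0 _.
    rewrite /g !patchE !mem_setE !in_itv/= !andbT oppr_gt0.
    case: (ltgtP t 0) => [h|h|h]; rewrite ?ef ?add0e ?adde0//.
rewrite e3 ge0_integralD//.
by rewrite e2 e1 mule_natl mule2n.
Qed.

Lemma crit_integrand_cons n (k h : 'I_n.+1 -> nat) (r : 'I_n.+1 -> R) (w t : R) (u : 'rV[R]_n) :
  crit_integrand k h r w (cons_row (t : measurableTypeR R, u : borel 'rV[R]_n)) =
  ((\1_`[- r ord0, r ord0]%classic t * `|t| ^+ h ord0)%:E *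
   crit_integrand (fun i => k (lift ord0 i)) (fun i => h (lift ord0 i)) (fun i => r (lift ord0 i))
     (w * `|t| ^+ (2 * k ord0)) u)%E.
Proof.
rewrite /crit_integrand -EFinM !big_ord_recl !cons_row0 -!mulrA.
have F (A : set R) q (x y : R) : x = y -> \1_A x * `|x| ^+ q = \1_A y * `|y| ^+ q by move=> ->.
have F' q (x y : R) : x = y -> `|x| ^+ q = `|y| ^+ q by move=> ->.
congr (_ * (_ * (_ * expR (- (w * (_ * _))))))%:E; apply: eq_bigr => i _.
  by apply: F; exact: cons_rowS.
by apply: F'; exact: cons_rowS.
Qed.

(** By induction on the number of coordinates. A critical coordinate satisfies
    [h + 1 = 2 * k * lam], so that the substitution [w = beta * t ^ (2 * k)]
    turns [t ^ h dt] into [w ^ lam * dw / w] up to a constant, whatever [k] is: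
    all critical coordinates act through the same operation on [H]. *)
Lemma crit_box n (s : 'I_n -> bool) (k h : 'I_n -> nat) (r : 'I_n -> R) :
  (forall i, 0 < r i) ->
  (forall i, s i -> k i = 0%N /\ h i = 0%N) ->
  (forall i, ~~ s i -> (0 < k i)%N /\ (h i).+1%:R = (2 * k i)%:R * lam) ->
  exists H, [/\ log_growth lam H (crit_count s).-1
      (if crit_count s == 0%N then 0 else
       Gamma lam / ((crit_count s).-1`!%:R * \prod_(i | ~~ s i) (k i)%:R)),
    crit_count s = 0%N -> H = exp_growth lam &
    forall w, 0 < w -> (\int[off s]_v crit_integrand k h r w v = (w `^ (- lam) * H w)%:E)%E].
Proof.
elim: n s k h r => [|n IH] s k h r r0 hs hk.
  exists (exp_growth lam); rewrite /crit_count big_ord0/=; split => //; first exact: log_growth_exp.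
  move=> w w0; rewrite /off /= integral_dirac//; last exact: measurable_crit_integrand.
  rewrite diracT mul1e /crit_integrand !big_ord0 mul1r mulr1 /exp_growth mulrA -powRD.
    by rewrite addNr powRr0 mul1r.
  by apply/implyP => _; rewrite gt_eqF.
have [H [HG Hexp HE]] := IH (fun i => s (lift ord0 i)) (fun i => k (lift ord0 i)) (fun i => h (lift ord0 i))
  (fun i => r (lift ord0 i)) (fun i => r0 _) (fun i => hs _) (fun i => hk _).
have mI w := measurable_crit_integrand k h r w.
pose tail w (t : R) : \bar R := (\int[off (fun i => s (lift ord0 i))]_u
  crit_integrand (fun i => k (lift ord0 i)) (fun i => h (lift ord0 i))
        (fun i => r (lift ord0 i)) (w * `|t| ^+ (2 * k ord0))%R u)%E.
pose wt (t : R) : R := \1_`[- r ord0, r ord0]%classic t * `|t| ^+ h ord0.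
have wt0 t : 0 <= wt t by rewrite mulr_ge0// exprn_ge0.
have tailE w t : (\int[off (fun i => s (lift ord0 i))]_u crit_integrand k h r w (cons_row (t : measurableTypeR R, u : borel 'rV[R]_n)) =
    (wt t)%:E * tail w t)%E.
  rewrite -ge0_integralZl//.
  - by apply: eq_integral => u _; rewrite crit_integrand_cons.
  - exact: measurable_crit_integrand.
  - by move=> u _; exact: crit_integrand_ge0.
  - by rewrite lee_fin.
have consE w : (\int[off s]_v crit_integrand k h r w v = \int[coord_measure (s ord0)]_t ((wt t)%:E * tail w t))%E.
  rewrite /off ge0_integral_cons//; last by move=> v; exact: crit_integrand_ge0.
  by apply: eq_integral => t _; rewrite -tailE.
have mF w : measurable_fun setT ((fun t => (wt t)%:E * tail w t)%E : measurableTypeR R -> \bar R).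
  have := @measurable_fubini_cons R n (fun i => coord_measure (s i)) _ (mI w) (fun v => crit_integrand_ge0 _ _ _ _ _).
  by congr measurable_fun; apply/funext => t; rewrite -tailE.
have prodE : \prod_(i | ~~ s i) (k i)%:R = (if ~~ s ord0 then (k ord0)%:R else 1) *
    \prod_(i | ~~ s (lift ord0 i)) (k (lift ord0 i))%:R :> R.
  by rewrite big_mkcond big_ord_recl -big_mkcond.
have countE : crit_count s = (~~ s ord0 + crit_count (fun i => s (lift ord0 i)))%N.
  by rewrite /crit_count big_ord_recl.
case E : (s ord0).
- exists H; rewrite countE prodE E /= mul1r; split => // w w0.
  have [k0 h0] := hs _ E.
  rewrite consE.
  have -> : coord_measure (s ord0) = coord_measure true :> {sigma_finite_measure set (measurableTypeR R) -> \bar R} by rewrite E.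
  rewrite (integral_coord_dirac (mF w)) /tail /wt normr0 k0 h0 muln0 !expr0 !mulr1 HE//.
  by rewrite indicE mem_set ?mul1e//= in_itv/= oppr_le0 !ltW.
have [k0 hl] := hk ord0 (negbT E).
have kR : 0 < (k ord0)%:R :> R by rewrite ltr0n.
have rho0 : 0 < r ord0 ^+ (2 * k ord0) by rewrite exprn_gt0.
exists (fun w => log_primitive H (w * r ord0 ^+ (2 * k ord0)) / (k ord0)%:R); split; [|by rewrite countE E|].
  rewrite countE prodE E /=; move: HG.
  case Ec : (crit_count _) => [|c] /= HG.
    rewrite big1 ?mulr1 ?fact0 ?mul1r ?(Hexp Ec); first exact: log_growth_first.
    move=> i; move/eqP: Ec; rewrite sum_nat_eq0 => /forallP/(_ i)/=; by case: (s _).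
  have := log_growth_step lam0 HG rho0 kR; congr (log_growth _ _ _ _).
  rewrite factS natrM.
  have f0 : (c`!)%:R != 0 :> R by rewrite pnatr_eq0 -lt0n fact_gt0.
  have c0 : c.+1%:R != 0 :> R by rewrite pnatr_eq0.
  have p0 : \prod_(i | ~~ s (lift ord0 i)) (k (lift ord0 i))%:R != 0 :> R.
    by apply/prodf_neq0 => i si; rewrite pnatr_eq0 -lt0n; have [] := hk _ si.
  move: (\prod_(i | _) _) (c`!%:R : R) (c.+1%:R : R) p0 f0 c0 => P Fc C P0 F0 C0.
  by field; rewrite P0 F0 C0 gt_eqF.
move=> w w0; rewrite consE.
have -> : coord_measure (s ord0) = coord_measure false :> {sigma_finite_measure set (measurableTypeR R) -> \bar R} by rewrite E.
have T0 t : (0 <= (wt t)%:E * tail w t)%E.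
  apply: mule_ge0; first by rewrite lee_fin.
  by apply: integral_ge0 => u _; exact: crit_integrand_ge0.
have TN t : ((wt (- t)%R)%:E * tail w (- t)%R = (wt t)%:E * tail w t)%E.
  rewrite /wt /tail normrN; congr ((_ * _)%:E * _)%E.
  by rewrite !indicE !mem_setE !in_itv/= lerN2 andbC lerNl.
rewrite (integral_even (mF w) T0 TN).
have two0 : (0 < 2 * k ord0)%N by rewrite muln_gt0.
have [H0 Hc _ _] := HG.
have mp : measurable_fun (`]0, r ord0]%classic : set (measurableTypeR R)) (fun t => (H (w * t ^+ (2 * k ord0)) / t)%:E).
  apply/measurable_EFinP.
  have sub : `]0, r ord0]%classic `<=` (`]0, +oo[%classic : set R).
    by move=> t; rewrite /= !in_itv/= andbT => /andP[].
  suff mf' : measurable_fun (`]0, +oo[%classic : set (measurableTypeR R)) (fun t : R => H (w * t ^+ (2 * k ord0)) / t).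
    by apply: measurable_funS sub mf'; exact: measurable_itv.
  apply: measurable_realfun.open_continuous_measurable_fun; first exact: interval_open.
  move=> t; rewrite inE/= in_itv/= andbT => t0.
  apply: continuousM; last by apply: continuousV; [rewrite gt_eqF|exact: cvg_id].
  have c1 : {for t, continuous (fun t : R => w * t ^+ (2 * k ord0))}.
    by apply: continuousM; [exact: cst_continuous|exact: exprn_continuous].
  have c2 : {for w * t ^+ (2 * k ord0), continuous H} by apply: Hc; rewrite mulr_gt0 ?exprn_gt0.
  exact: (continuous_comp c1 c2).
have key : (\int[lebesgue_measure]_(t in `]0%R, +oo[) ((wt t)%:E * tail w t) =
   \int[lebesgue_measure]_(t in `]0%R, r ord0]) ((w `^ (- lam))%:E * (H (w * t ^+ (2 * k ord0)) / t)%:E))%E.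
  rewrite integral_mkcond [RHS]integral_mkcond; apply: eq_integral => t _.
  rewrite !patchE !mem_setE !in_itv/= andbT; case: ltP => //= t0.
  rewrite /wt indicE mem_setE in_itv/= (le_trans _ (ltW t0)) ?oppr_le0 ?(ltW (r0 _))//=.
  case: leP => tr; last by rewrite mul0r mul0e.
  have wt1 : 0 < w * `|t| ^+ (2 * k ord0) by rewrite mulr_gt0// exprn_gt0// normr_gt0 gt_eqF.
  rewrite mul1r /tail HE// -!EFinM; congr EFin.
  rewrite (gtr0_norm t0) powRM ?(ltW w0) ?exprn_ge0 ?(ltW t0)//.
  have -> : t ^+ h ord0 = t `^ ((2 * k ord0)%:R * lam) / t.
    by rewrite -hl powR_mulrn ?(ltW t0)// exprSr mulfK// gt_eqF.
  have -> : (t ^+ (2 * k ord0)) `^ (- lam) = (t `^ ((2 * k ord0)%:R * lam))^-1.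
    by rewrite powRN powRrM powR_mulrn// ltW.
  have p0 : t `^ ((2 * k ord0)%:R * lam) != 0 by rewrite gt_eqF// powR_gt0.
  move: (t `^ _) (w `^ _) (H _) p0 => a b c a0.
  by field; rewrite a0 gt_eqF.
rewrite key ge0_integralZl//; last 2 first.
- move=> t; rewrite /= in_itv/= => /andP[t0 _]; rewrite lee_fin.
  by rewrite mulr_ge0 ?H0 ?mulr_gt0 ?exprn_gt0// invr_ge0 ltW.
- by rewrite lee_fin powR_ge0.
rewrite (integral_log_primitive lam0 HG w0 (r0 _) two0) -!EFinM; congr EFin.
rewrite natrM; move: ((k ord0)%:R : R) kR (log_primitive _ _) (w `^ _) => K K0 a b.
by field; rewrite gt_eqF.
Qed.

End CriticalBox.

(** * Monomial Laplace integrals *)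

Lemma squeeze_aux (R : realFieldType) (a B c e1 dl e j hq hr nc : R) :
  0 <= a -> 0 <= B -> 0 <= e1 -> 0 <= dl -> e1 <= 1 -> dl <= 1 -> 0 <= e ->
  dl * (a + 1 + 2 * B + 1) <= e / 4 -> c <= nc -> e1 * (nc + 1) <= e / 4 ->
  - dl < c - hr -> c - hr < dl -> - dl < c - hq -> c - hq < dl ->
  j + B * hq <= (a + e1 + B) * hr -> a * hq <= j + e1 * hr -> `|c * a - j| <= e.
Proof.
move=> a0 B0 e10 d0 e11 d1 e0 dK cn e1c r1 r2 q1 q2 u1 u2.
have t1 : (a + e1 + B) * hr <= (a + e1 + B) * (c + dl).
  by apply: ler_wpM2l; [rewrite !addr_ge0|lra].
have t2 : B * (c - dl) <= B * hq by apply: ler_wpM2l => //; lra.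
have t3 : e1 * c <= e1 * (nc + 1) by apply: ler_wpM2l => //; lra.
have t4 : (a + e1 + 2 * B) * dl <= dl * (a + 1 + 2 * B + 1) by rewrite mulrC; apply: ler_wpM2l => //; lra.
have t5 : a * (c - dl) <= a * hq by apply: ler_wpM2l => //; lra.
have t6 : e1 * hr <= e1 * (nc + 1) by apply: ler_wpM2l => //; lra.
have t7 : a * dl <= dl * (a + 1 + 2 * B + 1) by rewrite mulrC; apply: ler_wpM2l => //; lra.
rewrite ler_norml [c * a]mulrC.
by apply/andP; split; lra.
Qed.

Lemma rescale_aux (R : fieldType) (A A' L x : R) : A * A' = 1 -> A / L * (A' * x) = x / L.
Proof. by move=> AA; rewrite -[in RHS](mul1r x) -AA; ring. Qed.

Lemma powR_prod (R : realType) n (F : 'I_n -> R) (x : R) : (forall i, 0 <= F i) ->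
  (\prod_i F i) `^ x = \prod_i (F i `^ x).
Proof.
move=> F0; suff [] : 0 <= \prod_i F i /\ (\prod_i F i) `^ x = \prod_i (F i `^ x) by [].
apply: (big_ind2 (fun a b : R => 0 <= a /\ a `^ x = b)).
- by rewrite powR1.
- by move=> a a' b b' [a0 <-] [b0 <-]; rewrite mulr_ge0// powRM.
- by move=> i _.
Qed.

(** Dominated convergence is available along sequences, which suffices as the
    filter at infinity has a countable base. *)
Lemma cvg_pinfty_seq (R : realType) (T : topologicalType) (f : R -> T) (l : T) :
  (forall b : nat -> R, b @ \oo --> +oo%R -> (fun j => f (b j)) @ \oo --> l) -> f @ +oo%R --> l.
Proof.
move=> hs A nA; apply: contrapT => hA.
have /choice[b hb] : forall j : nat, exists x, j%:R < x /\ ~ A (f x).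
  move=> j; apply: contrapT => hj; apply: hA; exists j%:R; split; first exact: num_real.
  by move=> x jx; apply: contrapT => fx; apply: hj; exists x.
have boo : b @ \oo --> +oo%R.
  apply/cvgryPge => M; near=> j; have [bj _] := hb j; apply: le_trans (ltW bj).
  by near: j; exact: nbhs_infty_ger.
have [N _ hN] := hs b boo A nA; have [_] := hb N; apply; exact: (hN N (leqnn N)).
Unshelve. all: by end_near. Qed.

Section Monomial.
Context {R : realType}.

(** By Tonelli each coordinate misses its set with measure zero. Applied with
    points for the Dirac coordinates and with complements of points for the
    others. *)
Lemma prod_measure_ae n (nu : 'I_n -> {sigma_finite_measure set (measurableTypeR R) -> \bar R})
    (A : 'I_n -> set R) : (forall i, measurable (A i : set (measurableTypeR R))) ->
  (forall i, nu i (~` A i) = 0%E) ->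
  (prod_measure nu).-negligible [set y : 'rV[R]_n | ~ forall i, A i (y ord0 i)].
Proof.
move=> mA A0.
have h i : (prod_measure nu).-negligible [set y : 'rV[R]_n | ~ A i (y ord0 i)].
  pose B j : set R := if j == i then ~` A i else setT.
  have mB j : measurable (B j : set (measurableTypeR R)).
    by rewrite /B; case: ifP => _ //; exact: measurableC.
  exists [set y : 'rV[R]_n | forall j, B j (y ord0 j)]; split.
  - rewrite (_ : [set y | _] = \bigcap_(j in [set` finset.setT]) (fun y : borel 'rV[R]_n => y ord0 j) @^-1` B j).
      apply: fin_bigcap_measurable => // j _; rewrite -[X in measurable X]setTI.
      exact: (rV_coord_measurable j measurableT (mB j)).
    by apply/seteqP; split=> y hy; [move=> j _; exact: hy|move=> j; apply: hy; rewrite /= inE].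
  - have := prod_measure_box nu mB; rewrite (bigD1 i)//=.
    by rewrite (_ : B i = ~` A i) ?A0 ?mul0e//; rewrite /B eqxx.
  - by move=> y /= hy j; rewrite /B; case: eqP => [->|].
have -> : [set y : 'rV[R]_n | ~ forall i, A i (y ord0 i)] = \bigcup_k
    [set y : 'rV[R]_n | exists2 i : 'I_n, val i = k & ~ A i (y ord0 i)].
  apply/seteqP; split=> y /=.
    by move=> /existsNP[i hi]; exists (val i) => //; exists i.
  by move=> [k _ [i _ hi]] /(_ i).
apply: negligible_bigcup => k.
have [kn|kn] := ltnP k n.
  apply: negligibleS (h (Ordinal kn)) => y /= [i ik]; congr (~ A _ (y _ _)); exact/val_inj.
by apply: negligibleS (negligible_set0 _) => y /= [i ik _]; move: (ltn_ord i); rewrite ik ltnNge kn.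
Qed.

Lemma ae_integral_prod n (nu : 'I_n -> {sigma_finite_measure set (measurableTypeR R) -> \bar R})
    (A : 'I_n -> set R) (f g : 'rV[R]_n -> \bar R) :
  (forall i, measurable (A i : set (measurableTypeR R))) ->
  (forall i, nu i (~` A i) = 0%E) ->
  measurable_fun setT (f : borel 'rV[R]_n -> \bar R) ->
  measurable_fun setT (g : borel 'rV[R]_n -> \bar R) ->
  (forall y : 'rV[R]_n, (forall i, A i (y ord0 i)) -> f y = g y) ->
  (\int[prod_measure nu]_y f y = \int[prod_measure nu]_y g y)%E.
Proof.
move=> mA A0 mf mg fg; apply: ae_eq_integral => //.
apply: negligibleS (prod_measure_ae mA A0) => y /=; apply: contra_not => hy _; exact: fg.
Qed.

Variable lam : R.
Hypothesis lam0 : 0 < lam.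
Variables (n : nat) (s : 'I_n -> bool) (k h : 'I_n -> nat) (r : R) (m : nat).
Hypothesis r0 : 0 < r.
Hypothesis hs : forall i, ~~ s i -> (0 < k i)%N /\ (h i).+1%:R = (2 * k i)%:R * lam.
Hypothesis m0 : (0 < m)%N.
Hypothesis pm : (crit_count s <= m)%N.

Let k' i := if s i then 0%N else k i.
Let h' i := if s i then 0%N else h i.
Let CI (q : R) w v := crit_integrand k' h' (fun=> q) w v.

(** The coefficient vanishes when there are fewer than [m] critical
    coordinates: such faces are negligible at the logarithmic scale of the
    maximal multiplicity. *)
Definition crit_coef : R :=
  if crit_count s == m then Gamma lam / (m.-1`!%:R * \prod_(i | ~~ s i) (k i)%:R) else 0.

(** The same scale [m.-1] is used whatever the number of critical coordinates
    is, the limit being zero when it falls short of [m]. *)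
Lemma crit_box_growth (q : R) : 0 < q ->
  exists H, log_growth lam H m.-1 crit_coef /\
    forall w, 0 < w -> (\int[off s]_v CI q w v = (w `^ (- lam) * H w)%:E)%E.
Proof.
move=> q0.
have h1 i : s i -> k' i = 0%N /\ h' i = 0%N by rewrite /k' /h' => ->.
have h2 i : ~~ s i -> (0 < k' i)%N /\ (h' i).+1%:R = (2 * k' i)%:R * lam.
  by rewrite /k' /h' => si; rewrite (negbTE si); exact: hs.
have [H [HG _ HE]] := crit_box lam0 (fun=> q0) h1 h2.
exists H; split => //; move: HG; rewrite /crit_coef.
have -> : \prod_(i | ~~ s i) (k' i)%:R = \prod_(i | ~~ s i) (k i)%:R :> R.
  by apply: eq_bigr => i si; rewrite /k' (negbTE si).
case: (crit_count s =P m) => [cm|/eqP cm].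
  by rewrite cm gtn_eqF.
have pm' : (crit_count s < m)%N by rewrite ltn_neqAle cm.
case: (crit_count s) pm' => [|p] /= pm' HG; first exact: log_growth_raise_le HG _.
by apply: log_growth_raise_le (log_growth_raise HG) _; rewrite -ltnS prednK.
Qed.

Let in_box (q : R) (v : 'rV[R]_n) := forall i, `|v ord0 i| <= q.

Lemma CI_in q w v : in_box q v -> CI q w v =
  ((\prod_i `|v ord0 i| ^+ h' i) * expR (- (w * \prod_i `|v ord0 i| ^+ (2 * k' i))))%:E.
Proof.
move=> hv; congr (_ * _)%:E; apply: eq_bigr => i _.
by rewrite indicE mem_set ?mul1r//= in_itv/= -ler_norml.
Qed.

Lemma CI_out q w v : ~ in_box q v -> CI q w v = 0%E.
Proof.
move=> /existsNP[i hi]; rewrite /CI /crit_integrand (bigD1 i)//= indicE memNset ?mul0r//=.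
by rewrite in_itv/= -ler_norml.
Qed.

Lemma in_box_le q q' v : q <= q' -> in_box q v -> in_box q' v.
Proof. by move=> qq hv i; exact: le_trans (hv i) qq. Qed.

Let CI0 q w v : (0 <= CI q w v)%E. Proof. exact: crit_integrand_ge0. Qed.
Let mCI q w : measurable_fun setT (CI q w : borel 'rV[R]_n -> \bar R).
Proof. exact: measurable_crit_integrand. Qed.

Lemma crit_integral_le (psi : 'rV[R]_n -> R) (B w : R) :
  measurable_fun setT (psi : borel 'rV[R]_n -> measurableTypeR R) ->
  (forall v, 0 <= psi v <= B) ->
  (\int[off s]_v ((psi v)%:E * CI r w v) <= B%:E * \int[off s]_v CI r w v)%E.
Proof.
move=> mpsi hpsi; have B0 : 0 <= B by have /andP[h1 h2] := hpsi 0; exact: le_trans h2.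
rewrite -ge0_integralZl//; apply: ge0_le_integral => //.
- by move=> v _; apply: mule_ge0 => //; rewrite lee_fin; have /andP[] := hpsi v.
- by apply: emeasurable_funM => //; exact/measurable_EFinP.
- exact: measurable_funeM.
- by move=> v _; apply: lee_wpmul2r => //; rewrite lee_fin; have /andP[] := hpsi v.
Qed.

(** The limit of the integral over a box does not depend on its size, so that
    what lies outside of a small box around the origin is negligible and the
    amplitude may be replaced by its value at the origin. *)
Lemma crit_localize (psi : 'rV[R]_n -> R) (B : R) :
  measurable_fun setT (psi : borel 'rV[R]_n -> measurableTypeR R) ->
  (forall v, 0 <= psi v <= B) ->
  (forall e, 0 < e -> exists2 q, 0 < q & forall v : 'rV[R]_n, (forall i, `|v ord0 i| <= r) ->
     (forall i, `|v ord0 i| <= q) -> `|psi v - psi 0| <= e) ->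
  (fun w => w `^ lam * fine (\int[off s]_v ((psi v)%:E * CI r w v))%E / ln w ^+ m.-1) @ +oo%R --> crit_coef * psi 0.
Proof.
move=> mpsi hpsi hc.
have [Hr [Gr Er]] := crit_box_growth r0.
set c := crit_coef; set a := psi 0.
have /andP[a0 aB] := hpsi 0; have B0 : 0 <= B by exact: le_trans aB.
pose J w := fine (\int[off s]_v ((psi v)%:E * CI r w v))%E.
have mpc w : measurable_fun setT (fun v : borel 'rV[R]_n => ((psi v)%:E * CI r w v)%E).
  by apply: emeasurable_funM => //; exact/measurable_EFinP.
have pc0 w v : (0 <= (psi v)%:E * CI r w v)%E.
  by apply: mule_ge0 => //; rewrite lee_fin; have /andP[] := hpsi v.
have JE w : 0 < w -> (\int[off s]_v ((psi v)%:E * CI r w v) = (J w)%:E)%E.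
  move=> w0; rewrite fineK// ge0_fin_numE; last by apply: integral_ge0 => v _.
  apply: le_lt_trans (crit_integral_le w mpsi hpsi) _.
  by rewrite Er// -EFinM ltry.
apply/cvgrPdist_le => e e0.
have c0 : 0 < `|c| + 1 by rewrite ltr_wpDl.
pose e1 := Num.min 1 (e / 4 / (`|c| + 1)).
have e10 : 0 < e1 by rewrite lt_min ltr01 !divr_gt0.
have e1c : e1 * (`|c| + 1) <= e / 4 by rewrite -ler_pdivlMr// ge_min lexx orbT.
have e11 : e1 <= 1 by rewrite ge_min lexx.
have [q' q'0 hq'] := hc _ e10.
pose q := Num.min q' r; have q0 : 0 < q by rewrite lt_min q'0.
have qr : q <= r by rewrite ge_min lexx orbT.
have hq v : in_box q v -> `|psi v - a| <= e1.
  move=> hv; apply: hq'; first exact: in_box_le qr hv.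
  by apply: in_box_le hv; rewrite ge_min lexx.
have [Hq [Gq Eq]] := crit_box_growth q0.
have up w : 0 < w -> J w + B * (w `^ (- lam) * Hq w) <= (a + e1 + B) * (w `^ (- lam) * Hr w).
  move=> w0; rewrite -lee_fin EFinD !EFinM -EFinM -EFinM -Eq// -Er// -JE//.
  rewrite -!ge0_integralZl//; last by rewrite lee_fin !addr_ge0// ltW.
  rewrite -ge0_integralD//; last 2 first.
  - by move=> v _; apply: mule_ge0.
  - exact: measurable_funeM.
  apply: ge0_le_integral => //.
  - by move=> v _; apply: adde_ge0 => //; apply: mule_ge0.
  - by apply: emeasurable_funD => //; exact: measurable_funeM.
  - exact: measurable_funeM.
  move=> v _; have [hv|hv] := pselect (in_box q v).
    rewrite !CI_in//; last exact: in_box_le qr hv.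
    rewrite -!EFinM -EFinD lee_fin -mulrDl; apply: ler_wpM2r.
      by rewrite mulr_ge0 ?expR_ge0// prodr_ge0// => i _; exact: exprn_ge0.
    by have := hq _ hv; rewrite ler_norml => /andP[h1 h2]; lra.
  rewrite (CI_out w hv) mule0 adde0; apply: lee_wpmul2r => //.
  rewrite lee_fin; have /andP[_ h2] := hpsi v; apply: (le_trans h2).
  by rewrite lerDr addr_ge0// ltW.
have dn w : 0 < w -> a * (w `^ (- lam) * Hq w) <= J w + e1 * (w `^ (- lam) * Hr w).
  move=> w0; rewrite -lee_fin EFinD !EFinM -EFinM -EFinM -Eq// -Er// -JE//.
  have e10' : (0 <= e1%:E)%E by rewrite lee_fin ltW.
  rewrite -!ge0_integralZl//.
  rewrite -ge0_integralD//; last 2 first.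
  - by move=> v _; apply: mule_ge0.
  - exact: measurable_funeM.
  apply: ge0_le_integral => //.
  - by move=> v _; apply: mule_ge0.
  - exact: measurable_funeM.
  - by apply: emeasurable_funD => //; exact: measurable_funeM.
  move=> v _; have [hv|hv] := pselect (in_box q v).
    rewrite !CI_in//; last exact: in_box_le qr hv.
    rewrite -!EFinM -EFinD lee_fin -mulrDl; apply: ler_wpM2r.
      by rewrite mulr_ge0 ?expR_ge0// prodr_ge0// => i _; exact: exprn_ge0.
    by have := hq _ hv; rewrite ler_norml => /andP[h1 h2]; lra.
  by rewrite (CI_out w hv) mule0 adde_ge0// mule_ge0.
have [_ _ _ Lr] := Gr; have [_ _ _ Lq] := Gq.
have K0 : 0 < a + 1 + 2 * B + 1 by rewrite ltr_wpDl// !addr_ge0// mulr_ge0.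
pose dl := Num.min 1 (e / 4 / (a + 1 + 2 * B + 1)).
have d0 : 0 < dl by rewrite lt_min ltr01 !divr_gt0.
have dlK : dl * (a + 1 + 2 * B + 1) <= e / 4 by rewrite -ler_pdivlMr// ge_min lexx orbT.
have dl1 : dl <= 1 by rewrite ge_min lexx.
have /cvgrPdist_lt /(_ _ d0) nr := Lr.
have /cvgrPdist_lt /(_ _ d0) nq := Lq.
near=> w.
have w0 : 0 < w by near: w; exact: nbhs_pinfty_gt.
have l0 : 0 < ln w by near: w; exact: near_pinfty_ln.
have P0 : 0 < w `^ lam / ln w ^+ m.-1 by rewrite divr_gt0 ?powR_gt0 ?exprn_gt0.
have wl : w `^ lam * w `^ (- lam) = 1.
  by rewrite -powRD ?subrr ?powRr0//; apply/implyP => _; rewrite gt_eqF.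
have resc (x : R) : w `^ lam / ln w ^+ m.-1 * (w `^ (- lam) * x) = x / ln w ^+ m.-1.
  exact: rescale_aux.
have hu : `|c - Hr w / ln w ^+ m.-1| < dl by near: w.
have hv : `|c - Hq w / ln w ^+ m.-1| < dl by near: w.
have u1 : w `^ lam * J w / ln w ^+ m.-1 + B * (Hq w / ln w ^+ m.-1) <= (a + e1 + B) * (Hr w / ln w ^+ m.-1).
  have := up w w0; rewrite -(ler_pM2l P0) mulrDr [_ / _ * J w]mulrAC.
  by rewrite (mulrCA (w `^ lam / ln w ^+ m.-1) B) (mulrCA (w `^ lam / ln w ^+ m.-1) (a + e1 + B)) !resc.
have u2 : a * (Hq w / ln w ^+ m.-1) <= w `^ lam * J w / ln w ^+ m.-1 + e1 * (Hr w / ln w ^+ m.-1).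
  have := dn w w0; rewrite -(ler_pM2l P0) mulrDr [_ / _ * J w]mulrAC.
  by rewrite (mulrCA (w `^ lam / ln w ^+ m.-1) a) (mulrCA (w `^ lam / ln w ^+ m.-1) e1) !resc.
move: hu hv; rewrite !ltr_norml => /andP[r1 r2] /andP[q1 q2].
exact: (squeeze_aux a0 B0 (ltW e10) (ltW d0) e11 dl1 (ltW e0) dlK (ler_norm c) e1c r1 r2 q1 q2 u1 u2).
Unshelve. all: by end_near. Qed.


(** The monomial integral over a cube, around a face of the critical
   coordinates. *)
Section Cube.
Variables (y0 : 'rV[R]_n) (Phi : 'rV[R]_n -> R) (B : R).
Let I i : set R := `[y0 ord0 i - r, y0 ord0 i + r]%classic.
Let ex i : R := - (2 * (k i)%:R * lam) + (h i)%:R.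
Hypothesis hy0 : forall i, ~~ s i -> y0 ord0 i = 0.
Hypothesis hint : forall i, s i ->
  (\int[lebesgue_measure]_t (\1_(I i) t * `|t| `^ ex i)%:E < +oo)%E.
Hypothesis mPhi : measurable_fun setT (Phi : borel 'rV[R]_n -> measurableTypeR R).
Hypothesis Phi_bnd : forall y, 0 <= Phi y <= B.
Hypothesis Phi_cont : forall u : 'rV[R]_n, (forall i, I i (u ord0 i)) -> forall e, 0 < e ->
  exists2 q, 0 < q & forall y : 'rV[R]_n, (forall i, I i (y ord0 i)) ->
     (forall i, `|y ord0 i - u ord0 i| <= q) -> `|Phi y - Phi u| <= e.

(** The Laplace integrand of a monomial chart, restricted to a cube: [h] comes
    from the Jacobian and [Phi] collects the amplitude and the unit factor of
    the Jacobian. *)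
Definition mono_integrand (beta : R) (y : 'rV[R]_n) : \bar R :=
  ((\prod_i (\1_(I i) (y ord0 i) * `|y ord0 i| ^+ h i)) * Phi y *
   expR (- (beta * \prod_i `|y ord0 i| ^+ (2 * k i))))%:E.

(** The integrand of the limit density on the face of the critical coordinates;
    its exponents come from rescaling [beta] by the monomial in the other
    coordinates. *)
Definition face_integrand (y : 'rV[R]_n) : \bar R :=
  ((\prod_i (\1_(I i) (y ord0 i) * (if s i then `|y ord0 i| `^ ex i else 1))) * Phi y)%:E.

Let B0 : 0 <= B. Proof. by have /andP[h1 h2] := Phi_bnd 0; exact: le_trans h2. Qed.
Let mI i : measurable (I i : set (measurableTypeR R)). Proof. exact: measurable_itv. Qed.
Let mc i : measurable_fun setT ((fun v => v ord0 i) : borel 'rV[R]_n -> measurableTypeR R) := rV_coord_measurable i.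

Lemma measurable_mono_integrand beta : measurable_fun setT (mono_integrand beta : borel 'rV[R]_n -> \bar R).
Proof.
apply/measurable_EFinP.
have mp q i : measurable_fun setT ((fun v => `|v ord0 i| ^+ q) : borel 'rV[R]_n -> measurableTypeR R).
  by apply: measurable_funX; apply: measurableT_comp (mc i); exact: normr_measurable.
apply: measurable_funM.
  apply: measurable_funM => //.
  apply: measurable_prod => i _; apply: measurable_funM; [|exact: mp].
  by apply: measurableT_comp (mc i); exact: measurable_indic.
apply: measurableT_comp; first exact: measurable_expR.
apply: measurableT_comp; first exact: oppr_measurable.
apply: measurable_funM => //.
by apply: measurable_prod => i _; exact: mp.
Qed.

Lemma mono_integrand_ge0 beta y : (0 <= mono_integrand beta y)%E.
Proof.
rewrite lee_fin !mulr_ge0 ?expR_ge0 ?(andP (Phi_bnd y)).1//.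
by apply: prodr_ge0 => i _; rewrite mulr_ge0// exprn_ge0.
Qed.

Lemma measurable_face_factor i : measurable_fun setT
  ((fun t => \1_(I i) t * (if s i then `|t| `^ ex i else 1)) : measurableTypeR R -> measurableTypeR R).
Proof.
apply: measurable_funM; first exact: measurable_indic.
by case: (s i) => //; apply: (@measurableT_comp _ _ _ _ _ _ (fun x : R => x `^ ex i)).
Qed.

Lemma measurable_face_integrand : measurable_fun setT (face_integrand : borel 'rV[R]_n -> \bar R).
Proof.
apply/measurable_EFinP; apply: measurable_funM => //.
apply: measurable_prod => i _.
exact: (measurableT_comp (measurable_face_factor i) (mc i)).
Qed.

Let mask (v : 'rV[R]_n) : 'rV[R]_n := \row_i (if s i then 0 else v ord0 i).

Let measurable_mask : measurable_fun setT (mask : borel 'rV[R]_n -> borel 'rV[R]_n).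
Proof.
apply: measurable_rV => i; rewrite (_ : (fun x => _) = (fun v : borel 'rV[R]_n => if s i then 0 else v ord0 i)).
  by case: (s i) => //; exact: measurable_cst.
by apply/funext => v; rewrite mxE.
Qed.

Let X i (u : 'rV[R]_n) : R := if s i then \1_(I i) (u ord0 i) * `|u ord0 i| ^+ h i else 1.
Let W u := \prod_i X i u.
Let S (u : 'rV[R]_n) := \prod_i (if s i then `|u ord0 i| ^+ (2 * k i) else 1).
Let psi (u v : 'rV[R]_n) := Phi (u + mask v).
Let goodu (u : 'rV[R]_n) := forall i, if s i then u ord0 i != 0 else u ord0 i == 0.

(** For fixed noncritical coordinates the monomial in them merely rescales
    [beta]. *)
Lemma inner_integral beta u : goodu u ->
  (\int[off s]_v mono_integrand beta (u + (v : 'rV[R]_n))%R =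
   (W u)%:E * \int[off s]_v ((psi u v)%:E * CI r (beta * S u) v))%E.
Proof.
move=> gu.
have W0 : 0 <= W u by apply: prodr_ge0 => i _; rewrite /X; case: ifP => // _; rewrite mulr_ge0// exprn_ge0.
have mps : measurable_fun setT (fun v : borel 'rV[R]_n => ((psi u v)%:E * CI r (beta * S u) v)%E).
  apply: emeasurable_funM => //; apply/measurable_EFinP.
  have m1 := measurableT_comp (@measurable_rVD R n) (measurable_fun_pair (measurable_cst (u : borel 'rV[R]_n)) measurable_mask).
  exact: (measurableT_comp mPhi m1).
rewrite -ge0_integralZl//; last first.
  by move=> v _; apply: mule_ge0 => //; rewrite lee_fin; have /andP[] := Phi_bnd (u + mask v).
pose A i : set R := if s i then [set 0] else setT.
apply: (ae_integral_prod (A := A)).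
- by move=> i; rewrite /A; case: (s i).
- move=> i; rewrite /A; case: (s i) => /=; last by rewrite setCT measure0.
  by rewrite diracE memNset//= => /(_ erefl).
- exact: (measurable_add_l u (measurable_mono_integrand beta)).
- exact: measurable_funeM.
move=> v gv.
have v0 i : s i -> v ord0 i = 0 by move=> si; have := gv i; rewrite /A si.
have u0 i : ~~ s i -> u ord0 i = 0 by move=> si; have := gu i; rewrite (negbTE si) => /eqP.
have mv : mask v = v by apply/rowP => i; rewrite mxE; case: ifP => // /v0 ->.
rewrite /mono_integrand /CI /crit_integrand /psi mv -!EFinM; congr EFin.
have -> : \prod_i (\1_(I i) ((u + v) ord0 i) * `|(u + v) ord0 i| ^+ h i) =
    W u * \prod_i (\1_`[- r, r]%classic (v ord0 i) * `|v ord0 i| ^+ h' i).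
  rewrite -big_split/=; apply: eq_bigr => i _; rewrite mxE /X /h'; have [si|si] := boolP (s i).
    have ind0 : \1_(`[- r, r]%classic : set R) (0 : R) = 1 :> R.
      by rewrite indicE mem_set//= in_itv/= oppr_le0 (ltW r0).
    by rewrite (v0 i si) addr0 expr0 ind0 !mulr1.
  by rewrite u0// add0r mul1r /I hy0// sub0r add0r.
have -> : \prod_i `|(u + v) ord0 i| ^+ (2 * k i) = S u * \prod_i `|v ord0 i| ^+ (2 * k' i).
  rewrite -big_split/=; apply: eq_bigr => i _; rewrite mxE /k'; have [si|si] := boolP (s i).
    by rewrite v0// addr0 muln0 expr0 mulr1.
  by rewrite u0// add0r mul1r.
by rewrite [beta * (_ * _)]mulrA; ring.
Qed.

Lemma S_gt0 u : goodu u -> 0 < S u.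
Proof.
move=> gu; apply: prodr_gt0 => i _; case: ifP => // si.
by rewrite exprn_gt0// normr_gt0; have := gu i; rewrite si.
Qed.

Lemma face_prod u : goodu u ->
  \prod_i (\1_(I i) (u ord0 i) * (if s i then `|u ord0 i| `^ ex i else 1)) = W u * S u `^ (- lam).
Proof.
move=> gu.
have -> : S u `^ (- lam) = \prod_i ((if s i then `|u ord0 i| ^+ (2 * k i) else 1) `^ (- lam)).
  by apply: powR_prod => i; case: ifP => // _; exact: exprn_ge0.
rewrite /W -big_split/=; apply: eq_bigr => i _; rewrite /X.
have := gu i; case: ifP => si ui.
  rewrite -mulrA; congr (_ * _); rewrite /ex powRD; last by apply/implyP => _; rewrite normr_eq0.
  rewrite powR_mulrn// mulrC; congr (_ * _).
  by rewrite -powR_mulrn// -powRrM natrM mulrN.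
rewrite powR1 !mulr1; rewrite (eqP ui) indicE mem_set//=.
by rewrite /I /= in_itv/= hy0 ?si// sub0r add0r oppr_le0 (ltW r0).
Qed.

Lemma face_weight u : goodu u -> face_integrand u = (W u * S u `^ (- lam) * Phi u)%:E.
Proof. by move=> gu; rewrite /face_integrand face_prod. Qed.

Lemma face_null i : coord_measure (~~ s i) (~` (if s i then ~` [set 0] else [set 0] : set R)) = 0%E :> \bar R.
Proof.
case: (s i) => /=; first by rewrite setCK; exact: lebesgue_measure_set1.
by rewrite diracE memNset//= => /(_ erefl).
Qed.

(** The rescaling is by a nonzero factor off the coordinate hyperplanes. *)
Lemma goodu_ae : (off (fun i => ~~ s i)).-negligible [set u | ~ goodu u].
Proof.
pose A i : set R := if s i then ~` [set 0] else [set 0].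
have mA i : measurable (A i : set (measurableTypeR R)) by rewrite /A; case: (s i) => //; exact: measurableC.
apply: negligibleS (prod_measure_ae mA face_null) => u /=; apply: contra_not => hu i.
by have := hu i; rewrite /A; case: (s i) => /= [/eqP|->].
Qed.

(** The integral factors over the coordinates into the one-variable integrals
    that are assumed to be finite. *)
Lemma face_integral_fin C : 0 <= C ->
  (\int[off (fun i => ~~ s i)]_y (C * \prod_i (\1_(I i) (y ord0 i) * (if s i then `|y ord0 i| `^ ex i else 1)))%:E < +oo)%E.
Proof.
move=> C0.
pose F i (t : R) : \bar R := (\1_(I i) t * (if s i then `|t| `^ ex i else 1))%:E.
have mF i : measurable_fun setT (F i : measurableTypeR R -> \bar R).
  by apply/measurable_EFinP; exact: measurable_face_factor.
have F0 i t : (0 <= F i t)%E.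
  by rewrite lee_fin mulr_ge0//; case: ifP => // _; exact: powR_ge0.
have E : (\int[off (fun i => ~~ s i)]_y \prod_i F i (y ord0 i) = \prod_i \int[coord_measure (~~ s i)]_t F i t)%E.
  exact: ge0_integral_prod_measure.
rewrite (_ : (fun y => _) = (fun y : borel 'rV[R]_n => C%:E * \prod_i F i (y ord0 i))%E); last first.
  by apply/funext => y; rewrite prodEFin EFinM.
rewrite ge0_integralZl//; last 2 first.
- rewrite (_ : (fun y => _) = (fun y : borel 'rV[R]_n => (\prod_i (\1_(I i) (y ord0 i) * (if s i then `|y ord0 i| `^ ex i else 1)))%:E)); last first.
    by apply/funext => y; rewrite prodEFin.
  apply/measurable_EFinP; apply: measurable_prod => i _.
  exact: (measurableT_comp (measurable_face_factor i) (mc i)).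
- by move=> y _; apply: prode_ge0 => i _.
rewrite E.
have fin i : (\int[coord_measure (~~ s i)]_t F i t \is a fin_num)%E.
  rewrite ge0_fin_numE; last by apply: integral_ge0.
  have := hint (i := i); rewrite /F; case: (boolP (s i)) => si /=; first exact.
  move=> _; rewrite integral_dirac//; last by have := mF i; rewrite /F (negbTE si).
  by rewrite -EFinM ltry.
rewrite (eq_bigr (fun i => (fine (\int[coord_measure (~~ s i)]_t F i t))%:E)%E); last first.
  by move=> i _; rewrite fineK.
by rewrite prodEFin -EFinM ltry.
Qed.

Let J u w := fine (\int[off s]_v ((psi u v)%:E * CI r w v))%E.

Let mpsi u : measurable_fun setT (psi u : borel 'rV[R]_n -> measurableTypeR R).
Proof.
have m1 := measurableT_comp (@measurable_rVD R n) (measurable_fun_pair (measurable_cst (u : borel 'rV[R]_n)) measurable_mask).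
exact: (measurableT_comp mPhi m1).
Qed.

Let psi_bnd u v : 0 <= psi u v <= B. Proof. exact: Phi_bnd. Qed.

Let J0 u w : 0 <= J u w.
Proof.
apply: fine_ge0; apply: integral_ge0 => v _; apply: mule_ge0 => //.
by rewrite lee_fin; have /andP[] := psi_bnd u v.
Qed.

(** A bound for all values of [w], uniform in the noncritical coordinates, is
    needed as the rescaled parameter becomes small near the hyperplanes. *)
Lemma J_bound : exists C, 0 <= C /\ forall u w, 0 < w ->
  (\int[off s]_v ((psi u v)%:E * CI r w v) = (J u w)%:E)%E /\
  w `^ lam * J u w <= C * (1 + ln (1 + w)) ^+ m.-1.
Proof.
have [H [G E]] := crit_box_growth r0.
have [C [C0 hC]] := log_growth_bound lam0 G.
exists (B * C); split; first exact: mulr_ge0.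
move=> u w w0; have hle := crit_integral_le w (mpsi u) (psi_bnd u).
have JE : (\int[off s]_v ((psi u v)%:E * CI r w v) = (J u w)%:E)%E.
  rewrite fineK// ge0_fin_numE; last first.
    by apply: integral_ge0 => v _; apply: mule_ge0 => //; rewrite lee_fin; have /andP[] := psi_bnd u v.
  by apply: le_lt_trans hle _; rewrite E// -EFinM ltry.
split => //; move: hle; rewrite JE E// -EFinM lee_fin => hle.
apply: (@le_trans _ _ (B * H w)); last by rewrite -mulrA; apply: ler_wpM2l => //; exact: hC.
apply: le_trans (ler_wpM2l (powR_ge0 _ _) hle) _.
rewrite mulrCA [w `^ lam * _]mulrA -powRD ?subrr ?powRr0 ?mul1r//.
by apply/implyP => _; rewrite gt_eqF.
Qed.

(** The inner integral localises at the origin of the critical coordinates,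
    that is on the face. *)
Lemma J_limit (u : 'rV[R]_n) : goodu u -> (forall i, s i -> I i (u ord0 i)) ->
  (fun w => w `^ lam * J u w / ln w ^+ m.-1) @ +oo%R --> crit_coef * Phi u.
Proof.
move=> gu uI.
have psi0 : psi u 0 = Phi u.
  rewrite /psi (_ : mask 0 = 0) ?addr0//; apply/rowP => i; rewrite !mxE; by case: ifP.
rewrite -psi0; apply: (crit_localize (mpsi u) (psi_bnd u)) => e e0.
have uI' i : I i (u ord0 i).
  have [/uI//|si] := boolP (s i); have := gu i; rewrite (negbTE si) => /eqP ->.
  by rewrite /I /= in_itv/= hy0// sub0r add0r oppr_le0 (ltW r0).
have [q q0 hq] := Phi_cont uI' e0; exists q => // v vr vq; rewrite psi0; apply: hq.
  move=> i; rewrite !mxE; case: ifP => si; first by rewrite addr0.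
  have := gu i; rewrite si => /eqP ->.
  by rewrite /I /= in_itv/= hy0 ?si// sub0r !add0r -ler_norml.
move=> i; rewrite !mxE addrAC subrr add0r; case: ifP => // _.
by rewrite normr0 ltW.
Qed.

Let Smax : R := Num.max 1 (\prod_i (if s i then (`|y0 ord0 i| + r) ^+ (2 * k i) else 1)).

Lemma S_le (u : 'rV[R]_n) : (forall i, s i -> I i (u ord0 i)) -> S u <= Smax.
Proof.
move=> uI; rewrite le_max; apply/orP; right; apply: ler_prod => i _.
case: ifP => si; last by rewrite ler01 lexx.
rewrite exprn_ge0//=; apply: lerXn2r; rewrite ?nnegrE ?addr_ge0 ?(ltW r0)//.
have := uI i si; rewrite /I /= in_itv/= => /andP[h1 h2].
rewrite -[u ord0 i](subrK (y0 ord0 i)) addrC; apply: le_trans (ler_normD _ _) _.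
by rewrite lerD2l ler_norml; apply/andP; split; lra.
Qed.

Lemma W_out (u : 'rV[R]_n) : ~ (forall i, s i -> I i (u ord0 i)) -> W u = 0.
Proof.
move=> /existsNP[i /not_implyP[si hi]].
by rewrite /W (bigD1 i)//= /X si indicE memNset ?mul0r.
Qed.

(** Compares the logarithm of the rescaled parameter with that of [beta],
    uniformly in the rescaling factor. *)
Lemma ln_bound (b x K : R) : 1 <= ln b -> 0 < b -> 0 < x -> x <= K -> 1 <= K ->
  1 + ln (1 + b * x) <= (3 + ln K) * ln b.
Proof.
move=> lb b0 x0 xK K1; have K0 : 0 < K by exact: lt_le_trans K1.
have b1 : 1 <= b.
  apply: ltW; rewrite -[b]lnK ?posrE// -expR0 ltr_expR; exact: lt_le_trans lb.
have e2 : ln 2 <= 1 :> R.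
  rewrite -[leRHS](expRK 1) ler_ln ?posrE ?expR_gt0//.
  by apply: le_trans (expR_ge1Dx 1); rewrite -[2]/(1 + 1).
have h1 : 1 + b * x <= 2 * (b * K).
  have h2 : b * x <= b * K by apply: ler_wpM2l => //; exact: ltW.
  have h3 : 1 <= b * K by rewrite -[1]mulr1 ler_pM.
  lra.
have h2 : ln (1 + b * x) <= ln 2 + (ln b + ln K).
  rewrite -lnM ?posrE// -lnM ?posrE ?mulr_gt0// ler_ln ?posrE ?mulr_gt0//.
  by rewrite addr_gt0 ?mulr_gt0.
have lK : 0 <= ln K by exact: ln_ge0.
have h3 : ln K <= ln K * ln b by rewrite ler_peMr.
rewrite mulrDl; lra.
Qed.

(** Dominated convergence in the noncritical coordinates: the inner integrals
    converge by localisation, and their bound is a multiple of the integrable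
    face integrand. *)
Lemma mono_limit_seq (b : nat -> R) : (forall j, 1 <= ln (b j)) -> (forall j, 0 < b j) -> b @ \oo --> +oo%R ->
  ((fun j => (b j `^ lam / ln (b j) ^+ m.-1)%:E * \int[lebesgue_rV n]_y mono_integrand (b j) y) @ \oo -->
   crit_coef%:E * \int[off (fun i => ~~ s i)]_u face_integrand u)%E.
Proof.
move=> lb b0 boo.
pose c_ j := b j `^ lam / ln (b j) ^+ m.-1.
have l0 j : 0 < ln (b j) by exact: lt_le_trans (lb j).
have c0 j : 0 <= c_ j by rewrite divr_ge0 ?powR_ge0 ?exprn_ge0// ltW.
have cc0 : 0 <= crit_coef.
  rewrite /crit_coef; case: ifP => // _; rewrite divr_ge0 ?(ltW (Gamma_gt0 lam0))// mulr_ge0//.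
  by apply: prodr_ge0.
pose F j u := ((c_ j)%:E * \int[off s]_v mono_integrand (b j) ((u : 'rV[R]_n) + (v : 'rV[R]_n))%R)%E.
have minner j : measurable_fun setT (fun u : borel 'rV[R]_n => (\int[off s]_v mono_integrand (b j) ((u : 'rV[R]_n) + (v : 'rV[R]_n))%R)%E).
  exact: (measurable_integral_add (F := fun v => v) (fun i => coord_measure (s i)) (measurable_mono_integrand (b j)) (mono_integrand_ge0 (b j)) (@measurable_id _ _ _)).
have mF j : measurable_fun setT (F j : borel 'rV[R]_n -> \bar R) by exact: measurable_funeM.
have splitE j : ((c_ j)%:E * \int[lebesgue_rV n]_y mono_integrand (b j) y = \int[off (fun i => ~~ s i)]_u F j u)%E.
  rewrite (integral_lebesgue_split (fun i => ~~ s i) (measurable_mono_integrand (b j)) (mono_integrand_ge0 (b j))).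
  rewrite (_ : (fun i => ~~ ~~ s i) = s); last by apply/funext => i; rewrite negbK.
  by rewrite -ge0_integralZl ?lee_fin// => u _; apply: integral_ge0 => v _; exact: mono_integrand_ge0.
have mL : measurable_fun setT ((fun u => crit_coef%:E * face_integrand u)%E : borel 'rV[R]_n -> \bar R).
  by apply: measurable_funeM; exact: measurable_face_integrand.
have Lint : (crit_coef%:E * \int[off (fun i => ~~ s i)]_u face_integrand u = \int[off (fun i => ~~ s i)]_u (crit_coef%:E * face_integrand u))%E.
  rewrite -ge0_integralZl//; first exact: measurable_face_integrand.
  move=> u _; rewrite lee_fin mulr_ge0 ?(andP (Phi_bnd u)).1//.
  by apply: prodr_ge0 => i _; rewrite mulr_ge0//; case: ifP => // _; exact: powR_ge0.
have [C [C0 hC]] := J_bound.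
pose K := (3 + ln Smax) ^+ m.-1.
have S1 : 1 <= Smax by rewrite le_max lexx.
have K0 : 0 <= K by rewrite exprn_ge0// addr_ge0// ln_ge0.
pose D (u : 'rV[R]_n) : \bar R := (C * K * \prod_i (\1_(I i) (u ord0 i) * (if s i then `|u ord0 i| `^ ex i else 1)))%:E.
have FE j u : goodu u -> F j u = (W u * (c_ j * J u (b j * S u)))%:E.
  move=> gu; have w0 : 0 < b j * S u by rewrite mulr_gt0// S_gt0.
  by rewrite /F inner_integral// (hC u _ w0).1 -!EFinM mulrCA.
have SS u : goodu u -> S u `^ lam * S u `^ (- lam) = 1.
  move=> gu; rewrite -powRD ?subrr ?powRr0//; apply/implyP => _; by rewrite gt_eqF// S_gt0.
have cJ j u : goodu u -> c_ j * J u (b j * S u) =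
    S u `^ (- lam) * ((b j * S u) `^ lam * J u (b j * S u) / ln (b j) ^+ m.-1).
  move=> gu; rewrite powRM ?(ltW (b0 j)) ?(ltW (S_gt0 gu))//.
  have := SS u gu; rewrite /c_; move: (S u `^ lam) (S u `^ (- lam)) => x x' xx.
  transitivity (x * x' * (b j `^ lam / ln (b j) ^+ m.-1 * J u (b j * S u))); first by rewrite xx mul1r.
  ring.
have ptw u : goodu u -> (F ^~ u) @ \oo --> (crit_coef%:E * face_integrand u)%E.
  move=> gu; rewrite face_weight// -EFinM.
  rewrite (_ : F ^~ u = EFin \o (fun j => W u * (c_ j * J u (b j * S u)))); last first.
    by apply/funext => j; rewrite FE.
  apply: cvg_EFin; first exact: nearW.
  have [uI|uI] := pselect (forall i, s i -> I i (u ord0 i)); last first.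
    rewrite W_out// !mul0r mulr0 (_ : _ \o _ = fun=> 0); first exact: cvg_cst.
    by apply/funext => j /=; rewrite mul0r.
  have Sp := S_gt0 gu.
  have woo : (fun j => b j * S u) @ \oo --> +oo%R.
    apply/cvgryPge => A; move/cvgryPge : boo => /(_ (A / S u)); apply: filterS => j.
    by rewrite ler_pdivrMr.
  have L1 : (fun j => (b j * S u) `^ lam * J u (b j * S u) / ln (b j * S u) ^+ m.-1) @ \oo --> crit_coef * Phi u.
    exact: cvg_comp woo (J_limit gu uI).
  have L2 : (fun j => (1 + ln (S u) / ln (b j) ^+ 1) ^+ m.-1) @ \oo --> ((1 + 0) ^+ m.-1 : R).
    have hb : (fun j => 1 + ln (S u) / ln (b j) ^+ 1) @ \oo --> (1 + 0 : R).
      apply: cvgD; first exact: cvg_cst.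
      exact: cvg_comp boo (@cvg_div_ln R (ln (S u)) 1 isT).
    have e1 := @exprn_continuous R m.-1 (1 + 0).
    exact: (continuous_cvg _ e1 hb).
  have L3 : (fun j => W u * S u `^ (- lam) * ((b j * S u) `^ lam * J u (b j * S u) / ln (b j * S u) ^+ m.-1 * (1 + ln (S u) / ln (b j) ^+ 1) ^+ m.-1))
      @ \oo --> (W u * S u `^ (- lam) * (crit_coef * Phi u * (1 + 0) ^+ m.-1) : R).
    by apply: cvgM; [exact: cvg_cst|exact: cvgM].
  rewrite addr0 expr1n mulr1 in L3.
  rewrite [crit_coef * _]mulrCA.
  apply: cvg_trans L3; apply: near_eq_cvg; near=> j.
  have w0 : 0 < b j * S u by rewrite mulr_gt0.
  have lw : 0 < ln (b j * S u).
    by near: j; move: (near_pinfty_ln (0 : R)) => hn; exact: (woo _ hn).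
  have -> : 1 + ln (S u) / ln (b j) ^+ 1 = ln (b j * S u) / ln (b j).
    by rewrite lnM ?posrE// expr1; field; rewrite gt_eqF.
  rewrite /= cJ// expr_div_n; field.
  by rewrite !expf_neq0// gt_eqF.
have dom j u : goodu u -> (`|F j u| <= D u)%E.
  move=> gu; rewrite FE//.
  have W0 : 0 <= W u by apply: prodr_ge0 => i _; rewrite /X; case: ifP => // _; rewrite mulr_ge0// exprn_ge0.
  rewrite /= lee_fin ger0_norm; last by apply: mulr_ge0 => //; apply: mulr_ge0; [exact: c0|exact: J0].
  have [uI|uI] := pselect (forall i, s i -> I i (u ord0 i)); last first.
    rewrite W_out// mul0r !mulr_ge0//; apply: prodr_ge0 => i _.
    by rewrite mulr_ge0//; case: ifP => // _; exact: powR_ge0.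
  have Sp := S_gt0 gu; have w0 : 0 < b j * S u by rewrite mulr_gt0.
  rewrite face_prod//.
  rewrite cJ// mulrA [C * K * _]mulrC; apply: ler_wpM2l; first by rewrite mulr_ge0// powR_ge0.
  rewrite ler_pdivrMr ?exprn_gt0//.
  apply: le_trans (hC u _ w0).2 _; rewrite -mulrA; apply: ler_wpM2l => //.
  rewrite /K -exprMn; apply: lerXn2r; rewrite ?nnegrE ?mulr_ge0 ?(ltW (l0 j))//.
  - by rewrite addr_ge0// ln_ge0// lerDl ltW.
  - by rewrite addr_ge0// ln_ge0.
  - by apply: ln_bound => //; exact: S_le.
have [|||||_ _ hc] := @dominated_convergence _ _ R (off (fun i => ~~ s i)) setT measurableT F (fun u => crit_coef%:E * face_integrand u)%E D.
- exact: mF.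
- exact: mL.
- apply: negligibleS goodu_ae => u /=; apply: contra_not => gu _; exact: ptw.
- apply/integrableP; split.
    apply/measurable_EFinP; apply: measurable_funM => //; apply: measurable_prod => i _.
    exact: (measurableT_comp (measurable_face_factor i) (mc i)).
  rewrite [X in (X < _)%E](_ : _ = (\int[off (fun i => ~~ s i)]_u D u)%E).
    exact: (face_integral_fin (mulr_ge0 C0 K0)).
  apply: eq_integral => u _; rewrite gee0_abs// lee_fin !mulr_ge0//; apply: prodr_ge0 => i _.
  by rewrite mulr_ge0//; case: ifP => // _; exact: powR_ge0.
- apply: negligibleS goodu_ae => u /=; apply: contra_not => gu j _; exact: dom.
rewrite Lint; under eq_fun do rewrite splitE; exact: hc.
Unshelve. all: by end_near. Qed.

(** Sequences suffice; taking their maximum with [exp 1] keeps the logarithm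
    away from zero without changing the limit. *)
Theorem mono_limit :
  ((fun beta : R => (beta `^ lam / ln beta ^+ m.-1)%:E * \int[lebesgue_rV n]_y mono_integrand beta y) @ +oo%R -->
   crit_coef%:E * \int[off (fun i => ~~ s i)]_u face_integrand u)%E.
Proof.
have hseq (b : nat -> R) : b @ \oo --> +oo%R ->
  ((fun j => (b j `^ lam / ln (b j) ^+ m.-1)%:E * \int[lebesgue_rV n]_y mono_integrand (b j) y) @ \oo -->
   crit_coef%:E * \int[off (fun i => ~~ s i)]_u face_integrand u)%E.
  move=> boo; pose b' j := Num.max (b j) (expR 1).
  have bb : \forall j \near \oo, b j = b' j.
    move/cvgryPge : boo => /(_ (expR 1)); apply: filterS => j hj.
    by rewrite /b' max_l.
  have e1 j : expR 1 <= b' j by rewrite le_max lexx orbT.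
  have b'0 j : 0 < b' j by apply: lt_le_trans (e1 j); exact: expR_gt0.
  have := @mono_limit_seq b' _ b'0; set L := (crit_coef%:E * _)%E => hL.
  have h1 : forall j, 1 <= ln (b' j) by move=> j; rewrite -[leLHS](expRK 1) ler_ln ?posrE ?expR_gt0.
  have h2 : b' @ \oo --> +oo%R.
    by apply: cvg_trans boo; apply: near_eq_cvg; move: bb; apply: filterS.
  apply: cvg_trans (hL h1 h2); apply: near_eq_cvg.
  by move: bb; apply: filterS => j ->.
exact: cvg_pinfty_seq hseq.
Qed.

End Cube.

End Monomial.

(** * Charts and the resolution *)

Section Charts.
Context {R : realType}.

Lemma within_open_at (T U : topologicalType) (A : set T) (f : T -> U) (x : T) :
  open A -> A x -> {within A, continuous f} -> {for x, continuous f}.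
Proof. by move=> oA Ax; rewrite continuous_open_subspace// => /(_ x); rewrite inE; apply. Qed.

Variables (M : topologicalType) (n : nat) (c : @chart R M n).
Hypothesis cc : is_chart c.

Lemma chart_bwdK y : chart_cod c y -> chart_fwd c (chart_bwd c y) = y.
Proof. by have [_ _ h _ _] := cc => -[p dp <-]; rewrite h. Qed.

Lemma chart_fwdK p : chart_dom c p -> chart_bwd c (chart_fwd c p) = p.
Proof. by have [_ _ h _ _] := cc; exact: h. Qed.

Lemma chart_bwd_dom y : chart_cod c y -> chart_dom c (chart_bwd c y).
Proof. by have [_ _ h _ _] := cc => -[p dp <-]; rewrite h. Qed.

Lemma chart_fwd_cod p : chart_dom c p -> chart_cod c (chart_fwd c p).
Proof. by move=> dp; exists p. Qed.

Lemma chart_fwd_continuous p : chart_dom c p -> {for p, continuous (chart_fwd c)}.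
Proof. by have [h _ _ h2 _] := cc => dp; exact: within_open_at dp h2. Qed.

Lemma chart_bwd_continuous y : chart_cod c y -> {for y, continuous (chart_bwd c)}.
Proof. by have [_ h _ _ h2] := cc => dp; exact: within_open_at dp h2. Qed.

Lemma chart_fwd_near (P : set 'rV[R]_n) p : chart_dom c p -> (\forall y \near chart_fwd c p, P y) ->
  \forall q \near p, chart_dom c q /\ P (chart_fwd c q).
Proof.
move=> dp nP; have [od _ _ _ _] := cc; near=> q; split; near: q; first exact: open_nbhs_nbhs.
exact: (chart_fwd_continuous dp nP).
Unshelve. all: by end_near. Qed.

Lemma chart_bwd_near (P : set M) y : chart_cod c y -> (\forall p \near chart_bwd c y, P p) ->
  \forall z \near y, chart_cod c z /\ P (chart_bwd c z).
Proof.
move=> dy nP; have [_ od _ _ _] := cc; near=> z; split; near: z; first exact: open_nbhs_nbhs.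
exact: (chart_bwd_continuous dy nP).
Unshelve. all: by end_near. Qed.

Lemma chart_bwd_imageE (N : set 'rV[R]_n) : N `<=` chart_cod c ->
  chart_bwd c @` N = chart_dom c `&` chart_fwd c @^-1` N.
Proof.
move=> Nc; apply/seteqP; split=> p.
  by move=> [y Ny <-]; split; [exact: chart_bwd_dom (Nc _ Ny)|rewrite /= chart_bwdK//; exact: Nc].
by move=> [dp Np]; exists (chart_fwd c p) => //; exact: chart_fwdK.
Qed.

Lemma open_chart_bwd (N : set 'rV[R]_n) : open N -> N `<=` chart_cod c -> open (chart_bwd c @` N).
Proof.
move=> oN Nc; rewrite chart_bwd_imageE// openE => p [dp Np].
exact: (chart_fwd_near dp (open_nbhs_nbhs (conj oN Np))).
Qed.

Lemma compact_chart_bwd (L : set 'rV[R]_n) : compact L -> L `<=` chart_cod c -> compact (chart_bwd c @` L).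
Proof.
move=> cL Lc; apply: continuous_compact => //; have [_ _ _ _ h] := cc.
exact: continuous_subspaceW Lc h.
Qed.

(** Functions with compact support in the domain of a chart extend by zero to
    the whole space. *)
Definition chart_ext (phi : 'rV[R]_n -> R) (p : M) : R :=
  if `[< chart_dom c p >] then phi (chart_fwd c p) else 0.

Lemma chart_ext_dom phi p : chart_dom c p -> chart_ext phi p = phi (chart_fwd c p).
Proof. by move=> dp; rewrite /chart_ext asboolT. Qed.

Lemma chart_ext_bwd phi y : chart_cod c y -> chart_ext phi (chart_bwd c y) = phi y.
Proof. by move=> cy; rewrite chart_ext_dom ?chart_bwdK//; exact: chart_bwd_dom. Qed.

(** Off the compact image of the support, which is closed in a Hausdorff space,
    the extension vanishes. *)
Lemma chart_ext_continuous (phi : 'rV[R]_n -> R) (L : set 'rV[R]_n) :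
  hausdorff_space M -> compact L -> L `<=` chart_cod c -> continuous phi ->
  (forall y, ~ L y -> phi y = 0) -> continuous (chart_ext phi).
Proof.
move=> hM cL Lc cphi phi0 p; have [dp|dp] := pselect (chart_dom c p).
  have h := continuous_comp (chart_fwd_continuous dp) (cphi (chart_fwd c p)).
  rewrite /continuous_at chart_ext_dom//; apply: cvg_trans h; apply: near_eq_cvg.
  have [od _ _ _ _] := cc.
  by apply: filterS (open_nbhs_nbhs (conj od dp)) => q dq; rewrite chart_ext_dom.
have cK : closed (chart_bwd c @` L) by exact: compact_closed hM (compact_chart_bwd cL Lc).
have nK : ~ (chart_bwd c @` L) p by move=> [y Ly yp]; apply: dp; rewrite -yp; exact: chart_bwd_dom (Lc _ Ly).
have n0 : \forall q \near p, chart_ext phi q = 0.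
  have oC : open (~` (chart_bwd c @` L)) by exact: closed_openC.
  apply: filterS (open_nbhs_nbhs (conj oC nK)) => q nq; rewrite /chart_ext; case: asboolP => // dq.
  by apply: phi0 => Lq; apply: nq; exists (chart_fwd c q) => //; exact: chart_fwdK.
rewrite /continuous_at (nbhs_singleton n0).
by apply: cvg_near_cst.
Qed.

End Charts.

Section AnalyticMaps.
Context {R : realType}.

(** The columns of the derivative are the strict derivatives of the
    coordinates. *)
Lemma analytic_map_sdiff n p (U : set 'rV[R]_n) (f : 'rV[R]_n -> 'rV[R]_p) x :
  analytic_map_on U f -> U x -> exists A, sdiff f x A.
Proof.
move=> af Ux; have /choice[a ha] : forall j, exists a, sdiff1 (fun y => f y ord0 j) x a.
  by move=> j; exact: analytic_sdiff1 (af j x Ux).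
exists (\matrix_(i, j) a j i ord0); apply: sdiff_coord => j.
have -> : col j (\matrix_(i, j) a j i ord0) = a j by apply/colP => i; rewrite !mxE.
exact: ha.
Qed.

End AnalyticMaps.

Section ResolutionBasics.
Context {R : realType} {d : nat}.
Variables (V : 'rV[R]_d -> R) (D : set 'rV[R]_d) (X : resolution_data R d).
Hypothesis RX : resolution V D X.
Hypothesis oD : open D.
Notation M := (rd_space X).
Notation pi := (rd_proj X).

Lemma res_hausdorff : hausdorff_space M. Proof. by have [] := res_space RX. Qed.

Lemma atlas_chart c : rd_atlas X c -> is_chart c.
Proof. by have [_ _ [h _ _]] := res_space RX; exact: h. Qed.

Lemma atlas_cover p : exists2 c, rd_atlas X c & chart_dom c p.
Proof. by have [_ _ [_ h _]] := res_space RX; exact: h. Qed.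

Lemma atlas_analytic_chart c : rd_atlas X c -> analytic_chart (rd_atlas X) c.
Proof.
have [_ _ [h _ h2]] := res_space RX => Ac; split; first exact: h.
by move=> c' Ac'; split; exact: h2.
Qed.

(** Analyticity of the projection is given in the charts of the atlas, and the
    transition to another analytic chart is strictly differentiable. *)
Lemma proj_sdiff c y : analytic_chart (rd_atlas X) c -> chart_cod c y ->
  exists A, sdiff (pi \o chart_bwd c) y A.
Proof.
move=> [cc ct] cy; have [c0 A0 d0] := atlas_cover (chart_bwd c y).
have cc0 := atlas_chart A0; have [t1 t2] := ct c0 A0.
have dy := chart_bwd_dom cc cy.
have [A hA] : exists A, sdiff (chart_fwd c0 \o chart_bwd c) y A.
  apply: (analytic_map_sdiff t1); exists (chart_bwd c y) => //; exact: chart_bwdK.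
have [B hB] : exists B, sdiff (pi \o chart_bwd c0) (chart_fwd c0 (chart_bwd c y)) B.
  apply: (@analytic_map_sdiff R d d (chart_fwd c0 @` (chart_dom c0 `&` setT))).
    by move=> j; exact: (res_analytic RX j A0).
  by exists (chart_bwd c y).
exists (A *m B); apply: sdiff_near (sdiff_comp hA hB).
have [od0 _ _ _ _] := cc0.
have := chart_bwd_near cc cy (open_nbhs_nbhs (conj od0 d0)); apply: filterS => z [cz dz] /=.
by rewrite chart_fwdK.
Qed.

Lemma rd_proj_continuous : continuous pi.
Proof.
move=> p; have [c Ac dp] := atlas_cover p; have cc := atlas_chart Ac.
have [A hA] := proj_sdiff (atlas_analytic_chart Ac) (chart_fwd_cod dp).
have h := continuous_comp (chart_fwd_continuous cc dp) (sdiff_continuous hA).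
have e : pi p = (pi \o chart_bwd c) (chart_fwd c p) by rewrite /= chart_fwdK.
rewrite /continuous_at e; apply: cvg_trans h; apply: near_eq_cvg.
have [od _ _ _ _] := cc.
by apply: filterS (open_nbhs_nbhs (conj od dp)) => q dq; rewrite /= chart_fwdK.
Qed.

(** The same passage between charts as for the projection. *)
Lemma inverse_sdiff (O : set 'rV[R]_d) (g : 'rV[R]_d -> M) c x :
  open O -> {within O, continuous g} ->
  (forall c, rd_atlas X c -> analytic_map_on (O `&` g @^-1` chart_dom c) (chart_fwd c \o g)) ->
  analytic_chart (rd_atlas X) c -> O x -> chart_dom c (g x) ->
  exists A, sdiff (chart_fwd c \o g) x A.
Proof.
move=> oO cg ag [cc ct] Ox dx; have [c0 A0 d0] := atlas_cover (g x).
have cc0 := atlas_chart A0; have [t1 t2] := ct c0 A0.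
have [A hA] : exists A, sdiff (chart_fwd c0 \o g) x A by exact: (analytic_map_sdiff (ag _ A0)).
have [B hB] : exists B, sdiff (chart_fwd c \o chart_bwd c0) ((chart_fwd c0 \o g) x) B.
  by apply: (analytic_map_sdiff t2); exists (g x).
exists (A *m B); apply: sdiff_near (sdiff_comp hA hB).
have gx := within_open_at oO Ox cg; have [od0 _ _ _ _] := cc0.
have nz : \forall z \near x, chart_dom c0 (g z) := gx _ (open_nbhs_nbhs (conj od0 d0)).
by apply: filterS nz => z dz /=; rewrite chart_fwdK.
Qed.

Lemma divisor_closed a : closed (rd_div X a).
Proof. by have [] := res_divisor RX a. Qed.

Lemma stratum_closed (A : {set rd_index X}) : closed (stratum A).
Proof. by apply: closed_bigI => a _; exact: divisor_closed. Qed.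

Lemma Cset_closed lam m : closed (Cset X lam m).
Proof.
apply: closedU; apply: closed_bigcup; try exact: finite_finset.
- by move=> a _; exact: divisor_closed.
- by move=> A _; exact: stratum_closed.
Qed.

(** The part of [D] away from the image of the more singular strata. *)
Definition Dreg lam m := D `\` (pi @` Cset X lam m).

(** The image of the closed set of excluded points is closed in [D], as the
    projection is proper. *)
Lemma Dreg_open lam m : open (Dreg lam m).
Proof.
rewrite openE => x [Dx nx].
have [_ _ DW] := res_base RX.
have [e /= e0 eD] : exists2 e : R, 0 < e & forall y, `|y - x| <= e -> D y.
  have /nbhs_normP[e /= e0 he] := open_nbhs_nbhs (conj oD Dx).
  exists (e / 2); first exact: divr_gt0.
  move=> y hy; apply: he; rewrite /ball_/= distrC; apply: le_lt_trans hy _.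
  by rewrite ltr_pdivrMr// ltr_pMr// ltr1n.
pose K := [set y | `|y - x| <= e].
have cK : compact (pi @^-1` K).
  apply: (res_proper RX); last exact: compact_ball_rV.
  by move=> y Ky; apply: DW; apply: subset_closure; exact: eD.
have cI : closed (pi @` (pi @^-1` K `&` Cset X lam m)).
  apply: compact_rV_closed; apply: continuous_compact; last first.
    apply: (subclosed_compact _ cK) => //; apply: closedI; last exact: Cset_closed.
    exact: compact_closed res_hausdorff cK.
  exact: continuous_subspaceT rd_proj_continuous.
have nxI : (~` (pi @` (pi @^-1` K `&` Cset X lam m))) x.
  by move=> [p [_ Cp] px]; apply: nx; exists p.
have oI := closed_openC cI.
have h1 := open_nbhs_nbhs (conj oI nxI).
have h2 : \forall y \near x, `|y - x| < e.
  by apply/nbhs_normP; exists e => // y /=; rewrite distrC.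
near=> y; split; first by apply: eD; apply: ltW; near: y.
move=> [p Cp py]; suff : (pi @` (pi @^-1` K `&` Cset X lam m)) y by near: y.
by exists p => //; split => //; rewrite /K /= py; apply: ltW; near: y.
Unshelve. all: by end_near. Qed.

(** Removing the saturation of the excluded set upstairs amounts to removing
    its image downstairs. *)
Lemma Eset_regE lam m p : Eset D X lam m p <->
  Dreg lam m (pi p) /\ exists A : {set rd_index X}, [/\ A \subset crit X lam, #|A| = m & stratum A p].
Proof.
split.
  move=> [[Dp [A [Ac Am] Ap]] nC]; split; last by exists A.
  by split => // -[q Cq qp]; apply: nC; exists q.
move=> [[Dp nC] [A [Ac Am Ap]]]; split; last by move=> [q Cq qp]; apply: nC; exists q.
by split => //; exists A.
Qed.

End ResolutionBasics.

(** * Good cubes and their face measures *)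

Section Powers.
Context {R : realType}.
Notation mu := (@lebesgue_measure R).

Lemma measurable_norm_powR (e : R) : measurable_fun setT ((fun t => `|t| `^ e) : measurableTypeR R -> measurableTypeR R).
Proof. by apply: (@measurableT_comp _ _ _ _ _ _ (fun x : R => x `^ e)). Qed.

(** Away from zero every power is bounded. *)
Lemma integral_powR_away (a r e : R) : r < `|a| ->
  (\int[mu]_t (\1_(`[a - r, a + r]%classic) t * `|t| `^ e)%:E < +oo)%E.
Proof.
move=> ra; pose dl := `|a| - r; pose K := dl `^ e + (`|a| + `|r|) `^ e.
have dl0 : 0 < dl by rewrite subr_gt0.
have ar0 : 0 < `|a| + `|r| by have := ler_norm (- r); rewrite normrN; move: ra; lra.
have K0 : 0 <= K by rewrite addr_ge0 ?powR_ge0.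
have mI : measurable (`[a - r, a + r]%classic : set (measurableTypeR R)) by exact: measurable_itv.
apply: (@le_lt_trans _ _ (\int[mu]_t (K%:E * (\1_(`[(a - r)%R, (a + r)%R]%classic) t)%:E))%E).
  apply: ge0_le_integral => //.
  - apply/measurable_EFinP; apply: measurable_funM; first exact: measurable_indic.
    exact: measurable_norm_powR.
  - by apply: measurable_funeM; apply/measurable_EFinP; exact: measurable_indic.
  move=> t _; rewrite -EFinM lee_fin indicE mem_setE in_itv/=.
  case: (boolP (a - r <= t <= a + r)) => [/andP[h1 h2]|_] /=; last by rewrite mul0r mulr0.
  rewrite mul1r mulr1.
  have b1 : dl <= `|t|.
    have := ler_normB a t; have : `|a - t| <= r by rewrite ler_norml; apply/andP; split; lra.
    have := ler_distD t a 0; rewrite !subr0 /dl; lra.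
  have b2 : `|t| <= `|a| + `|r|.
    have : `|a - t| <= r by rewrite ler_norml; apply/andP; split; lra.
    have := ler_distD a t 0; rewrite !subr0 [`|t - a|]distrC; have := ler_norm r; lra.
  have t0 : 0 < `|t| by exact: lt_le_trans b1.
  rewrite /K; have [e0|e0] := leP 0 e.
    apply: ler_wpDl; first exact: powR_ge0.
    by rewrite ge0_ler_powR ?nnegrE// ltW.
  apply: ler_wpDr; first exact: powR_ge0.
  rewrite -[e]opprK !(powRN _ (- e)) lef_pV2 ?posrE ?powR_gt0//.
  by rewrite ge0_ler_powR ?nnegrE ?oppr_ge0// ltW.
rewrite ge0_integralZl//; last by apply/measurable_EFinP; exact: measurable_indic.
rewrite integral_indic//= setIT lebesgue_measure_itv/= lte_fin.
by case: ifP => _; rewrite ?mule0 ?ltry// -EFinD -EFinM ltry.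
Qed.

Lemma integral_powR_center (r e : R) : 0 < r -> 0 < e + 1 ->
  (\int[mu]_t (\1_(`[0 - r, 0 + r]%classic) t * `|t| `^ e)%:E < +oo)%E.
Proof.
move=> r0 e1; rewrite sub0r add0r.
have mf : measurable_fun setT ((fun t => (\1_(`[- r, r]%classic) t * `|t| `^ e)%:E) : measurableTypeR R -> \bar R).
  apply/measurable_EFinP; apply: measurable_funM; first exact: measurable_indic.
  exact: measurable_norm_powR.
have f0 t : (0 <= (\1_(`[(- r)%R, r]%classic) t * `|t| `^ e)%:E)%E by rewrite lee_fin mulr_ge0// powR_ge0.
rewrite (integral_even mf f0); last first.
  by move=> t; rewrite normrN !indicE !mem_setE !in_itv/= lerN2 andbC lerNl.
rewrite (_ : (\int[mu]_(t in `]0%R, +oo[) _)%E = (\int[mu]_(t in `]0%R, r]) (t `^ ((e + 1) - 1))%:E)%E).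
  by rewrite integral_powR// -EFinM ltry.
rewrite integral_mkcond [RHS]integral_mkcond; apply: eq_integral => t _.
rewrite !patchE !mem_setE !in_itv/= andbT addrK; case: ltP => //= t0.
rewrite indicE mem_setE in_itv/= (le_trans _ (ltW t0)) ?oppr_le0 ?(ltW r0)//=.
by case: leP => tr; rewrite ?mul0r// mul1r gtr0_norm.
Qed.

End Powers.

Section GoodCubes.
Context {R : realType} {d : nat}.
Variables (V : 'rV[R]_d -> R) (D : set 'rV[R]_d) (X : resolution_data R d).
Hypothesis RX : resolution V D X.
Hypothesis oD : open D.
Variables (lam : R) (m : nat).
Hypothesis lam0 : 0 < lam.
Hypothesis m0 : (0 < m)%N.
Notation M := (rd_space X).
Notation pi := (rd_proj X).

(** A cube in a monomializing chart, with the labels and the unit factor of the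
    Jacobian in that chart. *)
Record cube := Cube {
  q_chart : @chart R M d ;
  q_lab : 'I_d -> option (rd_index X) ;
  q_b : 'rV[R]_d -> R ;
  q_center : 'rV[R]_d ;
  q_radius : R }.

Implicit Types q : cube.

Definition q_closed q := [set y : 'rV[R]_d | `|y - q_center q| <= q_radius q].
Definition q_open q := [set y : 'rV[R]_d | `|y - q_center q| < q_radius q].
Definition q_nbhs q := chart_bwd (q_chart q) @` q_open q.

(** The conditions under which the Laplace integral over the cube is governed
    by the critical coordinates that vanish at its centre: over the regular
    part of [D] no divisor of smaller ratio meets the cube, and a divisor
    either misses the cube or passes through its centre. *)
Record good_cube q : Prop := GoodCube {
  gc_mono : monomializing V X (q_chart q) (q_lab q) (q_b q) ;
  gc_radius : 0 < q_radius q ;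
  gc_cod : q_closed q `<=` chart_cod (q_chart q) ;
  gc_reg : forall y, q_closed q y -> Dreg D X lam m (pi (chart_bwd (q_chart q) y)) ;
  gc_lab : forall i a, q_lab q i = Some a ->
     q_radius q < `|q_center q ord0 i| \/ (q_center q ord0 i = 0 /\ lam <= @Defs.ratio R d X a) }.

Definition q_crit q : {set 'I_d} :=
  [set i | (q_center q ord0 i == 0) && (if q_lab q i is Some a then @Defs.ratio R d X a == lam else false)]%SET.

(** On the regular part of [D] a divisor through the point cannot have a ratio
    smaller than [lam], and a small radius avoids the divisors that do not
    contain the point. *)
Lemma good_cube_exists (c : @chart R M d) lab b p :
  monomializing V X c lab b -> chart_dom c p -> Dreg D X lam m (pi p) ->
  forall U : set M, open U -> U p ->
  exists2 r, good_cube (Cube c lab b (chart_fwd c p) r) & forall y, `|y - chart_fwd c p| <= r -> U (chart_bwd c y).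
Proof.
move=> mo dp Dp U oU Up; have [[cc ct] h1 h2 h3] := mono_chart mo.
set y0 := chart_fwd c p; have cy0 : chart_cod c y0 by exists p.
have bp : chart_bwd c y0 = p by exact: chart_fwdK.
have n1 : \forall q \near p, Dreg D X lam m (pi q) /\ U q.
  have hpi : {for p, continuous pi} by move: (rd_proj_continuous RX) => hp; exact: hp.
  have oDr : open (Dreg D X lam m) by exact: (@Dreg_open _ _ V D X RX oD lam m).
  have n0 : \forall q \near p, Dreg D X lam m (pi q) := hpi _ (open_nbhs_nbhs (conj oDr Dp)).
  by move: n0 (open_nbhs_nbhs (conj oU Up)); apply: filterS2 => z hz1 hz2; split.
have n2 : \forall q \near chart_bwd c y0, Dreg D X lam m (pi q) /\ U q by rewrite bp.
have := chart_bwd_near cc cy0 n2 => /nbhs_normP[e /= e0 he].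
have [r1 r10 hr1] := coord_gap y0.
pose r := Num.min r1 (e / 2); have r0 : 0 < r by rewrite lt_min r10 divr_gt0.
have hr y : `|y - y0| <= r -> chart_cod c y /\ Dreg D X lam m (pi (chart_bwd c y)) /\ U (chart_bwd c y).
  move=> hy; apply: he; rewrite /ball_/= distrC; apply: le_lt_trans hy _.
  apply: (@le_lt_trans _ _ (e / 2)); first by rewrite ge_min lexx orbT.
  by rewrite ltr_pdivrMr// ltr_pMr// ltr1n.
exists r; last by move=> y /hr[_ []].
split => //=.
- by move=> y /= /hr[].
- by move=> y /= /hr[_ []].
- move=> i a la; have [yi|yi] := eqVneq (y0 ord0 i) 0; last first.
    by left; apply: le_lt_trans (hr1 i yi); rewrite ge_min lexx.
  right; split => //; rewrite leNgt; apply/negP => al.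
  have Eap : rd_div X a p by apply/(h3 i a la).
  by have [_] := Dp; apply; exists p => //; left; exists a => //=; rewrite inE.
Unshelve. all: by end_near. Qed.

Section one_cube.
Variable q : cube.
Hypothesis gq : good_cube q.
Notation c := (q_chart q).
Notation lab := (q_lab q).
Notation b := (q_b q).
Notation y0 := (q_center q).
Notation r := (q_radius q).
Notation J := (q_crit q).

Lemma q_is_chart : is_chart c.
Proof. by have [[]] := mono_chart (gc_mono gq). Qed.

Lemma q_open_closed : q_open q `<=` q_closed q.
Proof. by move=> y /ltW. Qed.

Lemma q_open_cod : q_open q `<=` chart_cod c.
Proof. by move=> y /q_open_closed; exact: gc_cod. Qed.

Lemma q_open_open : open (q_open q).
Proof.
rewrite (_ : q_open q = ball y0 r); first exact: ball_open.
by rewrite -ball_normE; apply/seteqP; split=> y /=; rewrite /q_open/= distrC.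
Qed.

Lemma q_nbhs_open : open (q_nbhs q).
Proof. by apply: (open_chart_bwd q_is_chart) => //; [exact: q_open_open|exact: q_open_cod]. Qed.

Lemma q_closed_compact : compact (q_closed q).
Proof. exact: compact_ball_rV. Qed.

Lemma q_closed_coord y : q_closed q y <-> forall i, `[y0 ord0 i - r, y0 ord0 i + r]%classic (y ord0 i).
Proof.
split=> [h i|h].
  have := rV_coord_le (y - y0) i; rewrite !mxE => /le_trans/(_ h).
  by rewrite /= in_itv/= ler_distl.
apply: rV_norm_le; first by apply: ltW; exact: gc_radius.
by move=> i; rewrite !mxE ler_distl; have := h i; rewrite /= in_itv.
Qed.

Lemma q_critP i : reflect (y0 ord0 i = 0 /\ exists2 a, lab i = Some a & @Defs.ratio R d X a = lam) (i \in J).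
Proof.
rewrite inE; apply: (iffP andP) => -[/eqP h1 h2]; split => //; last first.
  by case: h2 => a -> /eqP.
by move: h2; case: (lab i) => // a /eqP ra; exists a.
Qed.

(** The divisors through a point of the face [y_J = 0], [J] the critical
    coordinates, form a stratum. *)
Definition q_labels : {set rd_index X} := [set a | [exists i in J, lab i == Some a]]%SET.

Lemma q_labels_crit : q_labels \subset crit X lam.
Proof.
apply/fintype.subsetP => a; rewrite inE => /fintype.existsP[i /andP[/q_critP[_ [a' la ra]] /eqP la']].
by move: la'; rewrite la => -[<-]; rewrite inE ra.
Qed.

Lemma q_labels_card : #|q_labels| = #|J|.
Proof.
have [_ _ inj _] := mono_chart (gc_mono gq).
have [J0|/set0Pn[i0 i0J]] := eqVneq J finset.set0.
  rewrite J0 cards0; apply/eqP; rewrite cards_eq0; apply/eqP/setP => a; rewrite !inE.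
  by apply: negbTE; rewrite negb_exists; apply/forallP => i; rewrite J0 inE.
have [_ [a0 la0 _]] := q_critP _ i0J.
pose f i := odflt a0 (lab i).
have -> : q_labels = f @: J.
  apply/setP => a; rewrite inE; apply/fintype.existsP/imsetP => [[i /andP[iJ /eqP la]]|[i iJ ->]].
    by exists i => //; rewrite /f la.
  by exists i; rewrite iJ /f; have [_ [a' la _]] := q_critP _ iJ; rewrite la /= eqxx.
apply: card_in_imset => i j iJ jJ; have [_ [a la _]] := q_critP _ iJ; have [_ [a' la' _]] := q_critP _ jJ.
by rewrite /f la la' /= => aa; rewrite -aa in la'; exact: inj la la'.
Qed.

Lemma q_face_stratum y : q_closed q y -> (forall i, i \in J -> y ord0 i = 0) ->
  stratum q_labels (chart_bwd c y).
Proof.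
have [_ _ _ h3] := mono_chart (gc_mono gq).
move=> qy yJ a /=; rewrite inE => /fintype.existsP[i /andP[iJ /eqP la]].
have cy := gc_cod gq qy.
by apply/(h3 i a la); [exact: chart_bwd_dom q_is_chart _ cy|rewrite chart_bwdK ?yJ//; exact: q_is_chart].
Qed.

Lemma q_center_closed : q_closed q y0.
Proof. by rewrite /q_closed/= subrr normr0; apply: ltW; exact: gc_radius. Qed.

(** A larger number of critical divisors through the centre would make the
    centre a point of the excluded set. *)
Lemma q_crit_le : (#|J| <= m)%N.
Proof.
rewrite leqNgt; apply/negP => mJ.
have [_] := gc_reg gq q_center_closed; apply; exists (chart_bwd c y0) => //; right.
exists q_labels; first by split; [exact: q_labels_crit|rewrite q_labels_card].
by apply: q_face_stratum; [exact: q_center_closed|move=> i /q_critP[]].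
Qed.

Lemma q_b_continuous y : chart_cod c y -> {for y, continuous b}.
Proof.
move=> cy; have [ab _] := mono_b (gc_mono gq).
have [a ha] := analytic_sdiff1 (ab y cy).
have h : sdiff (fun z => (\row_(j < 1) b z) : 'rV[R]_1) y a.
  apply: sdiff_coord => j; rewrite (_ : col j a = a); last first.
    by apply/matrixP => i k; rewrite !mxE (ord1 j) (ord1 k).
  move=> e e0; have [dl dl0 hd] := ha e e0; exists dl => // y' z' h1 h2.
  rewrite [X in X - _ - _]mxE [X in _ - X - _]mxE; exact: hd.
have := sdiff_continuous h => h1.
have h2 := continuous_comp h1 (@coord_continuous R 1 1 ord0 ord0 _).
rewrite (_ : b = (fun N : 'M[R]_(1, 1) => N ord0 ord0) \o (fun z => \row_(j < 1) b z)); last first.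
  by apply/funext => z; rewrite /= mxE.
exact: h2.
Qed.

Lemma q_b_bound : exists2 B, 0 <= B & forall y, q_closed q y -> 0 <= b y <= B.
Proof.
have [_ bp] := mono_b (gc_mono gq).
have cb : {within q_closed q, continuous b}.
  by apply: continuous_in_subspaceT => y; rewrite inE => qy; apply: q_b_continuous; exact: gc_cod.
have cI := continuous_compact cb q_closed_compact.
have [B [_ hB]] := compact_bounded cI.
exists (`|B| + 1); first by rewrite addr_ge0.
move=> y qy; have b0 := bp y (gc_cod gq qy); rewrite (ltW b0)/=.
have : `|b y| <= `|B| + 1.
  by apply: hB; [apply: (le_lt_trans (ler_norm B)); rewrite ltrDl|exists y].
exact: le_trans (ler_norm _).
Qed.

(** The density coefficient with the unit factor read at the point itself,
    which agrees with its value on the face almost everywhere; it vanishes when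
    the face has too small a codimension to contribute. *)
Definition q_weight (y : 'rV[R]_d) : R :=
  if #|J| == m then
    Gamma lam / (m.-1)`!%:R * (b y / \prod_(i in J) (num_at (rd_k X) lab i)%:R) *
    \prod_(i in ~: J) `| y ord0 i | `^
     (- (2 * (num_at (rd_k X) lab i)%:R * lam) + (num_at (rd_h X) lab i)%:R)
  else 0.

Lemma q_weight_ge0 y : q_closed q y -> 0 <= q_weight y.
Proof.
move=> qy; rewrite /q_weight; case: ifP => // _; have [_ bp] := mono_b (gc_mono gq).
apply: mulr_ge0; last by apply: prodr_ge0 => i _; exact: powR_ge0.
apply: mulr_ge0; first by rewrite divr_ge0// ltW// Gamma_gt0.
by apply: divr_ge0; [apply/ltW/bp; exact: gc_cod|apply: prodr_ge0].
Qed.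

Lemma q_closed_borel : measurable (q_closed q : set (borel 'rV[R]_d)).
Proof. exact: compact_borel q_closed_compact. Qed.

Lemma measurable_q_b : measurable_fun (q_closed q : set (borel 'rV[R]_d)) (b : borel 'rV[R]_d -> measurableTypeR R).
Proof.
apply: within_borel_fun; first exact: q_closed_borel.
by apply: continuous_in_subspaceT => y; rewrite inE => qy; apply: q_b_continuous; exact: gc_cod.
Qed.

Lemma measurable_q_weight : measurable_fun (q_closed q : set (borel 'rV[R]_d)) (q_weight : borel 'rV[R]_d -> measurableTypeR R).
Proof.
rewrite /q_weight; have [_|_] := boolP (#|J| == m); last exact: measurable_cst.
apply: measurable_funM.
  apply: measurable_funM; first exact: measurable_cst.
  by apply: measurable_funM; [exact: measurable_q_b|exact: measurable_cst].
rewrite (_ : (fun x => _) = (fun x : borel 'rV[R]_d => \prod_i (if i \in ~: J then `|(x : 'rV[R]_d) ord0 i| `^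
     (- (2 * (num_at (rd_k X) lab i)%:R * lam) + (num_at (rd_h X) lab i)%:R) else 1))); last first.
  by apply/funext => x; rewrite big_mkcond.
apply: measurable_prod => i _; apply: measurable_funTS; case: (i \in ~: J) => //.
by apply: (measurableT_comp (measurable_norm_powR _)); exact: rV_coord_measurable.
Qed.

Lemma measurable_q_bwd : measurable_fun (q_closed q : set (borel 'rV[R]_d)) (chart_bwd c : borel 'rV[R]_d -> borel M).
Proof.
apply: borel_continuous_within; first exact: q_closed_borel.
have [_ _ _ _ h] := q_is_chart; exact: continuous_subspaceW (gc_cod gq) h.
Qed.

(** The measure on the resolution to which the Laplace integrals of functions
    supported in the cube converge. *)
Definition q_measure : {measure set (borel M) -> \bar R} :=
  wpush (lebesgue_off J) q_closed_borel measurable_q_bwd measurable_q_weight q_weight_ge0.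

End one_cube.
End GoodCubes.

(** * The limit in a good cube *)

Section LocalLimit.
Context {R : realType} {d : nat}.
Variables (V : 'rV[R]_d -> R) (D : set 'rV[R]_d) (X : resolution_data R d).
Hypothesis RX : resolution V D X.
Hypothesis oD : open D.
Variables (lam : R) (m : nat).
Hypothesis lam0 : 0 < lam.
Hypothesis m0 : (0 < m)%N.
Notation M := (rd_space X).
Notation pi := (rd_proj X).
Variables (O : set 'rV[R]_d) (g : 'rV[R]_d -> M).
Hypothesis OE : O = pi @` ~` total_divisor V X.
Hypothesis oO : open O.
Hypothesis gK : forall p, ~ total_divisor V X p -> g (pi p) = p.
Hypothesis cg : {within O, continuous g}.
Hypothesis ag : forall c, rd_atlas X c -> analytic_map_on (O `&` g @^-1` chart_dom c) (chart_fwd c \o g).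

(** The Laplace integral of a function on the resolution, transported to the
    base by the inverse of the projection off the divisor. *)
Definition lift_laplace (beta : R) (F : M -> R) : \bar R :=
  \int[lebesgue_rV d]_(x in O) (F (g x) * expR (- (beta * V x)))%:E.

Variable q : cube X.
Hypothesis gq : good_cube V D lam m q.
Notation c := (q_chart q).
Notation lab := (q_lab q).
Notation b := (q_b q).
Notation y0 := (q_center q).
Notation r := (q_radius q).
Notation J := (q_crit lam q).
Notation k := (num_at (rd_k X) lab).
Notation h := (num_at (rd_h X) lab).

Let cc : is_chart c := q_is_chart gq.
Let Qc := @q_closed R d X q.
Let Qo := @q_open R d X q.

(** The chart expression of the projection is strictly differentiable with the
    Jacobian prescribed by the chart. *)
Lemma cube_phi : exists Dphi : 'rV[R]_d -> 'M[R]_d, forall y, Qo y ->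
  sdiff (pi \o chart_bwd c) y (Dphi y) /\ absdet Dphi y = b y * \prod_i `|y ord0 i| ^+ h i.
Proof.
have /choice[Dphi hD] : forall y, exists A, Qo y -> sdiff (pi \o chart_bwd c) y A.
  move=> y; have [qy|nq] := pselect (Qo y); last by exists 0.
  have [ac _ _ _] := mono_chart (gc_mono gq).
  by have [A hA] := proj_sdiff RX ac (q_open_cod gq qy); exists A.
exists Dphi => y qy; have hs := hD y qy; split => //.
rewrite /absdet -(sdiff_jacobian hs); apply: (mono_jac (gc_mono gq)); exact: q_open_cod gq _ qy.
Qed.

(** The trace of the total divisor on the cube. *)
Definition divisor_hyper (y : 'rV[R]_d) := exists i, isSome (lab i) /\ y ord0 i = 0.

Lemma cube_divisor y : Qc y -> total_divisor V X (chart_bwd c y) <-> divisor_hyper y.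
Proof.
move=> qy; have cy := gc_cod gq qy; have dy := chart_bwd_dom cc cy.
have [_ h1 _ h3] := mono_chart (gc_mono gq).
rewrite (res_preimage RX); split.
  move=> [a _ Ea]; have [i la] := (h1 a).1 (ex_intro _ _ (conj Ea dy)).
  exists i; rewrite la; split => //.
  by have := (h3 i a la _ dy).1 Ea; rewrite chart_bwdK.
move=> [i []]; case la : (lab i) => [a|//] _ yi; exists a => //.
by apply/(h3 i a la _ dy); rewrite chart_bwdK.
Qed.

Lemma divisor_hyper_closed : closed (divisor_hyper : set 'rV[R]_d).
Proof.
have E : divisor_hyper = \bigcup_(i in [set i | isSome (lab i)]) [set y : 'rV[R]_d | y ord0 i = 0].
  by apply/seteqP; split=> y; [move=> [i [h1 h2]]; exists i|move=> [i h1 h2]; exists i].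
rewrite E; apply: closed_bigcup; first exact: finite_finset.
by move=> i _; exact: hyperplane_closed.
Qed.

Lemma divisor_hyper_null : (lebesgue_rV d).-negligible (divisor_hyper : set (borel 'rV[R]_d)).
Proof.
pose A (i : 'I_d) : set R := ~` [set 0].
have mA i : measurable (A i : set (measurableTypeR R)) by exact: measurableC.
have A0 (i : 'I_d) : lebesgue_measure (~` A i) = 0%E :> \bar R.
  by rewrite setCK; exact: lebesgue_measure_set1.
apply: negligibleS (prod_measure_ae (nu := fun=> lebesgue_measure) mA A0) => y [i [_ yi]] /= hy.
by have := hy i; apply.
Qed.

Let F' (F : M -> R) (y : 'rV[R]_d) : R := if `|y - y0| <= r then F (chart_bwd c y) else 0.
Let b' (y : 'rV[R]_d) : R := if `|y - y0| <= r then b y else 0.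

Lemma cube_cut_measurable (f : 'rV[R]_d -> R) : {within Qc, continuous f} ->
  measurable_fun setT ((fun y => if `|y - y0| <= r then f y else 0) : borel 'rV[R]_d -> measurableTypeR R).
Proof.
move=> cf; rewrite (_ : (fun y => _) = f \_ Qc); last first.
  apply/funext => y; rewrite patchE; case: ifPn => hy; first by rewrite mem_set.
  by rewrite memNset//; apply/negP.
by apply/(measurable_restrictT _ (q_closed_borel q)); apply: within_borel_fun => //; exact: (q_closed_borel q).
Qed.

Let V' (y : 'rV[R]_d) := \prod_i `|y ord0 i| ^+ (2 * k i).

Let V'E y : Qc y -> V (pi (chart_bwd c y)) = V' y.
Proof.
move=> qy; rewrite (mono_V (gc_mono gq) (gc_cod gq qy)); apply: eq_bigr => i _.
by rewrite mulnC exprM [RHS]exprM -normrX [RHS]real_normK// num_real.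
Qed.

Let measurable_V' : measurable_fun setT (V' : borel 'rV[R]_d -> measurableTypeR R).
Proof.
apply: measurable_prod => i _; apply: measurable_funX.
by apply: measurableT_comp (rV_coord_measurable i); exact: normr_measurable.
Qed.

Let s (i : 'I_d) := i \notin J.

Lemma crit_countE : crit_count s = #|J|.
Proof.
rewrite /crit_count -sum1_card [RHS]big_mkcond; apply: eq_bigr => i _.
by rewrite /s negbK; case: (i \in J).
Qed.

Lemma off_critE : off (fun i => ~~ s i) = lebesgue_off J :> {measure set (borel 'rV[R]_d) -> \bar R}.
Proof. by rewrite /off /lebesgue_off /s; under eq_fun do rewrite negbK. Qed.

(** The noncritical exponents are integrable: either the coordinate stays away
    from zero on the cube, or the ratio of the divisor exceeds [lam]. *)
Lemma cube_hint i : s i -> (\int[lebesgue_measure]_t (\1_(`[(y0 ord0 i - r)%R, (y0 ord0 i + r)%R]%classic) t *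
    `|t| `^ (- (2 * (k i)%:R * lam) + (h i)%:R))%:E < +oo)%E.
Proof.
have r0 := gc_radius gq.
move=> si; have [y0r|y0r] := ltP r `|y0 ord0 i|; first exact: integral_powR_away.
case la : (lab i) => [a|]; last first.
  rewrite /num_at la/= mulr0 mul0r oppr0 addr0.
  apply: (@le_lt_trans _ _ (\int[lebesgue_measure]_t (\1_(`[(y0 ord0 i - r)%R, (y0 ord0 i + r)%R]%classic) t)%:E)%E).
    apply: ge0_le_integral => //.
    - apply/measurable_EFinP; apply: measurable_funM; first exact: measurable_indic.
      exact: measurable_norm_powR.
    - by apply/measurable_EFinP; exact: measurable_indic.
    - by move=> t _; rewrite powRr0 mulr1.
  rewrite integral_indic//= setIT lebesgue_measure_itv/= lte_fin.
  by case: ifP => _; rewrite ?ltry// -EFinD ltry.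
have [h1|[y00 lr]] := gc_lab gq la; first by move: (lt_le_trans h1 y0r); rewrite ltxx.
rewrite y00; apply: integral_powR_center => //.
have rn : Defs.ratio a != lam.
  apply: contra si => /eqP ra; rewrite /s; apply/q_critP; split => //; by exists a.
have : lam < Defs.ratio a by rewrite lt_neqAle eq_sym rn.
rewrite /Defs.ratio ltr_pdivlMr ?ltr0n ?muln_gt0 ?(res_knum RX)//.
rewrite /num_at la/= natrM -natr1 => hh.
rewrite addrC addrA -[X in _ < X]addrC -[_ * lam]mulrC; lra.
Qed.

(** The exponents of the noncritical coordinates are integrable over the cube. *)
Lemma q_measure_fin : (q_measure lam0 gq setT < +oo)%E.
Proof.
have r0 := gc_radius gq.
have hs i : ~~ s i -> (0 < k i)%N /\ (h i).+1%:R = (2 * k i)%:R * lam.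
  rewrite negbK => /q_critP[_ [a la ra]]; rewrite /num_at la/=; have ka := res_knum RX a.
  split => //; rewrite -ra /Defs.ratio mulrC divfK// pnatr_eq0 muln_eq0/= -lt0n; move: ka; by case: (rd_k X a).
have hy0 i : ~~ s i -> y0 ord0 i = 0 by rewrite negbK => /q_critP[].
have [Bb Bb0 hBb] := q_b_bound gq.
rewrite /q_measure wpushE preimage_setT setIT.
pose C := Gamma lam / (m.-1)`!%:R * (Bb / \prod_(i in J) (k i)%:R).
have C0 : 0 <= C.
  apply: mulr_ge0; first by rewrite divr_ge0// ltW// Gamma_gt0.
  by apply: divr_ge0 => //; apply: prodr_ge0.
have := face_integral_fin (lam := lam) (s := s) (k := k) (h := h) (r := r) (y0 := y0) cube_hint C0.
apply: le_lt_trans; rewrite off_critE integral_mkcond; apply: ge0_le_integral => //.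
- by move=> y _; rewrite patchE; case: ifP => // /set_mem qy; rewrite lee_fin (q_weight_ge0 lam0 gq).
- apply/(measurable_restrictT _ (q_closed_borel q)); apply/measurable_EFinP; exact: (measurable_q_weight gq).
- apply/measurable_EFinP; apply: measurable_funM => //; apply: measurable_prod => i _.
  exact: (measurableT_comp (measurable_face_factor lam s k h r y0 i) (rV_coord_measurable i)).
move=> y _; rewrite patchE; case: ifPn => [/set_mem qy|_]; last first.
  rewrite lee_fin mulr_ge0//; apply: prodr_ge0 => i _.
  by rewrite mulr_ge0//; case: ifP => // _; exact: powR_ge0.
rewrite lee_fin /q_weight; case: ifP => _; last first.
  rewrite mulr_ge0//; apply: prodr_ge0 => i _.
  by rewrite mulr_ge0//; case: ifP => // _; exact: powR_ge0.
have -> : \prod_i (\1_(`[(y0 ord0 i - r)%R, (y0 ord0 i + r)%R]%classic) (y ord0 i) *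
     (if s i then `|y ord0 i| `^ (- (2 * (k i)%:R * lam) + (h i)%:R) else 1)) =
      \prod_(i in ~: J) `|y ord0 i| `^ (- (2 * (k i)%:R * lam) + (h i)%:R).
  rewrite [RHS]big_mkcond; apply: eq_bigr => i _; rewrite indicE mem_set ?mul1r; last exact: (q_closed_coord gq y).1.
  by rewrite /s finset.in_setC.
apply: ler_wpM2r; first by apply: prodr_ge0 => i _; exact: powR_ge0.
apply: ler_wpM2l; first by rewrite divr_ge0// ltW// Gamma_gt0.
apply: ler_wpM2r; first by rewrite invr_ge0; apply: prodr_ge0.
by have /andP[] := hBb y qy.
Qed.

(** The measure lives on the face of the critical coordinates, which lies in a
    stratum of codimension [m] over the regular part of [D]. *)
Lemma q_measure_Eset (A : set M) : measurable (A : set (borel M)) ->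
  (forall p, A p -> ~ Eset D X lam m p) -> q_measure lam0 gq A = 0%E.
Proof.
move=> mA hA; rewrite /q_measure wpushE.
have [Jm|Jm] := boolP (#|J| == m); last first.
  by rewrite integral0_eq// => y _; rewrite /q_weight (negbTE Jm).
pose Z i : set R := if i \in J then [set 0] else setT.
have mZ i : measurable (Z i : set (measurableTypeR R)) by rewrite /Z; case: ifP.
have Z0 i : coord_measure (i \in J) (~` Z i) = 0%E :> \bar R.
  rewrite /Z; case: (i \in J) => /=; last by rewrite setCT measure0.
  by rewrite diracE memNset//= => /(_ erefl).
have mQA : measurable (Qc `&` chart_bwd c @^-1` A : set (borel 'rV[R]_d)).
  exact: (measurable_q_bwd gq (q_closed_borel q) mA).
have -> : (\int[lebesgue_off J]_(x in Qc `&` chart_bwd c @^-1` A) (q_weight lam m q x)%:E =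
    \int[lebesgue_off J]_(x in Qc `&` chart_bwd c @^-1` A) 0)%E; last by rewrite integral0.
apply: ae_eq_integral => //.
  apply/measurable_EFinP; have mw := measurable_q_weight gq; exact: (measurable_funS (q_closed_borel q) (@subIsetl _ _ _) mw).
apply: (@negligibleS _ _ _ (lebesgue_off J) _ _ _ (prod_measure_ae mZ Z0)) => y /=; apply: contra_notP => hy [qy Ay]; exfalso; apply: (hA _ Ay).
apply/Eset_regE; split; first exact: gc_reg gq _ qy.
exists (q_labels lam q); split; [exact: q_labels_crit|by rewrite (q_labels_card gq) (eqP Jm)|].
by apply: (q_face_stratum gq qy) => i iJ; have := contrapT hy i; rewrite /Z iJ.
Qed.

Section test_function.
Variables (F : M -> R) (B : R).
Hypothesis cF : continuous F.
Hypothesis F_bnd : forall p, 0 <= F p <= B.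
Hypothesis F_supp : forall p, ~ q_nbhs q p -> F p = 0.

Let cFb : {within Qc, continuous (F \o chart_bwd c)}.
Proof.
apply: continuous_in_subspaceT => y; rewrite inE => qy.
by have := continuous_comp (chart_bwd_continuous cc (gc_cod gq qy)) (@cF _).
Qed.

Let mF' : measurable_fun setT (F' F : borel 'rV[R]_d -> measurableTypeR R).
Proof. exact: cube_cut_measurable cFb. Qed.

Let F'0 y : 0 <= F' F y.
Proof. by rewrite /F'; case: ifP => // _; have /andP[] := F_bnd (chart_bwd c y). Qed.

(** Change of variables in the chart. The divisor is removed first, as the
    projection is only invertible off it, and is a null set in the chart. *)
Lemma lift_laplace_chart beta : lift_laplace beta F =
  (\int[lebesgue_rV d]_y (F' F y * b' y * (\prod_i `|y ord0 i| ^+ h i) * expR (- (beta * V' y)))%:E)%E.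
Proof.
have [Dphi hD] := cube_phi.
pose O1 := Qo `\` divisor_hyper.
have o1 : open O1.
  rewrite /O1 setDE; apply: openI; first exact: q_open_open.
  by apply: closed_openC; exact: divisor_hyper_closed.
have O1c : O1 `<=` chart_cod c by move=> y [/(q_open_cod gq)].
have O1C y : O1 y -> Qc y by move=> [/q_open_closed].
have nd y : O1 y -> ~ total_divisor V X (chart_bwd c y).
  by move=> o1y /(cube_divisor (O1C _ o1y)); case: o1y.
pose phi := pi \o chart_bwd c; pose psi := chart_fwd c \o g.
pose O2 := phi @` O1.
have gphi y : O1 y -> g (phi y) = chart_bwd c y by move=> o1y; exact: gK (nd _ o1y).
have O2O : O2 `<=` O by move=> x [y o1y <-]; rewrite OE; exists (chart_bwd c y) => //; exact: nd.
have O2E : O2 = O `&` g @^-1` (chart_bwd c @` O1).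
  apply/seteqP; split=> x.
    by move=> [y o1y <-]; split; [apply: O2O; exists y|exists y => //; rewrite gphi].
  move=> [Ox [y o1y gy]]; exists y => //; move: Ox; rewrite OE => -[p np px].
  by rewrite /phi/= gy -px gK.
have o2 : open O2.
  rewrite O2E openE => x [Ox gx]; apply: filterI; first exact: open_nbhs_nbhs.
  apply: (within_open_at oO Ox cg); apply: open_nbhs_nbhs; split => //.
  exact: open_chart_bwd.
have psiK y : O1 y -> psi (phi y) = y.
  by move=> o1y; rewrite /psi/= gphi// chart_bwdK//; exact: O1c.
have dphi y : O1 y -> sdiff phi y (Dphi y) by move=> [qy _]; exact: (hD y qy).1.
have /choice[Dpsi dpsi] : forall x, exists A, O2 x -> sdiff psi x A.
  move=> x; have [ox|nx] := pselect (O2 x); last by exists 0.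
  have [ac _ _ _] := mono_chart (gc_mono gq).
  have dx : chart_dom c (g x).
    by move: ox => [y o1y <-]; rewrite gphi//; apply: chart_bwd_dom cc _ _; exact: O1c.
  by have [A hA] := inverse_sdiff RX oO cg ag ac (O2O _ ox) dx; exists A.
pose G (y : 'rV[R]_d) : \bar R := (F' F y * expR (- (beta * V' y)))%:E.
have mE : measurable_fun setT ((fun y => expR (- (beta * V' y))) : borel 'rV[R]_d -> measurableTypeR R).
  apply: measurableT_comp; first exact: measurable_expR.
  by apply: measurableT_comp; [exact: oppr_measurable|exact: measurable_funM].
have mG : measurable_fun setT (G : borel 'rV[R]_d -> \bar R).
  by apply/measurable_EFinP; exact: measurable_funM.
have G0 y : (0 <= G y)%E by rewrite lee_fin mulr_ge0// expR_ge0.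
have CV := change_of_variables o1 o2 (erefl O2) dphi dpsi psiK mG G0.
have E1 : lift_laplace beta F = (\int[lebesgue_rV d]_(x in O2) G (psi x))%E.
  rewrite /lift_laplace integral_mkcond [RHS]integral_mkcond; apply: eq_integral => x _.
  rewrite !patchE; have [ox|nx] := pselect (O2 x).
    rewrite !mem_set//; last exact: O2O.
    move: ox => [y o1y <-]; rewrite gphi// psiK// /G /F'.
    have qy := O1C _ o1y; rewrite /phi/= V'E//.
    by move: qy; rewrite /Qc /q_closed /= => ->.
  rewrite [x \in O2]memNset//; case: ifP => // /set_mem Ox.
  rewrite F_supp ?mul0r// => -[y qy gy]; apply: nx; rewrite O2E; split => //.
  exists y => //; split => // /(cube_divisor (q_open_closed qy)); rewrite gy.
  by move: Ox; rewrite OE => -[p np <-]; rewrite gK.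
rewrite E1 CV integral_mkcond; apply: ae_eq_integral => //.
- apply/(measurable_restrictT _ (open_borel o1)); apply: emeasurable_funM; first exact: measurable_funTS.
  apply/measurable_EFinP; exact: (measurable_absdet o1 dphi (@subset_refl _ O1) (open_borel o1)).
- apply/measurable_EFinP; apply: measurable_funM => //; apply: measurable_funM; last first.
    apply: measurable_prod => i _; apply: measurable_funX.
    by apply: measurableT_comp (rV_coord_measurable i); exact: normr_measurable.
  apply: measurable_funM => //; apply: cube_cut_measurable.
  by apply: continuous_in_subspaceT => y; rewrite inE => qy; exact: (q_b_continuous gq (gc_cod gq qy)).
apply: negligibleS divisor_hyper_null => y /=; apply: contra_notP => ny _.
rewrite patchE; have [qy|qy] := pselect (Qo y); last first.
  rewrite memNset; last by move=> [].
  have [qc|qc] := pselect (Qc y); last first.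
    by rewrite /F' ifF ?mul0r//; apply/negP.
  have cy := gc_cod gq qc.
  have -> : F' F y = 0; last by rewrite !mul0r.
  rewrite /F' qc F_supp// => -[z qz zy]; apply: qy.
  by rewrite -(chart_bwdK cc cy) -zy chart_bwdK//; exact: (q_open_cod gq qz).
rewrite mem_set; last by split.
have [_ ->] := hD y qy; rewrite /G -EFinM /b' ifT; last exact: ltW.
by congr EFin; ring.
Qed.

(** The local form of the limit: the critical coordinates of the cube carry the
    asymptotics, the other ones the density. *)
Lemma local_limit :
  ((fun beta : R => (beta `^ lam / ln beta ^+ m.-1)%:E * lift_laplace beta F) @ +oo%R -->
   \int[q_measure lam0 gq]_p (F p)%:E)%E.
Proof.
have r0 := gc_radius gq.
have hs i : ~~ s i -> (0 < k i)%N /\ (h i).+1%:R = (2 * k i)%:R * lam.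
  rewrite negbK => /q_critP[_ [a la ra]]; rewrite /num_at la/=; have ka := res_knum RX a.
  split => //; rewrite -ra /Defs.ratio mulrC divfK// pnatr_eq0 muln_eq0/= -lt0n; move: ka; by case: (rd_k X a).
have hy0 i : ~~ s i -> y0 ord0 i = 0 by rewrite negbK => /q_critP[].
have pm : (crit_count s <= m)%N by rewrite crit_countE; exact: q_crit_le gq.
have hint := cube_hint.
have [Bb Bb0 hBb] := q_b_bound gq.
have b'_bnd y : 0 <= b' y <= Bb by rewrite /b'; case: ifP => hy; [exact: hBb|rewrite lexx].
have F'_bnd y : 0 <= F' F y <= `|B|.
  rewrite F'0 /F'; case: ifP => _ /=; last exact: normr_ge0.
  have /andP[_ h2] := F_bnd (chart_bwd c y).
  exact: le_trans (ler_norm _).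
pose Phi y := F' F y * b' y.
have Phi_bnd y : 0 <= Phi y <= `|B| * Bb.
  have /andP[h1 h2] := b'_bnd y; have /andP[h3 h4] := F'_bnd y.
  by rewrite mulr_ge0//= ler_pM.
have mb' : measurable_fun setT (b' : borel 'rV[R]_d -> measurableTypeR R).
  apply: cube_cut_measurable.
  by apply: continuous_in_subspaceT => y; rewrite inE => qy; exact: (q_b_continuous gq (gc_cod gq qy)).
have mPhi : measurable_fun setT (Phi : borel 'rV[R]_d -> measurableTypeR R) by exact: measurable_funM.
have Phi_cont (u : 'rV[R]_d) : (forall i, `[y0 ord0 i - r, y0 ord0 i + r]%classic (u ord0 i)) -> forall e, 0 < e ->
  exists2 q', 0 < q' & forall y : 'rV[R]_d, (forall i, `[y0 ord0 i - r, y0 ord0 i + r]%classic (y ord0 i)) ->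
     (forall i, `|y ord0 i - u ord0 i| <= q') -> `|Phi y - Phi u| <= e.
  move=> /(q_closed_coord gq) qu e e0.
  have cu : {for u, continuous (fun y => F (chart_bwd c y) * b y)}.
    have cy := gc_cod gq qu.
    have h1 := continuous_comp (chart_bwd_continuous cc cy) (@cF _).
    exact: (continuousM h1 (q_b_continuous gq cy)).
  have /cvgrPdist_lt /(_ _ e0) /nbhs_normP[q' /= q'0 hq'] := cu.
  exists (q' / 2); first exact: divr_gt0.
  move=> y /(q_closed_coord gq) qy yu.
  have : ball_ Num.norm u q' y.
    rewrite /ball_/= distrC; apply: (@le_lt_trans _ _ (q' / 2)); last by rewrite ltr_pdivrMr// ltr_pMr// ltr1n.
    by apply: rV_norm_le; [rewrite ltW// divr_gt0|move=> i; rewrite !mxE].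
  move=> /hq'; rewrite /Phi /F' /b'.
  by move: qu qy; rewrite /q_closed/= => -> ->; rewrite distrC => /ltW.
have ML := mono_limit lam0 r0 hs m0 pm hy0 hint mPhi Phi_bnd Phi_cont.
have mFM : measurable_fun setT (fun p : borel M => (F p)%:E).
  by apply/measurable_EFinP; exact: continuous_borel_fun.
rewrite (ge0_integral_wpush (lebesgue_off J) (q_closed_borel q) (measurable_q_bwd gq) (measurable_q_weight gq) (q_weight_ge0 lam0 gq) mFM); last by move=> p; rewrite lee_fin; have /andP[] := F_bnd p.
have cubeI (y : 'rV[R]_d) : \prod_i \1_(`[(y0 ord0 i - r)%R, (y0 ord0 i + r)%R]%classic) ((y : 'rV[R]_d) ord0 i) = (nat_of_bool (`|y - y0| <= r)%R)%:R :> R.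
  case: (boolP (`|y - y0| <= r)) => hy.
    rewrite big1// => i _; rewrite indicE mem_set//; exact: (q_closed_coord gq y).1.
  have /existsNP[i hi] : ~ forall i, `[y0 ord0 i - r, y0 ord0 i + r]%classic (y ord0 i).
    by move=> /(q_closed_coord gq); apply/negP.
  by rewrite (bigD1 i)//= indicE memNset// mul0r.
have E1 beta : lift_laplace beta F = (\int[lebesgue_rV d]_y mono_integrand k h r y0 Phi beta y)%E.
  rewrite lift_laplace_chart; apply: eq_integral => y _; rewrite /mono_integrand; congr EFin.
  rewrite big_split/= cubeI /Phi -/(V' y) /F'; case: ifP => hy; last by rewrite ?(mul0r, mulr0).
  by rewrite mul1r [X in _ = X * _]mulrC.
have fi0 y : (0 <= face_integrand lam s k h r y0 Phi y)%E.
  rewrite lee_fin mulr_ge0 ?(andP (Phi_bnd y)).1//; apply: prodr_ge0 => i _.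
  by rewrite mulr_ge0//; case: ifP => // _; exact: powR_ge0.
have E2 : ((crit_coef lam s k m)%:E * \int[off (fun i => ~~ s i)]_u face_integrand lam s k h r y0 Phi u =
    \int[lebesgue_off J]_(y in Qc) ((F (chart_bwd c y))%:E * (q_weight lam m q y)%:E))%E.
  rewrite off_critE; have [Jm|Jm] := boolP (#|J| == m); last first.
    rewrite /crit_coef crit_countE (negbTE Jm) mul0e integral0_eq// => y _.
    by rewrite /q_weight (negbTE Jm) mule0.
  have cc0 : 0 <= crit_coef lam s k m.
    rewrite /crit_coef; case: ifP => // _; rewrite divr_ge0 ?(ltW (Gamma_gt0 lam0))// mulr_ge0//.
    by apply: prodr_ge0.
  have mfi : measurable_fun setT (face_integrand lam s k h r y0 Phi : borel 'rV[R]_d -> \bar R).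
    by apply: measurable_face_integrand.
  rewrite -ge0_integralZl ?lee_fin//.
  rewrite [RHS]integral_mkcond; apply: eq_integral => y _.
  rewrite patchE /face_integrand big_split/= cubeI; have [hy|hy] := boolP (`|y - y0| <= r); last first.
    by rewrite memNset ?mul0r ?mule0//; apply/negP.
  rewrite mem_set// -!EFinM; congr EFin; rewrite mul1r /Phi /F' /b' hy /q_weight Jm /crit_coef crit_countE Jm.
  have -> : \prod_(i | ~~ s i) (k i)%:R = \prod_(i in J) (k i)%:R :> R.
    by apply: eq_bigl => i; rewrite /s negbK.
  have -> : \prod_i (if s i then `|y ord0 i| `^ (- (2 * (k i)%:R * lam) + (h i)%:R) else 1) =
      \prod_(i in ~: J) `|y ord0 i| `^ (- (2 * (k i)%:R * lam) + (h i)%:R).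
    by rewrite [RHS]big_mkcond; apply: eq_bigr => i _; rewrite /s finset.in_setC.
  rewrite invfM; ring.
rewrite E2 in ML; apply: cvg_trans ML; apply: near_eq_cvg; apply: nearW => beta.
by rewrite E1.
Qed.

End test_function.
End LocalLimit.

(** * Test functions and countable covers *)

Section Distance.
Context {R : realType} {n : nat}.
Implicit Types (A : set 'rV[R]_n) (z : 'rV[R]_n).

(** The distance to [A], truncated at 1 so that it makes sense when [A] is
    empty. *)
Definition dist1 A z : R := inf ([set 1] `|` [set `|z - a| | a in A]).

Let lb0 A z : lbound ([set 1] `|` [set `|z - a| | a in A]) 0.
Proof. by move=> x [->|[a _ <-]]; rewrite ?ler01. Qed.

Let hasinf A z : has_inf ([set 1] `|` [set `|z - a| | a in A]).
Proof. by split; [exists 1; left|exists 0; exact: lb0]. Qed.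

Lemma dist1_ge0 A z : 0 <= dist1 A z.
Proof. by apply: lb_le_inf; [exists 1; left|exact: lb0]. Qed.

Lemma dist1_le A z a : A a -> dist1 A z <= `|z - a|.
Proof. by move=> Aa; apply: inf_lbound; [exact: (hasinf A z).2|right; exists a]. Qed.

Lemma dist1_in A z : A z -> dist1 A z = 0.
Proof.
move=> Az; apply/eqP; rewrite eq_le dist1_ge0 andbT.
by have := dist1_le z Az; rewrite subrr normr0.
Qed.

Lemma dist1_gt0 A z : closed A -> ~ A z -> 0 < dist1 A z.
Proof.
move=> cA nA; have oA : open (~` A) by exact: closed_openC.
have /nbhs_normP[e /= e0 he] := open_nbhs_nbhs (conj oA nA).
apply: (@lt_le_trans _ _ (Num.min 1 e)); first by rewrite lt_min ltr01.
apply: lb_le_inf; first by exists 1; left.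
move=> x [->|[a Aa <-]]; rewrite ge_min ?lexx// orbC leNgt; apply/orP; left; apply/negP => h.
exact: (he a h).
Qed.

Lemma dist1_lip A z z' : dist1 A z <= dist1 A z' + `|z - z'|.
Proof.
rewrite -lerBlDr; apply: lb_le_inf; first by exists 1; left.
move=> x [->|[a Aa <-]]; rewrite lerBlDr.
  apply: (@le_trans _ _ 1); last by rewrite lerDl.
  by apply: inf_lbound; [exact: (hasinf A z).2|left].
apply: le_trans (dist1_le z Aa) _.
have -> : z - a = (z - z') + (z' - a) by rewrite addrA subrK.
rewrite [leRHS]addrC; exact: ler_normD.
Qed.

Lemma dist1_continuous A : continuous (dist1 A).
Proof.
move=> z; apply/continuous_at_normP => e e0; exists e => // y yz.
apply: le_lt_trans yz; rewrite ler_norml; have h1 := dist1_lip A z y; have h2 := dist1_lip A y z.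
by move: h1; rewrite distrC => h1; apply/andP; split; lra.
Qed.

(** Continuous functions that increase to the indicator function of the
    complement of a closed set [A]. They vanish on [A], so that for [A] the
    complement of an open set they serve as test functions supported in it. *)
Definition tent A (k : nat) z : R := Num.min 1 (k%:R * dist1 A z).

Lemma tent_bnd A k z : 0 <= tent A k z <= 1.
Proof. by rewrite le_min ler01 mulr_ge0 ?dist1_ge0//= ge_min lexx. Qed.

Lemma tent_in A k z : A z -> tent A k z = 0.
Proof. by move=> Az; rewrite /tent dist1_in// mulr0 min_r. Qed.

Lemma tent_continuous A k : continuous (tent A k).
Proof.
move=> z; have h1 : {for z, continuous (fun z => k%:R * dist1 A z)}.
  by apply: continuousM; [exact: cst_continuous|exact: dist1_continuous].
have h0 : {for z, continuous (fun _ : 'rV[R]_n => 1 : R)} by exact: cst_continuous.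
exact: (continuous_min h0 h1).
Qed.

Lemma tent_homo A z : {homo (tent A)^~ z : k l / (k <= l)%N >-> k <= l}.
Proof.
move=> k l kl; rewrite /tent le_min !ge_min lexx/=; apply/orP; right.
by rewrite ler_wpM2r ?dist1_ge0// ler_nat.
Qed.

Lemma tent_cvg A z : closed A -> ~ A z -> \forall k \near \oo, tent A k z = 1.
Proof.
move=> cA nA; have d0 := dist1_gt0 cA nA; near=> k.
rewrite /tent min_l// -ler_pdivrMr//; near: k; exact: nbhs_infty_ger.
Unshelve. all: by end_near. Qed.

End Distance.

Section Lindelof.

(** Over each member of a countable base contained in some member of the cover,
    one such member is chosen. *)
Lemma lindelof (T : topologicalType) (I : Type) (N : I -> set T) (S : set T) (i0 : I) :
  @second_countable T -> (forall i, open (N i)) -> (forall p, S p -> exists i, N i p) ->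
  exists f : nat -> I, S `<=` \bigcup_j N (f j).
Proof.
move=> [B /countable_injP[h hinj] [Bo Bb]] oN SN.
have /choice[f hf] : forall j : nat, exists i, forall U, B U -> h U = j -> (exists i', U `<=` N i') -> U `<=` N i.
  move=> j; have [[U [BU hU [i' Ui']]]|nU] := pselect (exists U, [/\ B U, h U = j & exists i', U `<=` N i']).
    exists i' => U' BU' hU' _; rewrite (_ : U' = U)//.
    by apply: hinj; rewrite ?inE// hU hU'.
  by exists i0 => U BU hU Ui; exfalso; apply: nU; exists U.
exists f => p Sp; have [i Nip] := SN p Sp.
have [U [BU Up] UN] := Bb p (N i) (open_nbhs_nbhs (conj (oN i) Nip)).
by exists (h U) => //; apply: (hf (h U) U BU erefl) => //; exists i.
Qed.

(** Measures that agree on small sets agree, as a Borel set is a countable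
    disjoint union of small ones. *)
Lemma measure_agree (R : realType) (M : ptopologicalType) (rho rho' : {measure set (borel M) -> \bar R}) (S : set M) :
  @second_countable M ->
  (forall p, S p -> exists2 N : set M, open N /\ N p &
     forall B : set (borel M), measurable B -> B `<=` N -> rho B = rho' B) ->
  forall B : set (borel M), measurable B -> B `<=` S -> rho B = rho' B.
Proof.
move=> sM hS B mB BS.
have [->|/set0P[p0 Bp0]] := eqVneq B set0; first by rewrite !measure0.
pose I := {N : set M | open N /\ forall B : set (borel M), measurable B -> B `<=` N -> rho B = rho' B}.
have [N0 [oN0 _] hN0] := hS _ (BS _ Bp0).
have oI (i : I) : open (sval i) by case: i => N [].
have cI p : S p -> exists i : I, sval i p.
  by move=> /hS[N [oN Np] hN]; exists (exist _ N (conj oN hN)).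
have [f Sf] := @lindelof _ I (fun i => sval i) S (exist _ N0 (conj oN0 hN0)) sM oI cI.
pose F j : set (borel M) := B `&` sval (f j).
have mF j : measurable (F j) by apply: measurableI => //; exact: open_borel.
have BE : B = \bigcup_j F j.
  by rewrite -setI_bigcupr setIidl// => p Bp; exact: Sf (BS _ Bp).
have mD j : measurable (seqDU F j) by apply: measurableD => //; apply: bigsetU_measurable.
have E (mu : {measure set (borel M) -> \bar R}) : mu B = (\sum_(0 <= j <oo) mu (seqDU F j))%E.
  have BE' : B = \bigcup_j seqDU F j by rewrite -seqDU_bigcup_eq.
  rewrite {1}BE'; apply/esym/cvg_lim => //; apply: measure_semi_sigma_additive => //.
  by rewrite -BE'.
rewrite !E; apply: eq_eseriesr => j _.
have [oN hN] := svalP (f j); apply: hN => // p [[_ h] _]; exact: h.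
Qed.

End Lindelof.

(** * The density on the resolution *)

Section Global.
Context {R : realType} {d : nat}.
Variables (V : 'rV[R]_d -> R) (D : set 'rV[R]_d) (X : resolution_data R d).
Hypothesis RX : resolution V D X.
Hypothesis oD : open D.
Variables (lam : R) (m : nat).
Hypothesis lam0 : 0 < lam.
Hypothesis m0 : (0 < m)%N.
Notation M := (rd_space X).
Notation pi := (rd_proj X).
Variables (O : set 'rV[R]_d) (g : 'rV[R]_d -> M).
Hypothesis OE : O = pi @` ~` total_divisor V X.
Hypothesis oO : open O.
Hypothesis gK : forall p, ~ total_divisor V X p -> g (pi p) = p.
Hypothesis cg : {within O, continuous g}.
Hypothesis ag : forall c, rd_atlas X c -> analytic_map_on (O `&` g @^-1` chart_dom c) (chart_fwd c \o g).

Let sM : @second_countable M. Proof. by have [_ h _] := res_space RX. Qed.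

(** Both measures are limits of the same Laplace integrals, hence give the same
    integral to continuous functions supported in both cubes, thus the same
    measure to open sets; being finite, they agree on Borel sets by inner
    regularity, in a chart. *)
Lemma cube_agree_local q q' (gq : good_cube V D lam m q) (gq' : good_cube V D lam m q') p :
  (q_nbhs q `&` q_nbhs q') p -> exists2 N : set M, open N /\ N p &
    forall B : set (borel M), measurable B -> B `<=` N -> q_measure lam0 gq B = q_measure lam0 gq' B.
Proof.
move=> [[y qy yp] Np']; set c := q_chart q; have cc := q_is_chart gq.
have oU : open (q_nbhs q `&` q_nbhs q') by apply: openI; [exact: (q_nbhs_open gq)|exact: (q_nbhs_open gq')].
have cy := q_open_cod gq qy.
have Uy : (q_nbhs q `&` q_nbhs q') (chart_bwd c y) by rewrite yp; split => //; exists y.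
have := chart_bwd_near cc cy (open_nbhs_nbhs (conj oU Uy)) => /nbhs_normP[e /= e0 he].
pose L := [set z : 'rV[R]_d | `|z - y| <= e / 2]; pose L0 := [set z : 'rV[R]_d | `|z - y| < e / 2].
have e20 : 0 < e / 2 by rewrite divr_gt0.
have LU z : L z -> chart_cod c z /\ (q_nbhs q `&` q_nbhs q') (chart_bwd c z).
  move=> Lz; apply: he; rewrite /ball_/= distrC; apply: le_lt_trans Lz _.
  by rewrite ltr_pdivrMr// ltr_pMr// ltr1n.
have cL : compact L by exact: compact_ball_rV.
have oL0 : open L0.
  rewrite (_ : L0 = ball y (e / 2)); first exact: ball_open.
  by rewrite -ball_normE; apply/seteqP; split=> z /=; rewrite /L0/= distrC.
have L0L : L0 `<=` L by move=> z /ltW.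
have L0c : L0 `<=` chart_cod c by move=> z /L0L /LU[].
pose N := chart_bwd c @` L0.
have oN : open N by exact: (open_chart_bwd cc oL0 L0c).
exists N; first by split => //; exists y => //; rewrite /L0/= subrr normr0.
(* The tent functions increase to the indicator functions of open sets. *)
have openE (W : set 'rV[R]_d) : open W -> W `<=` L0 -> q_measure lam0 gq (chart_bwd c @` W) = q_measure lam0 gq' (chart_bwd c @` W).
  move=> oW WL; pose F k := chart_ext c (tent (~` W) k).
  have cW : closed (~` W) by exact: open_closedC.
  have Wc : W `<=` chart_cod c by move=> z /WL /L0c.
  have cF k : continuous (F k).
    apply: (chart_ext_continuous cc (L := L) (res_hausdorff RX) cL).
    - by move=> z /LU[].
    - exact: tent_continuous.
    - by move=> z nz; apply: tent_in => Wz; apply: nz; exact: L0L (WL _ Wz).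
  have Fb k p' : 0 <= F k p' <= 1.
    by rewrite /F /chart_ext; case: asboolP => _; [exact: tent_bnd|rewrite lexx ler01].
  have F0 k p' : ~ (chart_bwd c @` W) p' -> F k p' = 0.
    move=> np; rewrite /F /chart_ext; case: asboolP => // dp; apply: tent_in => Wp; apply: np.
    by exists (chart_fwd c p') => //; exact: chart_fwdK.
  have sub1 k p' : ~ q_nbhs q p' -> F k p' = 0.
    by move=> np; apply: F0 => -[z Wz zp]; apply: np; rewrite -zp; have [_ []] := LU _ (L0L _ (WL _ Wz)).
  have sub2 k p' : ~ q_nbhs q' p' -> F k p' = 0.
    by move=> np; apply: F0 => -[z Wz zp]; apply: np; rewrite -zp; have [_ []] := LU _ (L0L _ (WL _ Wz)).
  have IE k : (\int[q_measure lam0 gq]_p (F k p)%:E = \int[q_measure lam0 gq']_p (F k p)%:E)%E.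
    have h1 := local_limit RX (gq := gq) m0 OE oO gK cg ag (cF k) (Fb k) (sub1 k); have h2 := local_limit RX (gq := gq') m0 OE oO gK cg ag (cF k) (Fb k) (sub2 k).
    exact: (cvg_unique _ (h1 lam0) (h2 lam0)).
  have mF k : measurable_fun setT (fun p : borel M => (F k p)%:E).
    by apply/measurable_EFinP; exact: continuous_borel_fun.
  have mW : measurable (chart_bwd c @` W : set (borel M)) by apply: open_borel; exact: (open_chart_bwd cc oW Wc).
  have MC (mu : {measure set (borel M) -> \bar R}) :
      (\int[mu]_p (F k p)%:E)%E @[k --> \oo] --> mu (chart_bwd c @` W).
    have -> : mu (chart_bwd c @` W) = (\int[mu]_p (\1_(chart_bwd c @` W) p)%:E)%E by rewrite integral_indic// setIT.
    rewrite (_ : (fun p => (\1_(chart_bwd c @` W) p)%:E) = (fun p => limn (fun k => (F k p)%:E))).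
      apply: cvg_monotone_convergence => //.
      - by move=> k p' _; rewrite lee_fin; have /andP[] := Fb k p'.
      - move=> p' _ k l kl; rewrite lee_fin /F /chart_ext; case: asboolP => // _; exact: tent_homo.
    apply/funext => p'; apply/esym/cvg_lim => //; have [Wp|nW] := pselect ((chart_bwd c @` W) p'); last first.
      rewrite indicE memNset//; rewrite (_ : (fun k => _) = fun=> 0%E); first exact: cvg_cst.
      by apply/funext => k; rewrite F0.
    rewrite indicE mem_set//; apply: cvg_near_cst.
    move: Wp => [z Wz <-]; have nz : ~ (~` W) z by apply.
    by apply: filterS (tent_cvg cW nz) => k hk; rewrite /F chart_ext_bwd ?hk//; exact: Wc.
  have h1 := MC (q_measure lam0 gq); have h2 := MC (q_measure lam0 gq').
  rewrite (funext IE : (fun k => _) = (fun k => _)) in h1.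
  exact: (cvg_unique _ h1 h2).
(* In the chart, the regularity of Borel measures on row vectors applies. *)
have mN : measurable (N : set (borel M)) by exact: open_borel.
have mf : measurable_fun (N : set (borel M)) (chart_fwd c : borel M -> borel 'rV[R]_d).
  apply: borel_continuous_within => //; have [_ _ _ h _] := cc.
  apply: continuous_subspaceW h => p' [z Lz <-]; exact: chart_bwd_dom cc _ (L0c _ Lz).
have m1 : measurable_fun (N : set (borel M)) (fun _ : borel M => 1 : R) by exact: measurable_cst.
have w1 (p' : borel M) : N p' -> 0 <= 1 :> R by [].
have mNf A : measurable (A : set (borel 'rV[R]_d)) -> measurable (N `&` chart_fwd c @^-1` A : set (borel M)).
  by move=> mA; have := mf mN _ mA.
have [kap kapE] : exists kap : {measure set (borel M) -> \bar R} -> {measure set (borel 'rV[R]_d) -> \bar R},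
    forall mu A, measurable (A : set (borel 'rV[R]_d)) -> kap mu A = mu (N `&` chart_fwd c @^-1` A).
  exists (fun mu => wpush mu mN mf m1 w1) => mu A mA.
  by rewrite wpushE (integral_cst mu (mNf A mA)) mul1e.
have NfE A : N `&` chart_fwd c @^-1` A = chart_bwd c @` (L0 `&` A).
  apply/seteqP; split=> p'; first by move=> [[z Lz <-]] /=; rewrite chart_bwdK//; [exists z|exact: L0c].
  by move=> [z [Lz Az] <-]; split; [exists z|rewrite /= chart_bwdK//; exact: L0c].
have kO A : open A -> kap (q_measure lam0 gq) A = kap (q_measure lam0 gq') A.
  move=> oA; rewrite !kapE ?NfE; try exact: open_borel.
  by apply: openE; [exact: openI|exact: subIsetl].
have kfin A : measurable (A : set (borel 'rV[R]_d)) -> (kap (q_measure lam0 gq) A < +oo)%E /\ (kap (q_measure lam0 gq') A < +oo)%E.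
  move=> mA; rewrite !kapE//; split.
    by apply: le_lt_trans (q_measure_fin RX lam0 gq); apply: le_measure; rewrite ?inE//; exact: mNf.
  by apply: le_lt_trans (q_measure_fin RX lam0 gq'); apply: le_measure; rewrite ?inE//; exact: mNf.
have kC A : closed A -> kap (q_measure lam0 gq) A = kap (q_measure lam0 gq') A.
  move=> cA; have mA := closed_borel cA; have oA := closed_openC cA.
  have split_ (mu : {measure set (borel 'rV[R]_d) -> \bar R}) : mu setT = (mu A + mu (~` A))%E.
    by rewrite -measureU ?setUv ?setICr//; exact: measurableC.
  have t := kO setT openT; rewrite !split_ (kO _ oA) in t.
  have f1 := (kfin _ (measurableC mA)).2.
  have fn : kap (q_measure lam0 gq') (~` A) \is a fin_num by rewrite ge0_fin_numE.
  by move/(congr1 (fun x => x - kap (q_measure lam0 gq') (~` A))%E): t; rewrite !addeK.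
pose K k := [set z : 'rV[R]_d | `|z - 0| <= k%:R].
have cK k : compact (K k) by exact: compact_ball_rV.
have hK : {homo K : k l / (k <= l)%N >-> (k <= l)%O}.
  by move=> k l kl; apply/subsetPset => z /= hz; apply: le_trans hz _; rewrite ler_nat.
have KT : [set: 'rV[R]_d] = \bigcup_k K k.
  apply/seteqP; split=> // z _; exists (Num.trunc `|z - 0|).+1 => //=.
  by apply: ltW; exact: truncnS_gt.
have kB A : measurable (A : set (borel 'rV[R]_d)) -> kap (q_measure lam0 gq) A = kap (q_measure lam0 gq') A.
  move=> mA; apply/eqP; rewrite eq_le; apply/andP; split.
  - apply: (compact_le_measure cK hK KT) => //; first by move=> k; exact: (kfin _ (compact_borel (cK k))).1.
    by move=> K' cK' _; rewrite kC//; exact: compact_rV_closed.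
  - apply: (compact_le_measure cK hK KT) => //; first by move=> k; exact: (kfin _ (compact_borel (cK k))).2.
    by move=> K' cK' _; rewrite kC//; exact: compact_rV_closed.
move=> B mB BN.
have mbw : measurable_fun (L0 : set (borel 'rV[R]_d)) (chart_bwd c : borel 'rV[R]_d -> borel M).
  apply: borel_continuous_within; first exact: open_borel.
  by have [_ _ _ _ h] := cc; exact: continuous_subspaceW L0c h.
have mA : measurable (L0 `&` chart_bwd c @^-1` B : set (borel 'rV[R]_d)) by apply: mbw => //; exact: open_borel.
have BE : B = N `&` chart_fwd c @^-1` (L0 `&` chart_bwd c @^-1` B).
  rewrite NfE; apply/seteqP; split=> p'; last by move=> [z [_ [_ Bz]] <-].
  by move=> Bp; have [z Lz zp] := BN _ Bp; exists z => //; split => //; split => //=; rewrite zp.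
by rewrite BE -!kapE// kB.
Qed.

Lemma cube_agree q q' (gq : good_cube V D lam m q) (gq' : good_cube V D lam m q') (B : set (borel M)) :
  measurable B -> B `<=` q_nbhs q `&` q_nbhs q' -> q_measure lam0 gq B = q_measure lam0 gq' B.
Proof.
move=> mB BS; apply: (measure_agree (S := q_nbhs q `&` q_nbhs q')) => // p hp.
exact: cube_agree_local hp.
Qed.

Definition gcube := {q : cube X | good_cube V D lam m q}.

Lemma gcube_at p : total_divisor V X p -> Dreg D X lam m (pi p) -> exists q : gcube, q_nbhs (sval q) p.
Proof.
move=> tp Dp; have [c [lab [b [dp mo]]]] := res_mono RX tp.
have [r gq _] := good_cube_exists RX oD mo dp Dp (@openT M) I.
exists (exist _ _ gq); exists (chart_fwd c p).
  by rewrite /q_open/= subrr normr0; exact: (gc_radius gq).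
by apply: chart_fwdK => //; exact: (q_is_chart gq).
Qed.

Lemma Eset_divisor p : Eset D X lam m p -> total_divisor V X p /\ Dreg D X lam m (pi p).
Proof.
move=> /Eset_regE[Dp [A [_ Am Ap]]]; split => //; rewrite (res_preimage RX).
have /card_gt0P[a aA] : (0 < #|A|)%N by rewrite Am.
by exists a => //; apply: Ap.
Qed.

(** The face measures of overlapping cubes agree, so that those of a countable
    cover, restricted to a disjoint refinement, add up to a measure that
    restricts to each of them. *)
Lemma global_density (p0 : M) : Eset D X lam m p0 ->
  exists rho : {measure set (borel M) -> \bar R}, 
    (forall A : set (borel M), measurable A -> (forall p, A p -> ~ Eset D X lam m p) -> rho A = 0%E) /\
    forall (q : cube X) (gq : good_cube V D lam m q) (B : set (borel M)), measurable B -> B `<=` q_nbhs q ->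
      rho B = q_measure lam0 gq B.
Proof.
move=> /Eset_divisor[t0 D0]; have [q0 _] := gcube_at t0 D0.
have oI (q : gcube) : open (q_nbhs (sval q)) by exact: (q_nbhs_open (svalP q)).
have cI p : Eset D X lam m p -> exists q : gcube, q_nbhs (sval q) p.
  by move=> /Eset_divisor[tp Dp]; exact: gcube_at.
have [f Sf] := @lindelof _ gcube (fun q => q_nbhs (sval q)) (Eset D X lam m) q0 sM oI cI.
pose N j : set (borel M) := q_nbhs (sval (f j)).
have mN j : measurable (N j) by apply: open_borel; exact: oI.
have mD j : measurable (seqDU N j) by apply: measurableD => //; apply: bigsetU_measurable.
pose rj j : {measure set (borel M) -> \bar R} := mrestr (q_measure lam0 (svalP (f j))) (mD j).
pose rho : {measure set (borel M) -> \bar R} := mseries rj 0.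
have rhoE A : rho A = (\sum_(0 <= j <oo) q_measure lam0 (svalP (f j)) (A `&` seqDU N j))%E by [].
exists rho; split.
  move=> A mA hA; rewrite rhoE eseries0// => j _ _; apply: (q_measure_Eset lam0 (svalP (f j))).
    exact: measurableI.
  by move=> p [Ap _]; exact: hA.
move=> q gq B mB Bq; rewrite rhoE.
have mBj j : measurable (B `&` seqDU N j) by exact: measurableI.
have -> : (\sum_(0 <= j <oo) q_measure lam0 (svalP (f j)) (B `&` seqDU N j) =
   \sum_(0 <= j <oo) q_measure lam0 gq (B `&` seqDU N j))%E.
  apply: eq_eseriesr => j _; apply: cube_agree => // p [Bp [Np _]]; split => //; exact: Bq.
have mU : measurable (\bigcup_j (B `&` seqDU N j)) by exact: bigcupT_measurable.
have -> : (\sum_(0 <= j <oo) q_measure lam0 gq (B `&` seqDU N j) = q_measure lam0 gq (\bigcup_j (B `&` seqDU N j)))%E.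
  apply/cvg_lim => //; apply: measure_semi_sigma_additive => //.
  by apply: trivIset_setIl; exact: trivIset_seqDU.
have UE : \bigcup_j (B `&` seqDU N j) = B `&` \bigcup_j N j by rewrite -setI_bigcupr -seqDU_bigcup_eq.
have mNN : measurable (B `\` \bigcup_j N j) by apply: measurableD => //; exact: bigcupT_measurable.
have z : q_measure lam0 gq (B `\` \bigcup_j N j) = 0%E.
  by apply: (q_measure_Eset lam0 gq) => // p [_ np] /Sf.
have -> : q_measure lam0 gq B = (q_measure lam0 gq (B `&` \bigcup_j N j) + q_measure lam0 gq (B `\` \bigcup_j N j))%E.
  by rewrite addeC -measureDI//; exact: bigcupT_measurable.
by rewrite z adde0 UE.
Qed.

End Global.

(** * Inverse functions and line crossings *)

Section Inverse.
Context {R : realType} {n : nat}.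

(** A map with an invertible strict derivative is bi-Lipschitz and open near the
    point: it is a perturbation of the derivative that is Lipschitz with a small
    constant, so that a point minimising the distance to a target near the centre
    can be improved by one Newton step unless it hits the target. *)
Lemma sdiff_inverse (f : 'rV[R]_n -> 'rV[R]_n) y (A : 'M[R]_n) :
  sdiff f y A -> A \in unitmx -> exists C del eta : R,
  [/\ [/\ 0 < C, 0 < del & 0 < eta],
   (forall z z' : 'rV[R]_n, `|z - y| < del -> `|z' - y| < del -> `|z - z'| <= C * `|f z - f z'|) &
   (forall x : 'rV[R]_n, `|x - f y| < eta -> exists2 z, `|z - y| < del & f z = x)].
Proof.
move=> fA uA; have [K K0 hK] := mulmx_norm_le (invmx A).
have invK (w : 'rV[R]_n) : `|w| <= K * `|w *m A| by have := hK (w *m A); rewrite mulmxK.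
have e0 : 0 < (2 * K)^-1 by rewrite invr_gt0 mulr_gt0.
have [del del0 hdel] := fA _ e0.
have lip (z z' : 'rV[R]_n) : `|z - y| < del -> `|z' - y| < del -> `|z - z'| <= 2 * K * `|f z - f z'|.
  move=> zd zd'; have h := hdel z z' zd zd'; have h1 := invK (z - z').
  have h2 : `|(z - z') *m A| <= `|f z - f z'| + (2 * K)^-1 * `|z - z'|.
    rewrite -[X in `|X|](subrK (f z - f z')) -opprB addrC; apply: le_trans (ler_normB _ _) _.
    by rewrite lerD2l.
  have h3 : `|z - z'| <= K * `|f z - f z'| + `|z - z'| / 2.
    apply: le_trans h1 _; apply: le_trans (ler_wpM2l (ltW K0) h2) _.
    by rewrite mulrDr lerD2l le_eqVlt; apply/orP; left; apply/eqP; field; rewrite gt_eqF.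
  by move: h3; set u := `|z - z'|; set w := `|f z - f z'|; move=> h3; nra.
exists (2 * K), del, (del / (16 * K)); split => //; first by split; rewrite ?divr_gt0// mulr_gt0.
move=> x hx; pose B := [set z : 'rV[R]_n | `|z - y| <= del / 2].
have BS z : B z -> `|z - y| < del.
  by move=> /le_lt_trans; apply; rewrite ltr_pdivrMr// ltr_pMr// ltr1n.
have B0 : B !=set0 by exists y; rewrite /B/= subrr normr0 divr_ge0// ltW.
have [L L0 hL] := mulmx_norm_le A.
have cf : {within B, continuous (fun z => `|f z - x| : R)}.
  apply: continuous_in_subspaceT => z; rewrite inE => Bz.
  apply/continuous_at_normP => e ep; have zd := BS _ Bz.
  have c0 : 0 < (2 * K)^-1 + L by rewrite addr_gt0.
  exists (Num.min (del - `|z - y|) (e / ((2 * K)^-1 + L))); first by rewrite lt_min subr_gt0 zd divr_gt0.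
  move=> z'; rewrite lt_min => /andP[h1 h2].
  have zd' : `|z' - y| < del.
    by rewrite -(subrK z z') -addrA (le_lt_trans (ler_normD _ _))// -ltrBrDr.
  apply: le_lt_trans (ler_dist_dist _ _) _; rewrite opprB addrA subrK.
  have h := hdel z' z zd' zd.
  apply: (@le_lt_trans _ _ (((2 * K)^-1 + L) * `|z' - z|)); last by rewrite mulrC -ltr_pdivlMr.
  rewrite -[X in `|X|](subrK ((z' - z) *m A)) mulrDl; apply: le_trans (ler_normD _ _) _.
  by apply: lerD.
have [z0] := EVT_min_rV B0 (compact_ball_rV (x := y) (r := del / 2)) cf; rewrite inE => Bz0 hz0.
have z0d := BS _ Bz0.
exists z0 => //; apply: contrapT => nz.
have r0 : 0 < `|f z0 - x| by rewrite normr_gt0 subr_eq0; apply/eqP.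
have yy : `|y - y| < del by rewrite subrr normr0.
have By : B y by rewrite /B/= subrr normr0 divr_ge0// ltW.
have hy : `|f z0 - x| <= `|f y - x| by apply: hz0; rewrite inE.
rewrite (distrC (f y)) in hy.
have hz := lip z0 y z0d yy.
have hf : `|f z0 - f y| <= `|f z0 - x| + `|x - f y|.
  have E0 : f z0 - f y = (f z0 - x) + (x - f y) by rewrite addrA subrK.
  by rewrite E0; exact: ler_normD.
have e8 : del / (16 * K) * K = del / 16 by field; rewrite gt_eqF.
pose w := (x - f z0) *m invmx A; pose z1 := z0 + w.
have ws : `|w| <= K * `|f z0 - x| by rewrite (distrC (f z0)); exact: hK.
have ws2 : `|w| < del / 16.
  by apply: le_lt_trans ws _; rewrite -e8 [X in _ < X]mulrC ltr_pM2l//; apply: le_lt_trans hy _.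
suff : False by [].
have [B1|nB1] := pselect (B z1).
  have h := hdel z1 z0 (BS _ B1) z0d.
  have E : z1 - z0 = w by rewrite /z1 addrC addKr.
  rewrite E /w mulmxKV// in h.
  have := hz0 z1; rewrite inE => /(_ B1).
  have -> : f z1 - x = f z1 - f z0 - (x - f z0) by rewrite opprB addrA subrK.
  move=> /le_trans/(_ h); apply/negP; rewrite -ltNge.
  apply: le_lt_trans (ler_wpM2l (ltW e0) ws) _.
  have -> : (2 * K)^-1 * (K * `|f z0 - x|) = `|f z0 - x| / 2 by field; rewrite gt_eqF.
  by rewrite ltr_pdivrMr// ltr_pMr// ltr1n.
have hw1 : `|z1 - y| <= `|z0 - y| + `|w|.
  by rewrite /z1 addrAC; exact: ler_normD.
have z05 : `|z0 - y| <= del / 4.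
  have ha : `|f z0 - f y| < 2 * (del / (16 * K)).
    by rewrite mulr_natl mulr2n; apply: le_lt_trans hf _; apply: ltrD => //; exact: le_lt_trans hy hx.
  have hb : 2 * K * `|f z0 - f y| < 2 * K * (2 * (del / (16 * K))) by rewrite ltr_pM2l// mulr_gt0.
  apply: le_trans hz _; apply: le_trans (ltW hb) _.
  by rewrite le_eqVlt; apply/orP; left; apply/eqP; field; rewrite gt_eqF.
apply: nB1; rewrite /B/=; apply: le_trans hw1 _; apply: le_trans (lerD z05 (ltW ws2)) _.
have -> : del / 4 + del / 16 = del * (5 / 16) by field.
by rewrite ler_pM2l// ler_pdivrMr// mulrC ler_pdivlMr// -!natrM ler_nat.
Qed.

Lemma sdiffB m (f g : 'rV[R]_n -> 'rV[R]_m) y A B : sdiff f y A -> sdiff g y B ->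
  sdiff (fun z => f z + g z) y (A + B).
Proof.
move=> fA gB e e0; have e20 : 0 < e / 2 by rewrite divr_gt0.
have [a a0 ha] := fA _ e20; have [b b0 hb] := gB _ e20.
exists (Num.min a b); first by rewrite lt_min a0.
move=> z z'; rewrite !lt_min => /andP[za zb] /andP[za' zb'].
have -> : f z + g z - (f z' + g z') - (z - z') *m (A + B) =
    (f z - f z' - (z - z') *m A) + (g z - g z' - (z - z') *m B).
  by rewrite mulmxDr !opprD [X in X + _ = _]addrACA [LHS]addrACA.
rewrite (splitr e) mulrDl.
by apply: le_trans (ler_normD _ _) _; apply: lerD; [exact: ha|exact: hb].
Qed.

Lemma sdiff_mulmx m (A : 'M[R]_(n, m)) y : sdiff (fun z => z *m A) y A.
Proof. by move=> e e0; exists 1 => // z z' _ _; rewrite -mulmxBl subrr normr0 mulr_ge0// ltW. Qed.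

Definition drop_coord (i : 'I_n) : 'M[R]_n := 1%:M - delta_mx i i.

Lemma drop_coordE i (y : 'rV[R]_n) j : (y *m drop_coord i) ord0 j = if j == i then 0 else y ord0 j.
Proof.
rewrite /drop_coord mulmxBr mulmx1 !mxE (bigD1 i)//= big1 => [|l li].
  by rewrite !mxE eqxx/= addr0; case: eqP => [->|_]; rewrite ?mulr1 ?mulr0 ?subrr ?subr0.
by rewrite !mxE (negbTE li) mulr0.
Qed.

Definition coord_line (i : 'I_n) (v : 'rV[R]_n) : 'M[R]_n := (delta_mx i ord0 : 'cV[R]_n) *m v.

Lemma coord_lineE i v (y : 'rV[R]_n) : y *m coord_line i v = y ord0 i *: v.
Proof.
rewrite /coord_line mulmxA (_ : y *m _ = (y ord0 i)%:M) ?mul_scalar_mx//.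
by rewrite -colE; apply/matrixP => a b; rewrite !ord1 !mxE eqxx mulr1n.
Qed.

(** On each side of zero such a function has a constant sign, and the signs are
    opposite: otherwise a small value would be taken on both sides. The
    intermediate value theorem does the rest. *)
Lemma injective_crossing (phi : R -> R) (s1 : R) : 0 < s1 -> phi 0 = 0 ->
  (forall a b t, - s1 <= a -> a <= b -> b <= s1 -> Num.min (phi a) (phi b) <= t <= Num.max (phi a) (phi b) ->
    exists2 c, a <= c <= b & phi c = t) ->
  (forall s, `|s| <= s1 -> s != 0 -> phi s != 0) ->
  (forall s s', `|s| <= s1 -> `|s'| <= s1 -> s != 0 -> s' != 0 -> phi s = phi s' -> s = s') ->
  exists2 eta : R, 0 < eta & forall t, `|t| < eta -> exists2 c, - s1 <= c <= s1 & phi c = t.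
Proof.
move=> s10 phi0 iv phin phiI.
have bs1 s : - s1 <= s <= s1 -> `|s| <= s1 by rewrite -ler_norml.
have pr1 : phi s1 != 0 by apply: phin; [apply: bs1; rewrite lexx andbT; lra|lra].
have pl1 : phi (- s1) != 0 by apply: phin; [apply: bs1; rewrite lexx/=; lra|lra].
(* the two ends lie on opposite sides, for otherwise a value is taken twice *)
have key (t : R) : Num.min `|phi s1| `|phi (- s1)| > `|t| -> exists2 c, - s1 <= c <= s1 & phi c = t.
  rewrite lt_min => /andP[t1 t2].
  have same (u : R) : u = Num.min `|phi s1| `|phi (- s1)| / 2 -> 
     (forall eps : R, eps = 1 \/ eps = -1 -> ~ (0 < eps * phi s1 /\ 0 < eps * phi (- s1))).
    move=> uE eps he [p1 p2].
    have ee : eps * eps = 1 by case: he => ->; rewrite ?mulr1// mulrNN mulr1.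
    have ne : `|eps| = 1 by case: he => ->; rewrite ?normrN1 ?normr1.
    have u0 : 0 < u by rewrite uE divr_gt0// lt_min !normr_gt0 pr1 pl1.
    have um : u < Num.min `|phi s1| `|phi (- s1)|.
      by rewrite uE ltr_pdivrMr// ltr_pMr ?ltr1n// lt_min !normr_gt0 pr1 pl1.
    move: um; rewrite lt_min => /andP[u1 u2].
    have e1 : `|phi s1| = eps * phi s1 by rewrite -[LHS]mul1r -ne -normrM gtr0_norm.
    have e2 : `|phi (- s1)| = eps * phi (- s1) by rewrite -[LHS]mul1r -ne -normrM gtr0_norm.
    rewrite e1 in u1; rewrite e2 in u2.
    have [c hc pc] : exists2 c, 0 <= c <= s1 & phi c = eps * u.
      apply: iv; [lra|lra|lra|]; rewrite phi0 ge_min le_max.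
      by case: he => he; move: u1 u0; rewrite he ?mul1r ?mulN1r => u1 u0; apply/andP; split; apply/orP; (left; lra) || (right; lra).
    have [c' hc' pc'] : exists2 c, - s1 <= c <= 0 & phi c = eps * u.
      apply: iv; [lra|lra|lra|]; rewrite phi0 ge_min le_max.
      by case: he => he; move: u2 u0; rewrite he ?mul1r ?mulN1r => u2 u0; apply/andP; split; apply/orP; (left; lra) || (right; lra).
    have nu : eps * u != 0 by apply: mulf_neq0; [rewrite -normr_eq0 ne oner_eq0|rewrite gt_eqF].
    have nc : c != 0 by apply: contra nu => /eqP c0; rewrite -pc c0 phi0.
    have nc' : c' != 0 by apply: contra nu => /eqP c0; rewrite -pc' c0 phi0.
    have cc : c = c'.
      apply: phiI => //; [apply: bs1; move: hc => /andP[]; lra|apply: bs1; move: hc' => /andP[]; lra|by rewrite pc pc'].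
    by move: nc hc hc'; rewrite -cc => /eqP nc /andP[h1 _] /andP[_ h2]; apply: nc; lra.
  have sm := same _ erefl.
  apply: iv; [lra|lra|lra|].
  have := sm 1 (or_introl erefl); have := sm (-1) (or_intror erefl).
  rewrite !mul1r !mulN1r !oppr_gt0 => q1 q2.
  rewrite ge_min le_max; move: t1 t2; rewrite !ltr_norml => t1 t2.
  case: (ltrgtP (phi s1) 0) pr1 => // ps _; case: (ltrgtP (phi (- s1)) 0) pl1 => // pn _.
  - by case: q1.
  - move: t1 t2; rewrite (ltr0_norm ps) (gtr0_norm pn) => /andP[a1 a2] /andP[a3 a4].
    by apply/andP; split; apply/orP; [right|left]; lra.
  - move: t1 t2; rewrite (gtr0_norm ps) (ltr0_norm pn) => /andP[a1 a2] /andP[a3 a4].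
    by apply/andP; split; apply/orP; [left|right]; lra.
  - by case: q2.
exists (Num.min `|phi s1| `|phi (- s1)|); first by rewrite lt_min !normr_gt0 pr1 pl1.
by move=> t; exact: key.
Qed.

(** A hypersurface [y_i = 0] immersed transversally to the direction [v], across
    which the map is injective, is crossed by the preimage of the line in the
    direction [v]: the preimage is a curve parametrised by [y_i], on which the
    position along the line is continuous and injective, hence monotone. *)
Lemma line_crossing (G : 'rV[R]_n -> 'rV[R]_n) (y : 'rV[R]_n) (A : 'M[R]_n) (i : 'I_n) (v : 'rV[R]_n) (r : R) :
  v != 0 -> y ord0 i = 0 -> sdiff G y A -> \det (drop_coord i *m A + coord_line i v) != 0 ->
  0 < r ->
  (forall z z' : 'rV[R]_n, `|z - y| < r -> `|z' - y| < r -> z ord0 i != 0 -> z' ord0 i != 0 -> G z = G z' -> z = z') ->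
  (forall z : 'rV[R]_n, `|z - y| < r -> z ord0 i != 0 -> G z <> G y) ->
  exists2 eta, 0 < eta & forall t : R, `|t| < eta -> exists2 z, `|z - y| < r & G z = G y + t *: v.
Proof.
move=> v0 yi GA dA r0 Ginj Gy.
have [k vk] : exists k, v ord0 k != 0.
  apply: contrapT => h; move/eqP: v0; apply; apply/rowP => k; rewrite mxE.
  by apply: contrapT => vk; apply: h; exists k; apply/eqP.
pose ell (w : 'rV[R]_n) : R := w ord0 k / v ord0 k.
have ellD w w' : ell (w + w') = ell w + ell w' by rewrite /ell !mxE mulrDl.
have ellZ a w : ell (a *: w) = a * ell w by rewrite /ell !mxE mulrA.
have ellB w w' : ell (w - w') = ell w - ell w' by rewrite /ell !mxE mulrBl.
have ellv : ell v = 1 by rewrite /ell divff.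
pose L : 'cV[R]_n := (v ord0 k)^-1 *: delta_mx k ord0.
have LE (w : 'rV[R]_n) : w *m (L *m v) = ell w *: v.
  rewrite mulmxA (_ : w *m L = (ell w)%:M) ?mul_scalar_mx//.
  rewrite /L -scalemxAr; rewrite -colE; apply/matrixP => a b; rewrite !ord1 !mxE mulr1n.
  by rewrite mulrC.
pose P : 'M[R]_n := 1%:M - L *m v.
have PE (w : 'rV[R]_n) : w *m P = w - ell w *: v by rewrite /P mulmxBr mulmx1 LE.
have ellP w : ell (w *m P) = 0 by rewrite PE ellD -scaleNr ellZ ellv mulr1 subrr.
pose B := A *m P + coord_line i v.
have BU : B \in unitmx.
  rewrite unitmxE unitfE; apply/negP => /det0P[u u0 uB].
  move: uB; rewrite /B mulmxDr mulmxA coord_lineE => uB.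
  have ui : u ord0 i = 0.
    by have := congr1 ell uB; rewrite ellD ellP add0r ellZ ellv mulr1 => ->; rewrite /ell mxE mul0r.
  move: uB; rewrite ui scale0r addr0 PE => /eqP; rewrite subr_eq0 => /eqP uA.
  pose w : 'rV[R]_n := u - ell (u *m A) *: delta_mx ord0 i.
  have wZ : w *m drop_coord i = u.
    apply/rowP => j; rewrite drop_coordE /w !mxE/=; case: eqP => [->|_]; first by rewrite ui.
    by rewrite mulr0 subr0.
  have wi : w ord0 i = - ell (u *m A) by rewrite /w !mxE !eqxx/= ui mulr1 add0r.
  move/negP: dA; apply; apply/det0P; exists w.
    by apply: contra u0 => /eqP w0; rewrite -wZ w0 mul0mx.
  by rewrite mulmxDr coord_lineE mulmxA wZ wi scaleNr {1}uA subrr.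
pose F z := G z *m P + z *m coord_line i v.
have FB : sdiff F y B.
  apply: sdiffB; last exact: sdiff_mulmx.
  exact: (sdiff_comp (f := G) (g := fun z => z *m P) GA (sdiff_mulmx P (G y))).
have [C [del [eta [[C0 del0 eta0] lip sur]]]] := sdiff_inverse FB BU.
have [rG rG0 hG] := GA _ ltr01.
have [KA KA0 hKA] := mulmx_norm_le A.
have lipG (z z' : 'rV[R]_n) : `|z - y| < rG -> `|z' - y| < rG -> `|G z - G z'| <= (1 + KA) * `|z - z'|.
  move=> h1 h2; rewrite -(subrK ((z - z') *m A) (G z - G z')) (le_trans (ler_normD _ _))// mulrDl lerD//.
  exact: hG.
have nv0 : 0 < `|v| by rewrite normr_gt0.
pose mr := Num.min (Num.min del r) rG.
have mr0 : 0 < mr by rewrite !lt_min del0 r0.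
pose s0 := Num.min eta (mr / C) / `|v| / 2.
have s00 : 0 < s0 by rewrite !divr_gt0// lt_min eta0 divr_gt0.
have Fy : F y = G y *m P by rewrite /F coord_lineE yi scale0r addr0.
have /choice[gam hgam] : forall s, exists z, `|s| <= s0 -> [/\ `|z - y| < mr, `|z - y| < del & F z = F y + s *: v].
  move=> s; have [hs|hs] := boolP (`|s| <= s0); last by exists y.
  have sv : `|s| * `|v| < Num.min eta (mr / C).
    rewrite -ltr_pdivlMr//; apply: le_lt_trans hs _.
    by rewrite /s0 ltr_pdivrMr// ltr_pMr ?ltr1n// divr_gt0// lt_min eta0 divr_gt0.
  move: sv; rewrite lt_min => /andP[sv1 sv2].
  have [z zd Fz] : exists2 z, `|z - y| < del & F z = F y + s *: v.
    by apply: sur; rewrite addrC addKr normrZ.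
  exists z => _; split => //.
  have := lip z y zd; rewrite subrr normr0 => /(_ del0)/le_lt_trans; apply.
  by rewrite Fz addrC addKr normrZ mulrC -ltr_pdivlMr.
have gE s : `|s| <= s0 -> [/\ `|gam s - y| < mr, gam s ord0 i = s & G (gam s) = G y + ell (G (gam s) - G y) *: v].
  move=> /hgam[h1 _ h2]; split => //.
    have := congr1 ell h2; rewrite Fy /F coord_lineE !ellD !ellP !add0r !ellZ ellv !mulr1//.
  have := congr1 (fun w => w *m P) h2; rewrite Fy /F coord_lineE !mulmxDl.
  have vP : v *m P = 0 by rewrite PE ellv scale1r subrr.
  have PP (w : 'rV[R]_n) : w *m P *m P = w *m P by rewrite (PE (w *m P)) ellP scale0r subr0.
  rewrite -!scalemxAl vP !scaler0 !addr0 !PP !PE => h.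
  by rewrite ellB scalerBl addrCA -h addrC subrK.
have mrr (z : 'rV[R]_n) : `|z - y| < mr -> `|z - y| < r by rewrite !lt_min => /andP[/andP[]].
have mrG (z : 'rV[R]_n) : `|z - y| < mr -> `|z - y| < rG by rewrite !lt_min => /andP[/andP[]].
pose phi s := ell (G (gam s) - G y).
have ball0 : `|(0 : R)| <= s0 by rewrite normr0 ltW.
have g0 : gam 0 = y.
  have [h1 h2 h3] := hgam 0 ball0; apply/eqP; rewrite -subr_eq0 -normr_le0.
  have := lip _ y h2; rewrite subrr normr0 => /(_ del0).
  by rewrite h3 scale0r addr0 subrr normr0 mulr0.
have phi0 : phi 0 = 0 by rewrite /phi g0 subrr /ell mxE mul0r.
have phin s : `|s| <= s0 -> s != 0 -> phi s != 0.
  move=> hs ns; have [h1 h2 h3] := gE s hs; apply/eqP => p0.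
  by apply: (Gy (gam s)); rewrite ?h2//; [exact: mrr|rewrite h3 -/(phi s) p0 scale0r addr0].
have phiI s s' : `|s| <= s0 -> `|s'| <= s0 -> s != 0 -> s' != 0 -> phi s = phi s' -> s = s'.
  move=> hs hs' ns ns' e; have [h1 h2 h3] := gE s hs; have [h1' h2' h3'] := gE s' hs'.
  rewrite -h2 -h2' (Ginj (gam s) (gam s')) ?h2 ?h2'//; [exact: mrr|exact: mrr|].
  by rewrite h3 h3' -/(phi s) -/(phi s') e.
have cphi a b : - s0 < a -> b < s0 -> {within `[a, b], continuous phi}.
  move=> sa bs; apply: continuous_in_subspaceT => s; rewrite inE/= in_itv/= => /andP[as_ sb].
  have hs : `|s| < s0 by rewrite ltr_norml (lt_le_trans sa as_) (le_lt_trans sb bs).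
  pose KK := (1 + KA) * (C * `|v|) / `|v ord0 k|.
  have KK0 : 0 < KK by rewrite divr_gt0 ?normr_gt0// !mulr_gt0// addr_gt0.
  apply/continuous_at_normP => e e0; exists (Num.min (s0 - `|s|) (e / KK)).
    by rewrite lt_min subr_gt0 hs divr_gt0.
  move=> s'; rewrite lt_min => /andP[h1 h2].
  have hs' : `|s'| <= s0.
    by apply: ltW; rewrite -(subrK s s') (le_lt_trans (ler_normD _ _))// -ltrBrDr.
  have [a1 a2 a3] := hgam s (ltW hs); have [b1 b2 b3] := hgam s' hs'.
  have -> : phi s' - phi s = (G (gam s') - G (gam s)) ord0 k / v ord0 k.
    by rewrite /phi /ell -mulrBl !mxE opprB addrA subrK.
  rewrite normrM normfV ltr_pdivrMr ?normr_gt0//; apply: le_lt_trans (rV_coord_le _ _) _.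
  apply: le_lt_trans (lipG _ _ (mrG _ b1) (mrG _ a1)) _.
  have l1 := lip _ _ b2 a2; rewrite b3 a3 opprD addrACA subrr add0r -scalerBl normrZ in l1.
  have l2 : `|s' - s| * KK < e by rewrite -ltr_pdivlMr.
  apply: le_lt_trans (ler_wpM2l _ l1) _; first by rewrite addr_ge0// ltW.
  have -> : (1 + KA) * (C * (`|s' - s| * `|v|)) = `|s' - s| * KK * `|v ord0 k|.
    by rewrite /KK; field; rewrite normr_eq0.
  by rewrite ltr_pM2r ?normr_gt0.
pose s1 := s0 / 2.
have s10 : 0 < s1 by rewrite divr_gt0.
have s1s : s1 < s0 by rewrite ltr_pdivrMr// ltr_pMr// ltr1n.
have bs1 s : - s1 <= s <= s1 -> `|s| <= s0 by rewrite -ler_norml => /le_trans; apply; exact: ltW.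
have n1 := phin s1 (bs1 _ _) (lt0r_neq0 s10).
have iv a b t : - s1 <= a -> a <= b -> b <= s1 -> Num.min (phi a) (phi b) <= t <= Num.max (phi a) (phi b) ->
    exists2 c, a <= c <= b & phi c = t.
  move=> sa ab sb /(IVT ab (cphi a b _ _))[||c]; rewrite ?in_itv/=; last by move=> ? ?; exists c.
  - by apply: lt_le_trans sa; rewrite ltrN2.
  - exact: le_lt_trans sb s1s.
have [eta1 eta10 key] : exists2 eta : R, 0 < eta & forall t, `|t| < eta -> exists2 c, - s1 <= c <= s1 & phi c = t.
  apply: injective_crossing => //.
  - by move=> s hs; apply: phin; apply: le_trans hs _; exact: ltW.
  - by move=> s s' hs hs'; apply: phiI; [apply: le_trans hs _|apply: le_trans hs' _]; exact: ltW.
exists eta1 => // t /key[c hc pc]; have [h1 h2 h3] := gE c (bs1 _ hc).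
by exists (gam c); [exact: mrr|rewrite h3 -/(phi c) pc].
Qed.

End Inverse.

(** * Surjectivity of the projection near the zeros *)

Section Surjectivity.
Context {R : realType} {d : nat}.
Variables (V : 'rV[R]_d -> R) (D : set 'rV[R]_d) (X : resolution_data R d).
Hypothesis RX : resolution V D X.
Hypothesis oD : open D.
Notation M := (rd_space X).
Notation pi := (rd_proj X).
Notation leb := (lebesgue_rV d).
Variables (O : set 'rV[R]_d) (g : 'rV[R]_d -> M).
Hypothesis OE : O = pi @` ~` total_divisor V X.
Hypothesis oO : open O.
Hypothesis gK : forall p, ~ total_divisor V X p -> g (pi p) = p.

Let sM : @second_countable M. Proof. by have [_ h _] := res_space RX. Qed.

Lemma mono_zeroP c lab b z : monomializing V X c lab b -> chart_cod c z ->
  V (pi (chart_bwd c z)) = 0 <-> exists i a, lab i = Some a /\ z ord0 i = 0.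
Proof.
move=> mo cz; rewrite (mono_V mo cz); split.
  move=> /eqP; rewrite prodf_seq_eq0 => /hasP[i _ /= ]; rewrite expf_eq0 => /andP[k0 /eqP zi].
  by exists i; move: k0; rewrite /num_at; case: (lab i) => [a _|]; [exists a|rewrite /= muln0].
move=> [i [a [la zi]]]; rewrite (bigD1 i)//= zi expr0n /num_at la /=.
by have := res_knum RX a; case: (rd_k X a) => // k _; rewrite mul0r.
Qed.

Lemma divisorP p : total_divisor V X p <-> V (pi p) = 0.
Proof. by split=> [[]//|h]; split => //; exact: (res_range RX). Qed.

(** The monomializing charts, as an index type for countable covers of the
    divisor. *)
Definition mono_data := {q : chart M d * ('I_d -> option (rd_index X)) * ('rV[R]_d -> R) |
  monomializing V X q.1.1 q.1.2 q.2}.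

(** The resolution is second countable. *)
Lemma mono_countable (p0 : M) : total_divisor V X p0 -> exists f : nat -> mono_data,
  forall p, total_divisor V X p -> exists j, chart_dom (sval (f j)).1.1 p.
Proof.
have ex p : total_divisor V X p -> exists q : mono_data, chart_dom (sval q).1.1 p.
  by move=> /(res_mono RX)[c [lab [b [dp mo]]]]; exists (exist _ (c, lab, b) mo).
move=> tp; have [q0 _] := ex _ tp.
have oI (q : mono_data) : open (chart_dom (sval q).1.1).
  by have [[[h _ _ _ _] _] _ _ _] := mono_chart (svalP q).
have [f Sf] := @lindelof _ mono_data (fun q => chart_dom (sval q).1.1) (total_divisor V X) q0 sM oI ex.
by exists f => p /Sf[j _ h]; exists j.
Qed.

(** The zeros of [V] are the images of countably many pieces of hyperplanes,
    under maps that send null sets to null sets. *)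
Lemma zeros_negligible : leb.-negligible (D `&` V @^-1` [set 0] : set (borel 'rV[R]_d)).
Proof.
have [[x0 [Dx0 Vx0]]|h] := pselect (exists x, D x /\ V x = 0); last first.
  by apply: negligibleS (negligible_set0 _) => x [Dx Vx]; apply: h; exists x.
have [p0 pp0] := res_lift RX Dx0 Vx0.
have [f hf] : exists f : nat -> mono_data, forall p, total_divisor V X p -> exists j, chart_dom (sval (f j)).1.1 p.
  by apply: (@mono_countable p0); apply/divisorP; rewrite pp0.
have /choice[T hT] : forall ji : nat * 'I_d, exists T : set 'rV[R]_d, [/\ measurable (T : set (borel 'rV[R]_d)), leb T = 0%E &
   (pi \o chart_bwd (sval (f ji.1)).1.1) @` (chart_cod (sval (f ji.1)).1.1 `&` [set y | y ord0 ji.2 = 0]) `<=` T].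
  move=> [j i] /=; set c := (sval (f j)).1.1.
  have [[cc ac] _ _ _] := mono_chart (svalP (f j)).
  apply: (area_null_set (Dphi := jacobian (pi \o chart_bwd c))).
  - by have [_ h _ _ _] := cc.
  - move=> y cy; have [A hA] := proj_sdiff RX (conj cc ac) cy.
    by rewrite /c (sdiff_jacobian hA).
  - exact: hyperplane_closed.
  - exact: lebesgue_hyperplane.
pose N k : set (borel 'rV[R]_d) := if @unpickle (nat * 'I_d)%type k is Some ji then T ji else set0.
apply: negligibleS (_ : leb.-negligible (\bigcup_k N k)); last first.
  apply: negligible_bigcup => k; rewrite /N; case: unpickle => [ji|]; last exact: negligible_set0.
  by have [mT T0 _] := hT ji; exact/(negligibleP leb mT).
move=> x [Dx Vx]; have [p px] := res_lift RX Dx Vx.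
have tp : total_divisor V X p by apply/divisorP; rewrite px.
have [j dp] := hf p tp; set c := (sval (f j)).1.1 in dp.
have [[cc ac] _ _ _] := mono_chart (svalP (f j)).
have cy : chart_cod c (chart_fwd c p) by exists p.
have bp : chart_bwd c (chart_fwd c p) = p by exact: chart_fwdK.
have [i [a [la yi]]] : exists i a, (sval (f j)).1.2 i = Some a /\ chart_fwd c p ord0 i = 0.
  by apply/(mono_zeroP (svalP (f j)) cy); rewrite bp px.
exists (pickle (j, i)) => //; rewrite /N pickleK; have [_ _] := hT (j, i); apply.
by exists (chart_fwd c p) => //=; rewrite -/c bp px.
Qed.

(** For almost every line in a given direction, the image of the resolution is
    open in the line at the points of the divisor. A line fails this only if it
    meets the image of a point of a hyperplane [y_i = 0] where the restriction to
    the hyperplane is not an immersion transversal to the direction, or of a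
    point on two of the hyperplanes; adding a multiple of the direction to the
    restriction makes these points critical values, or values on a hyperplane,
    of a map of equal dimensions, and a translation along the line brings them
    to any prescribed point of the line. *)
Lemma line_open (v : 'rV[R]_d) : v != 0 -> exists2 Bad : set (borel 'rV[R]_d), leb.-negligible Bad &
  forall x, ~ Bad x -> forall t p, total_divisor V X p -> pi p = x + t *: v ->
    exists2 eta : R, 0 < eta & forall t' : R, `|t'| < eta -> exists p', pi p' = x + (t + t') *: v.
Proof.
move=> v0; have [[p0 tp0]|h] := pselect (exists p, total_divisor V X p); last first.
  by exists set0; [exact: negligible_set0|move=> x _ t p tp; case: h; exists p].
have [f hf] := mono_countable tp0.
pose ch j := (sval (f j)).1.1.
have cac j : is_chart (ch j) /\ analytic_chart (rd_atlas X) (ch j).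
  by have [[cc ac] _ _ _] := mono_chart (svalP (f j)).
pose G j := pi \o chart_bwd (ch j).
pose Om j (i : 'I_d) := [set y : 'rV[R]_d | chart_cod (ch j) (y *m drop_coord i)].
pose Psi j i (y : 'rV[R]_d) := G j (y *m drop_coord i) + y *m coord_line i v.
pose DPsi j i (y : 'rV[R]_d) := drop_coord i *m jacobian (G j) (y *m drop_coord i) + coord_line i v.
have oOm j i : open (Om j i).
  have [[_ oc _ _ _] _] := cac j.
  have c1 : continuous (fun y : 'rV[R]_d => y *m drop_coord i).
    by move=> y; exact: sdiff_continuous (sdiff_mulmx (drop_coord i) y).
  by move/continuousP : c1 => /(_ _ oc).
have dPsi j i y : Om j i y -> sdiff (Psi j i) y (DPsi j i y).
  move=> Oy; have [_ ac] := cac j; have [A hA] := proj_sdiff RX ac Oy.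
  apply: sdiffB; last exact: sdiff_mulmx.
  have -> : jacobian (G j) (y *m drop_coord i) = A by exact: sdiff_jacobian hA.
  exact: (sdiff_comp (f := fun z => z *m drop_coord i) (g := G j) (sdiff_mulmx _ y) hA).
have /choice[T hT] : forall u : nat * 'I_d * 'I_d, exists T : set (borel 'rV[R]_d), [/\ leb.-negligible T,
    (forall y, Om u.1.1 u.1.2 y -> \det (DPsi u.1.1 u.1.2 y) = 0 -> T (Psi u.1.1 u.1.2 y)) &
    (forall y, Om u.1.1 u.1.2 y -> y ord0 u.2 = 0 -> T (Psi u.1.1 u.1.2 y))].
  move=> [[j i] i'] /=.
  have [T1 [m1 z1 h1]] := area_critical (oOm j i) (@dPsi j i).
  have cN : closed [set y : 'rV[R]_d | y ord0 i' = 0] by exact: hyperplane_closed.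
  have [T2 [m2 z2 h2]] := area_null_set (oOm j i) (@dPsi j i) cN (lebesgue_hyperplane i').
  exists (T1 `|` T2); split.
  - by apply: negligibleU; [exact/(negligibleP leb m1)|exact/(negligibleP leb m2)].
  - by move=> y Oy dy; left; exact: h1.
  - by move=> y Oy yi; right; apply: h2; exists y.
pose N k : set (borel 'rV[R]_d) := if @unpickle (nat * 'I_d * 'I_d)%type k is Some u then T u else set0.
exists (\bigcup_k N k).
  apply: negligible_bigcup => k; rewrite /N; case: unpickle => [u|]; last exact: negligible_set0.
  by have [] := hT u.
move=> x nB t p tp px.
have nT u : ~ T u x.
  by move=> Tx; apply: nB; exists (pickle u) => //; rewrite /N pickleK.
have [j dp] := hf p tp; set c := ch j; have [cc ac] := cac j.
pose y := chart_fwd c p; have cy : chart_cod c y by exists p.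
have bp : chart_bwd c y = p by exact: chart_fwdK.
pose lab := (sval (f j)).1.2; have mo := svalP (f j).
have [i [a [la yi]]] : exists i a, lab i = Some a /\ y ord0 i = 0.
  by apply/(mono_zeroP mo cy); rewrite -/c bp; apply/divisorP.
pose z : 'rV[R]_d := y - t *: delta_mx ord0 i.
have zZ : z *m drop_coord i = y.
  apply/rowP => l; rewrite drop_coordE /z !mxE/=; case: eqP => [->|_]; first by rewrite yi.
  by rewrite mulr0 subr0.
have zO : Om j i z by rewrite /Om/= zZ.
have zi : z ord0 i = - t by rewrite /z !mxE !eqxx yi mulr1 add0r.
have Pz : Psi j i z = x by rewrite /Psi coord_lineE zZ zi /G/= -/c bp px scaleNr addrK.
have dA : \det (drop_coord i *m jacobian (G j) y + coord_line i v) != 0.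
  apply/eqP => d0; have [_ h _] := hT (j, i, i).
  have d1 : \det (DPsi j i z) = 0 by rewrite /DPsi zZ.
  by have := h z zO d1; rewrite [X in T _ X]Pz; exact: nT.
have other l : l != i -> y ord0 l != 0.
  move=> li; apply/eqP => yl; have [_ _ h] := hT (j, i, l).
  have zl : z ord0 l = 0 by rewrite /z !mxE (negbTE li) andbF mulr0 subr0.
  by have := h z zO zl; rewrite [X in T _ X]Pz; exact: nT.
have [A hA] := proj_sdiff RX ac cy.
have JA : jacobian (G j) y = A by exact: sdiff_jacobian hA.
rewrite JA in dA.
have [r1 r10 hr1] := coord_gap y.
have [_ oc _ _ _] := cc.
have /nbhs_normP[r2 /= r20 hr2] := open_nbhs_nbhs (conj oc cy).
pose r := Num.min r1 r2; have r0 : 0 < r by rewrite lt_min r10.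
have near_ (w : 'rV[R]_d) : `|w - y| < r -> chart_cod c w /\ (w ord0 i != 0 -> V (pi (chart_bwd c w)) <> 0).
  rewrite lt_min => /andP[w1 w2].
  have cw : chart_cod c w by apply: hr2; rewrite /ball_/= distrC.
  split => // wi /(mono_zeroP mo cw)[l [a' [la' wl]]].
  have [li|li] := eqVneq l i; first by move: wi; rewrite -li wl eqxx.
  have := hr1 l (other l li); apply/negP; rewrite -leNgt.
  have := rV_coord_le (w - y) l; rewrite !mxE wl sub0r normrN => /le_trans; apply; exact: ltW.
have [eta eta0 heta] : exists2 eta : R, 0 < eta & forall t' : R, `|t'| < eta -> 
    exists2 w, `|w - y| < r & G j w = G j y + t' *: v.
  apply: (line_crossing v0 yi hA dA r0).
  - move=> w w' hw hw' wi wi' Gw; have [cw Vw] := near_ _ hw; have [cw' Vw'] := near_ _ hw'.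
    have e : chart_bwd c w = chart_bwd c w'.
      rewrite -[LHS]gK; last by move=> /divisorP; exact: Vw.
      rewrite -[RHS]gK; last by move=> /divisorP; exact: Vw'.
      by congr g.
    by rewrite -(chart_bwdK cc cw) e chart_bwdK.
  - move=> w hw wi Gw; have [cw Vw] := near_ _ hw; apply: Vw => //.
    by have := Gw; rewrite /G /= -/c => ->; rewrite bp; apply/divisorP.
exists eta => // t' /heta[w hw Gw]; exists (chart_bwd c w).
by have := Gw; rewrite /G/= -/c => ->; rewrite bp px scalerDl addrA.
Qed.

(** Near a zero of [V] the projection is onto: a generic segment from an interior
    point of the image to a point outside would leave the image at a point where
    the image is open in the segment. *)
Lemma proj_onto x0 : D x0 -> V x0 = 0 ->
  exists2 del : R, 0 < del & forall x, `|x - x0| < del -> exists p, pi p = x.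
Proof.
move=> Dx0 Vx0.
have /nbhs_normP[e /= e0 he] := open_nbhs_nbhs (conj oD Dx0).
pose del := e / 2; have del0 : 0 < del by rewrite divr_gt0.
pose K := [set x : 'rV[R]_d | `|x - x0| <= del].
have KD : K `<=` D.
  by move=> x Kx; apply: he; rewrite /ball_/= distrC (le_lt_trans Kx)// ltr_pdivrMr// ltr_pMr// ltr1n.
have Kb : K `<=` rd_base X.
  by move=> x /KD Dx; have [_ _ h] := res_base RX; apply: h; exact: subset_closure.
pose T := pi @` (pi @^-1` K).
have cT : closed T.
  apply: compact_rV_closed; apply: continuous_compact.
    by apply: continuous_subspaceT; exact: (rd_proj_continuous RX).
  by apply: (res_proper RX) => //; exact: compact_ball_rV.
have TP x : K x -> (exists p, pi p = x) -> T x by move=> Kx [p px]; exists p => //=; rewrite px.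
exists del => // x2 hx2; apply: contrapT => nx2.
pose B0 : set 'rV[R]_d := [set x | `|x - x0| < del].
have oB0 : open B0.
  rewrite (_ : B0 = ball x0 del); first exact: ball_open.
  by rewrite -ball_normE; apply/seteqP; split=> x /=; rewrite /B0/= distrC.
(* The point over a zero is moved off the coordinate hyperplanes of its chart,
   which gives an interior point [x1] of the image. *)
have [p0 pp0] := res_lift RX Dx0 Vx0.
have tp0 : total_divisor V X p0 by apply/divisorP; rewrite pp0.
have [c [lab [b [dp mo]]]] := res_mono RX tp0.
have [[cc ac] _ _ _] := mono_chart mo.
pose y0 := chart_fwd c p0; have cy0 : chart_cod c y0 by exists p0.
have bp0 : chart_bwd c y0 = p0 by exact: chart_fwdK.
have [x1 Ox1 hx1] : exists2 x1, O x1 & `|x1 - x0| < del.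
  have n1 : \forall p \near chart_bwd c y0, `|pi p - x0| < del.
    have nb : nbhs (pi p0) B0.
      by rewrite pp0; apply: open_nbhs_nbhs; split => //; rewrite /B0/= subrr normr0.
    by rewrite bp0; move: (rd_proj_continuous RX) => h; exact: h nb.
  have /nbhs_normP[s /= s0 hs] := chart_bwd_near cc cy0 n1.
  pose z : 'rV[R]_d := \row_i (if y0 ord0 i == 0 then s / 2 else y0 ord0 i).
  have [cz zd] : chart_cod c z /\ `|pi (chart_bwd c z) - x0| < del.
    apply: hs; rewrite /ball_/= distrC; apply: (@le_lt_trans _ _ (s / 2)); last first.
      by rewrite ltr_pdivrMr// ltr_pMr// ltr1n.
    apply: rV_norm_le => [|i]; first by rewrite divr_ge0// ltW.
    rewrite !mxE; case: eqP => [->|_]; first by rewrite subr0 ger0_norm// divr_ge0// ltW.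
    by rewrite subrr normr0 divr_ge0// ltW.
  exists (pi (chart_bwd c z)) => //; rewrite OE; exists (chart_bwd c z) => //.
  move=> /divisorP/(mono_zeroP mo cz)[i [a [_]]]; rewrite mxE; case: eqP => // _ /eqP.
  by rewrite mulf_eq0 invr_eq0 pnatr_eq0 orbF gt_eqF.
have /nbhs_normP[r1 /= r10 hr1] := open_nbhs_nbhs (conj (openI oO oB0) (conj Ox1 hx1)).
have nT2 : ~ T x2 by move=> [p _ px]; apply: nx2; exists p.
have /nbhs_normP[r2 /= r20 hr2] := open_nbhs_nbhs (conj (openI (closed_openC cT) oB0) (conj nT2 hx2)).
pose v := x2 - x1.
have OT x : O x -> exists p, pi p = x by rewrite OE => -[p _ <-]; exists p.
have v0 : v != 0.
  by rewrite subr_eq0; apply/eqP => e12; apply: nx2; rewrite e12; exact: OT.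
have [Bad nBad line] := line_open v0.
pose r := Num.min r1 r2; have r0 : 0 < r by rewrite lt_min r10.
have r20' : 0 < r / 2 by rewrite divr_gt0.
have [x hx nx] : exists2 x, hcube x1 (r / 2) x & ~ Bad x.
  apply: contrapT => h; have sub : hcube x1 (r / 2) `<=` Bad.
    by move=> x hx; apply: contrapT => nx; apply: h; exists x.
  have nh : leb.-negligible (hcube x1 (r / 2) : set (borel 'rV[R]_d)) by apply: negligibleS nBad; exact: sub.
  have /(negligibleP leb (measurable_hcube x1 (r / 2))) := nh.
  move=> /(eq_trans (esym (lebesgue_hcube x1 (ltW r20')))) [] /eqP.
  by rewrite expf_eq0 => /andP[_]; rewrite mulf_eq0 pnatr_eq0/= gt_eqF.
have xr : `|x - x1| < r.
  apply: le_lt_trans (hcube_norm (ltW r20') hx) _.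
  by rewrite ltr_pdivrMr// ltr_pMr// ltr1n.
move: (xr); rewrite lt_min => /andP[xr1 xr2].
have [Ox Bx] : (O `&` B0) x by apply: hr1; rewrite /ball_/= distrC.
have xv : x + v - x2 = x - x1 by rewrite /v addrA addrAC addrK.
have [nTx2 Bx2] : (~` T `&` B0) (x + v) by apply: hr2; rewrite /ball_/= distrC xv.
have seg t : 0 <= t <= 1 -> `|x + t *: v - x0| < del.
  move=> /andP[t0 t1]; have -> : x + t *: v - x0 = (1 - t) *: (x - x0) + t *: (x + v - x0).
    by apply/rowP => j; rewrite !mxE; ring.
  have [->|tn] := eqVneq t 0; first by rewrite subr0 scale1r scale0r addr0.
  have tp : 0 < t by rewrite lt_def tn.
  apply: le_lt_trans (ler_normD _ _) _; rewrite !normrZ (ger0_norm t0) ger0_norm ?subr_ge0//.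
  rewrite [X in _ < X](_ : del = (1 - t) * del + t * del); last by rewrite -mulrDl subrK mul1r.
  by apply: ler_ltD; [apply: ler_wpM2l; [rewrite subr_ge0|exact: ltW]|rewrite ltr_pM2l].
have segK t : 0 <= t <= 1 -> K (x + t *: v) by move=> /seg/ltW.
pose S : set R := [set t | 0 <= t <= 1 /\ T (x + t *: v)].
have S0 : S 0 by split; rewrite ?lexx ?ler01// scale0r addr0; apply: TP; [exact: ltW|exact: OT].
have uS : ubound S 1 by move=> t [/andP[]].
have hS : has_sup S by split; [exists 0|exists 1].
pose ts := sup S.
have ts01 : 0 <= ts <= 1.
  by rewrite (ub_le_sup _ S0) ?(ge_sup _ uS)//; [exists 0|exists 1].
have nv0 : 0 < `|v| by rewrite normr_gt0.
have Tts : T (x + ts *: v).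
  apply: contrapT => nTt.
  have /nbhs_normP[eps /= eps0 heps] := open_nbhs_nbhs (conj (closed_openC cT) nTt).
  have [t St ht] := sup_adherent (divr_gt0 eps0 nv0) hS.
  have tts : t <= ts by apply: ub_le_sup => //; exists 1.
  have [_ Tt] := St; apply: (heps (x + t *: v)) => //; rewrite /ball_/=.
  rewrite opprD addrACA subrr add0r -scalerBl normrZ -ltr_pdivlMr// ger0_norm ?subr_ge0//.
  by rewrite ltrBlDr -ltrBlDl.
have [eta eta0 heta] : exists2 eta : R, 0 < eta & forall t' : R, `|t'| < eta -> exists p', pi p' = x + (ts + t') *: v.
  have [p _ px] := Tts.
  have [tp|np] := pselect (total_divisor V X p); first exact: line nx _ _ tp px.
  have Ot : O (x + ts *: v) by rewrite OE; exists p.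
  have /nbhs_normP[eps /= eps0 heps] := open_nbhs_nbhs (conj oO Ot).
  exists (eps / `|v|); first exact: divr_gt0.
  move=> t' ht'; apply: OT; apply: heps; rewrite /ball_/=.
  by rewrite scalerDl addrA opprD addrA subrr sub0r normrN normrZ -ltr_pdivlMr.
have [ts1|ts1] := leP 1 ts.
  apply: nTx2; have -> : x + v = x + ts *: v; last by [].
  by have -> : ts = 1 by [apply/eqP; rewrite eq_le ts1; case/andP: ts01 => _ ->]; rewrite scale1r.
pose t' := Num.min (eta / 2) (1 - ts).
have t'0 : 0 < t' by rewrite lt_min divr_gt0// subr_gt0.
have t'e : `|t'| < eta.
  rewrite gtr0_norm//; apply: (@le_lt_trans _ _ (eta / 2)); first by rewrite ge_min lexx.
  by rewrite ltr_pdivrMr// ltr_pMr// ltr1n.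
have t1 : 0 <= ts + t' <= 1.
  rewrite addr_ge0 ?(ltW t'0)//=; last by case/andP: ts01.
  by rewrite addrC -lerBrDr ge_min lexx orbT.
have : S (ts + t') by split => //; apply: TP; [exact: segK|exact: heta].
move=> /(ub_le_sup (ex_intro _ 1 uS)); rewrite -/ts gerDl.
by apply/negP; rewrite -ltNge.
Qed.

End Surjectivity.

(** * Singularity types and the density formula *)

Section Types.
Context {R : realType} {d : nat}.
Variables (V : 'rV[R]_d -> R) (D : set 'rV[R]_d) (X : resolution_data R d).
Hypothesis RX : resolution V D X.
Hypothesis oD : open D.
Notation M := (rd_space X).
Notation pi := (rd_proj X).

Lemma divisor_zero a p : rd_div X a p -> V (pi p) = 0.
Proof.
move=> ap; have : total_divisor V X p by rewrite (res_preimage RX); exists a.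
by move=> [].
Qed.

Lemma lambda_le a p : rd_div X a p -> (lambda_at X (pi p) <= (@Defs.ratio R d X a)%:E)%E.
Proof. by move=> ap; apply: bigmin_le_cond; apply/asboolP; exists p. Qed.

(** The minimum is over a nonempty family, as every zero of [V] in [D] has a
    preimage, which lies on some divisor. *)
Lemma lambda_attained x : D x -> V x = 0 -> exists p a, [/\ pi p = x, rd_div X a p &
  lambda_at X x = (@Defs.ratio R d X a)%:E].
Proof.
move=> Dx Vx; have [p px] := res_lift RX Dx Vx.
have [a0 _ ap] : (\bigcup_a rd_div X a) p.
  by rewrite -(res_preimage RX); split; [exact: (res_range RX)|rewrite /= px].
have le0 : (lambda_at X x <= (@Defs.ratio R d X a0)%:E)%E by rewrite -px; exact: lambda_le.
have [e|[a [q qx aq] e]] : lambda_at X x = +oo%E \/ exists2 a, (pi @` rd_div X a) x & lambda_at X x = (@Defs.ratio R d X a)%:E.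
- rewrite /lambda_at; elim/big_ind : _ => [|u v hu hv|a /asboolP h]; first by left.
  + by rewrite /Order.min; case: ifP.
  + by right; exists a.
- by move: le0; rewrite e leye_eq.
- by exists q, a.
Qed.

Lemma ratio_gt0 a : 0 < @Defs.ratio R d X a.
Proof. by rewrite /Defs.ratio divr_gt0// ltr0n muln_gt0/= (res_knum RX). Qed.

(** The ratios are positive, and a single divisor attaining the minimum gives
    multiplicity at least one. *)
Lemma type_pos lam m x : Zset V D X lam m x -> 0 < lam /\ (0 < m)%N.
Proof.
move=> [[Dx Vx] lx mx]; have [p [a [px ap e]]] := lambda_attained Dx Vx; split.
  by move: e; rewrite lx => -[->]; exact: ratio_gt0.
rewrite -mx; apply: (@leq_trans #|[set a]%SET|); first by rewrite cards1.
rewrite /mult_at; apply: (leq_bigmax_cond (F := fun A : {set rd_index X} => #|A|)); apply/asboolP; split.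
  by exists p => // a' /=; rewrite inE => /eqP ->.
by move=> a'; rewrite inE => /eqP ->.
Qed.

Variables (lam : R) (m : nat).
Hypothesis m0 : (0 < m)%N.

(** A divisor of smaller ratio, or more critical divisors, through another
    point of the fibre would put the point in the saturation of the excluded
    set. *)
Lemma Eset_Zset p : Eset D X lam m p -> Zset V D X lam m (pi p).
Proof.
move=> /Eset_regE[[Dp nC] [A [Ac Am Ap]]].
have /card_gt0P[a aA] : (0 < #|A|)%N by rewrite Am.
have ratA b : b \in A -> @Defs.ratio R d X b = lam.
  by move=> bA; have := fintype.subsetP Ac b bA; rewrite inE => /eqP.
have lamE : lambda_at X (pi p) = lam%:E.
  apply/eqP; rewrite eq_le; apply/andP; split.
    by rewrite -(ratA a aA); apply: lambda_le; exact: Ap.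
  apply: le_bigmin; first exact: leey.
  move=> b /asboolP[q bq qp]; rewrite lee_fin leNgt; apply/negP => lb; apply: nC.
  by exists q => //; left; exists b => //=; rewrite inE.
split => //.
  by split => //; exact: divisor_zero (Ap a aA).
apply/eqP; rewrite eqn_leq; apply/andP; split; last first.
  rewrite -Am; apply: (leq_bigmax_cond (F := fun A : {set rd_index X} => #|A|)); apply/asboolP; split; first by exists p.
  by move=> b bA; rewrite lamE ratA.
apply/bigmax_leqP => A' /asboolP[[q qA qp] hA]; rewrite leqNgt; apply/negP => mA; apply: nC.
exists q => //; right; exists A' => //=; split => //.
by apply/fintype.subsetP => b bA; rewrite inE; have := hA b bA; rewrite lamE => -[->].
Qed.

Lemma mult_lower (A : {set rd_index X}) p : (forall a, a \in A -> (@Defs.ratio R d X a)%:E = lambda_at X (pi p)) -> stratum A p ->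
  (#|A| <= mult_at X (pi p))%N.
Proof.
move=> hA Ap; apply: (leq_bigmax_cond (F := fun A : {set rd_index X} => #|A|)).
by apply/asboolP; split => //; exists p.
Qed.

(** On the admissible domain no singularity is worse than [(lam, m)], so that its
    points have no preimage in the excluded divisors and intersections. *)
Lemma Dset_Dreg x : Dset V D X lam m x -> Dreg D X lam m x.
Proof.
move=> [Dx nx]; split => // -[p Cp px]; apply: nx.
have Vx : V x = 0.
  rewrite -px; case: Cp => [[a _ ap]|[A [_ mA] Ap]]; first exact: divisor_zero ap.
  have /card_gt0P[a aA] : (0 < #|A|)%N by exact: leq_ltn_trans mA.
  exact: divisor_zero (Ap a aA).
have [q [b [qx bq lx]]] := lambda_attained Dx Vx.
exists (@Defs.ratio R d X b), (mult_at X x); split; last by split.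
case: Cp => [[a /= al ap]|[A [Ac mA] Ap]].
  left; move: al; rewrite inE; apply: le_lt_trans.
  by have := lambda_le ap; rewrite px lx lee_fin.
have ratA a : a \in A -> @Defs.ratio R d X a = lam.
  by move=> aA; have := fintype.subsetP Ac a aA; rewrite inE => /eqP.
have /card_gt0P[a aA] : (0 < #|A|)%N by exact: leq_ltn_trans mA.
have : @Defs.ratio R d X b <= lam.
  by have := lambda_le (Ap a aA); rewrite px lx lee_fin (ratA a aA).
rewrite le_eqVlt => /predU1P[e|]; last by left.
right; split => //; apply: leq_trans mA _; rewrite -px; apply: mult_lower => // a' aA'.
by rewrite px lx e ratA.
Qed.

(** The maximum defining the multiplicity is attained by a stratum, whose point
    over [x] is not excluded. *)
Lemma Zset_lift x : Zset V D X lam m x -> exists2 p, Eset D X lam m p & pi p = x.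
Proof.
move=> [[Dx Vx] lx mx].
have Rx : Dreg D X lam m x.
  apply: Dset_Dreg; split => // -[l' [m' [lt [_ lx' mx']]]].
  move: lx'; rewrite lx => -[e]; move: mx'; rewrite mx => e'; rewrite -e -e' in lt.
  by case: lt => [|[_]]; rewrite ?ltxx ?ltnn.
have [A [[p Ap px] hA] mA] : exists2 A : {set rd_index X}, (pi @` stratum A) x /\
    (forall a, a \in A -> (@Defs.ratio R d X a)%:E = lambda_at X x) & (m <= #|A|)%N.
  apply: contrapT => h; have : (mult_at X x <= m.-1)%N.
    apply/bigmax_leqP => A /asboolP hA; rewrite -ltnS prednK// ltnNge; apply/negP => mA.
    by apply: h; exists A.
  by rewrite mx leqNgt prednK// leqnn.
have Ac : A \subset crit X lam.
  by apply/fintype.subsetP => a aA; rewrite inE; have := hA a aA; rewrite lx => -[->].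
exists p => //; apply/Eset_regE; rewrite px; split => //; exists A; split => //.
apply/eqP; rewrite eqn_leq mA andbT leqNgt; apply/negP => mA'.
by have [_ h] := Rx; apply: h; exists p => //; right; exists A.
Qed.

Definition strata : set M := \bigcup_(A in [set A : {set rd_index X} | A \subset crit X lam /\ #|A| = m]) stratum A.

Lemma strata_closed : closed strata.
Proof. by apply: closed_bigcup; [exact: finite_finset|move=> A _; exact: (stratum_closed RX)]. Qed.

Lemma EsetE : Eset D X lam m = pi @^-1` Dreg D X lam m `&` strata.
Proof.
apply/seteqP; split=> p; first by move=> /Eset_regE[h [A [h1 h2 h3]]]; split => //; exists A.
by move=> [h [A [h1 h2] h3]]; apply/Eset_regE; split => //; exists A.
Qed.

Lemma preimage_open (U : set 'rV[R]_d) : open U -> open (pi @^-1` U).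
Proof. by move=> oU; have /continuousP := rd_proj_continuous RX; exact. Qed.

Lemma Eset_borel : measurable (Eset D X lam m : set (borel M)).
Proof.
have m1 : measurable (pi @^-1` Dreg D X lam m : set (borel M)).
  have oP : open (pi @^-1` Dreg D X lam m) by apply: preimage_open; exact: (Dreg_open RX oD).
  exact: open_borel oP.
have m2 : measurable (strata : set (borel M)) by exact: (@closed_borel M _ strata_closed).
by rewrite EsetE; exact: (measurableI _ _ m1 m2).
Qed.

Lemma preimage_compact (K : set 'rV[R]_d) : compact K -> K `<=` D -> compact (pi @^-1` K).
Proof.
move=> cK KD; apply: (res_proper RX) => // x /KD Dx.
by have [_ _ h] := res_base RX; apply: h; exact: subset_closure.
Qed.

(** The zeros of a given type are closed in the open regular part of [D], as
    images of closed strata under a proper map. This makes them a Borel set and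
    gives inner regularity. *)
Lemma Zset_sigma_compact : exists K : nat -> set 'rV[R]_d,
  [/\ forall k, compact (K k), {homo K : k l / (k <= l)%N >-> (k <= l)%O} & Zset V D X lam m = \bigcup_k K k].
Proof.
have [K [cK hK KE]] := open_sigma_compact (Dreg_open (lam := lam) (m := m) RX oD).
have KR k : K k `<=` Dreg D X lam m by move=> x Kx; rewrite KE; exists k.
exists (fun k => pi @` (pi @^-1` K k `&` strata)); split.
- move=> k; apply: continuous_compact; first by apply: continuous_subspaceT; exact: (rd_proj_continuous RX).
  apply: compact_closedI strata_closed; apply: preimage_compact => // x /KR[].
  done.
- move=> k l kl; apply/subsetPset => x [p [Kp Sp] <-]; exists p => //; split => //.
  by have /subsetPset := hK _ _ kl; exact.
- apply/seteqP; split => x.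
    move=> /Zset_lift[p]; rewrite EsetE => -[Rp Sp] <-; move: (Rp); rewrite /= KE => -[k _ Kp].
    by exists k => //; exists p.
  by move=> [k _ [p [Kp Sp] <-]]; apply: Eset_Zset; rewrite EsetE; split => //; exact: KR Kp.
Qed.

End Types.

Section Density.
Context {R : realType} {d : nat}.
Variables (V : 'rV[R]_d -> R) (D : set 'rV[R]_d) (X : resolution_data R d).
Hypothesis RX : resolution V D X.
Hypothesis oD : open D.
Variables (lam : R) (m : nat).
Hypothesis lam0 : 0 < lam.
Hypothesis m0 : (0 < m)%N.
Notation M := (rd_space X).
Notation pi := (rd_proj X).
Variable rho : {measure set (borel M) -> \bar R}.
Hypothesis rho0 : forall A : set (borel M), measurable A -> (forall p, A p -> ~ Eset D X lam m p) -> rho A = 0%E.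
Hypothesis rho_cube : forall (q : cube X) (gq : good_cube V D lam m q) (B : set (borel M)),
  measurable B -> B `<=` q_nbhs q -> rho B = q_measure lam0 gq B.

Let sM : @second_countable M. Proof. by have [_ h _] := res_space RX. Qed.

(** Moving along a coordinate axis near a point of a chart shows which
    coordinates cut out a given set. *)
Lemma chart_axis (c : @chart R M d) p (i : 'I_d) : is_chart c -> chart_dom c p -> exists2 s : R, s != 0 &
  exists2 p', chart_dom c p' & forall l, chart_fwd c p' ord0 l = chart_fwd c p ord0 l + (if l == i then s else 0).
Proof.
move=> cc dp; set y := chart_fwd c p; have cy : chart_cod c y by exists p.
have [_ oc _ _ _] := cc.
have /nbhs_normP[e /= e0 he] := open_nbhs_nbhs (conj oc cy).
have e20 : 0 < e / 2 by rewrite divr_gt0.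
pose z : 'rV[R]_d := \row_l (y ord0 l + (if l == i then e / 2 else 0)).
have cz : chart_cod c z.
  apply: he; rewrite /ball_/= distrC; apply: (@le_lt_trans _ _ (e / 2)); last first.
    by rewrite ltr_pdivrMr// ltr_pMr// ltr1n.
  apply: rV_norm_le => [|l]; first exact: ltW.
  by rewrite !mxE addrC addKr; case: ifP => _; rewrite ?normr0 ?(ger0_norm (ltW e20))// ltW.
exists (e / 2); first by rewrite gt_eqF.
exists (chart_bwd c z); first exact: chart_bwd_dom.
by move=> l; rewrite chart_bwdK// mxE.
Qed.

(** The divisors of the stratum give [m] critical coordinates, and a good cube
    has no more. *)
Lemma q_crit_stratum (A : {set rd_index X}) c lab b p r : A \subset crit X lam -> #|A| = m ->
  good_cube V D lam m (Cube c lab b (chart_fwd c p) r) -> chart_dom c p -> stratum A p ->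
  q_crit lam (Cube c lab b (chart_fwd c p) r) = [set i | [exists a in A, lab i == Some a]]%SET.
Proof.
move=> Ac Am gq dp Ap; set q := Cube _ _ _ _ _; have mo := gc_mono gq.
have [_ h1 inj h3] := mono_chart mo.
set IA := [set i | _]%SET.
have sub : IA \subset q_crit lam q.
  apply/fintype.subsetP => i; rewrite inE => /fintype.existsP[a /andP[aA /eqP la]].
  apply/q_critP; split; first by apply/(h3 i a la p dp); exact: Ap.
  by exists a => //; have := fintype.subsetP Ac a aA; rewrite inE => /eqP.
have ia a : a \in A -> exists i, lab i == Some a.
  move=> aA; have [] := (h1 a).1; last by move=> i la; exists i; apply/eqP.
  by exists p; split => //; exact: Ap.
have /card_gt0P[a0 a0A] : (0 < #|A|)%N by rewrite Am.
have [i0 _] := ia a0 a0A.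
pose f a := odflt i0 [pick i | lab i == Some a].
have fP a : a \in A -> lab (f a) = Some a.
  by move=> aA; rewrite /f; case: pickP => [i /eqP//|h]; have [i] := ia a aA; rewrite h.
have cA : (m <= #|IA|)%N.
  have finj : {in A &, injective f}.
    by move=> a a' aA aA' e; have := fP a aA; rewrite e fP// => -[->].
  rewrite -Am -(card_in_imset finj); apply: subset_leq_card; apply/fintype.subsetP => i /imsetP[a aA ->].
  by rewrite inE; apply/fintype.existsP; exists a; rewrite aA fP//=.
apply/esym/eqP; rewrite eqEcard sub; apply: leq_trans (q_crit_le gq) cA.
Qed.

(** The labels of the critical coordinates contain the [m] divisors of the
    stratum. *)
Lemma q_crit_stratum_card (A : {set rd_index X}) c lab b p r : A \subset crit X lam -> #|A| = m ->
  good_cube V D lam m (Cube c lab b (chart_fwd c p) r) -> chart_dom c p -> stratum A p ->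
  #|q_crit lam (Cube c lab b (chart_fwd c p) r)| = m.
Proof.
move=> Ac Am gq dp Ap; have [_ h1 _ _] := mono_chart (gc_mono gq).
apply/eqP; rewrite eqn_leq (q_crit_le gq)/= -(q_labels_card gq) -Am.
apply: subset_leq_card; apply/fintype.subsetP => a aA; rewrite inE.
have [i la] : exists i, lab i = Some a by apply/(h1 a).1; exists p; split => //; exact: Ap.
apply/fintype.existsP; exists i; rewrite (q_crit_stratum Ac Am gq dp Ap) inE /= la eqxx andbT.
by apply/fintype.existsP; exists a; rewrite aA /=.
Qed.

Lemma Eset_reg p : Eset D X lam m p -> Dreg D X lam m (pi p).
Proof. by move=> /Eset_regE[]. Qed.

(** The set is cut into countably many pieces, each in a good cube of the given
    chart, for which the density is the face measure; on the face the point and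
    its projection to the face coincide, so that the weight is the density
    coefficient. *)
Lemma density_formula : has_density_formula V D lam m rho.
Proof.
move=> A Ac Am c lab b mo J hJ HE B mB BE.
have [[p1 Bp1]|nB] := pselect (exists p, B p); last first.
  have B0 : B = set0 by apply/seteqP; split => // p Bp; case: nB; exists p.
  by rewrite B0 image_set0 integral_set0 measure0.
have [cc ac] : is_chart c /\ analytic_chart (rd_atlas X) c by have [[h1 h2] _ _ _] := mono_chart mo.
have [_ h1 inj h3] := mono_chart mo.
have Bdom p : B p -> chart_dom c p by move=> /BE[].
have BA p : B p -> stratum A p by move=> /BE[[]].
have BEs p : B p -> Eset D X lam m p by move=> /BE[[]].
have BJ p : B p -> forall i, i \in J -> chart_fwd c p ord0 i = 0.
  move=> Bp; have : (stratum A `&` chart_dom c) p by split; [exact: BA|exact: Bdom].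
  by rewrite HE => -[].
pose IA := [set i | [exists a in A, lab i == Some a]]%SET.
have JIA : J = IA.
  apply/setP => i; have d1 := Bdom _ Bp1; have [s s0 [p' dp' hp']] := chart_axis i cc d1.
  apply/idP/idP => [iJ|]; last first.
    rewrite inE => /fintype.existsP[a /andP[aA /eqP la]]; apply: contrapT => /negP nJ.
    have : (stratum A `&` chart_dom c) p'.
      rewrite HE; split => // l lJ; rewrite hp' (BJ _ Bp1)// add0r; case: eqP => // li.
      by move: nJ; rewrite -li lJ.
    move=> [/(_ a aA) ap' _]; have := (h3 i a la p' dp').1 ap'.
    rewrite hp' eqxx (h3 i a la p1 d1).1 ?add0r => [s0'|]; last exact: (BA _ Bp1).
    by move: s0; rewrite s0' eqxx.
  apply: contrapT => /negP nI.
  have : (stratum A `&` chart_dom c) p'.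
    split => // a aA; have [j la] : exists j, lab j = Some a.
      by apply/(h1 a).1; exists p1; split => //; exact: BA Bp1 _ aA.
    apply/(h3 j a la p' dp'); rewrite hp' (h3 j a la p1 d1).1 ?add0r; last exact: (BA _ Bp1).
    case: eqP => // ji; move: nI; rewrite -ji inE => /negP []; apply/fintype.existsP; exists a.
    by rewrite aA la /=.
  rewrite HE => -[_ /(_ i iJ)]; rewrite hp' eqxx (BJ _ Bp1)// add0r => s0'.
  by move: s0; rewrite s0' eqxx.
pose Q := {yr : 'rV[R]_d * R | good_cube V D lam m (Cube c lab b yr.1 yr.2) /\ q_crit lam (Cube c lab b yr.1 yr.2) = J}.
pose qc (u : Q) : cube X := Cube c lab b (sval u).1 (sval u).2.
have qg u : good_cube V D lam m (qc u) by have [] := svalP u.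
have ex p : B p -> exists u : Q, q_nbhs (qc u) p.
  move=> Bp; have dp := Bdom _ Bp.
  have [r gq _] := good_cube_exists RX oD mo dp (Eset_reg (BEs _ Bp)) (@openT M) I.
  have qJ : q_crit lam (Cube c lab b (chart_fwd c p) r) = J.
    by rewrite JIA; apply: q_crit_stratum gq dp _ => //; exact: BA.
  exists (exist _ (chart_fwd c p, r) (conj gq qJ)); exists (chart_fwd c p); last exact: chart_fwdK.
  by rewrite /q_open/= subrr normr0; exact: gc_radius gq.
have [u0 _] := ex _ Bp1.
have [f Bf] := @lindelof _ Q (fun u => q_nbhs (qc u)) B u0 sM (fun u => q_nbhs_open (qg u)) ex.
pose N j : set (borel M) := q_nbhs (qc (f j)).
have mN j : measurable (N j) by apply: open_borel; exact: q_nbhs_open (qg (f j)).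
pose Bj j := B `&` seqDU N j.
have mBj j : measurable (Bj j).
  by apply: measurableI => //; apply: measurableD => //; apply: bigsetU_measurable.
have BjN j : Bj j `<=` q_nbhs (qc (f j)) by move=> p [_ []].
have UB : \bigcup_j Bj j = B.
  by rewrite -setI_bigcupr -seqDU_bigcup_eq; apply/setIidPl.
have tB : trivIset setT Bj by apply: trivIset_setIl; exact: trivIset_seqDU.
pose S j : set (borel 'rV[R]_d) := chart_fwd c @` Bj j.
have SE j : S j = q_closed (qc (f j)) `&` chart_bwd c @^-1` Bj j.
  apply/seteqP; split=> y.
    move=> [p Bp <-]; have [y' qy' yp] := BjN _ _ Bp.
    have cy' := q_open_cod (qg (f j)) qy'.
    rewrite -yp /= in Bp *; rewrite chart_bwdK//; split => //; exact: q_open_closed qy'.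
  by move=> [qy By]; exists (chart_bwd c y) => //; apply: chart_bwdK => //; exact: gc_cod (qg (f j)) _ qy.
have mS j : measurable (S j).
  rewrite SE; exact: (measurable_q_bwd (qg (f j)) (q_closed_borel _) (mBj j)).
have weightE j y : S j y -> density_coef lab b lam m J y = q_weight lam m (qc (f j)) y.
  move=> [p [Bp _] <-]; rewrite /q_weight /density_coef /=.
  have [_ qJ] := svalP (f j); rewrite -/(qc (f j)) in qJ.
  have cJ : #|q_crit lam (qc (f j))| == m.
    rewrite qJ; have d1 := Bdom _ Bp.
    have [r gq _] := good_cube_exists RX oD mo d1 (Eset_reg (BEs _ Bp)) (@openT M) I.
    have e := q_crit_stratum Ac Am gq d1 (BA _ Bp).
    by rewrite -/IA -JIA in e; rewrite -e (q_crit_stratum_card Ac Am gq d1 (BA _ Bp)).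
  rewrite cJ qJ; congr (_ * (b _ / _) * _).
  by apply/rowP => i; rewrite mxE; case: ifP => // iJ; rewrite (BJ _ Bp).
rewrite -{1}UB.
have -> : rho (\bigcup_j Bj j) = (\sum_(0 <= j <oo) rho (Bj j))%E.
  by apply/esym/cvg_lim => //; apply: measure_semi_sigma_additive => //; rewrite UB.
have rhoE j : rho (Bj j) = (\int[lebesgue_off J]_(y in S j) (density_coef lab b lam m J y)%:E)%E.
  rewrite (rho_cube (qg (f j)) (mBj j) (@BjN j)) /q_measure wpushE.
  have [_ qJ] := svalP (f j); rewrite -/(qc (f j)) in qJ.
  rewrite -SE qJ; apply: eq_integral => y; rewrite inE => Sy; by rewrite (weightE j).
rewrite (eq_eseriesr (fun j _ => rhoE j)).
have -> : chart_fwd c @` B = \bigcup_j S j.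
  by rewrite -[in LHS]UB image_bigcup.
rewrite ge0_integral_bigcup//.
- apply/(measurable_fun_bigcup _ mS) => j; apply/measurable_EFinP.
  have mw := measurable_q_weight (qg (f j)).
  apply: (@eq_measurable_fun _ _ _ _ _ (q_weight lam m (qc (f j)) : borel 'rV[R]_d -> measurableTypeR R)).
    by move=> y; rewrite inE => Sy; rewrite (weightE j).
  apply: measurable_funS mw; first exact: q_closed_borel.
  by rewrite SE; exact: subIsetl.
- move=> y [j _ Sy]; rewrite lee_fin (weightE j)//; apply: (q_weight_ge0 lam0 (qg (f j))).
  by move: Sy; rewrite SE => -[].
- apply/trivIsetP => i j _ _ ij; move/trivIsetP : tB => /(_ i j I I ij) e.
  rewrite -subset0 => y [[p Bp <-] [p' Bp' e']].
  have pp : p = p'.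
    by rewrite -(chart_fwdK cc (Bdom p _)) -?e' ?chart_fwdK//; [case: Bp'|case: Bp] => ? _ //; exact: Bdom.
  have : (Bj i `&` Bj j) p by split => //; rewrite pp.
  by rewrite e.
Qed.

End Density.

(** * The limit measure *)

Section LimitMeasure.
Context {R : realType} {d : nat}.
Variables (V : 'rV[R]_d -> R) (D : set 'rV[R]_d) (X : resolution_data R d).
Hypothesis RX : resolution V D X.
Hypothesis oD : open D.
Variables (lam : R) (m : nat).
Hypothesis lam0 : 0 < lam.
Hypothesis m0 : (0 < m)%N.
Notation M := (rd_space X).
Notation pi := (rd_proj X).
Notation Z := (Zset V D X lam m).
Notation Es := (Eset D X lam m).
Variable rho : {measure set (borel M) -> \bar R}.
Hypothesis rho0 : forall A : set (borel M), measurable A -> (forall p, A p -> ~ Es p) -> rho A = 0%E.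
Hypothesis rho_cube : forall (q : cube X) (gq : good_cube V D lam m q) (B : set (borel M)),
  measurable B -> B `<=` q_nbhs q -> rho B = q_measure lam0 gq B.

Let mE : measurable (Es : set (borel M)). Proof. exact: (Eset_borel RX oD). Qed.

Let mpi : measurable_fun (Es : set (borel M)) (pi : borel M -> borel 'rV[R]_d).
Proof.
apply: borel_continuous_within => //; apply: continuous_subspaceT.
exact: (rd_proj_continuous RX).
Qed.

Let m1 : measurable_fun (Es : set (borel M)) (fun _ : borel M => 1 : R).
Proof. exact: measurable_cst. Qed.

Let p1 (p : borel M) : Es p -> 0 <= 1 :> R. Proof. by []. Qed.

(** The pushforward of the density by the projection, with the density
    restricted to the stratum so that it lives on the right manifold. *)
Definition limit_measure : {measure set (borel 'rV[R]_d) -> \bar R} := wpush rho mE mpi m1 p1.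
Notation mu := limit_measure.

Lemma limit_measureE (B : set (borel 'rV[R]_d)) : measurable B -> mu B = rho (pi @^-1` B `&` Es).
Proof.
move=> mB; have mI := mpi mE mB.
by rewrite setIC /limit_measure wpushE (integral_cst rho mI) mul1e.
Qed.

Lemma rho_setC : rho (~` Es) = 0%E.
Proof.
have mC := measurableC mE.
apply: (rho0 mC) => p np; exact np.
Qed.

Lemma rho_Eset (A : set (borel M)) : measurable A -> rho A = rho (A `&` Es).
Proof.
move=> mA; have mD : measurable (A `\` Es) by exact: (measurableD mA mE).
have z : rho (A `\` Es) = 0%E by apply: (rho0 mD) => p [_ np]; exact np.
have h := measureDI rho mA mE.
apply: (etrans h); apply: (etrans (congr1 (fun u => (u + rho (A `&` Es))%E) z)); exact: add0e.
Qed.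

Lemma compact_cubes (L : set M) : compact L -> (forall p, L p -> total_divisor V X p /\ Dreg D X lam m (pi p)) ->
  exists n (f : 'I_n -> gcube V D X lam m), forall p, L p -> exists j, q_nbhs (sval (f j)) p.
Proof.
move=> cL hL; have [[p0 Lp0]|nL] := pselect (exists p, L p); last first.
  have h0 (j : 'I_0) : gcube V D X lam m by case: j.
  by exists 0%N, h0 => p Lp; case: nL; exists p.
have ex p : L p -> exists q : gcube V D X lam m, q_nbhs (sval q) p.
  by move=> /hL[tp Dp]; exact: gcube_at.
have [q0 _] := ex _ Lp0.
have /choice[h hh] : forall p, exists q : gcube V D X lam m, L p -> q_nbhs (sval q) p.
  by move=> p; have [/ex[q hq]|nLp] := pselect (L p); [exists q|exists q0].
move: cL; rewrite compact_cover => /(_ M L (fun p => q_nbhs (sval (h p)))) [].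
- by move=> p Lp; exact: (q_nbhs_open (svalP (h p))).
- by move=> p Lp; exists p => //; exact: hh.
move=> E' EL cov; pose s : seq M := finmap.enum_fset E'.
exists (size s), (fun j => h (tnth (in_tuple s) j)) => p /cov[p' /= pE hp].
have ps : p' \in in_tuple s by [].
by have /tnthP[j e] := ps; exists j; rewrite -e.
Qed.

(** The preimage of a compact set is compact by properness, and its part on the
    divisor is covered by finitely many cubes of finite face measure. *)
Lemma limit_measure_compact (K : set 'rV[R]_d) : compact K -> K `<=` Z -> (mu K < +oo)%E.
Proof.
move=> cK KZ; rewrite limit_measureE; last exact: compact_borel.
pose L := pi @^-1` K `&` total_divisor V X.
have cdiv : closed (total_divisor V X).
  rewrite (res_preimage RX); apply: closed_bigcup; first exact: finite_finset.
  by move=> a _; exact: (divisor_closed RX).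
have cL : compact L.
  have KD : K `<=` D by move=> x /KZ[[]].
  exact: (compact_closedI (preimage_compact RX cK KD) cdiv).
have [n [f hf]] : exists n (f : 'I_n -> gcube V D X lam m), forall p, L p -> exists j, q_nbhs (sval (f j)) p.
  apply: compact_cubes cL _ => p [Kp tp]; split => //.
  by have [q /Eset_regE[h _] <-] := Zset_lift RX m0 (KZ _ Kp).
have mN j : measurable (q_nbhs (sval (f j)) : set (borel M)).
  by apply: open_borel; exact: q_nbhs_open (svalP (f j)).
have mP : measurable (pi @^-1` K `&` Es : set (borel M)).
  by rewrite setIC; apply: mpi => //; exact: compact_borel.
have fin_ (B : set (borel M)) : measurable B -> forall k : nat, (k <= n)%N ->
   (forall p, B p -> exists2 j : 'I_n, (j < k)%N & q_nbhs (sval (f j)) p) -> (rho B < +oo)%E.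
  move=> mB k; elim: k B mB => [|k IH] B mB kn hB.
    have -> : B = set0 by apply/seteqP; split => // p /hB[].
    by rewrite measure0.
  pose N := q_nbhs (sval (f (Ordinal kn))) : set (borel M).
  have -> : rho B = (rho (B `&` N) + rho (B `\` N))%E by rewrite addeC -measureDI//; exact: mN.
  rewrite lte_add_pinfty//.
    rewrite (rho_cube (svalP (f (Ordinal kn)))); [|exact: measurableI (mN _)|exact: subIsetr].
    apply: le_lt_trans (q_measure_fin RX lam0 (svalP (f (Ordinal kn)))).
    by apply: le_measure; rewrite ?inE//; exact: measurableI (mN _).
  apply: IH; [exact: measurableD (mN _)|exact: ltnW|].
  move=> p [/hB[j jk hj] nN]; exists j => //; move: jk; rewrite ltnS leq_eqVlt => /predU1P[jk|//].
  by case: nN; rewrite /N (_ : Ordinal kn = j)//; apply: val_inj.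
apply: (fin_ _ mP n (leqnn n)) => p [Kp Ep]; have [tp _] := Eset_divisor RX m0 Ep.
by have [j hj] := hf p (conj Kp tp); exists j.
Qed.

(** The zeros of the given type are an increasing union of compact sets of
    finite measure, so that inner regularity holds. *)
Lemma limit_measure_radon : radon_on Z mu.
Proof.
have [K [cK hK KE]] := Zset_sigma_compact RX oD lam m0.
have mZ : measurable (Z : set (borel 'rV[R]_d)).
  by rewrite KE; apply: bigcupT_measurable => k; exact: compact_borel.
have KZ k : K k `<=` Z by move=> x Kx; rewrite KE; exists k.
have mu0 : mu (~` Z) = 0%E.
  rewrite limit_measureE; last exact: measurableC.
  rewrite (_ : _ `&` _ = set0) ?measure0//; apply/seteqP; split => // p [nz Ep].
  exact: (nz (Eset_Zset RX m0 Ep)).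
split => //; first exact: limit_measure_compact.
move=> B mB.
have -> : mu B = mu (B `&` Z).
  have -> : mu B = (mu (B `&` Z) + mu (B `\` Z))%E by rewrite addeC -measureDI.
  rewrite [X in (_ + X)%E](_ : _ = 0%E) ?adde0//; apply: subset_measure0 mu0; [exact: measurableD|exact: measurableC|].
  by move=> x [].
apply: (inner_regular cK hK KE) => //; last exact: measurableI.
by move=> k; apply: limit_measure_compact.
Qed.

(** The weight is positive where the coordinates that are not critical are
    nonzero, and this part of the face has positive measure. *)
Lemma q_measure_pos (q : cube X) (gq : good_cube V D lam m q) : #|q_crit lam q| = m -> (0 < q_measure lam0 gq (q_nbhs q))%E.
Proof.
move=> Jm; set J := q_crit lam q; have r0 := gc_radius gq.
have mN : measurable (q_nbhs q : set (borel M)) by apply: open_borel; exact: q_nbhs_open gq.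
rewrite /q_measure wpushE.
set S : set (borel 'rV[R]_d) := _ `&` _.
have mS : measurable S by exact: (measurable_q_bwd gq (q_closed_borel q) mN).
have mw : measurable_fun S (fun y => (q_weight lam m q y)%:E).
  by apply/measurable_EFinP; apply: (measurable_funS (q_closed_borel q) _ (measurable_q_weight gq)); exact: subIsetl.
rewrite lt_neqAle integral_ge0 ?andbT; last by move=> y [qy _]; rewrite lee_fin (q_weight_ge0 lam0 gq).
apply/eqP => /esym I0.
have /(ae_eq_integral_abs (lebesgue_off J) mS mw) : (\int[lebesgue_off J]_(y in S) `|(q_weight lam m q y)%:E|)%E = 0%E.
  rewrite -I0; apply: eq_integral => y; rewrite inE => -[qy _].
  by rewrite gee0_abs// lee_fin (q_weight_ge0 lam0 gq).
move=> aew.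
pose A (i : 'I_d) : set R := if i \in J then [set 0] else `]q_center q ord0 i - q_radius q, q_center q ord0 i + q_radius q[%classic `\ 0.
have mA i : measurable (A i : set (measurableTypeR R)).
  by rewrite /A; case: ifP => // _; exact: measurableD.
have boxE := prod_measure_box (fun i => coord_measure (i \in J)) mA.
have box_pos : (0 < lebesgue_off J [set y | forall i, A i (y ord0 i)])%E.
  rewrite boxE; elim/big_ind : _ => //; first exact: mule_gt0.
  move=> i _; rewrite /A; case: ifP => iJ /=.
    by rewrite diracE mem_set//= lte01.
  set I : set R := `]_, _[%classic.
  have mI : measurable (I : set (measurableTypeR R)) by exact: measurable_itv.
  have m0' : measurable ([set 0] : set (measurableTypeR R)) by exact: measurable_set1.
  have z : lebesgue_measure (I `&` [set 0]) = 0%E :> \bar R.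
    by apply: subset_measure0 (lebesgue_measure_set1 0); [exact: measurableI|by []|exact: subIsetr].
  have h : lebesgue_measure I = (lebesgue_measure (I `\ 0%R) + lebesgue_measure (I `&` [set 0%R]))%E :> \bar R.
    exact: (measureDI lebesgue_measure mI m0').
  rewrite z adde0 in h; rewrite -h /I.
  rewrite lebesgue_measure_itv/= lte_fin; have -> : q_center q ord0 i - q_radius q < q_center q ord0 i + q_radius q by lra.
  by rewrite -EFinB lte_fin; lra.
have mbox : measurable ([set y | forall i, A i (y ord0 i)] : set (borel 'rV[R]_d)).
  have E : [set y : borel 'rV[R]_d | forall i, A i (y ord0 i)] =
      \bigcap_(i in [set` finset.setT]) (fun y : borel 'rV[R]_d => y ord0 i) @^-1` A i.
    by apply/seteqP; split=> y /= h i; [move=> _; exact: h|exact: (h i (finset.in_setT i))].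
  have : measurable [set y : borel 'rV[R]_d | forall i, A i (y ord0 i)].
    rewrite E; apply: fin_bigcap_measurable => // i _; rewrite -[X in measurable X]setTI.
    exact: (rV_coord_measurable i measurableT (mA i)).
  by [].
move: box_pos; rewrite lt_neqAle => /andP[/eqP + _]; apply; apply/esym.
apply/(negligibleP _ mbox); apply: negligibleS aew => y /= hy /(_ _)/eqP.
have qy : q_open q y.
  have [i0|nd] := pselect (exists i : 'I_d, True); last first.
    rewrite /q_open/= (_ : y - q_center q = 0) ?normr0//; apply/rowP => i; case: nd; by exists i.
  apply: rV_norm_lt => // i; rewrite !mxE.
  have := hy i; rewrite /A; case: ifP => iJ.
    by move=> -> ; have [-> _] := q_critP _ _ _ iJ; rewrite subrr normr0.
  by move=> [/=]; rewrite in_itv/= => h _; rewrite ltr_distl.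
move=> h; have Sy : S y by split; [exact: q_open_closed qy|exists y].
have w0 : q_weight lam m q y = 0 by have /eqP[] := h Sy.
suff : 0 < q_weight lam m q y by rewrite w0 ltxx.
rewrite /q_weight -/J Jm eqxx.
have [cb [_ cbp]] := (mono_chart (gc_mono gq), mono_b (gc_mono gq)).
rewrite !mulr_gt0//.
- by rewrite Gamma_gt0.
- by rewrite cbp//; exact: q_open_cod gq _ qy.
- rewrite invr_gt0; apply: prodr_gt0 => i /q_critP[_ [a la _]].
  by rewrite /num_at la ltr0n (res_knum RX).
- apply: prodr_gt0 => i; rewrite finset.in_setC => iJ; apply: powR_gt0; rewrite normr_gt0.
  by have := hy i; rewrite /A (negbTE iJ) => -[_ /eqP].
Qed.

(** An open set meeting the zeros of the given type contains the image of a
    good cube centred on a stratum of codimension [m]. *)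
Lemma limit_measure_support : full_support_on Z mu.
Proof.
move=> O' oO' [x [Ox Zx]].
have [K [cK hK KE]] := Zset_sigma_compact RX oD lam m0.
have mZ : measurable (Z : set (borel 'rV[R]_d)).
  by rewrite KE; apply: bigcupT_measurable => k; exact: compact_borel.
have mO : measurable (O' : set (borel 'rV[R]_d)) by exact: open_borel.
have [p Ep px] := Zset_lift RX m0 Zx.
have [tp Dp] := Eset_divisor RX m0 Ep.
have [c [lab [b [dp mo]]]] := res_mono RX tp.
have Op : (pi @^-1` O') p by rewrite /= px.
have [r gq hr] := good_cube_exists RX oD mo dp Dp (preimage_open RX oO') Op.
have [_ [A [Ac Am Ap]]] := (Eset_regE D lam m p).1 Ep.
set q := Cube _ _ _ _ _ in gq.
have Jm : #|q_crit lam q| = m by exact: (q_crit_stratum_card m0 Ac Am gq dp Ap).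
have mN : measurable (q_nbhs q : set (borel M)) by apply: open_borel; exact: q_nbhs_open gq.
apply: lt_le_trans (q_measure_pos gq Jm) _.
rewrite -(rho_cube gq mN (@subset_refl _ _)) (rho_Eset mN) limit_measureE; last exact: measurableI.
apply: le_measure; rewrite ?inE; [exact: measurableI| |].
  by rewrite setIC; apply: mpi => //; exact: measurableI.
move=> p' [[y qy yp] Ep']; have Zp := Eset_Zset RX m0 Ep'.
split; last by exact Ep'.
split; last by exact Zp.
by rewrite -yp; apply: hr; exact: ltW.
Qed.

End LimitMeasure.

(** * Convergence of the Laplace integrals *)

Section Remainder.
Context {R : realType}.

(** From [ln (t * beta) <= t * beta] with [t] so small that half of the
    exponential remains. *)
Lemma powR_exp_decay (lam eps : R) : 0 < lam -> 0 < eps ->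
  exists2 C, 0 <= C & forall beta, 0 < beta -> beta `^ lam * expR (- (beta * eps)) <= C / beta.
Proof.
move=> lam0 eps0; pose t := eps / (2 * lam).
have t0 : 0 < t by rewrite divr_gt0// mulr_gt0.
exists (expR (- (lam * ln t)) * (2 / eps)); first by rewrite mulr_ge0 ?expR_ge0// divr_ge0// ltW.
move=> beta b0; rewrite /powR gt_eqF// -expRD.
have h1 : ln beta <= t * beta - ln t.
  rewrite lerBrDl -lnM ?posrE//; apply: ltW; apply: ln_sublinear; exact: mulr_gt0.
have h2 : lam * ln beta - beta * eps <= - (lam * ln t) - beta * eps / 2.
  have := ler_wpM2l (ltW lam0) h1; rewrite mulrBr.
  have -> : lam * (t * beta) = beta * eps / 2 by rewrite /t; field; rewrite gt_eqF.
  move: (ln beta) (ln t) (beta * eps) => u w z h; move: (lam * u) (lam * w) h => u' w' h.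
  by lra.
apply: (@le_trans _ _ (expR (- (lam * ln t) - beta * eps / 2))); first by rewrite ler_expR.
rewrite expRD -[X in _ <= X]mulrA; apply: ler_wpM2l; first exact: expR_ge0.
have p0 : 0 < beta * eps / 2 by rewrite divr_gt0// mulr_gt0.
rewrite expRN -[X in _ <= X]invrK lef_pV2 ?posrE ?expR_gt0// ?invr_gt0 ?divr_gt0//.
  apply: le_trans (expR_ge1Dx _); rewrite !invf_div.
  have -> : beta * (eps / 2) = beta * eps / 2 by rewrite mulrA.
  by rewrite lerDr.
Qed.

End Remainder.

Section Laplace.
Context {R : realType} {d : nat}.
Variables (V : 'rV[R]_d -> R) (D : set 'rV[R]_d) (X : resolution_data R d).
Hypothesis aV : analytic_on setT V.
Hypothesis V0 : forall x, 0 <= V x.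
Hypothesis RX : resolution V D X.
Hypothesis oD : open D.
Hypothesis bD : bounded_set D.
Variables (lam : R) (m : nat).
Hypothesis lam0 : 0 < lam.
Hypothesis m0 : (0 < m)%N.
Notation M := (rd_space X).
Notation pi := (rd_proj X).
Notation Z := (Zset V D X lam m).
Notation Es := (Eset D X lam m).
Notation leb := (lebesgue_rV d).
Variable rho : {measure set (borel M) -> \bar R}.
Hypothesis rho0 : forall A : set (borel M), measurable A -> (forall p, A p -> ~ Es p) -> rho A = 0%E.
Hypothesis rho_cube : forall (q : cube X) (gq : good_cube V D lam m q) (B : set (borel M)),
  measurable B -> B `<=` q_nbhs q -> rho B = q_measure lam0 gq B.
Variables (O : set 'rV[R]_d) (g : 'rV[R]_d -> M).
Hypothesis OE : O = pi @` ~` total_divisor V X.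
Hypothesis oO : open O.
Hypothesis gK : forall p, ~ total_divisor V X p -> g (pi p) = p.
Hypothesis cg : {within O, continuous g}.
Hypothesis ag : forall c, rd_atlas X c -> analytic_map_on (O `&` g @^-1` chart_dom c) (chart_fwd c \o g).
Notation mu := (limit_measure RX oD lam m rho).

Let cV : continuous V.
Proof.
pose W x : 'rV[R]_1 := \row_(j < 1) V x.
have aW : analytic_map_on setT W.
  by move=> j x _; rewrite (_ : (fun y => W y ord0 j) = V); [exact: aV|apply/funext => y; rewrite mxE].
move=> x; have [A hA] := analytic_map_sdiff aW (I : setT x).
have e : V = (fun y : 'rV[R]_1 => y ord0 ord0) \o W by apply/funext => y; rewrite /= mxE.
rewrite [in X in continuous_at _ X]e; apply: continuous_comp; first exact: sdiff_continuous hA.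
exact: coord_continuous.
Qed.

Let cpi : continuous pi. Proof. exact: (rd_proj_continuous RX). Qed.

(** Parts of the domain away from the zeros of [V] contribute an exponentially
    small term only. *)
Lemma compact_pos (K : set 'rV[R]_d) : compact K -> (forall x, K x -> V x <> 0) ->
  exists2 e : R, 0 < e & forall x, K x -> e <= V x.
Proof.
move=> cK hK; have [[x0 Kx0]|nK] := pselect (exists x, K x); last first.
  by exists 1 => // x Kx; case: nK; exists x.
have [x] := EVT_min_rV (ex_intro K x0 Kx0) cK (continuous_subspaceT cV).
rewrite inE => Kx hx; exists (V x); first by rewrite lt_def V0 andbT; apply/eqP; exact: hK.
by move=> y Ky; apply: hx; rewrite inE.
Qed.

Section nonneg.
Variables (f : 'rV[R]_d -> R) (K : set 'rV[R]_d) (B : R).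
Hypothesis cf : continuous f.
Hypothesis f_bnd : forall x, 0 <= f x <= B.
Hypothesis cK : compact K.
Hypothesis KD : K `<=` Dreg D X lam m.
Hypothesis fK : forall x, ~ K x -> f x = 0.

Let KD' : K `<=` D. Proof. by move=> x /KD[]. Qed.
Let B0 : 0 <= B. Proof. by have /andP[] := f_bnd 0; exact: le_trans. Qed.

(** Tent functions of finitely many good cubes, divided by their sum where this
    is not too small. Near the divisor the pieces sum to [f], elsewhere to at
    most [f]. *)
Lemma partition_cubes : exists n (q : 'I_n -> gcube V D X lam m) (F : 'I_n -> M -> R) (G : set M),
  [/\ open G, (forall p, total_divisor V X p -> K (pi p) -> G p),
   (forall j, [/\ continuous (F j), (forall p, 0 <= F j p <= B) & (forall p, ~ q_nbhs (sval (q j)) p -> F j p = 0)]),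
   (forall p, \sum_j F j p <= f (pi p)) &
   (forall p, G p -> \sum_j F j p = f (pi p))].
Proof.
have cdiv : closed (total_divisor V X).
  rewrite (res_preimage RX); apply: closed_bigcup; first exact: finite_finset.
  by move=> a _; exact: (divisor_closed RX).
pose L := pi @^-1` K `&` total_divisor V X.
have cL : compact L by exact: (compact_closedI (preimage_compact RX cK KD') cdiv).
have [n [q hq]] : exists n (q : 'I_n -> gcube V D X lam m), forall p, L p -> exists j, q_nbhs (sval (q j)) p.
  by apply: (compact_cubes RX oD cL) => p [Kp tp]; split => //; exact: KD.
pose psi j : M -> R := chart_ext (q_chart (sval (q j))) (tent (~` q_open (sval (q j))) 1).
have cpsi j : continuous (psi j).
  have gq := svalP (q j).
  apply: (chart_ext_continuous (q_is_chart gq) (L := q_closed (sval (q j))) (res_hausdorff RX)).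
  - exact: compact_ball_rV.
  - exact: gc_cod gq.
  - exact: tent_continuous.
  - by move=> y ny; apply: tent_in => qy; apply: ny; exact: q_open_closed qy.
have psi_bnd j p : 0 <= psi j p <= 1.
  by rewrite /psi /chart_ext; case: asboolP => _; [exact: tent_bnd|rewrite lexx ler01].
have psi_off j p : ~ q_nbhs (sval (q j)) p -> psi j p = 0.
  move=> np; rewrite /psi /chart_ext; case: asboolP => // dp; apply: tent_in => qy; apply: np.
  by exists (chart_fwd (q_chart (sval (q j))) p) => //; apply: chart_fwdK => //; exact: q_is_chart (svalP (q j)).
have psi_pos j p : q_nbhs (sval (q j)) p -> 0 < psi j p.
  move=> [y qy <-]; have gq := svalP (q j).
  rewrite /psi (chart_ext_bwd (q_is_chart gq)); last exact: q_open_cod gq _ qy.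
  rewrite /tent lt_min ltr01/= mul1r; apply: dist1_gt0; first exact/open_closedC/q_open_open.
  by move=> ny; exact: ny qy.
pose sig p := \sum_j psi j p.
have csig : continuous sig.
  by move=> p; apply: continuous_at_sum => j; exact: cpsi.
have sig0 p : 0 <= sig p by apply: sumr_ge0 => j _; have /andP[] := psi_bnd j p.
have sigL p : L p -> 0 < sig p.
  move=> /hq[j hj]; apply: lt_le_trans (psi_pos j p hj) _; rewrite /sig (bigD1 j)//= lerDl.
  by apply: sumr_ge0 => i _; have /andP[] := psi_bnd i p.
have [tau tau0 htau] : exists2 tau : R, 0 < tau & forall p, L p -> tau < sig p.
  have [[p0 Lp0]|nL] := pselect (exists p, L p); last by exists 1 => // p Lp; case: nL; exists p.
  have [p1] := compact_EVT_min (ex_intro L p0 Lp0) cL (continuous_subspaceT csig).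
  rewrite inE => Lp1 hp1; have s1 := sigL _ Lp1.
  exists (sig p1 / 2); first exact: divr_gt0.
  move=> p Lp; apply: (@lt_le_trans _ _ (sig p1)); last by apply: hp1; rewrite inE.
  by rewrite ltr_pdivrMr// ltr_pMr// ltr1n.
pose mx p := Num.max (sig p) tau.
have mx0 p : 0 < mx p by rewrite lt_max tau0 orbT.
have cmx : continuous mx by move=> p; apply: continuous_max; [exact: csig|exact: cst_continuous].
pose F j p := f (pi p) * psi j p / mx p.
have sumF p : \sum_j F j p = f (pi p) * sig p / mx p by rewrite /F -mulr_suml -mulr_sumr.
exists n, q, F, [set p | tau < sig p]; split.
- rewrite (_ : [set p | _] = sig @^-1` [set r : R | tau < r])//.
  by move/continuousP : csig; apply; exact: open_gt.
- by move=> p tp Kp; apply: htau.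
- move=> j; split.
  + have c1 : continuous (fun p : M => f (pi p)).
      by move=> p; apply: continuous_comp; [exact: cpi|exact: cf].
    have c2 : continuous (fun p : M => f (pi p) * psi j p).
      by move=> p; apply: (continuousM (c1 p) (cpsi j p)).
    have c3 : continuous (fun p : M => (mx p)^-1).
      by move=> p; apply: continuousV; [rewrite gt_eqF|exact: cmx].
    by move=> p; apply: (continuousM (c2 p) (c3 p)).
  + move=> p; have /andP[f0 fB] := f_bnd (pi p); have /andP[s0 s1] := psi_bnd j p.
    rewrite /F !mulr_ge0 ?invr_ge0 ?(ltW (mx0 p))//=.
    rewrite -mulrA; apply: le_trans fB; rewrite -[X in _ <= X]mulr1 ler_wpM2l//.
    rewrite ler_pdivrMr// mul1r le_max; apply/orP; left.
    by rewrite /sig (bigD1 j)//= lerDl; apply: sumr_ge0 => i _; have /andP[] := psi_bnd i p.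
  + by move=> p np; rewrite /F psi_off// mulr0 mul0r.
- move=> p; rewrite sumF -mulrA; have /andP[f0 _] := f_bnd (pi p).
  by rewrite -[X in _ <= X]mulr1 ler_wpM2l// ler_pdivrMr// mul1r le_max lexx.
- move=> p /= tp; rewrite sumF /mx max_l ?(ltW tp)// mulfK// gt_eqF//.
  exact: lt_trans tau0 tp.
Qed.

Definition laplace beta : \bar R := (\int[leb]_(x in D) (f x * expR (- (beta * V x)))%:E)%E.

Let mDs : measurable (D : set (borel 'rV[R]_d)). Proof. exact: open_borel. Qed.

Let lebD : (leb D < +oo)%E.
Proof.
have [r [_ hr]] := bD; apply: (@lebesgue_bounded _ _ _ (Num.max r 0 + 2)) => //.
move=> y Dy; apply: (@le_lt_trans _ _ (Num.max r 0 + 1)).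
  by apply: hr => //; rewrite ltr_pwDr// le_max lexx.
by rewrite ltrD2l ltr1n.
Qed.

Let cE beta : continuous (fun x => expR (- (beta * V x))).
Proof.
move=> x; apply: (continuous_comp (f := fun x => - (beta * V x)) (g := expR)); last exact: continuous_expR.
by apply: continuousN; apply: continuousM; [exact: cst_continuous|exact: cV].
Qed.

Let cfE beta : continuous (fun x => f x * expR (- (beta * V x))).
Proof.
move=> x; have h : {for x, continuous (f \* (fun y : 'rV[R]_d => expR (- (beta * V y))))}.
  by apply: continuousM; [exact: cf|exact: cE].
exact: h.
Qed.

Lemma laplace_fin beta : 0 <= beta -> (0 <= laplace beta < +oo)%E.
Proof.
move=> b0; have nn x : (0 <= (f x * expR (- (beta * V x)))%:E)%E.
  by rewrite lee_fin mulr_ge0 ?expR_ge0//; have /andP[] := f_bnd x.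
apply/andP; split; first by apply: integral_ge0 => x _; exact: nn.
apply: (@le_lt_trans _ _ (\int[leb]_(x in D) cst B%:E x)%E).
  apply: ge0_le_integral => //.
  - apply: measurable_funTS; apply/measurable_EFinP; exact: continuous_borel_fun (@cfE beta).
  - move=> x _; rewrite lee_fin -[X in _ <= X]mulr1; have /andP[f0 fB] := f_bnd x.
    by apply: ler_pM; rewrite ?expR_ge0// -expR0 ler_expR oppr_le0 mulr_ge0.
by rewrite integral_cst//; apply: lte_mul_pinfty.
Qed.

(** The pieces of [f] in the good cubes give the limit. They sum to [f] near
    the divisor over the support, and elsewhere [V] is bounded below almost
    everywhere: off the image of the projection this uses that the image is a
    neighbourhood of the zeros. The Laplace integral is thus squeezed between
    the sum over the pieces and the same sum with an exponentially small term
    added. *)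
Lemma laplace_lim : ((\int[mu]_x (f x)%:E)%E < +oo)%E /\ 
  ((beta `^ lam / ln beta ^+ m.-1)%:E * laplace beta)%E @[beta --> +oo] --> (\int[mu]_x (f x)%:E)%E.
Proof.
have [n [q [F [G [oG GK hF sumF sumG]]]]] := partition_cubes.
have F0 j p : 0 <= F j p by have [_ h _] := hF j; have /andP[] := h p.
have mN j : measurable (q_nbhs (sval (q j)) : set (borel M)).
  by apply: open_borel; exact: q_nbhs_open (svalP (q j)).
have mF j : measurable_fun setT (fun p : borel M => (F j p)%:E).
  by have [h _ _] := hF j; apply/measurable_EFinP; exact: continuous_borel_fun.
have IF j : (\int[q_measure lam0 (svalP (q j))]_p (F j p)%:E = \int[rho]_p (F j p)%:E)%E.
  have sup (nu : {measure set (borel M) -> \bar R}) : (\int[nu]_p (F j p)%:E = \int[nu]_(p in q_nbhs (sval (q j))) (F j p)%:E)%E.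
    rewrite [RHS]integral_mkcond; apply: eq_integral => p _; rewrite patchE; case: ifPn => // /negP np.
    by have [_ _ ->] := hF j => // hp; apply: np; rewrite inE.
  rewrite !sup; apply: eq_measure_integral => A mA AN.
  by rewrite (rho_cube (svalP (q j)) mA AN).
have limE : (\int[mu]_x (f x)%:E = \sum_j \int[rho]_p (F j p)%:E)%E.
  rewrite ge0_integral_wpush; [|by apply/measurable_EFinP; exact: continuous_borel_fun|by move=> x; rewrite lee_fin; have /andP[] := f_bnd x].
  have mE : measurable (Es : set (borel M)) by exact: (Eset_borel RX oD).
  rewrite -ge0_integral_sum//; last by move=> j p _; rewrite lee_fin.
  have -> : (\int[rho]_p (\sum_(j < n) (F j p)%:E) = \int[rho]_(p in Es) (\sum_(j < n) (F j p)%:E))%E.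
    rewrite (@ge0_negligible_integral _ _ _ rho setT (~` Es))//.
    - by rewrite setTD setCK.
    - exact: measurableC.
    - by apply: emeasurable_sum => j; exact: mF.
    - by move=> p _; apply: sume_ge0 => j _; rewrite lee_fin.
    - by apply: rho0; [exact: measurableC|move=> p np; exact np].
  apply: eq_integral => p; rewrite inE => Ep; rewrite mule1 sumEFin; congr (_%:E).
  have [tp Dp] := Eset_divisor RX m0 Ep.
  have [Kp|nKp] := pselect (K (pi p)); first by rewrite sumG//; exact: GK.
  rewrite fK//; apply/esym/eqP; rewrite eq_le; apply/andP; split; last by apply: sumr_ge0.
  by apply: le_trans (sumF p) _; rewrite fK.
have fin : (\sum_(j < n) \int[rho]_p (F j p)%:E < +oo)%E.
  apply: lte_sum_pinfty => j _; rewrite -IF.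
  apply: (@le_lt_trans _ _ (\int[q_measure lam0 (svalP (q j))]_p (cst B%:E p))%E).
    apply: ge0_le_integral => //; first by move=> p _; rewrite lee_fin.
    by move=> p _; rewrite lee_fin; have [_ h _] := hF j; have /andP[] := h p.
  rewrite integral_cst//; apply: lte_mul_pinfty => //; exact: (q_measure_fin RX lam0 (svalP (q j))).
split; first by rewrite limE.
rewrite limE.
pose lift beta := (\sum_j lift_laplace V O g beta (F j))%E.
have mO : measurable (O : set (borel 'rV[R]_d)) by exact: open_borel.
have mFg beta j : measurable_fun (O : set (borel 'rV[R]_d)) (fun x => (F j (g x) * expR (- (beta * V x)))%:E).
  apply/measurable_EFinP; apply: within_borel_fun => //.
  apply: continuous_in_subspaceT => x; rewrite inE => Ox.
  have gx : {for x, continuous g} by exact: (within_open_at oO Ox cg).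
  have Fx : {for x, continuous (F j \o g)}.
    by apply: continuous_comp gx _; have [h _ _] := hF j; exact: h.
  have h : {for x, continuous ((F j \o g) \* (fun y : 'rV[R]_d => expR (- (beta * V y))))}.
    by apply: continuousM; [exact: Fx|exact: cE].
  exact: h.
have Fg0 beta j x : (0 <= (F j (g x) * expR (- (beta * V x)))%:E)%E by rewrite lee_fin mulr_ge0// expR_ge0.
have liftE beta : lift beta = (\int[leb]_(x in O) (\sum_(j < n) (F j (g x) * expR (- (beta * V x)))%:E))%E.
  by rewrite /lift -ge0_integral_sum.
have lift0 beta : (0 <= lift beta)%E by apply: sume_ge0 => j _; apply: integral_ge0.
have lift_lim : ((beta `^ lam / ln beta ^+ m.-1)%:E * lift beta)%E @[beta --> +oo] --> (\sum_j \int[rho]_p (F j p)%:E)%E.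
  rewrite (_ : (fun beta => _) = (fun beta : R => \sum_(j < n) ((beta `^ lam / ln beta ^+ m.-1)%:E * lift_laplace V O g beta (F j)))%E); last first.
    by apply/funext => beta; rewrite ge0_sume_distrr// => j _; apply: integral_ge0.
  apply: cvg_nnesum => j _.
    near=> beta; apply: mule_ge0; last by apply: integral_ge0.
    rewrite lee_fin divr_ge0 ?powR_ge0// exprn_ge0//; apply: ltW.
    by near: beta; exact: near_pinfty_ln.
  have [h1 h2 h3] := hF j; rewrite -IF.
  have h := local_limit RX (gq := svalP (q j)) m0 OE oO gK cg ag h1 h2 h3.
  exact: (h lam0).
(* The points of the support where the pieces do not sum to [f] lie in [K1] if
   they have a preimage, and in [K2] or among the zeros otherwise. *)
pose T : set 'rV[R]_d := range pi.
pose K1 := pi @` (pi @^-1` K `&` ~` G).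
pose K2 := K `&` ~` (interior T).
have [e1 e10 h1] : exists2 e : R, 0 < e & forall x, K1 x -> e <= V x.
  apply: compact_pos.
    apply: continuous_compact; first exact: continuous_subspaceT.
    exact: (compact_closedI (preimage_compact RX cK KD') (open_closedC oG)).
  move=> x [p [Kp nG] <-] Vp; apply: nG; apply: GK => //.
  by split => //; exact: (res_range RX).
have [e2 e20 h2] : exists2 e : R, 0 < e & forall x, K2 x -> e <= V x.
  apply: compact_pos.
    by apply: compact_closedI cK _; apply: open_closedC; exact: open_interior.
  move=> x [Kx nT] Vx; apply: nT.
  have [del del0 hdel] := proj_onto RX oD OE oO gK (KD' Kx) Vx.
  apply: filterS (nbhsx_ballx x del del0) => y; rewrite -ball_normE /ball_/= distrC => /hdel[p <-].
  by exists p.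
pose e := Num.min e1 e2; have e0 : 0 < e by rewrite lt_min e10.
have upper beta : 0 < beta -> (laplace beta <= lift beta + (B * expR (- (beta * e)))%:E * leb D)%E.
  move=> b0.
  pose S x := if `[< O x >] then (\sum_(j < n) (F j (g x) * expR (- (beta * V x)))%:E)%E else 0%E.
  have SE : S = (fun x => (\sum_(j < n) (F j (g x) * expR (- (beta * V x)))%:E)%E) \_ O.
    apply/funext => x; rewrite /S patchE; case: asboolP => Ox; first by rewrite mem_set.
    by rewrite memNset.
  have S0 x : (0 <= S x)%E by rewrite /S; case: asboolP => // _; apply: sume_ge0 => j _.
  have mS : measurable_fun setT (S : borel 'rV[R]_d -> \bar R).
    rewrite SE; apply/(measurable_restrictT _ mO); apply: emeasurable_sum => j; exact: mFg.
  have SO : (\int[leb]_(x in D) S x = lift beta)%E.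
    rewrite liftE [RHS]integral_mkcond -SE [LHS]integral_mkcond; apply: eq_integral => x _.
    rewrite patchE; case: ifPn => // /negP nD.
    rewrite /S; case: asboolP => // Ox; rewrite big1// => j _; congr (_%:E).
    have nK : ~ K (pi (g x)).
      have [p np px] : (pi @` ~` total_divisor V X) x by rewrite -OE.
      by rewrite -px gK// px => /KD' Dx; apply: nD; rewrite inE.
    have : F j (g x) <= 0.
      have := sumF (g x); rewrite (fK nK); apply: le_trans.
      by rewrite (bigD1 j)//= lerDl; apply: sumr_ge0.
    by move=> h; have -> : F j (g x) = 0 by [apply/eqP; rewrite eq_le h F0]; rewrite mul0r.
  rewrite -SO -[X in (_ + X)%E]integral_cst// -ge0_integralD//; last 2 first.
  - exact: measurable_funTS.
  - by move=> x _; rewrite /cst lee_fin mulr_ge0// expR_ge0.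
  apply: ae_ge0_le_integral => //.
  - by move=> x _; rewrite lee_fin mulr_ge0 ?expR_ge0//; have /andP[] := f_bnd x.
  - apply: measurable_funTS; apply/measurable_EFinP; exact: continuous_borel_fun (@cfE beta).
  - by move=> x _; rewrite adde_ge0// /cst lee_fin mulr_ge0// expR_ge0.
  - by apply: emeasurable_funD => //; exact: measurable_funTS.
  apply: negligibleS (zeros_negligible RX) => x /= h; apply: contrapT => nz; apply: h => Dx.
  have Vx : V x <> 0 by move=> Vx; apply: nz.
  have /andP[f0 fB] := f_bnd x.
  have [Kx|nKx] := pselect (K x); last first.
    by rewrite (fK nKx) mul0r adde_ge0// /cst lee_fin mulr_ge0// expR_ge0.
  have small : e <= V x -> ((f x * expR (- (beta * V x)))%:E <= S x + (B * expR (- (beta * e)))%:E)%E.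
    move=> eV; apply: (@le_trans _ _ (B * expR (- (beta * e)))%:E); last by rewrite leeDr.
    by rewrite lee_fin; apply: ler_pM => //; rewrite ?expR_ge0// ler_expR lerN2 ler_pM2l.
  have [Ox|nOx] := pselect (O x); last first.
    apply: small; apply: le_trans (h2 x _); first by rewrite ge_min lexx orbT.
    split => //; move=> /interior_subset[p _ px]; apply: nOx; rewrite OE; exists p => //.
    by move=> [_]; rewrite /= px.
  have [p np px] : (pi @` ~` total_divisor V X) x by rewrite -OE.
  have [Gp|nGp] := pselect (G p); last first.
    apply: small; apply: le_trans (h1 x _); first by rewrite ge_min lexx.
    by exists p => //; split => //=; rewrite px.
  rewrite /S asboolT// sumEFin -mulr_suml -px gK// sumG// px.
  by rewrite leeDl// lee_fin mulr_ge0// expR_ge0.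
have lower beta : (lift beta <= laplace beta)%E.
  rewrite liftE /laplace integral_mkcond [leRHS]integral_mkcond; apply: ge0_le_integral => //.
  - by move=> x _; rewrite patchE; case: ifP => // _; apply: sume_ge0 => j _.
  - by apply/(measurable_restrictT _ mO); apply: emeasurable_sum => j; exact: mFg.
  - apply/(measurable_restrictT _ mDs); apply: measurable_funTS; apply/measurable_EFinP; exact: continuous_borel_fun (@cfE beta).
  move=> x _; have f0 : 0 <= f x by have /andP[] := f_bnd x.
  rewrite !patchE; case: ifPn; last first.
    by move=> _; case: ifP => // _; rewrite lee_fin mulr_ge0// expR_ge0.
  rewrite inE => Ox; have [p np px] : (pi @` ~` total_divisor V X) x by rewrite -OE.
  have hs : (\sum_(j < n) (F j (g x) * expR (- (beta * V x)))%:E <= (f x * expR (- (beta * V x)))%:E)%E.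
    by rewrite sumEFin lee_fin -mulr_suml ler_wpM2r ?expR_ge0// -px gK//; exact: sumF.
  case: ifPn => // /negP nD; apply: le_trans hs _.
  by rewrite fK ?mul0r// => /KD' Dx; apply: nD; rewrite inE.
have [C C0 hC] := powR_exp_decay lam0 e0.
have lD : leb D = (fine (leb D))%:E by rewrite fineK// ge0_fin_numE.
have lD0 : 0 <= fine (leb D) by exact: fine_ge0.
pose bound (beta : R) : \bar R := (C * B * fine (leb D) / beta)%:E.
have bound0 : bound beta @[beta --> +oo] --> 0%E.
  apply: cvg_EFin; first by near=> beta.
  apply/cvgrPdist_lt => eps eps0; near=> beta.
  have b0 : 0 < beta by near: beta; exact: nbhs_pinfty_gt.
  rewrite sub0r normrN /bound /= normrM normfV (gtr0_norm b0) ltr_pdivrMr// -ltr_pdivrMl//.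
  by near: beta; apply: nbhs_pinfty_gt; exact: num_real.
apply: (squeeze_cvge _ lift_lim (_ : (fun beta => ((beta `^ lam / ln beta ^+ m.-1)%:E * lift beta + bound beta)%E) @ +oo --> _)); last first.
  by rewrite -[X in _ --> X]adde0; apply: cvgeD => //; rewrite fin_num_adde_defl.
near=> beta.
have b0 : 0 < beta by near: beta; exact: nbhs_pinfty_gt.
have ln1 : 1 < ln beta by near: beta; exact: near_pinfty_ln.
have c0 : (0 <= (beta `^ lam / ln beta ^+ m.-1)%:E)%E.
  by rewrite lee_fin divr_ge0 ?powR_ge0// exprn_ge0// ltW// (lt_trans ltr01).
apply/andP; split; first exact: lee_wpmul2l (lower beta).
apply: le_trans (lee_wpmul2l c0 (upper beta b0)) _.
rewrite ge0_muleDr//; last by rewrite mule_ge0// lee_fin mulr_ge0// expR_ge0.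
rewrite leeD2l// lD -!EFinM lee_fin.
have -> : C * B * fine (leb D) / beta = C / beta * (B * fine (leb D)) by ring.
have -> : beta `^ lam / ln beta ^+ m.-1 * (B * expR (- (beta * e)) * fine (leb D)) =
  (beta `^ lam * expR (- (beta * e)) / ln beta ^+ m.-1) * (B * fine (leb D)) by ring.
apply: ler_wpM2r; first exact: mulr_ge0.
apply: le_trans (hC beta b0); rewrite -[X in _ <= X]mulr1; apply: ler_wpM2l.
  by rewrite mulr_ge0 ?powR_ge0// expR_ge0.
by rewrite invf_le1 ?exprn_gt0 ?(lt_trans ltr01)// exprn_ege1// ltW.
Unshelve. all: by end_near. Qed.

End nonneg.

(** Positive and negative parts have finite limits, so that their difference
    converges. *)
Lemma laplace_limit_signed f : compactly_supported_in (Dset V D X lam m) f -> laplace_limit V D lam m Z mu f.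
Proof.
move=> [cf cK KD]; set K := closure _ in cK KD.
have KR : K `<=` Dreg D X lam m by move=> x /KD; exact: (Dset_Dreg RX).
have fK x : ~ K x -> f x = 0.
  by move=> nK; apply/eqP; apply: contrapT => /negP fx; apply: nK; exact: subset_closure.
have cnf : continuous (fun x => `|f x|).
  by move=> x; apply: (continuous_comp (f := f) (g := Num.norm)); [exact: cf|exact: norm_continuous].
have [B hB] : exists B, forall x, `|f x| <= B.
  have [[x0 Kx0]|nK] := pselect (exists x, K x); last first.
    by exists 0 => x; rewrite fK ?normr0// => Kx; apply: nK; exists x.
  have [x1 _ h] := EVT_max_rV (ex_intro K x0 Kx0) cK (continuous_subspaceT cnf).
  exists `|f x1| => x; have [Kx|nKx] := pselect (K x); first by apply: h; rewrite inE.
  by rewrite fK// normr0.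
pose part (s : R) x := Num.max (s * f x) 0.
have cpart s : continuous (part s).
  move=> x; have h1 : {for x, continuous ((fun _ : 'rV[R]_d => s) \* f)}.
    by apply: continuousM; [exact: cst_continuous|exact: cf].
  have h : {for x, continuous (((fun _ : 'rV[R]_d => s) \* f) \max (fun _ => 0))}.
    by apply: continuous_max; [exact: h1|exact: cst_continuous].
  exact: h.
have bpart s x : `|s| = 1 -> 0 <= part s x <= B.
  move=> s1; rewrite /part le_max lexx orbT/= ge_max; apply/andP; split; last exact: le_trans (hB x).
  by apply: le_trans (hB x); rewrite -[X in _ <= X]mul1r -s1 -normrM; exact: ler_norm.
have Kpart s x : ~ K x -> part s x = 0 by move=> /fK fx; rewrite /part fx mulr0 maxxx.
have s1 : `|1 : R| = 1 by rewrite normr1.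
have sN1 : `|-1 : R| = 1 by rewrite normrN1.
have [Ip Lp] := laplace_lim (cpart 1) (fun x => bpart 1 x s1) cK KR (Kpart 1).
have [Im Lm] := laplace_lim (cpart (-1)) (fun x => bpart (-1) x sN1) cK KR (Kpart (-1)).
have fp beta := laplace_fin (cpart 1) (fun x => bpart 1 x s1) (beta := beta).
have fm beta := laplace_fin (cpart (-1)) (fun x => bpart (-1) x sN1) (beta := beta).
have [mu0 _ _] := limit_measure_radon RX oD m0 rho_cube.
have [KZ [cKZ _ KZE]] := Zset_sigma_compact RX oD lam m0.
have mZ : measurable (Z : set (borel 'rV[R]_d)).
  by rewrite KZE; apply: bigcupT_measurable => k; exact: compact_borel.
have restr s : `|s| = 1 -> (\int[mu]_(x in Z) (part s x)%:E = \int[mu]_x (part s x)%:E)%E.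
  move=> hs; rewrite [RHS](@ge0_negligible_integral _ _ _ mu setT (~` Z))//.
  - by rewrite setTD setCK.
  - exact: measurableC.
  - by apply/measurable_EFinP; exact: continuous_borel_fun.
  - by move=> x _; rewrite lee_fin; have /andP[] := bpart s x hs.
rewrite /laplace_limit.
have -> : (\int[mu]_(x in Z) (f x)%:E = \int[mu]_x (part 1 x)%:E - \int[mu]_x (part (-1) x)%:E)%E.
  rewrite integralE -!restr//; congr (_ - _)%E; apply: eq_integral => x _.
    by rewrite funeposE /part mul1r EFin_max.
  by rewrite funenegE /part mulN1r EFin_max.
have fI : (\int[mu]_x (part 1 x)%:E)%E \is a fin_num.
  by rewrite ge0_fin_numE//; apply: integral_ge0 => x _; rewrite lee_fin; have /andP[] := bpart 1 x s1.
have lim : (fun b : R => ((b `^ lam / ln b ^+ m.-1)%:E * laplace (part 1%R) b - (b `^ lam / ln b ^+ m.-1)%:E * laplace (part (-1)%R) b)%E) @ +oo -->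
    (\int[mu]_x (part 1%R x)%:E - \int[mu]_x (part (-1)%R x)%:E)%E.
  exact: (cvgeB (fin_num_adde_defr _ fI) Lp Lm).
apply: cvg_trans lim; apply: near_eq_cvg; near=> beta.
have b0 : 0 < beta by near: beta; exact: nbhs_pinfty_gt.
have /andP[p0 pf] := fp beta (ltW b0).
have -> : beta `^ lam * ln beta ^ (1 - m%:Z) = beta `^ lam / ln beta ^+ m.-1.
  have mz (k : nat) : 1 - k.+1%:Z = - k%:Z by rewrite -addn1 PoszD opprD addrCA subrr addr0.
  have -> : 1 - m%:Z = - m.-1%:Z by rewrite -{1}(prednK m0) mz.
  by rewrite -exprnN.
have -> : (\int[leb]_(x in D) (f x * expR (- (beta * V x)))%:E = laplace (part 1%R) beta - laplace (part (-1)%R) beta)%E.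
  rewrite integralE; congr (_ - _)%E; apply: eq_integral => x _.
    by rewrite funeposE -EFin_max /part mul1r -[X in Num.max _ X](mul0r (expR (- (beta * V x)))) -maxr_pMl// expR_ge0.
  by rewrite funenegE -EFinN -EFin_max /part mulN1r -mulNr -[X in Num.max _ X](mul0r (expR (- (beta * V x)))) -maxr_pMl// expR_ge0.
have pfn : laplace (part 1%R) beta \is a fin_num by rewrite ge0_fin_numE.
by rewrite (muleBr _ (fin_num_adde_defr _ pfn)).
Unshelve. all: by end_near. Qed.

End Laplace.

Theorem theorem3p1 (R : realType) (d : nat) (V : 'rV[R]_d -> R)
    (D : set 'rV[R]_d) (X : resolution_data R d)
    (V_analytic : analytic_on setT V) (V_ge0 : forall x, 0 <= V x)
    (V_zero : exists x, V x = 0) (V_nonzero : exists x, V x <> 0)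
    (D_open : open D) (D_bounded : bounded_set D)
    (D_subanalytic : subanalytic (@rV_atlas R d) D)
    (D_zero : zeros V D !=set0)
    (X_resolution : resolution V D X)
    (lam : R) (m : nat) (occurs : Zset V D X lam m !=set0) :
  exists mu : {measure set (borel 'rV[R]_d) -> \bar R},
    [/\ radon_on (Zset V D X lam m) mu,
        full_support_on (Zset V D X lam m) mu,
        (forall f : 'rV[R]_d -> R,
           compactly_supported_in (Dset V D X lam m) f ->
           laplace_limit V D lam m (Zset V D X lam m) mu f) &
        exists rho : {measure set (borel (rd_space X)) -> \bar R},
          [/\ rho (~` Eset D X lam m) = 0%E,
              (forall B : set (borel 'rV[R]_d), measurable B ->
                 mu B = rho (rd_proj X @^-1` B `&` Eset D X lam m)) &
              has_density_formula V D lam m rho]].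
Proof.
have [x0 Zx0] := occurs; have [lam0 m0] := type_pos X_resolution Zx0.
have [ O [g [OE oO gK cg ag]]] := res_iso X_resolution.
have [p0 Ep0 _] := Zset_lift X_resolution m0 Zx0.
have [rho [rho0 rho_cube]] := global_density X_resolution D_open lam0 m0 OE oO gK cg ag Ep0.
exists (limit_measure X_resolution D_open lam m rho); split.
- exact: (limit_measure_radon X_resolution D_open m0 rho_cube).
- exact: (limit_measure_support X_resolution D_open m0 rho0 rho_cube).
- move=> f hf.
  apply: (laplace_limit_signed V_analytic V_ge0 D_bounded m0 rho0 rho_cube OE oO gK cg ag hf).
- exists rho; split.
  + exact: (rho_setC X_resolution D_open rho0).
  + by move=> B mB; exact: limit_measureE.
  + exact: (density_formula X_resolution D_open m0 rho_cube).
Qed.
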